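(* Let $T>0$ and let $\Omega\subset\mathbb{R}^2$ be a bounded, smooth, connected and simply connected domain. Let $\nu_n$ be positive numbers such that $\nu_n\to 0$. For each $n$ let $u^n\in L^\infty((0,T);L^2(\Omega))\cap L^2((0,T);H^1_0(\Omega))$ be a Leray-Hopf weak solution of the incompressible Navier-Stokes equations in $(0,T)\times\Omega$ with viscosity $\nu_n$ and no slip boundary condition. Set $\omega^n=\omega^n(t,\cdot)=\operatorname{curl}u^n\equiv\nabla^\perp\cdot u^n(t,\cdot)$. Assume the following: \begin{enumerate} \item there exists $u^\infty$ such that $u^n\rightharpoonup u^\infty$ weak-$\ast$ in $L^\infty(0,T;L^2(\Omega))$; \item $\{\omega^n\}\subset L^\infty((0,T);L^1_{\mathrm{loc}}(\Omega))$ and, for each $\mathcal{K}\subset\subset\Omega$, there exists $C_{\mathcal{K}}>0$ so that $$\sup_n\sup_{t\in(0,T)}\|\omega^n(t,\cdot)\|_{L^1(\mathcal{K})}\le C_{\mathcal{K}}<\infty;$$ \item for any $\mathcal{K}\subset\subset\Omega$ we have $$\sup_n\int_0^T\left(\sup_{x\in\mathcal{K}}\int_{B(x;r)\cap\Omega}|\omega^n(t,y)|\,dy\right)dt\to 0\quad\text{as } r\to 0.$$ \end{enumerate} Then $u^\infty$ is a weak solution of the incompressible Euler equations on $(0,T)\times\Omega$, in the sense defined in the context.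
   Context: Notation: $\nabla^\perp=(-\partial_{x_2},\partial_{x_1})$, so that $\operatorname{curl}u=\nabla^\perp\cdot u=-\partial_{x_2}u_1+\partial_{x_1}u_2$. $B(x;r)$ is the open ball in $\mathbb{R}^2$ with center $x$ and radius $r$. $\mathcal{K}\subset\subset\Omega$ means that the closure of $\mathcal{K}$ is a compact subset of $\Omega$. Navier-Stokes equations with viscosity $\nu>0$: $\partial_t u+(u\cdot\nabla)u=-\nabla p+\nu\Delta u$ in $(0,T)\times\Omega$; $\operatorname{div}u=0$ in $[0,T)\times\Omega$; $u=0$ on $(0,T)\times\partial\Omega$ (no slip); $u|_{t=0}=u_0$ in $\Omega$. Leray-Hopf weak solutions are understood in the standard sense. Definition (weak solution of the Euler equations). A vector field $u\in L^\infty((0,T);L^2(\Omega))$ is a weak solution of the incompressible Euler equations if: (i) $\operatorname{div}u(t,\cdot)=0$ in the sense of distributions for a.e. $t\in(0,T)$; and (ii) for each test vector field $\Phi\in C^\infty_c((0,T)\times\Omega)$ (with values in $\mathbb{R}^2$) such that $\operatorname{div}\Phi(t,\cdot)=0$, $$\int_0^T\int_\Omega\partial_t\Phi\cdot u\,dx\,dt+\int_0^T\int_\Omega\nabla\Phi:u\otimes u\,dx\,dt=0,$$ where $\nabla\Phi:u\otimes u=\sum_{i,j}\partial_{x_j}\Phi_i\,u_i u_j$. *)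

(* Defs.v *)
From HB Require Import structures.
From mathcomp Require Import all_boot all_order all_algebra.
From mathcomp Require Import all_classical all_reals all_analysis.

Set Implicit Arguments.
Unset Strict Implicit.
Unset Printing Implicit Defensive.

Import Order.TTheory GRing.Theory Num.Theory.
Import numFieldNormedType.Exports.

Local Open Scope classical_set_scope.
Local Open Scope ring_scope.

(* Coordinates are numbered from 0: x_1, x_2 of the usual notation are the
   coordinates 0 and 1 of 'I_2. A vector field on the plane is the family of its
   components, v : 'I_2 -> plane R -> R; a time-dependent one is
   u : 'I_2 -> R -> plane R -> R, with u i t x the i-th component at (t, x). *)
Notation plane R := (R * R)%type.
Notation leb2 := (lebesgue_measure \x lebesgue_measure)%E.

Section Defs.
Context {R : realType}.

Local Notation leb := (@lebesgue_measure R).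

(* The norm of the product type R * R is the sup norm, so its balls are squares:
   Euclidean balls have to be introduced separately. *)
Definition eball (x : plane R) (r : R) : set (plane R) :=
  [set y | (y.1 - x.1) ^+ 2 + (y.2 - x.2) ^+ 2 < r ^+ 2].

Definition basis (j : 'I_2) : plane R := if j == 0 then (1, 0) else (0, 1).

Definition pderiv (j : 'I_2) (f : plane R -> R) (x : plane R) : R :=
  'D_(basis j) f x.

Definition divergence (v : 'I_2 -> plane R -> R) (x : plane R) : R :=
  \sum_(i < 2) pderiv i (v i) x.

Fixpoint iter_derive (V : normedModType R) (s : seq V) (f : V -> R) : V -> R :=
  if s is v :: s' then fun x => 'D_v (iter_derive s' f) x else f.

Definition smooth (V : normedModType R) (f : V -> R) : Prop :=
  forall s : seq V, continuous (iter_derive s f) /\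
    forall v x, derivable (iter_derive s f) x v.

Definition relatively_compact_in (V : topologicalType) (K U : set V) : Prop :=
  compact (closure K) /\ closure K `<=` U.

(* C^oo_c(U), each function being extended by 0 outside U. *)
Definition test_function (V : normedModType R) (U : set V) (f : V -> R) : Prop :=
  smooth f /\ relatively_compact_in [set x | f x != 0] U.

(* Divergence-free fields in C^oo_c(J x Om; R^2). *)
Definition solenoidal_test_field (J : set R) (Om : set (plane R))
    (Phi : 'I_2 -> R -> plane R -> R) : Prop :=
  (forall i, test_function (J `*` Om) (fun z : R * plane R => Phi i z.1 z.2)) /\
  (forall t x, divergence (fun i => Phi i t) x = 0).

(* For some choice of which coordinate is the "vertical" one and of its
   orientation, Om is locally the region above a smooth graph. *)
Definition smooth_boundary (Om : set (plane R)) : Prop :=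
  forall x0, (closure Om `\` Om°) x0 ->
  exists (r : R) (gamma : R -> R) (swapped flipped : bool),
  [/\ 0 < r, smooth gamma &
    forall x, eball x0 r x ->
      let: (h, v) := if swapped then (x.2, x.1) else x in
      Om x <-> gamma h < (-1) ^+ flipped * v].

(* Every loop in Om is homotopic in Om, with fixed base point, to a constant. *)
Definition simply_connected (Om : set (plane R)) : Prop :=
  forall g : R -> plane R,
  {within `[0, 1], continuous g} -> g @` `[0, 1] `<=` Om -> g 0 = g 1 ->
  exists H : R * R -> plane R,
  [/\ {within `[0, 1] `*` `[0, 1], continuous H},
      H @` (`[0, 1] `*` `[0, 1]) `<=` Om,
      forall s, s \in `[0, 1] -> H (0, s) = g s /\ H (1, s) = g 0 &
      forall l, l \in `[0, 1] -> H (l, 0) = g 0 /\ H (l, 1) = g 0].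

Definition L2normsq (Om : set (plane R)) (f : plane R -> R) : \bar R :=
  (\int[leb2]_(x in Om) ((f x) ^+ 2)%:E)%E.

Definition L2normsq_vec (Om : set (plane R)) (v : 'I_2 -> plane R -> R) : \bar R :=
  (\sum_(i < 2) L2normsq Om (v i))%E.

Definition L2normsq_mat (Om : set (plane R)) (A : 'I_2 -> 'I_2 -> plane R -> R)
    : \bar R :=
  (\sum_(i < 2) \sum_(j < 2) L2normsq Om (A i j))%E.

Definition spacetime_measurable (T : R) (Om : set (plane R))
    (f : R -> plane R -> R) : Prop :=
  measurable_fun (`]0, T[ `*` Om) (fun z : R * plane R => f z.1 z.2).

(* L^oo((0,T); L^2(Om)). Since L^2(Om) is separable, the elements of the Bochner
   spaces below are represented by jointly measurable functions. *)
Definition LinftyL2 (T : R) (Om : set (plane R)) (u : 'I_2 -> R -> plane R -> R)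
    : Prop :=
  (forall i, spacetime_measurable T Om (u i)) /\
  exists C : R, {ae leb, forall t, t \in `]0, T[ ->
    (L2normsq_vec Om (fun i => u i t) <= C%:E)%E}.

(* Convergence against the predual L^1((0,T); L^2(Om)). *)
Definition weak_star_cvg (T : R) (Om : set (plane R))
    (u : nat -> 'I_2 -> R -> plane R -> R) (v : 'I_2 -> R -> plane R -> R) : Prop :=
  LinftyL2 T Om v /\
  forall psi : 'I_2 -> R -> plane R -> R,
    (forall i, spacetime_measurable T Om (psi i)) ->
    (\int[leb]_(t in `]0%R, T[) sqrte (L2normsq_vec Om (fun i => psi i t))
       < +oo)%E ->
    (\int[leb]_(t in `]0, T[) \int[leb2]_(x in Om)
        (\sum_(i < 2) u n i t x * psi i t x)) @[n --> \oo] -->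
    \int[leb]_(t in `]0, T[) \int[leb2]_(x in Om)
        (\sum_(i < 2) v i t x * psi i t x).

(* f belongs to H^1_0(Om), the closure of C^oo_c(Om) in H^1(Om), and its weak
   gradient is g. *)
Definition H10 (Om : set (plane R)) (f : plane R -> R) (g : 'I_2 -> plane R -> R)
    : Prop :=
  [/\ measurable_fun Om f /\ (L2normsq Om f < +oo)%E,
      (forall j, measurable_fun Om (g j)) /\ (L2normsq_vec Om g < +oo)%E,
      forall j phi, test_function Om phi ->
        \int[leb2]_(x in Om) (f x * pderiv j phi x) =
        - \int[leb2]_(x in Om) (g j x * phi x) &
      exists phi : nat -> plane R -> R,
      [/\ forall k, test_function Om (phi k),
          L2normsq Om (fun x => f x - phi k x) @[k --> \oo] --> 0%E &
          forall j,
          L2normsq Om (fun x => g j x - pderiv j (phi k) x) @[k --> \oo] --> 0%E]].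

(* u belongs to L^2((0,T); H^1_0(Om)), with weak gradient
   Du i j = \partial_{x_j} u_i. *)
Definition L2H10 (T : R) (Om : set (plane R)) (u : 'I_2 -> R -> plane R -> R)
    (Du : 'I_2 -> 'I_2 -> R -> plane R -> R) : Prop :=
  [/\ forall i, spacetime_measurable T Om (u i),
      forall i j, spacetime_measurable T Om (Du i j),
      {ae leb, forall t, t \in `]0, T[ ->
        forall i, H10 Om (u i t) (fun j => Du i j t)} &
      (\int[leb]_(t in `]0%R, T[)
        (L2normsq_vec Om (fun i => u i t) +
         L2normsq_mat Om (fun i j => Du i j t)) < +oo)%E].

(* The closure in L^2(Om) of the divergence-free fields in C^oo_c(Om). *)
Definition L2sigma (Om : set (plane R)) (v : 'I_2 -> plane R -> R) : Prop :=
  [/\ forall i, measurable_fun Om (v i),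
      (L2normsq_vec Om v < +oo)%E &
      exists phi : nat -> 'I_2 -> plane R -> R,
      [/\ forall k i, test_function Om (phi k i),
          forall k x, divergence (phi k) x = 0 &
          L2normsq_vec Om (fun i x => v i x - phi k i x) @[k --> \oo] --> 0%E]].

Definition weakly_divergence_free (Om : set (plane R)) (v : 'I_2 -> plane R -> R)
    : Prop :=
  forall phi, test_function Om phi ->
    \int[leb2]_(x in Om) (\sum_(i < 2) v i x * pderiv i phi x) = 0.

Definition L1loc (Om : set (plane R)) (w : plane R -> R) : Prop :=
  measurable_fun Om w /\
  forall K : set (plane R), measurable K -> relatively_compact_in K Om ->
    (\int[leb2]_(x in K) `|w x|%:E < +oo)%E.

(* w = - \partial_{x_2} v_1 + \partial_{x_1} v_2 in the sense of distributions. *)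
Definition weak_curl (Om : set (plane R)) (v : 'I_2 -> plane R -> R)
    (w : plane R -> R) : Prop :=
  L1loc Om w /\
  forall phi, test_function Om phi ->
    \int[leb2]_(x in Om) (w x * phi x) =
    \int[leb2]_(x in Om) (v 0 x * pderiv 1 phi x - v 1 x * pderiv 0 phi x).

(* Leray-Hopf weak solution in (0,T) x Om with viscosity nu, no slip boundary
   condition and initial velocity u0. Test fields are in C^oo_c([0,T) x Om),
   obtained by restriction from ]-oo, T[ x Om; the second term of the weak
   formulation imposes the initial condition. *)
Definition leray_hopf (T : R) (Om : set (plane R)) (nu : R)
    (u0 : 'I_2 -> plane R -> R) (u : 'I_2 -> R -> plane R -> R) : Prop :=
  L2sigma Om u0 /\ LinftyL2 T Om u /\
  exists Du : 'I_2 -> 'I_2 -> R -> plane R -> R,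
  [/\ L2H10 T Om u Du,
      {ae leb, forall t, t \in `]0, T[ ->
        weakly_divergence_free Om (fun i => u i t)},
      forall Phi, solenoidal_test_field `]-oo, T[ Om Phi ->
        \int[leb]_(t in `]0, T[) \int[leb2]_(x in Om)
          (\sum_(i < 2) u i t x * derive1 (Phi i ^~ x) t
           + \sum_(i < 2) \sum_(j < 2) u i t x * u j t x * pderiv j (Phi i t) x
           - nu * \sum_(i < 2) \sum_(j < 2) Du i j t x * pderiv j (Phi i t) x)
        + \int[leb2]_(x in Om) (\sum_(i < 2) u0 i x * Phi i 0 x) = 0 &
      {ae leb, forall t, t \in `]0, T[ ->
        (L2normsq_vec Om (fun i => u i t)
         + (2 * nu)%:E *
           \int[leb]_(s in `]0%R, t[) L2normsq_mat Om (fun i j => Du i j s)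
         <= L2normsq_vec Om u0)%E}].

Definition euler_weak_solution (T : R) (Om : set (plane R))
    (u : 'I_2 -> R -> plane R -> R) : Prop :=
  [/\ LinftyL2 T Om u,
      {ae leb, forall t, t \in `]0, T[ ->
        weakly_divergence_free Om (fun i => u i t)} &
      forall Phi, solenoidal_test_field `]0, T[ Om Phi ->
        \int[leb]_(t in `]0, T[) \int[leb2]_(x in Om)
          (\sum_(i < 2) derive1 (Phi i ^~ x) t * u i t x)
        + \int[leb]_(t in `]0, T[) \int[leb2]_(x in Om)
          (\sum_(i < 2) \sum_(j < 2) pderiv j (Phi i t) x * u i t x * u j t x)
        = 0].

End Defs.

(* Main.v *)
(* For a divergence-free test field Phi, the integral of grad Phi : v (x) v over
   the mollification v_e = rho_e * v is minus that of curl v_e (Phi x v_e). At two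
   scales e <= d, v_e - v_d = G * omega where the kernel G is odd, vanishes at
   distance d and is O(1/|x|): symmetrizing the double integral over omega (x) omega
   as Delort does makes the kernel bounded. Hence the fluxes at the scales e and d
   differ by at most a constant times the mass of |omega| (x) |omega| at distance
   less than 2d from the diagonal, up to O(e), and by the absence of concentrations
   this is small uniformly in n after integration in time.
   At a fixed scale e the flux only involves the products of curl v_e(x) and v_e(x),
   which are pairings of v(t) with test fields; the test field of the first one is
   divergence-free, so by the Navier-Stokes equations this pairing is equicontinuous
   in time and converges strongly, while the second one converges weakly. A
   gliding-hump argument on the weak-* convergence bounds the energies uniformly. *)
Require Import Defs.
From HB Require Import structures.
From mathcomp Require Import all_boot all_order all_algebra.
From mathcomp Require Import all_classical all_reals all_analysis.
From mathcomp Require Import measurable_realfun lebesgue_integral_under.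
From mathcomp Require Import ring lra.

Set Implicit Arguments.
Unset Strict Implicit.
Unset Printing Implicit Defensive.

Import Order.TTheory GRing.Theory Num.Theory.
Import numFieldNormedType.Exports.

Local Open Scope classical_set_scope.
Local Open Scope ring_scope.

(** The flux is quadratic while the velocities converge only weakly, and vorticities bounded in L^1
    do not make the velocity at two scales close in L^2: in the plane the kernel 1/|x| just fails to
    be square-integrable. Only the flux against a solenoidal field, through its antisymmetric
    structure, can be compared between scales. The difference of two regularized kernels cancels
    beyond the larger scale, so every identity lives in a compact part of the domain, away from the
    boundary. The kernels are radial with a profile in |z|^2, so that curl, divergence, support and
    bounds all reduce to one function of one real variable. Scales are fixed in the order d, e, n: d
    by the absence of concentrations, uniformly in n; then e, small against constants that depend on
    d and for the limit velocity; then n. The hypotheses hold at almost every time only. Each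
    solution is therefore set to 0 off a full set of good times, after which energy bound,
    divergence and vorticity are available at every time. *)

Lemma ord2_cases (i : 'I_2) : i = 0 \/ i = 1.
Proof. by case: i => -[|[|//]] il; [left|right]; exact: val_inj. Qed.

(** * Integrable real-valued functions *)

Definition L1 d (T : measurableType d) (R : realType)
    (mu : {measure set T -> \bar R}) (f : T -> R) : Prop :=
  mu.-integrable setT (EFin \o f).

Section L1_theory.
Context d (T : measurableType d) (R : realType) (mu : {measure set T -> \bar R}).
Implicit Types f g h k : T -> R.

Lemma L1_measurable f : L1 mu f -> measurable_fun setT f.
Proof. by case/integrableP => /measurable_EFinP. Qed.

Lemma L1_le f g : measurable_fun setT f -> L1 mu g ->
  (forall x, `|f x| <= g x) -> L1 mu f.
Proof.
move=> mf gi fg; apply: le_integrable gi => //; first exact/measurable_EFinP.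
move=> x _ /=; rewrite lee_fin; apply: (le_trans (fg x)); exact: ler_norm.
Qed.

Lemma L1_0 : L1 mu (fun=> 0).
Proof. exact: integrable0. Qed.

Lemma L1D f g : L1 mu f -> L1 mu g -> L1 mu (fun x => f x + g x).
Proof. by move=> fi gi; apply: (integrableD _ fi gi). Qed.

Lemma L1N f : L1 mu f -> L1 mu (fun x => - f x).
Proof. by move=> fi; apply: (integrableN fi). Qed.

Lemma L1B f g : L1 mu f -> L1 mu g -> L1 mu (fun x => f x - g x).
Proof. by move=> fi gi; apply: L1D => //; exact: L1N. Qed.

Lemma L1Zl (c : R) f : L1 mu f -> L1 mu (fun x => c * f x).
Proof. by move=> fi; apply: (integrableZl _ _ fi). Qed.

Lemma L1Zr (c : R) f : L1 mu f -> L1 mu (fun x => f x * c).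
Proof. by move=> /(L1Zl c); rewrite /L1/comp; under eq_fun do rewrite mulrC. Qed.

Lemma L1_abs f : L1 mu f -> L1 mu (fun x => `|f x|).
Proof. by move=> fi; exact: (integrable_norm fi). Qed.

Lemma L1_sum (I : Type) (s : seq I) (F : I -> T -> R) :
  (forall i, L1 mu (F i)) -> L1 mu (fun x => \sum_(i <- s) F i x).
Proof.
move=> H; elim: s => [|a s IH].
  by under [X in L1 _ X]eq_fun do rewrite big_nil; exact: L1_0.
by under [X in L1 _ X]eq_fun do rewrite big_cons; exact: L1D.
Qed.

Lemma L1_bmul (c : R) k f : measurable_fun setT k -> (forall x, `|k x| <= c) ->
  L1 mu f -> L1 mu (fun x => k x * f x).
Proof.
move=> mk kc fi; apply: (@L1_le _ (fun x => c * `|f x|)).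
- by apply: measurable_funM => //; exact: L1_measurable.
- exact/L1Zl/L1_abs.
- by move=> x; rewrite normrM ler_wpM2r.
Qed.

Lemma Int_ext f g : f =1 g -> \int[mu]_x f x = \int[mu]_x g x.
Proof. by move=> fg; apply: eq_Rintegral => x _; rewrite fg. Qed.

Lemma IntD f g : L1 mu f -> L1 mu g ->
  \int[mu]_x (f x + g x) = \int[mu]_x f x + \int[mu]_x g x.
Proof. by move=> fi gi; rewrite RintegralD. Qed.

Lemma IntB f g : L1 mu f -> L1 mu g ->
  \int[mu]_x (f x - g x) = \int[mu]_x f x - \int[mu]_x g x.
Proof. by move=> fi gi; rewrite RintegralB. Qed.

Lemma IntZl (c : R) f : L1 mu f -> \int[mu]_x (c * f x) = c * \int[mu]_x f x.
Proof. by move=> fi; rewrite RintegralZl. Qed.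

Lemma IntZr (c : R) f : L1 mu f -> \int[mu]_x (f x * c) = \int[mu]_x f x * c.
Proof. by move=> fi; rewrite RintegralZr. Qed.

Lemma Int_0 : \int[mu]_x (0 : R) = 0.
Proof. by rewrite Rintegral_cst// mul0r. Qed.

Lemma IntN f : L1 mu f -> \int[mu]_x (- f x) = - \int[mu]_x f x.
Proof.
move=> fi; under Int_ext do rewrite -mulN1r.
by rewrite IntZl// mulN1r.
Qed.

Lemma Int_sum (I : Type) (s : seq I) (F : I -> T -> R) :
  (forall i, L1 mu (F i)) ->
  \int[mu]_x (\sum_(i <- s) F i x) = \sum_(i <- s) \int[mu]_x F i x.
Proof.
move=> H; elim: s => [|a s IH].
  by under Int_ext do rewrite big_nil; rewrite big_nil Int_0.
under Int_ext do rewrite big_cons.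
by rewrite IntD ?IH ?big_cons//; exact: L1_sum.
Qed.

Lemma Int_le f g : L1 mu f -> L1 mu g -> (forall x, f x <= g x) ->
  \int[mu]_x f x <= \int[mu]_x g x.
Proof. by move=> fi gi fg; apply: le_Rintegral. Qed.

Lemma Int_ge0 f : (forall x, 0 <= f x) -> 0 <= \int[mu]_x f x.
Proof. by move=> f0; apply: Rintegral_ge0. Qed.

Lemma Int_norm f : L1 mu f -> `|\int[mu]_x f x| <= \int[mu]_x `|f x|.
Proof. by move=> fi; apply: le_normr_Rintegral. Qed.

Lemma Int_norm_le f g : measurable_fun setT f -> L1 mu g ->
  (forall x, `|f x| <= g x) -> `|\int[mu]_x f x| <= \int[mu]_x g x.
Proof.
move=> mf gi fg; have fi := L1_le mf gi fg.
by apply: (le_trans (Int_norm fi)); apply: Int_le => //; exact: L1_abs.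
Qed.

Lemma EFin_Int f : L1 mu f -> (\int[mu]_x f x)%:E = (\int[mu]_x (f x)%:E)%E.
Proof. by move=> fi; rewrite /Rintegral fineK//; exact: integrable_fin_num. Qed.

Lemma L1_ge0P f : measurable_fun setT f -> (forall x, 0 <= f x) ->
  (\int[mu]_x (f x)%:E < +oo)%E -> L1 mu f.
Proof.
move=> mf f0 fi; apply/integrableP; split; first exact/measurable_EFinP.
by under eq_integral do rewrite /= ger0_norm//.
Qed.

Lemma Int_le_EFin f (c : R) : measurable_fun setT f -> (forall x, 0 <= f x) ->
  (\int[mu]_x (f x)%:E <= c%:E)%E -> L1 mu f /\ \int[mu]_x f x <= c.
Proof.
move=> mf f0 fc; have fi : L1 mu f.
  by apply: L1_ge0P => //; exact: (le_lt_trans fc (ltry _)).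
by split => //; rewrite -lee_fin EFin_Int.
Qed.

Lemma measurable_ae_bad (P : T -> Prop) : {ae mu, forall x, P x} ->
  exists N, [/\ measurable N, mu N = 0 & forall x, ~ N x -> P x].
Proof.
move=> [N [mN N0 sub]]; exists N; split=> // x Nx.
by apply: contrapT => Px; apply: Nx; exact: sub.
Qed.

Lemma Int_ae_eq f g : measurable_fun setT f -> measurable_fun setT g ->
  {ae mu, forall x, f x = g x} -> \int[mu]_x f x = \int[mu]_x g x.
Proof.
move=> mf mg fg; rewrite /Rintegral; congr fine; apply: ae_eq_integral => //.
- exact/measurable_EFinP.
- exact/measurable_EFinP.
- by apply: filterS fg => x /= ->.
Qed.

Lemma Int_DCT (F : nat -> T -> R) f g :
  (forall n, measurable_fun setT (F n)) -> measurable_fun setT f -> L1 mu g ->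
  {ae mu, forall x, F ^~ x @ \oo --> f x} ->
  {ae mu, forall x n, `|F n x| <= g x} ->
  L1 mu f /\ \int[mu]_x F n x @[n --> \oo] --> \int[mu]_x f x.
Proof.
move=> mF mf gi Ff Fg.
have [|||||fi _ H] := @dominated_convergence _ _ _ mu setT measurableT
  (fun n x => (F n x)%:E) (EFin \o f) (EFin \o g).
- by move=> n; exact/measurable_EFinP.
- exact/measurable_EFinP.
- apply: filterS Ff => x Ff _; apply: cvg_EFin; last exact: Ff.
  exact: nearW.
- exact: gi.
- by apply: filterS Fg => x Fg n _ /=; rewrite lee_fin.
split => //; apply: fine_cvg; rewrite fineK; last exact: integrable_fin_num.
exact: H.
Qed.

Lemma Int_DCT' (F : nat -> T -> R) f g :
  (forall n, measurable_fun setT (F n)) -> L1 mu g ->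
  (forall x, F ^~ x @ \oo --> f x) ->
  (forall x n, `|F n x| <= g x) ->
  L1 mu f /\ \int[mu]_x F n x @[n --> \oo] --> \int[mu]_x f x.
Proof.
move=> mF gi Ff Fg; apply: (@Int_DCT F f g) => //; last 2 first.
- exact: aeW.
- exact: aeW.
by apply: (measurable_fun_cvg mF) => x _; exact: Ff.
Qed.

Lemma L1_indic (A : set T) : measurable A -> (mu A < +oo)%E ->
  L1 mu (fun x => \1_A x).
Proof. move=> mA Aoo; apply/integrableP; split.
  by apply/measurable_EFinP; exact: measurable_indic.
under eq_integral do rewrite /= ger0_norm//.
by rewrite integral_indic// setIT. Qed.

Lemma L1_bounded_supp (A : set T) (c : R) f : measurable A -> (mu A < +oo)%E ->
  measurable_fun setT f -> (forall x, `|f x| <= c) ->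
  (forall x, ~ A x -> f x = 0) -> L1 mu f.
Proof.
move=> mA Aoo mf fc fA; apply: (@L1_le _ (fun x => c * \1_A x)) => //.
  by apply/L1Zl; exact: L1_indic.
move=> x; rewrite indicE; case: (boolP (x \in A)) => xA; first by rewrite mulr1.
by rewrite mulr0 fA ?normr0// => /mem_set; exact/negP.
Qed.

End L1_theory.

(** * Integration on the plane *)

Section Fubini.
Context d1 d2 (T1 : measurableType d1) (T2 : measurableType d2) (R : realType).
Variables (m1 : {sigma_finite_measure set T1 -> \bar R})
          (m2 : {sigma_finite_measure set T2 -> \bar R}).
Local Notation m12 := (m1 \x m2)%E.

(** Tonelli applied to the dominating product, whose iterated integral factors. *)
Lemma L1_prod (f : T1 * T2 -> R) (a : T1 -> R) (b : T2 -> R) :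
  measurable_fun setT f -> L1 m1 a -> L1 m2 b ->
  (forall x y, `|f (x, y)| <= a x * b y) -> L1 m12 f.
Proof.
move=> mf ai bi fab; apply/integrable12ltyP; first exact/measurable_EFinP.
have a0 x : 0 <= `|a x| by [].
apply: (@le_lt_trans _ _ (\int[m1]_x (`|a x|%:E * (\int[m2]_y `|b y|)%:E))%E).
  apply: ge0_le_integral => //.
  - by move=> x _; apply: integral_ge0 => y _; rewrite lee_fin.
  - apply: (measurable_fun_fubini_tonelli_F (fun z => `|(EFin \o f) z|%E)) => //=.
    by apply/measurable_EFinP; apply: measurableT_comp.
  - apply/emeasurable_funM => //; apply/measurable_EFinP/measurableT_comp => //.
    exact: L1_measurable ai.
  - move=> x _; rewrite EFin_Int; last exact: L1_abs.
    rewrite -ge0_integralZl//; last first.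
      by apply/measurable_EFinP/measurableT_comp => //; exact: L1_measurable bi.
    apply: ge0_le_integral => //.
    + apply/measurable_EFinP/measurableT_comp => //.
      exact: (measurableT_comp mf).
    + apply: measurable_funeM; apply/measurable_EFinP/measurableT_comp => //.
      exact: L1_measurable bi.
    + move=> y _; rewrite -EFinM lee_fin (le_trans (fab x y))// -normrM.
      exact: ler_norm.
rewrite ge0_integralZr//; last 2 first.
- by apply/measurable_EFinP/measurableT_comp => //; exact: L1_measurable ai.
- by rewrite lee_fin; apply: Int_ge0.
by rewrite -EFin_Int ?ltry//; exact: L1_abs.
Qed.

(** Measurability without integrability: the positive and negative parts have measurable partial
    integrals by Tonelli, and the difference of the two is measurable, points of the form oo - oo
    included. *)
Lemma fubini_measurable1 (f : T1 * T2 -> R) : measurable_fun setT f ->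
  measurable_fun setT (fun x => \int[m2]_y f (x, y)).
Proof.
move=> mf; apply: measurableT_comp => //; have mf' := (measurable_EFinP _ _).2 mf.
have -> : (fun x => \int[m2]_y (f (x, y))%:E)%E =
  (fun x => \int[m2]_y (EFin \o f)^\+ (x, y) - \int[m2]_y (EFin \o f)^\- (x, y))%E.
  apply/funext=> x; rewrite [LHS]integralE.
  by congr (_ - _)%E; apply: eq_integral => y _; rewrite ?funeposE ?funenegE.
apply: emeasurable_funB; apply: measurable_fun_fubini_tonelli_F => //.
- exact: measurable_funepos.
- exact: measurable_funeneg.
Qed.

Lemma fubini_measurable2 (f : T1 * T2 -> R) : measurable_fun setT f ->
  measurable_fun setT (fun y => \int[m1]_x f (x, y)).
Proof.
move=> mf; apply: measurableT_comp => //; have mf' := (measurable_EFinP _ _).2 mf.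
have -> : (fun y => \int[m1]_x (f (x, y))%:E)%E =
  (fun y => \int[m1]_x (EFin \o f)^\+ (x, y) - \int[m1]_x (EFin \o f)^\- (x, y))%E.
  apply/funext=> x; rewrite [LHS]integralE.
  by congr (_ - _)%E; apply: eq_integral => y _; rewrite ?funeposE ?funenegE.
apply: emeasurable_funB; apply: measurable_fun_fubini_tonelli_G => //.
- exact: measurable_funepos.
- exact: measurable_funeneg.
Qed.

Lemma fubini_L1 (f : T1 * T2 -> R) : L1 m12 f ->
  L1 m1 (fun x => \int[m2]_y f (x, y)).
Proof.
move=> fi; have := integrable_fubini_F fi => Fi.
have mf := fubini_measurable1 (L1_measurable fi).
apply/integrableP; split; first exact/measurable_EFinP.
have /integrableP[_] := Fi; apply: le_lt_trans.
apply: ge0_le_integral => //.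
- by apply: measurableT_comp => //; exact/measurable_EFinP.
- by apply: measurableT_comp => //; exact: measurable_int Fi.
- move=> x _ /=; rewrite /fubini_F /Rintegral.
  by case: (integral _ _ _) => [r| |] /=; rewrite ?normr0 ?leey.
Qed.

Lemma fubini_eq1 (f : T1 * T2 -> R) : L1 m12 f ->
  \int[m12]_z f z = \int[m1]_x \int[m2]_y f (x, y).
Proof.
move=> fi; rewrite {1}/Rintegral -(integral12_prod_meas1 fi) /Rintegral; congr fine.
apply: ae_eq_integral => //.
- exact: measurable_int (integrable_fubini_F fi).
- apply/measurable_EFinP; exact: fubini_measurable1 (L1_measurable fi).
- have := ae_integrable1 fi; apply: filterS => x xi _.
  by rewrite fineK//; exact: integrable_fin_num xi.
Qed.

Lemma fubini_eq2 (f : T1 * T2 -> R) : L1 m12 f ->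
  \int[m12]_z f z = \int[m2]_y \int[m1]_x f (x, y).
Proof.
move=> fi; rewrite {1}/Rintegral -(integral21_prod_meas1 fi) /Rintegral; congr fine.
apply: ae_eq_integral => //.
- exact: measurable_fubini_G fi.
- apply/measurable_EFinP; exact: fubini_measurable2 (L1_measurable fi).
- have := ae_integrable2 fi; apply: filterS => x xi _.
  by rewrite fineK//; exact: integrable_fin_num xi.
Qed.

Lemma fubini_swap (f : T1 * T2 -> R) : L1 m12 f ->
  \int[m1]_x \int[m2]_y f (x, y) = \int[m2]_y \int[m1]_x f (x, y).
Proof. by move=> fi; rewrite -fubini_eq1// fubini_eq2. Qed.

Lemma fubini_kernel (f : T1 -> R) (g : T2 -> R) (k : T1 * T2 -> R) (c : R) :
  L1 m1 f -> L1 m2 g -> measurable_fun setT k -> (forall z, `|k z| <= c) ->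
  \int[m1]_x (f x * \int[m2]_y (k (x, y) * g y)) =
  \int[m2]_y (g y * \int[m1]_x (k (x, y) * f x)).
Proof.
move=> fi gi mk kc.
have mf := L1_measurable fi; have mg := L1_measurable gi.
have kgi x : L1 m2 (fun y => k (x, y) * g y).
  by apply: (@L1_bmul _ _ _ _ c) => //; exact: (measurableT_comp mk).
have kfi y : L1 m1 (fun x => k (x, y) * f x).
  by apply: (@L1_bmul _ _ _ _ c) => //; exact: (measurableT_comp mk).
under Int_ext do rewrite -IntZl//.
under [RHS]Int_ext do rewrite -IntZl//.
rewrite (fubini_swap (f := fun z => f z.1 * (k z * g z.2))).
  by apply: Int_ext => y; apply: Int_ext => x /=; ring.
apply: (@L1_prod _ (fun x => c * `|f x|) (fun y => `|g y|)).
- apply: measurable_funM; first exact: measurableT_comp.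
  by apply: measurable_funM => //; exact: measurableT_comp.
- exact/L1Zl/L1_abs.
- exact: L1_abs.
- move=> x y /=; rewrite !normrM mulrA ler_wpM2r// mulrC ler_wpM2r//.
Qed.

End Fubini.

Section plane_measurability.
Context (R : realType).
Local Notation mu := (@lebesgue_measure R).

(** The sigma-algebra of the plane is the product one, so continuity does not give measurability at
    once. The first variable is replaced by the grid point below it, which leaves countably many
    measurable pieces, and the grid is then refined. *)
Lemma measurable_caratheodory d (T : measurableType d) (f : R * T -> R) :
  (forall y, continuous (fun x => f (x, y))) ->
  (forall x, measurable_fun setT (fun y => f (x, y))) ->
  measurable_fun setT f.
Proof.
move=> cf mf.
pose a (n : nat) (t : R) : R := (Num.floor (t * n.+1%:R))%:~R / n.+1%:R.
pose F (n : nat) (z : R * T) := f (a n z.1, z.2).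
have mF n : measurable_fun setT (F n).
  move=> _ B mB; rewrite setTI.
  have -> : F n @^-1` B = \bigcup_(k : int)
      ([set t : R | Num.floor (t * n.+1%:R) = k] `*`
       (fun y => f (k%:~R / n.+1%:R, y)) @^-1` B).
    apply/seteqP; split=> [[t y] /= H|[t y] [k _ [/= kE H]]].
      by exists (Num.floor (t * n.+1%:R)).
    by rewrite /F /a /= kE.
  apply: countable_bigcupT_measurable => // k; apply: measurableX.
    have -> : [set t : R | Num.floor (t * n.+1%:R) = k] =
        `[k%:~R / n.+1%:R, (k + 1)%:~R / n.+1%:R[%classic.
      apply/seteqP; split=> t /=; rewrite in_itv/= ler_pdivrMr// ltr_pdivlMr//.
        by move=> <-; exact: floor_itv.
      by move=> H; exact: floor_def.
    exact: measurable_itv.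
  by rewrite -[X in measurable X]setTI; exact: mf.
apply: (measurable_fun_cvg mF) => -[t y] _ /=.
apply: (@cvg_comp _ _ _ (fun n => a n t) (fun x => f (x, y)) _ (nbhs t)); last exact: cf.
apply/cvgrPdist_le => e e0; near=> n.
have n0 : 0 < n.+1%:R :> R by [].
have /andP[H1 H2] := floor_itv (t * n.+1%:R).
rewrite /a ger0_norm; last by rewrite subr_ge0 ler_pdivrMr.
rewrite lerBlDl -lerBlDr ler_pdivlMr// mulrBl.
have : 1 <= e * n.+1%:R.
  rewrite -ler_pdivrMl// mulr1.
  near: n; exists (Num.truncn e^-1) => // m /= hm.
  apply: (le_trans (ltW (truncnS_gt _))); rewrite ler_nat//.
by move: H2; rewrite intrD => H2 H3; lra.
Unshelve. all: by end_near. Qed.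

Lemma continuous_pair1 (T : topologicalType) (U : topologicalType) (V : topologicalType)
  (f : T * U -> V) y : continuous f -> continuous (fun x => f (x, y)).
Proof.
move=> cf x; apply: (@cvg_comp _ _ _ (fun x => (x, y)) f _ (nbhs (x, y))).
  by apply: cvg_pair; [exact: cvg_id|exact: cvg_cst].
exact: cf.
Qed.

Lemma continuous_pair2 (T : topologicalType) (U : topologicalType) (V : topologicalType)
  (f : T * U -> V) x : continuous f -> continuous (fun y => f (x, y)).
Proof.
move=> cf y; apply: (@cvg_comp _ _ _ (fun y => (x, y)) f _ (nbhs (x, y))).
  by apply: cvg_pair; [exact: cvg_cst|exact: cvg_id].
exact: cf.
Qed.

Lemma measurable_continuous_plane (f : plane R -> R) : continuous f ->
  measurable_fun setT f.
Proof.
move=> cf; apply: measurable_caratheodory => y; first exact: continuous_pair1.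
by have := continuous_pair2 (x := y) cf; exact: continuous_measurable_fun.
Qed.

Lemma measurable_continuous_spacetime (f : R * plane R -> R) : continuous f ->
  measurable_fun setT f.
Proof.
move=> cf; apply: measurable_caratheodory => y; first exact: continuous_pair1.
by have := continuous_pair2 (x := y) cf; exact: measurable_continuous_plane.
Qed.

Lemma plane_ballE (x : plane R) (r : R) : ball x r = ball x.1 r `*` ball x.2 r.
Proof. by []. Qed.

(** Second countability: an open set is the union of the squares with rational centre and radius
    1/(k+1) that it contains, and squares are products of intervals. *)
Lemma open_measurable_plane (A : set (plane R)) : open A -> measurable A.
Proof.
move=> oA.
pose P (q : rat * rat * nat) : set (plane R) :=
  ball (ratr q.1.1 : R, ratr q.1.2 : R) q.2.+1%:R^-1.
have -> : A = \bigcup_(q in [set q | P q `<=` A]) P q.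
  apply/seteqP; split=> [x Ax|x [q /= qA]]; last exact: qA.
  have /nbhs_ballP[e /= e0 eA] := open_nbhs_nbhs (conj oA Ax).
  (* With this [k] the radius is less than e/2, so any square of that radius containing x lies in
     [ball x e]. *)
  pose k := Num.truncn (2 / e).
  have kP : k.+1%:R^-1 < e / 2 :> R.
    rewrite -[e / 2]invrK ltf_pV2 ?posrE ?invr_gt0 ?divr_gt0//.
    by rewrite invf_div truncnS_gt.
  have : 0 < k.+1%:R^-1 :> R by rewrite invr_gt0.
  have PE q1 q2 : P (q1, q2, k) = ball (ratr q1 : R, ratr q2 : R) k.+1%:R^-1 by [].
  move: kP PE; move: (k.+1%:R^-1 : R) => h kP PE h0.
  have [q1] := @rat_in_itvoo R (x.1 - h) (x.1 + h) ltac:(lra); rewrite in_itv/= => /andP[a1 a2].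
  have [q2] := @rat_in_itvoo R (x.2 - h) (x.2 + h) ltac:(lra); rewrite in_itv/= => /andP[b1 b2].
  exists (q1, q2, k) => /=.
    rewrite PE.
    move=> y [/=]; rewrite /ball/= !ltr_norml => /andP[? ?] /andP[? ?].
    by apply: eA; split; rewrite /ball/= ltr_norml; apply/andP; split; lra.
  by rewrite PE; split; rewrite /ball/= ltr_norml; apply/andP; split; lra.
rewrite bigcup_mkcond; apply: countable_bigcupT_measurable => // q.
case: ifPn => _; last exact: measurable0.
by rewrite /P plane_ballE; apply: measurableX; exact: measurable_ball.
Qed.

Lemma leb2_bounded (A : set (plane R)) : measurable A -> bounded_set A ->
  (leb2 A < +oo :> \bar R)%E.
Proof.
move=> mA [M [_ /(_ (M + 1) ltac:(lra)) HM]].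
have sub : A `<=` `[- (M + 1), M + 1]%classic `*` `[- (M + 1), M + 1]%classic.
  move=> x /HM /=; rewrite prod_normE ge_max !ler_norml => /andP[/andP[? ?] /andP[? ?]].
  by split; rewrite /= in_itv/=; apply/andP.
apply: (@le_lt_trans _ _ (leb2 (`[- (M + 1), M + 1]%classic `*` `[- (M + 1), M + 1]%classic))).
  by apply: le_measure => //; rewrite inE//; apply: measurableX; exact: measurable_itv.
rewrite [X in (X < _)%E]product_measure1E//= !lebesgue_measure_itv/=.
by case: ifP => _; rewrite ?mule0 ?ltry// -EFinD -EFinM ltry.
Qed.

End plane_measurability.

Local Notation basis := Defs.basis.

(** * Differential calculus on the plane *)

Section directional_derivatives.
Context (R : realType) (V : normedModType R).
Implicit Types (f : V -> R).

(** The two difference quotients are the same function of h, so facts about one real variable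
    transfer to directional derivatives. *)
Lemma line_quotient f x v s :
  (fun h : R => h^-1 *: (((fun s : R => f (x + s *: v)) \o shift s) (h *: 1) -
     f (x + s *: v))) =
  (fun h : R => h^-1 *: ((f \o shift (x + s *: v)) (h *: v) - f (x + s *: v))).
Proof.
apply/funext => h /=; congr (_ *: (f _ - _)).
by rewrite [h *: 1]mulr1 scalerDl addrCA.
Qed.

Lemma derivable_line f x v s :
  derivable (fun s : R => f (x + s *: v)) s 1 <-> derivable f (x + s *: v) v.
Proof. by rewrite /derivable line_quotient. Qed.

Lemma derive_line f x v s :
  'D_1 (fun s : R => f (x + s *: v)) s = 'D_v f (x + s *: v).
Proof. by rewrite /derive line_quotient. Qed.

Lemma derive_near0 f x v : (\forall y \near x, f y = 0) -> 'D_v f x = 0.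
Proof.
by move=> H; rewrite (@near_eq_derive _ _ _ f (cst 0) x v)// derive_cst.
Qed.

Lemma bounded_on_compact (T : topologicalType) (f : T -> R) (K : set T) :
  continuous f -> compact K -> exists2 C : R, 0 <= C & forall x, K x -> `|f x| <= C.
Proof.
move=> cf cK.
have /compact_bounded[M [_ HM]] := continuous_compact (continuous_subspaceT cf) cK.
exists (`|M| + 1); first by rewrite addr_ge0.
move=> x Kx; apply: (HM (`|M| + 1)); last by exists x.
by rewrite (le_lt_trans (ler_norm M))// ltrDl.
Qed.

Lemma bounded_compact_support (T : topologicalType) (f : T -> R) :
  continuous f -> compact (closure [set x | f x != 0]) ->
  exists2 C : R, 0 <= C & forall x, `|f x| <= C.
Proof.
move=> cf /(bounded_on_compact cf)[C C0 HC]; exists C => // x.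
have [->|fx0] := eqVneq (f x) 0; first by rewrite normr0.
by apply: HC; exact: subset_closure.
Qed.

End directional_derivatives.

Section plane_calculus.
Context (R : realType).
Implicit Types (f g : plane R -> R).
Local Notation mu := (@lebesgue_measure R).

(** Only the two coordinate derivatives are asked for: they suffice for integration by parts and for
    the Lipschitz bound, and they are what differentiation under the integral provides for
    convolutions. *)
Definition C1 f := continuous f /\ forall j,
  (forall x, derivable f x (basis j)) /\ continuous (pderiv j f).

Lemma C1_continuous f : C1 f -> continuous f. Proof. by case. Qed.

Lemma C1_derivable f j x : C1 f -> derivable f x (basis j).
Proof. by case=> _ /(_ j)[]. Qed.

Lemma C1_continuousD f j : C1 f -> continuous (pderiv j f).
Proof. by case=> _ /(_ j)[]. Qed.
Arguments C1_continuousD {f} j _ _ _ _.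

Lemma pderivD f g j : C1 f -> C1 g ->
  pderiv j (fun x => f x + g x) = fun x => pderiv j f x + pderiv j g x.
Proof. by move=> cf cg; apply/funext=> x; rewrite /pderiv deriveD//; exact: C1_derivable. Qed.

Lemma pderivN f j : C1 f -> pderiv j (fun x => - f x) = fun x => - pderiv j f x.
Proof. by move=> cf; apply/funext=> x; rewrite /pderiv deriveN//; exact: C1_derivable. Qed.

Lemma pderivM f g j : C1 f -> C1 g -> pderiv j (fun x => f x * g x) =
  fun x => f x * pderiv j g x + g x * pderiv j f x.
Proof. by move=> cf cg; apply/funext=> x; rewrite /pderiv deriveM//; exact: C1_derivable. Qed.

Lemma pderivZ f (c : R) j : C1 f ->
  pderiv j (fun x => c * f x) = fun x => c * pderiv j f x.
Proof. by move=> cf; apply/funext=> x; rewrite /pderiv deriveZ//; exact: C1_derivable. Qed.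

Lemma C1D f g : C1 f -> C1 g -> C1 (fun x => f x + g x).
Proof.
move=> cf cg; split=> [|j]; first by move=> x; apply: cvgD; exact: C1_continuous.
split=> [x|]; first by apply: derivableD; exact: C1_derivable.
by rewrite pderivD// => x; apply: cvgD; exact: C1_continuousD.
Qed.

Lemma C1N f : C1 f -> C1 (fun x => - f x).
Proof.
move=> cf; split=> [|j]; first by move=> x; apply: cvgN; exact: C1_continuous.
split=> [x|]; first by apply: derivableN; exact: C1_derivable.
by rewrite pderivN// => x; apply: cvgN; exact: C1_continuousD.
Qed.

Lemma C1B f g : C1 f -> C1 g -> C1 (fun x => f x - g x).
Proof. by move=> cf cg; exact: (C1D cf (C1N cg)). Qed.

Lemma C1M f g : C1 f -> C1 g -> C1 (fun x => f x * g x).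
Proof.
move=> cf cg; split=> [|j]; first by move=> x; apply: cvgM; exact: C1_continuous.
split=> [x|]; first by apply: derivableM; exact: C1_derivable.
rewrite pderivM// => x.
have cDf := C1_continuousD j cf; have cDg := C1_continuousD j cg.
by apply: cvgD; apply: cvgM; [exact: cf.1|exact: cDg|exact: cg.1|exact: cDf].
Qed.

Lemma C1Z f (c : R) : C1 f -> C1 (fun x => c * f x).
Proof.
move=> cf; split=> [|j].
  by move=> x; apply: cvgM; [exact: cvg_cst|exact: C1_continuous].
split=> [x|]; first by apply: derivableZ; exact: C1_derivable.
by rewrite pderivZ// => x; apply: cvgM; [exact: cvg_cst|exact: C1_continuousD].
Qed.

Lemma basis0 : basis 0 = (1, 0) :> plane R. Proof. by []. Qed.
Lemma basis1 : basis 1 = (0, 1) :> plane R. Proof. by []. Qed.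

Lemma slice0 f y : (fun s => f (s, y)) = (fun s => f ((0, y) + s *: basis 0)).
Proof.
apply/funext => s; congr f; rewrite basis0; apply/pair_equal_spec; split => /=.
  by rewrite add0r [s *: 1]mulr1.
by rewrite scaler0 addr0.
Qed.

Lemma slice1 f x : (fun s => f (x, s)) = (fun s => f ((x, 0) + s *: basis 1)).
Proof.
apply/funext => s; congr f; rewrite basis1; apply/pair_equal_spec; split => /=.
  by rewrite scaler0 addr0.
by rewrite add0r [s *: 1]mulr1.
Qed.

Lemma slice0_derive f y s : C1 f -> derivable (fun s : R => f (s, y)) s 1 /\
  (derive1 (fun s : R => f (s, y))) s = pderiv 0 f (s, y).
Proof.
move=> cf; rewrite derive1E slice0; split.
  by apply/derivable_line; exact: C1_derivable.
have E : ((0, y) : plane R) + s *: basis 0 = (s, y).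
  by rewrite basis0; apply/pair_equal_spec; rewrite /= add0r [s *: 1]mulr1 scaler0 addr0.
by rewrite derive_line /pderiv E.
Qed.

Lemma slice1_derive f x s : C1 f -> derivable (fun s : R => f (x, s)) s 1 /\
  (derive1 (fun s : R => f (x, s))) s = pderiv 1 f (x, s).
Proof.
move=> cf; rewrite derive1E slice1; split.
  by apply/derivable_line; exact: C1_derivable.
have E : ((x, 0) : plane R) + s *: basis 1 = (x, s).
  by rewrite basis1; apply/pair_equal_spec; rewrite /= add0r [s *: 1]mulr1 scaler0 addr0.
by rewrite derive_line /pderiv E.
Qed.

Lemma Int_derive1_0 (g : R -> R) (M : R) : 0 < M ->
  (forall s, derivable g s 1) -> continuous (derive1 g) ->
  (forall s, M <= `|s| -> g s = 0) -> \int[mu]_s (derive1 g) s = 0.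
Proof.
move=> M0 dg cg g0.
have dg0 s : ~ (s \in `[- M, M]) -> (derive1 g) s = 0.
  move=> sM; rewrite derive1E; apply: derive_near0.
  have : M < `|s|.
    by rewrite ltNge; apply/negP => H; apply: sM; rewrite in_itv/= -ler_norml.
  move=> Ms; have /(_ (nbhs_filter s)) := cvgr_gt _ (@norm_continuous _ _ s) M Ms.
  by apply: filterS => t /= /ltW; exact: g0.
have -> : \int[mu]_s (derive1 g) s = \int[mu]_(s in `[- M, M]) (derive1 g) s.
  rewrite [RHS]Rintegral_mkcond; apply: Int_ext => s; rewrite patchE.
  by case: ifPn => //; rewrite notin_setE => /dg0.
have cgs s : {for s, continuous g}.
  by apply: differentiable_continuous; exact/derivable1_diffP.
have Mlt : - M < M by lra.
have cg' : {within `[- M, M], continuous (derive1 g)} by exact: continuous_subspaceT.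
have dg' : derivable_oo_LRcontinuous g (- M) M.
  split; first by move=> x _; exact: dg.
  - by apply: cvg_at_right_filter; exact: cgs.
  - by apply: cvg_at_left_filter; exact: cgs.
have E := continuous_FTC2 Mlt cg' dg' (fun x _ => erefl).
rewrite /Rintegral E.
have -> : g M = 0 by apply: g0; exact: ler_norm.
have -> : g (- M) = 0 by apply: g0; rewrite normrN; exact: ler_norm.
by rewrite subee.
Qed.

(** Compact support encoded by vanishing off an open square rather than by a closure: products and
    sums inherit it at once. *)
Definition box_supp (M : R) f := forall x, M <= `|x.1| \/ M <= `|x.2| -> f x = 0.

(** The half-side grows by 1 so that a point outside the larger square has a neighbourhood on which
    f vanishes identically. *)
Lemma box_supp_pderiv M j f : box_supp M f -> box_supp (M + 1) (pderiv j f).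
Proof.
move=> fM x H; apply: derive_near0.
have n1 : continuous (fun z : plane R => `|z.1|).
  move=> z; apply: (@cvg_comp _ _ _ fst (fun t : R => `|t|) _ (nbhs z.1)); first exact: cvg_fst.
  exact: norm_continuous.
have n2 : continuous (fun z : plane R => `|z.2|).
  move=> z; apply: (@cvg_comp _ _ _ snd (fun t : R => `|t|) _ (nbhs z.2)); first exact: cvg_snd.
  exact: norm_continuous.
case: H => H.
  have := cvgr_gt _ (n1 x) M ltac:(lra); apply: filterS => z /= /ltW Hz.
  by apply: fM; left.
have := cvgr_gt _ (n2 x) M ltac:(lra); apply: filterS => z /= /ltW Hz.
by apply: fM; right.
Qed.

Lemma box_supp_bounded M f : continuous f -> box_supp M f ->
  exists2 C : R, 0 <= C & forall x, `|f x| <= C.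
Proof.
move=> cf fM.
have cK : compact (`[- M, M]%classic `*` `[- M, M]%classic : set (plane R)).
  by apply: compact_setX; exact: segment_compact.
have [C C0 HC] := bounded_on_compact cf cK; exists C => // x.
have [fx|/negP fx] := eqVneq (f x) 0; first by rewrite fx normr0.
apply: HC; split; rewrite /= in_itv/= -ler_norml leNgt; apply/negP => H; apply: fx.
  by rewrite fM//; left; exact: ltW.
by rewrite fM//; right; exact: ltW.
Qed.

Lemma box_supp_L1 M f : continuous f -> box_supp M f -> L1 leb2 f.
Proof.
move=> cf fM; have [C C0 HC] := box_supp_bounded cf fM.
pose K : set (plane R) := `[- M, M]%classic `*` `[- M, M]%classic.
have mK : measurable K by apply: measurableX; exact: measurable_itv.
have Koo : (leb2 K < +oo)%E.
  rewrite [X in (X < _)%E]product_measure1E//= !lebesgue_measure_itv/=.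
  by case: ifP => _; rewrite ?mule0 ?ltry// -EFinD -EFinM ltry.
have H := @L1_bounded_supp _ _ R leb2 K C f mK Koo.
apply: (H (measurable_continuous_plane cf) HC) => x Hx.
apply: fM; apply/orP; rewrite -[X in is_true X]negbK negb_or -!ltNge.
apply/negP => /andP[/ltW H1 /ltW H2]; apply: Hx.
by split; rewrite /= in_itv/= -ler_norml.
Qed.

(** Fubini is taken in the order that makes the inner integral run along direction j, where the
    fundamental theorem of calculus gives 0. *)
Lemma Int_pderiv M j f : C1 f -> box_supp M f -> \int[leb2]_x pderiv j f x = 0.
Proof.
move=> cf fM; have fM' := box_supp_pderiv j fM.
have fi := box_supp_L1 (C1_continuousD j cf) fM'.
(* [M] may be non-positive, while the interval of integration needs a positive half-length. *)
have M0 : 0 < `|M| + 1 by rewrite ltr_wpDl.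
have leM t : `|M| + 1 <= t -> M <= t.
  by move=> H; rewrite (le_trans (ler_norm M))// (le_trans _ H)// lerDl.
have [j0|j1] := ord2_cases j.
- rewrite j0 in fi *; rewrite fubini_eq2//.
  rewrite (_ : (fun y => _) = fun=> 0) ?Int_0//; apply/funext => y.
  under Int_ext do rewrite -(slice0_derive _ _ cf).2.
  apply: (Int_derive1_0 M0).
  + by move=> s; exact: (slice0_derive _ _ cf).1.
  + rewrite (_ : (derive1 (fun s : R => f (s, y))) = fun s => pderiv 0 f (s, y)).
      by have := continuous_pair1 (y := y) (C1_continuousD 0 cf).
    by apply/funext => s; exact: (slice0_derive _ _ cf).2.
  + by move=> s /leM Ms; apply: fM; left.
- rewrite j1 in fi *; rewrite fubini_eq1//.
  rewrite (_ : (fun y => _) = fun=> 0) ?Int_0//; apply/funext => y.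
  under Int_ext do rewrite -(slice1_derive _ _ cf).2.
  apply: (Int_derive1_0 M0).
  + by move=> s; exact: (slice1_derive _ _ cf).1.
  + rewrite (_ : (derive1 (fun s : R => f (y, s))) = fun s => pderiv 1 f (y, s)).
      by have := continuous_pair2 (x := y) (C1_continuousD 1 cf).
    by apply/funext => s; exact: (slice1_derive _ _ cf).2.
  + by move=> s /leM Ms; apply: fM; right.
Qed.

Lemma derive1_lipschitz (g : R -> R) (C : R) : (forall s, derivable g s 1) ->
  (forall s, `|(derive1 g) s| <= C) -> forall a b, `|g a - g b| <= C * `|a - b|.
Proof.
move=> dg gC a b; wlog ab : a b / a <= b.
  move=> H; have [|/ltW] := leP a b; first exact: H.
  by move/H; rewrite distrC (distrC a).
have [||c _] := @MVT_segment _ g (derive1 g) a b ab.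
- by move=> x _; rewrite derive1E; exact: derivableP.
- by apply: derivable_within_continuous => x _; exact: dg.
by rewrite distrC (distrC a) => ->; rewrite normrM ler_wpM2r.
Qed.

(** The point moves along two segments parallel to the axes, each handled by the mean value theorem;
    this is where the l^1 distance comes from. *)
Lemma C1_lipschitz f (C : R) : C1 f -> (forall j x, `|pderiv j f x| <= C) ->
  forall x y, `|f x - f y| <= C * (`|x.1 - y.1| + `|x.2 - y.2|).
Proof.
move=> cf fC [x1 x2] [y1 y2] /=.
have -> : f (x1, x2) - f (y1, y2) = (f (x1, x2) - f (y1, x2)) + (f (y1, x2) - f (y1, y2)).
  by rewrite addrA subrK.
rewrite mulrDr (le_trans (ler_normD _ _))// lerD//.
- apply: (@derive1_lipschitz (fun s => f (s, x2))) => s.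
    exact: (slice0_derive _ _ cf).1.
  by rewrite (slice0_derive _ _ cf).2.
- apply: (@derive1_lipschitz (fun s => f (y1, s))) => s.
    exact: (slice1_derive _ _ cf).1.
  by rewrite (slice1_derive _ _ cf).2.
Qed.

End plane_calculus.

(** * Invariance of Lebesgue measure under point reflections *)

Section reflection.
Context (R : realType).
Local Notation mu := (@lebesgue_measure R).

Lemma measurable_reflect1 (a : R) : measurable_fun setT (fun y : R => a - y).
Proof. by apply: measurable_funB. Qed.

(** Translation and symmetry in one step: the preimage of ]b, c] is [a - c, a - b[, and Lebesgue
    measure is characterized by its values on half-open intervals. *)
Lemma pushforward_reflect1 (a : R) (A : set R) : measurable A ->
  pushforward mu (fun y : R => a - y) A = mu A.
Proof.
have mphi : measurable_fun setT ((fun y : R => a - y) : R -> measurableTypeR R).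
  exact: measurable_reflect1.
pose phi_mix := isMeasurableFun.Build _ _ _ _ _ mphi.
pose phi : {mfun _ >-> _} := HB.pack ((fun y : R => a - y) : R -> measurableTypeR R) phi_mix.
move=> mA; apply/esym.
apply: (@lebesgue_measure_unique R (pushforward mu phi)) => //= _ [[b c]] _ <-.
rewrite /pushforward.
have -> : phi @^-1` `]b, c] = `[a - c, a - b[%classic.
  apply/seteqP; split=> y /=; rewrite !in_itv/= => /andP[? ?]; apply/andP; split; lra.
rewrite /= !lebesgue_measure_itv/= !lte_fin.
have -> : (a - c < a - b) = (b < c) by apply/idP/idP => ?; lra.
by case: ifP => // _; congr (_%:E); ring.
Qed.

Lemma measurable_reflect2 (a : plane R) : measurable_fun setT (fun y : plane R => a - y).
Proof.
apply/measurable_fun_pairP; split => /=.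
- by apply: (measurable_funB (f := fun=> a.1)) => //; exact: measurable_fst.
- by apply: (measurable_funB (f := fun=> a.2)) => //; exact: measurable_snd.
Qed.

Let measurable_reflect2T (a : plane R) : measurable_fun setT ((fun y : plane R => a - y) :
  measurableTypeR R * measurableTypeR R -> measurableTypeR R * measurableTypeR R).
Proof. exact: measurable_reflect2. Qed.

Lemma pushforward_reflect2 (a : plane R) (A : set (plane R)) : measurable A ->
  pushforward leb2 (fun y : plane R => a - y) A = (leb2 A : \bar R).
Proof.
pose phi_mix := isMeasurableFun.Build _ _ _ _ _ (measurable_reflect2T a).
pose phi : {mfun _ >-> _} := HB.pack ((fun y : plane R => a - y) :
    measurableTypeR R * measurableTypeR R -> measurableTypeR R * measurableTypeR R) phi_mix.
move=> mA; apply/esym.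
apply: (@product_measure_unique _ _ _ _ R mu mu (pushforward leb2 phi)) => // B C mB mC.
have EB := pushforward_reflect1 a.1 mB; have EC := pushforward_reflect1 a.2 mC.
rewrite /pushforward in EB EC *.
apply: etrans; last exact: (f_equal2 mule EB EC).
apply: (@product_measure1E _ _ _ _ R mu mu
  ((fun y : R => a.1 - y) @^-1` B) ((fun y : R => a.2 - y) @^-1` C)).
- by rewrite -[X in measurable X]setTI; exact: (measurable_reflect1 a.1).
- by rewrite -[X in measurable X]setTI; exact: (measurable_reflect1 a.2).
Qed.

Lemma integral_reflect (a : plane R) (g : plane R -> \bar R) :
  measurable_fun setT g -> (forall x, 0 <= g x)%E ->
  (\int[leb2]_y g (a - y)%R = \int[leb2]_y g y)%E.
Proof.
move=> mg g0.
have := @ge0_integral_pushforward _ _ _ _ R _ (measurable_reflect2T a) leb2 setT g measurableT mg.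
rewrite preimage_setT => <-; last by move=> y _.
by apply: eq_measure_integral => A mA _; exact: pushforward_reflect2.
Qed.

Lemma L1_reflect (a : plane R) (f : plane R -> R) : L1 leb2 f ->
  L1 leb2 (fun y : plane R => f (a - y)) /\ \int[leb2]_y f (a - y) = \int[leb2]_y f y.
Proof.
move=> fi; have mf := L1_measurable fi.
have mfr : measurable_fun setT (fun y : plane R => f (a - y)).
  exact: (measurableT_comp mf (measurable_reflect2 a)).
have fri : L1 leb2 (fun y : plane R => f (a - y)).
  apply/integrableP; split; first exact/measurable_EFinP.
  rewrite (integral_reflect a (g := fun y => `|(f y)%:E|%E)) //.
    by case/integrableP : fi.
  by apply/measurable_EFinP; exact: measurableT_comp.
split=> //; rewrite /Rintegral; congr fine.
have mEf : measurable_fun setT (EFin \o f) by exact/measurable_EFinP.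
have H := @integral_pushforward _ _ _ _ R _ (measurable_reflect2T a) leb2 setT (EFin \o f) mEf.
apply: etrans; first (apply: esym; apply: (H _ measurableT); exact: fri).
by apply: eq_measure_integral => A mA _; exact: pushforward_reflect2.
Qed.

Lemma Int_reflect (a : plane R) (f : plane R -> R) : L1 leb2 f ->
  \int[leb2]_y f (a - y) = \int[leb2]_y f y.
Proof. by move=> fi; have [] := L1_reflect a fi. Qed.

End reflection.

(* The library's canonical sigma-finite structure on product measures is shadowed
   by the one on products of subprobabilities, hence this explicit structure. *)
Section leb2_sigma_finite.
Context (R : realType).
Local Notation mu := (@lebesgue_measure R).
Local Notation mplane := (measurableTypeR R * measurableTypeR R)%type.

Lemma leb2_sigma_finite : sigma_finite setT (leb2 : set mplane -> \bar R).
Proof.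
have /sigma_finiteP[F [TF ndF Foo]] := sigma_finiteT mu.
exists (fun n => F n `*` F n).
  rewrite -setXTT TF predeqE => -[x y]; split.
    move=> [/= [n _ Fnx] [k _ Gky]]; exists (maxn n k) => //; split.
    - by move: x Fnx; exact/subsetPset/ndF/leq_maxl.
    - by move: y Gky; exact/subsetPset/ndF/leq_maxr.
  by move=> [n _ []/= ? ?]; split; exists n.
move=> k; have [? ?] := Foo k; split; first exact: measurableX.
by rewrite product_measure1E// lte_mul_pinfty// ge0_fin_numE.
Qed.

Definition lebp : {sigma_finite_measure set mplane -> \bar R} :=
  HB.pack_for {sigma_finite_measure set mplane -> \bar R} (product_measure1 mu mu)
    (@Measure_isSigmaFinite.Build _ mplane R (product_measure1 mu mu) leb2_sigma_finite).

End leb2_sigma_finite.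

(** * Smooth functions *)

Section smooth_theory.
Context (R : realType) (V : normedModType R).
Implicit Types (f g : V -> R).

(** Smoothness quantifies over all iterated derivatives, so it is proved coinductively: each use
    below exhibits a class of functions that differentiation does not leave. *)
Lemma smooth_coind (S : set (V -> R)) :
  (forall f, S f -> continuous f) ->
  (forall f v x, S f -> derivable f x v) ->
  (forall f v, S f -> S ('D_v f)) -> forall f, S f -> smooth f.
Proof.
move=> Sc Sd SD f Sf s.
have Ss : S (iter_derive s f) by elim: s => [//|v s IH]; exact: SD.
by split; [exact: Sc|move=> v x; exact: Sd].
Qed.

Lemma smooth_continuous f : smooth f -> continuous f.
Proof. by move=> /(_ [::])[]. Qed.

Lemma smooth_derivable f x v : smooth f -> derivable f x v.
Proof. by move=> /(_ [::])[_]; exact. Qed.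

Lemma smooth_derive f v : smooth f -> smooth ('D_v f).
Proof.
move=> sf s; have -> : iter_derive s ('D_v f) = iter_derive (rcons s v) f.
  by elim: s => [//|a s IH] /=; rewrite IH.
exact: sf.
Qed.

Lemma smooth_cst (c : R) : smooth (fun _ : V => c).
Proof.
apply: (@smooth_coind [set f | exists c, f = fun=> c]); last by exists c.
- by move=> f [a ->] x; exact: cvg_cst.
- by move=> f v x [a ->]; exact: derivable_cst.
- by move=> f v [a ->]; exists 0; apply/funext => x; rewrite derive_cst.
Qed.

Lemma smoothD f g : smooth f -> smooth g -> smooth (fun x => f x + g x).
Proof.
move=> sf sg.
apply: (@smooth_coind [set h | exists a b, [/\ smooth a, smooth b & h = fun x => a x + b x]]).
- by move=> h [a [b [sa sb ->]]] x; apply: cvgD; exact: smooth_continuous.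
- by move=> h v x [a [b [sa sb ->]]]; apply: derivableD; exact: smooth_derivable.
- move=> h v [a [b [sa sb ->]]]; exists ('D_v a), ('D_v b); split; [exact: smooth_derive..|].
  by apply/funext => x; rewrite deriveD//; exact: smooth_derivable.
- by exists f, g.
Qed.

(** The Leibniz rule turns a product into a sum of products; closing under addition makes the class
    stable under differentiation, as [smooth_coind] requires. *)
Inductive smooth_products : (V -> R) -> Prop :=
| smooth_products_mul a b : smooth a -> smooth b ->
    smooth_products (fun x => a x * b x)
| smooth_products_add a b : smooth_products a -> smooth_products b ->
    smooth_products (fun x => a x + b x).

Lemma smoothM f g : smooth f -> smooth g -> smooth (fun x => f x * g x).
Proof.
move=> sf sg.
have dS a v x : smooth_products a -> derivable a x v.
  elim=> [h k sh sk|h k _ Ih _ Ik]; first by apply: derivableM; exact: smooth_derivable.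
  exact: derivableD.
apply: (@smooth_coind smooth_products) => //; last exact: smooth_products_mul.
- move=> h; elim=> [a b sa sb x|a b _ Ia _ Ib x]; last by apply: cvgD; [exact: Ia|exact: Ib].
  by apply: cvgM; [exact: (smooth_continuous sa)|exact: (smooth_continuous sb)].
- move=> h v; elim=> [a b sa sb|a b Sa Ia Sb Ib].
    have -> : 'D_v (fun x => a x * b x) = fun x => a x * 'D_v b x + b x * 'D_v a x.
      by apply/funext => x; rewrite deriveM//; exact: smooth_derivable.
    by apply: smooth_products_add; apply: smooth_products_mul;
      [exact: sa|exact: smooth_derive|exact: sb|exact: smooth_derive].
  have -> : 'D_v (fun x => a x + b x) = fun x => 'D_v a x + 'D_v b x.
    by apply/funext => x; rewrite deriveD//; exact: dS.
  exact: smooth_products_add.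
Qed.

Lemma smoothZ (c : R) f : smooth f -> smooth (fun x => c * f x).
Proof. by move=> sf; exact: (smoothM (smooth_cst c) sf). Qed.

Lemma smoothN f : smooth f -> smooth (fun x => - f x).
Proof.
by move=> /(smoothZ (-1)); under eq_fun do rewrite mulN1r.
Qed.

Lemma smoothB f g : smooth f -> smooth g -> smooth (fun x => f x - g x).
Proof. by move=> sf sg; exact: (smoothD sf (smoothN sg)). Qed.

End smooth_theory.

Section smooth_composition.
Context (R : realType).

Section affine.
Context (V W : normedModType R).
Variables (a : V -> W) (L : V -> W).
Hypothesis aL : forall (h : R) v x, a (h *: v + x) = h *: L v + a x.
Hypothesis ca : continuous a.

(** Composition with an affine map of linear part [L] only relabels the difference quotient, so the
    chain rule holds at the level of directional derivatives. *)
Lemma affine_quotient (F : W -> R) x v :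
  (fun h : R => h^-1 *: (((F \o a) \o shift x) (h *: v) - (F \o a) x)) =
  (fun h : R => h^-1 *: ((F \o shift (a x)) (h *: L v) - F (a x))).
Proof. by apply/funext => h /=; rewrite aL. Qed.

Lemma derive_affine (F : W -> R) x v : 'D_v (fun x => F (a x)) x = 'D_(L v) F (a x).
Proof. by have := affine_quotient F x v; rewrite /derive /= => <-. Qed.

Lemma derivable_affine (F : W -> R) x v : derivable F (a x) (L v) ->
  derivable (fun x => F (a x)) x v.
Proof. by have := affine_quotient F x v; rewrite /derivable /= => <-. Qed.

Lemma smooth_affine (F : W -> R) : smooth F -> smooth (fun x => F (a x)).
Proof.
move=> sF.
apply: (@smooth_coind _ _ [set h | exists2 F, smooth F & h = fun x => F (a x)]).
- move=> h [G sG ->] x; apply: (@cvg_comp _ _ _ a G _ (nbhs (a x))); first exact: ca.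
  exact: smooth_continuous.
- by move=> h v x [G sG ->]; apply: derivable_affine; exact: smooth_derivable.
- move=> h v [G sG ->]; exists ('D_(L v) G); first exact: smooth_derive.
  by apply/funext => x; rewrite derive_affine.
- by exists F.
Qed.

End affine.

Lemma derive_scale (f : R -> R) (x v : R) : derivable f x 1 ->
  derivable f x v /\ 'D_v f x = v * 'D_1 f x.
Proof.
move=> df; have dif : differentiable f x by exact/derivable1_diffP.
split; first exact: diff_derivable.
rewrite !deriveE//.
have -> : 'd f x v = 'd f x (v *: 1) by congr ('d f x _); rewrite [v *: 1]mulr1.
by rewrite linearZ.
Qed.

(** On the line every directional derivative is a multiple of the one in direction 1; the scalars
    [c] in the invariant class absorb these multiples. *)
Lemma smooth1_coind (S : set (R -> R)) :
  (forall f x, S f -> derivable f x 1) ->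
  (forall f, S f -> S (derive1 f)) -> forall f, S f -> smooth f.
Proof.
move=> Sd SD f Sf.
apply: (@smooth_coind _ _ [set h | exists (c : R) (g : R -> R), S g /\ h = fun x => c * g x]).
- move=> h [c [g [Sg ->]]] x; apply: cvgM; first exact: cvg_cst.
  apply: differentiable_continuous; exact/derivable1_diffP/Sd.
- move=> h v x [c [g [Sg ->]]]; apply: derivableZ.
  by have [] := @derive_scale g x v (Sd _ _ Sg).
- move=> h v [c [g [Sg ->]]]; exists (c * v), (derive1 g); split; first exact: SD.
  apply/funext => x; have [d1 d2] := @derive_scale g x v (Sd _ _ Sg).
  by rewrite (deriveZ c d1) d2 -derive1E -mulrA.
- by exists 1, f; split=> //; apply/funext => x; rewrite mul1r.
Qed.

Lemma smooth_id : smooth (fun x : R => x).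
Proof.
apply: (@smooth1_coind [set f | exists a b : R, f = fun x => a * x + b]).
- move=> f x [a [b ->]]; apply: derivableD; last exact: derivable_cst.
  by apply: derivableZ; exact: derivable_id.
- move=> f [a [b ->]]; exists 0, a; apply/funext => x.
  rewrite derive1E deriveD ?deriveZ ?derive_id ?derive_cst//.
  by rewrite [a *: _]mulr1 mul0r add0r addr0.
- by exists 1, 0; apply/funext => x; rewrite mul1r addr0.
Qed.

Section comp.
Context (V : normedModType R).

(** Restricted to the line through x with direction v, both sides concern functions of one variable,
    where the usual chain rule applies. *)
Lemma derive_comp1 (f : R -> R) (g : V -> R) x v : derivable f (g x) 1 ->
  derivable g x v -> derivable (fun x => f (g x)) x v /\
  'D_v (fun x => f (g x)) x = 'D_1 f (g x) * 'D_v g x.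
Proof.
have x0 : x + (0 : R) *: v = x by rewrite scale0r addr0.
move=> df dg.
have dg' : derivable (fun s : R => g (x + s *: v)) 0 1.
  by apply/derivable_line; rewrite x0.
have df' : derivable f (g (x + (0 : R) *: v)) 1 by rewrite x0.
split.
  have := (derivable_line (fun x => f (g x)) x v 0).1; rewrite x0; apply.
  apply/derivable1_diffP.
  have D1 := (derivable1_diffP _ _).1 dg'.
  have D2 : differentiable f (g (x + (0 : R) *: v)) by exact/derivable1_diffP.
  exact: (differentiable_comp D1 D2).
have := derive1_comp dg' df'; rewrite !derive1E => H.
have := derive_line (fun x => f (g x)) x v 0; rewrite x0 => <-.
by move: H; rewrite /comp => ->; rewrite derive_line x0.
Qed.

(** Differentiating (f o g) s gives (f o g) Ds + (f' o g) (Dg s), again a sum of terms of this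
    shape. *)
Inductive smooth_compositions (g : V -> R) : (V -> R) -> Prop :=
| smooth_compositions_mul f s : smooth f -> smooth s ->
    smooth_compositions g (fun x => f (g x) * s x)
| smooth_compositions_add a b :
    smooth_compositions g a -> smooth_compositions g b ->
    smooth_compositions g (fun x => a x + b x).

Lemma smooth_comp (f : R -> R) (g : V -> R) : smooth f -> smooth g ->
  smooth (fun x => f (g x)).
Proof.
move=> sf sg.
have dc (h : R -> R) x v : smooth h -> derivable (fun x => h (g x)) x v /\
    'D_v (fun x => h (g x)) x = 'D_1 h (g x) * 'D_v g x.
  by move=> sh; apply: derive_comp1; exact: smooth_derivable.
have dS a v x : smooth_compositions g a -> derivable a x v.
  elim=> [h k sh sk|h k _ Ih _ Ik]; last exact: derivableD.
  apply: derivableM; last exact: smooth_derivable.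
  by have [] := dc h x v sh.
apply: (@smooth_coind _ _ (smooth_compositions g)) => //.
- move=> h; elim=> [a b sa sb x|a b _ Ia _ Ib x]; last by apply: cvgD; [exact: Ia|exact: Ib].
  apply: cvgM; last exact: (smooth_continuous sb).
  apply: (@cvg_comp _ _ _ g a _ (nbhs (g x))); first exact: (smooth_continuous sg).
  exact: (smooth_continuous sa).
- move=> h v; elim=> [a b sa sb|a b Sa Ia Sb Ib].
    have -> : 'D_v (fun x => a (g x) * b x) =
        fun x => a (g x) * 'D_v b x + ('D_1 a) (g x) * ('D_v g x * b x).
      apply/funext => x; have [d1 d2] := dc a x v sa.
      have db : derivable b x v by exact: smooth_derivable.
      by rewrite (deriveM d1 db) d2 /GRing.scale /=; ring.
    apply: smooth_compositions_add.
      by apply: (@smooth_compositions_mul g a ('D_v b) sa); exact: smooth_derive.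
    apply: (@smooth_compositions_mul g ('D_1 a) (fun x => 'D_v g x * b x)).
      exact: smooth_derive.
    by apply: smoothM sb; exact: smooth_derive.
  have -> : 'D_v (fun x => a x + b x) = fun x => 'D_v a x + 'D_v b x.
    by apply/funext => x; rewrite deriveD//; exact: dS.
  exact: smooth_compositions_add.
- have -> : (fun x => f (g x)) = (fun x => f (g x) * 1).
    by apply/funext => x; rewrite mulr1.
  by apply: smooth_compositions_mul sf _; exact: smooth_cst.
Qed.

End comp.

Lemma smooth_fst (V W : normedModType R) (f : V -> R) : smooth f ->
  smooth (fun z : V * W => f z.1).
Proof.
by apply: (@smooth_affine (V * W)%type V fst fst) => [h v x|x]; [|exact: cvg_fst].
Qed.

Lemma smooth_snd (V W : normedModType R) (f : W -> R) : smooth f ->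
  smooth (fun z : V * W => f z.2).
Proof.
by apply: (@smooth_affine (V * W)%type W snd snd) => [h v x|x]; [|exact: cvg_snd].
Qed.

Lemma smooth_coord1 : smooth (fun z : plane R => z.1).
Proof. exact: (@smooth_fst R R (fun x : R => x) smooth_id). Qed.

Lemma smooth_coord2 : smooth (fun z : plane R => z.2).
Proof. exact: (@smooth_snd R R (fun x : R => x) smooth_id). Qed.

Lemma smooth_C1 (f : plane R -> R) : smooth f -> C1 f.
Proof.
move=> sf; split=> [|j]; first exact: smooth_continuous.
split=> [x|]; first exact: smooth_derivable.
by have := smooth_continuous (smooth_derive (basis j) sf).
Qed.

Lemma smooth_pderiv (f : plane R -> R) j : smooth f -> smooth (pderiv j f).
Proof. by move=> sf; exact: (smooth_derive (basis j) sf). Qed.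

Lemma smooth_reflect (f : plane R -> R) (a : plane R) : smooth f ->
  smooth (fun y => f (a - y)).
Proof.
apply: (@smooth_affine (plane R) (plane R) (fun y => a - y) (fun v => - v)) => [h v x|x].
  by rewrite opprD addrCA scalerN.
by apply: cvgB; [exact: cvg_cst|exact: cvg_id].
Qed.

Lemma pderiv_reflect (f : plane R -> R) (a : plane R) j y : smooth f ->
  pderiv j (fun y => f (a - y)) y = - pderiv j f (a - y).
Proof.
move=> sf; rewrite /pderiv.
rewrite (@derive_affine (plane R) (plane R) (fun y => a - y) (fun v => - v)).
  have df : derivable f (a - y) (basis j) by exact: smooth_derivable.
  have -> : - basis j = -1 *: basis j :> plane R by rewrite scaleN1r.
  have := @derive_line R _ f (a - y) (- 1 *: basis j) 0.
  have x0 : a - y + (0 : R) *: (- 1 *: basis j) = a - y by rewrite scale0r addr0.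
  rewrite x0 => <-.
  have -> : (fun s : R => f (a - y + s *: (- 1 *: basis j))) =
      (fun s : R => (fun r : R => f (a - y + r *: basis j)) (- s)).
    by apply/funext => s; rewrite scalerA mulrN1.
  have d0 : derivable (fun r : R => f (a - y + r *: basis j)) (- 0) 1.
    by apply/derivable_line; exact: smooth_derivable.
  have dN : derivable (fun s : R => - s) 0 1 by exact: derivable_opp.
  have [_ ->] := @derive_comp1 R (fun r : R => f (a - y + r *: basis j)) (fun s : R => - s) 0 1 d0 dN.
  rewrite derive_line oppr0 scale0r addr0.
  have -> : 'D_1 (fun s : R => - s) (0 : R) = -1.
    have di : derivable (fun s : R => s) 0 1 by exact: derivable_id.
    by rewrite (deriveN di) derive_id.
  by rewrite mulrN1.
by move=> h v x; rewrite opprD addrCA scalerN.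
Qed.

Lemma smooth_slice (F : R * plane R -> R) t : smooth F ->
  smooth (fun x : plane R => F (t, x)).
Proof.
apply: (@smooth_affine (plane R) (R * plane R)%type (fun x => (t, x)) (fun v => (0, v))) => [h v x|x].
  by apply/pair_equal_spec; split => //=; rewrite scaler0 add0r.
apply: (@cvg_pair (plane R) R (plane R) (nbhs x) (nbhs t) (nbhs x) _ _ _ (cst t) id);
  [exact: cvg_cst|exact: cvg_id].
Qed.

Lemma derive_slice (F : R * plane R -> R) t v x :
  'D_v (fun x : plane R => F (t, x)) x = 'D_(0, v) F (t, x).
Proof.
apply: (@derive_affine (plane R) (R * plane R)%type (fun x => (t, x)) (fun v => (0, v))).
by move=> h w y; apply/pair_equal_spec; split => //=; rewrite scaler0 add0r.
Qed.

Lemma derive_time_slice (F : R * plane R -> R) x t :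
  derive1 (fun t => F (t, x)) t = 'D_(1, 0) F (t, x).
Proof.
rewrite derive1E.
apply: (@derive_affine R (R * plane R)%type (fun t => (t, x)) (fun v => (v, 0))).
by move=> h w y; apply/pair_equal_spec; split => //=; rewrite scaler0 add0r.
Qed.

End smooth_composition.

(** * Functions flat at the origin *)

Section flat_functions.
Context (R : realType).

(** The powers of 1/x are the ones that differentiation of exp(-1/x) produces, so the span of this
    family is stable under differentiation. *)
Definition flat (n : nat) (x : R) : R :=
  if 0 < x then x^-1 ^+ n * expR (- x^-1) else 0.

Lemma flat_le0 n x : x <= 0 -> flat n x = 0.
Proof. by rewrite /flat leNgt; case: ifP. Qed.

Lemma flat_gt0 n x : 0 < x -> 0 < flat n x.
Proof. by move=> x0; rewrite /flat x0 mulr_gt0 ?expR_gt0// exprn_gt0 ?invr_gt0. Qed.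

Lemma flat_ge0 n x : 0 <= flat n x.
Proof. by rewrite /flat; case: ifP => // x0; rewrite mulr_ge0 ?expR_ge0// exprn_ge0 ?invr_ge0 ?ltW. Qed.

(** From exp y >= y^(n+2) / (n+2)! at y = 1/h. The quadratic decay is what gives the derivative 0 at
    the origin. *)
Lemma flat_bound n h : `|flat n h| <= (n.+2)`!%:R * h ^+ 2.
Proof.
rewrite ger0_norm ?flat_ge0// /flat; case: ifP => [h0|_]; last by rewrite mulr_ge0// sqr_ge0.
have y0 : 0 < h^-1 by rewrite invr_gt0.
rewrite -[h in leRHS]invrK; move: (h^-1) y0 => {h h0} y y0.
have F0 : 0 < (n.+2)`!%:R :> R by rewrite ltr0n fact_gt0.
have := expR_ge1Dxn n.+1 (ltW y0) => H.
rewrite expRN ler_pdivrMr ?expR_gt0//.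
have -> : y ^+ n = (n.+2)`!%:R * y^-1 ^+ 2 * (y ^+ n.+2 / (n.+2)`!%:R).
  by rewrite -addn2 exprD exprVn; field; rewrite !gt_eqF// exprn_gt0.
rewrite ler_wpM2l//; first by rewrite mulr_ge0 ?sqr_ge0// ltW.
by apply: le_trans H; rewrite lerDr.
Qed.

Lemma derive_flat n x : derivable (flat n) x 1 /\
  'D_1 (flat n) x = - n%:R * flat n.+1 x + flat n.+2 x.
Proof.
have [x0|x0|->] := ltgtP x 0.
- have E : \forall y \near x, flat n y = cst 0 y.
    by have := lt_nbhsl x0; apply: filterS => y /= /ltW; exact: flat_le0.
  rewrite (near_eq_derive _ E) derive_cst !flat_le0 ?(ltW x0)// mulr0 addr0; split=> //.
  apply: (@near_eq_derivable _ _ _ (cst 0)); last exact: derivable_cst.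
  by apply: filterS E => y.
- pose G (y : R) := y ^+ n * expR (- y).
  have E : \forall y \near x, flat n y = G y^-1.
    by have := lt_nbhsr x0; apply: filterS => y /= y0; rewrite /flat y0.
  have dV : derivable (fun y : R => y^-1) x 1.
    by apply: derivableV; [rewrite gt_eqF|exact: derivable_id].
  have DV : 'D_1 (fun y : R => y^-1) x = - x^-1 ^+ 2.
    have di : derivable (fun s : R => s) x 1 by exact: derivable_id.
    have xn0 : (fun s : R => s) x != 0 by rewrite gt_eqF.
    by rewrite (deriveV xn0 di) derive_id [_ *: _]mulr1 exprVn.
  have dN : derivable (fun s : R => - s) x^-1 1 by exact: derivable_opp.
  have DN : 'D_1 (fun s : R => - s) x^-1 = -1.
    have di : derivable (fun s : R => s) x^-1 1 by exact: derivable_id.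
    by rewrite (deriveN di) derive_id.
  have dexp : derivable expR (- x^-1) 1 by exact: derivable_expR.
  have [dE DE] := @derive_comp1 R R expR (fun s => - s) x^-1 1 dexp dN.
  have dX : derivable (fun y : R => y ^+ n) x^-1 1 by exact: exprn_derivable.
  have dG : derivable G x^-1 1 by exact: (derivableM dX dE).
  have DG : 'D_1 G x^-1 = (n%:R * x^-1 ^+ n.-1 - x^-1 ^+ n) * expR (- x^-1).
    have Dexp : 'D_1 expR (- x^-1) = expR (- x^-1) by have := congr1 (fun f => f (- x^-1)) (@derive_expR R).
    by rewrite /G (deriveM dX dE) DE DN Dexp exp_derive /GRing.scale /= -mulr_natl; ring.
  have [d D] := derive_comp1 dG dV.
  rewrite (near_eq_derive _ E) D DG DV; split.
    have E' : {near x, (fun y : R => G y^-1) =1 flat n} by apply: filterS E => y /= ->.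
    by apply: (near_eq_derivable E').
  rewrite /flat x0; case: n {G E dX dG DG d D} => [|n] /=; first by ring.
  by rewrite !exprS; ring.
- have H : (fun h : R => h^-1 *: ((flat n \o shift 0) (h *: 1) - flat n 0)) @ 0^' --> (0 : R).
    have F0 : 0 < (n.+2)`!%:R :> R by rewrite ltr0n fact_gt0.
    apply/cvgrPdist_le => e e0; near=> h.
    rewrite sub0r normrN (flat_le0 n (lexx 0)) subr0.
    have -> : (flat n \o shift 0) (h *: 1) = flat n h by rewrite /= addr0 [h *: 1]mulr1.
    rewrite normrM normfV.
    have h0 : 0 < `|h| by rewrite normr_gt0; near: h; exact: nbhs_dnbhs_neq.
    rewrite ler_pdivrMl//; apply: (le_trans (flat_bound n h)).
    rewrite -real_normK ?num_real// expr2 mulrCA ler_wpM2l//.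
    rewrite mulrC -ler_pdivlMr//; near: h; apply: dnbhs0_le.
    by rewrite divr_gt0.
  split; first by apply/cvg_ex; exists 0.
  by rewrite /derive (cvg_lim _ H)// !flat_le0// mulr0 addr0.
Unshelve. all: by end_near. Qed.

Inductive flat_span : (R -> R) -> Prop :=
| flat_span_mul n c : flat_span (fun x => c * flat n x)
| flat_span_add f g : flat_span f -> flat_span g -> flat_span (fun x => f x + g x).

Lemma smooth_flat n : smooth (flat n).
Proof.
have dS f x : flat_span f -> derivable f x 1.
  elim=> [m c|a b _ Ia _ Ib]; last exact: derivableD.
  by apply: derivableZ; have [] := derive_flat m x.
apply: (@smooth1_coind _ flat_span) => //.
- move=> f; elim=> [m c|a b Sa Ia Sb Ib].
    have -> : derive1 (fun x => c * flat m x) =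
        fun x => (c * - m%:R) * flat m.+1 x + c * flat m.+2 x.
      apply/funext => x; have [d D] := derive_flat m x.
      by rewrite derive1E (deriveZ c d) D /GRing.scale/=; ring.
    by apply: flat_span_add; exact: flat_span_mul.
  have -> : derive1 (fun x => a x + b x) = fun x => derive1 a x + derive1 b x.
    apply/funext => x; rewrite !derive1E.
    have da : derivable a x 1 by exact: dS.
    have db : derivable b x 1 by exact: dS.
    by rewrite (deriveD da db).
  exact: flat_span_add.
- have -> : flat n = (fun x => 1 * flat n x) by apply/funext => x; rewrite mul1r.
  exact: flat_span_mul.
Qed.

End flat_functions.

(** * The radial profile of the mollifier and of its kernel *)

Section radial_profile.
Context (R : realType).
Local Notation mu := (@lebesgue_measure R).

(** Profile of the mollifier in the variable q = |z|^2 / d^2. It vanishes for q >= 1, for compact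
    support, but also for q <= 1/4, so that its primitive vanishes near 0 and can be divided by
    q. *)
Definition bump (q : R) : R := flat 0 (q - 1 / 4) * flat 0 (1 - q).

Lemma bump_ge0 q : 0 <= bump q. Proof. by rewrite mulr_ge0// flat_ge0. Qed.

Lemma bump_eq0 q : q <= 1 / 4 \/ 1 <= q -> bump q = 0.
Proof.
by case=> H; rewrite /bump; [rewrite flat_le0 ?mul0r|rewrite (flat_le0 _ (x := 1 - q)) ?mulr0]; lra.
Qed.

Lemma smooth_bump : smooth bump.
Proof.
apply: smoothM.
  by apply: (smooth_comp (g := fun q : R => q - 1 / 4)); [exact: smooth_flat|apply: smoothB; [exact: smooth_id|exact: smooth_cst]].
by apply: (smooth_comp (g := fun q : R => 1 - q)); [exact: smooth_flat|apply: smoothB; [exact: smooth_cst|exact: smooth_id]].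
Qed.

Lemma flat0_homo (x y : R) : 0 < x -> x <= y -> flat 0 x <= flat 0 y.
Proof.
move=> x0 xy; rewrite /flat x0 (lt_le_trans x0 xy) !expr0 !mul1r ler_expR lerN2.
by rewrite lef_pV2 ?posrE//; lra.
Qed.

Lemma bump_ge q : 1 / 2 <= q <= 3 / 4 -> flat 0 (1 / 4) ^+ 2 <= bump q.
Proof.
move=> /andP[h1 h2]; rewrite expr2 /bump ler_pM// ?flat_ge0//; apply: flat0_homo; lra.
Qed.

Definition step (q : R) : R := \int[mu]_(x in `[0, q]) bump x.

Lemma step_derive q : derivable step q 1 /\ derive1 step q = bump q.
Proof.
have cb : continuous bump by apply: smooth_continuous; exact: smooth_bump.
have [q0|q0] := leP q 0.
  have E : {near q, cst 0 =1 step}.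
    have q4 : q < 1 / 4 by lra.
    have := lt_nbhsl q4; apply: filterS => y /= y4.
    rewrite /step Rintegral_mkcond -[LHS](@Int_0 _ _ _ mu); apply: Int_ext => x.
    rewrite patchE; case: ifPn => //; rewrite inE /= in_itv/= => /andP[_ xy].
    by rewrite bump_eq0//; left; lra.
  split; first by apply: (near_eq_derivable E); exact: derivable_cst.
  rewrite derive1E -(near_eq_derive _ (f := cst 0) E) derive_cst bump_eq0//.
  by left; lra.
have ib : mu.-integrable `[0, q + 1] (EFin \o bump).
  by apply: continuous_compact_integrable; [exact: segment_compact|exact: continuous_subspaceT].
by have [|d D] := @continuous_FTC1_closed R bump 0 q (q + 1) _ ib q0 (cb q); [lra|].
Qed.

Lemma smooth_step : smooth step.
Proof.
have D : derive1 step = bump by apply/funext => q; exact: (step_derive q).2.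
apply: (@smooth1_coind R [set f | f = step \/ smooth f]); last by left.
- move=> f x [->|sf]; first exact: (step_derive x).1.
  exact: smooth_derivable.
- move=> f [->|sf]; right; first by rewrite D; exact: smooth_bump.
  have -> : derive1 f = 'D_1 f by apply/funext => x; rewrite derive1E.
  exact: smooth_derive.
Qed.

Lemma step_homo (x y : R) : x <= y -> step x <= step y.
Proof.
have d q : derivable step q 1 by exact: (step_derive q).1.
move=> xy; apply: (@ger0_derive1_ndecr R step x y) => //.
- by move=> z _; rewrite (step_derive z).2 bump_ge0.
- by apply: derivable_within_continuous => z _; exact: d.
Qed.

Lemma step_eq0 q : q <= 1 / 4 -> step q = 0.
Proof.
move=> q4; rewrite /step Rintegral_mkcond -[RHS](@Int_0 _ _ _ mu); apply: Int_ext => x.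
rewrite patchE; case: ifPn => //; rewrite inE /= in_itv/= => /andP[_ xy].
by rewrite bump_eq0//; left; lra.
Qed.

Lemma step_ge1 q : 1 <= q -> step q = step 1.
Proof.
have d z : derivable step z 1 by exact: (step_derive z).1.
move=> q1; have [||c c1] := @MVT_segment R step (derive1 step) 1 q q1.
- by move=> x _; rewrite derive1E; exact: derivableP.
- by apply: derivable_within_continuous => z _; exact: d.
rewrite (step_derive c).2 bump_eq0 ?mul0r; first by move/eqP; rewrite subr_eq0 => /eqP.
by right; move: c1; rewrite in_itv/= => /andP[].
Qed.

Lemma step_ge0 q : 0 <= step q.
Proof.
have [q0|q0] := leP q 0; first by rewrite step_eq0//; lra.
by rewrite -(step_eq0 (q := 0)); [apply: step_homo; exact: ltW|lra].
Qed.

Lemma step_le1 q : step q <= step 1.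
Proof.
have [q0|q0] := leP q 1; first exact: step_homo.
by rewrite step_ge1//; exact: ltW.
Qed.

Lemma step1_gt0 : 0 < step 1.
Proof.
have d z : derivable step z 1 by exact: (step_derive z).1.
have h : (1 / 2 : R) < 3 / 4 by lra.
have [||c c1] := @MVT R step (derive1 step) (1 / 2) (3 / 4) h.
- by move=> x _; rewrite derive1E; exact: derivableP.
- by apply: derivable_within_continuous => z _; exact: d.
rewrite (step_derive c).2 => H.
have : 0 < step (3 / 4) - step (1 / 2).
  rewrite H mulr_gt0//; last lra.
  apply: (lt_le_trans _ (bump_ge _)); first by rewrite exprn_gt0// flat_gt0//; lra.
  by move: c1; rewrite in_itv/= => /andP[? ?]; apply/andP; split; lra.
have := step_le1 (3 / 4); have := step_ge0 (1 / 2); lra.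
Qed.

(** Profile of the regularized Biot-Savart kernel: times z^perp it is a constant multiple of z^perp
    / |z|^2 where q >= 1, and 0 near the origin. *)
Definition step_div (q : R) : R := step q / q.

(** Vanishing of the numerator below 1/4 confines the quotient to a region where q is invertible,
    and the numerators of the derivatives inherit it. *)
Inductive step_quotients : (R -> R) -> Prop :=
| step_quotients_mul (f : R -> R) n : smooth f -> (forall q : R, q < 1 / 4 -> f q = 0) ->
    step_quotients (fun q : R => f q * q^-1 ^+ n).

Lemma smooth_step_div : smooth step_div.
Proof.
have near0 (f : R -> R) n (q : R) : (forall q : R, q < 1 / 4 -> f q = 0) -> q < 1 / 4 ->
    \forall y \near q, (cst 0 : R -> R) y = f y * y^-1 ^+ n :> R.
  by move=> f0 q4; have := lt_nbhsl q4; apply: filterS => y /= y4; rewrite f0// mul0r.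
have key (f : R -> R) n (q : R) : smooth f -> (forall q : R, q < 1 / 4 -> f q = 0) ->
    derivable (fun q : R => f q * q^-1 ^+ n) q 1 /\
    'D_1 (fun q : R => f q * q^-1 ^+ n) q = (q * 'D_1 f q - n%:R * f q) * q^-1 ^+ n.+1.
  move=> sf f0; have [q4|q4] := ltP q (1 / 4).
    have E := near0 f n q f0 q4.
    split; first by apply: (near_eq_derivable E); exact: derivable_cst.
    rewrite -(near_eq_derive _ E) derive_cst (f0 q)//.
    have -> : 'D_1 f q = 0.
      by apply: derive_near0; have := lt_nbhsl q4; apply: filterS => y /= y4; exact: f0.
    by rewrite !mulr0 subr0 mul0r.
  have q0 : q != 0 by rewrite gt_eqF//; lra.
  have di : derivable (fun s : R => s) q 1 by exact: derivable_id.
  have dV : derivable (fun y : R => y^-1) q 1 by exact: (derivableV (f := fun s : R => s) q0 di).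
  have DV : 'D_1 (fun y : R => y^-1) q = - q^-1 ^+ 2.
    by rewrite (deriveV (f := fun s : R => s) q0 di) derive_id [_ *: _]mulr1 exprVn.
  have dX : derivable (fun y : R => y ^+ n) q^-1 1 by exact: exprn_derivable.
  have [dVX DVX] := @derive_comp1 R R (fun y => y ^+ n) (fun y : R => y^-1) q 1 dX dV.
  have df : derivable f q 1 by exact: smooth_derivable.
  split; first exact: (derivableM df dVX).
  rewrite (deriveM df dVX) DVX DV exp_derive /GRing.scale /= -mulr_natl.
  case: n {near0 dX dVX DVX} => [|n] /=.
    by rewrite expr1; field.
  by rewrite !exprS; field.
apply: (@smooth1_coind R step_quotients).
- by move=> h x [f n sf f0]; have [] := key f n x sf f0.
- move=> h [f n sf f0].
  have -> : derive1 (fun q : R => f q * q^-1 ^+ n) =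
      fun q => (q * 'D_1 f q - n%:R * f q) * q^-1 ^+ n.+1.
    by apply/funext => q; rewrite derive1E; have [] := key f n q sf f0.
  apply: step_quotients_mul; last first.
    move=> q q4; rewrite f0//.
    have -> : 'D_1 f q = 0.
      by apply: derive_near0; have := lt_nbhsl q4; apply: filterS => y /= y4; exact: f0.
    by rewrite !mulr0 subr0.
  apply: smoothB; last exact: smoothZ.
  by apply: smoothM; [exact: smooth_id|exact: smooth_derive].
- have -> : step_div = fun q => step q * q^-1 ^+ 1 by [].
  by apply: step_quotients_mul; [exact: smooth_step|move=> q /ltW; exact: step_eq0].
Qed.

Lemma step_div_mul q : q * step_div q = step q.
Proof.
have [->|q0] := eqVneq q 0; first by rewrite mul0r step_eq0//; lra.
by rewrite /step_div mulrCA divff// mulr1.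
Qed.

Lemma step_div_ge0 q : 0 <= q -> 0 <= step_div q.
Proof. by move=> q0; rewrite /step_div divr_ge0// step_ge0. Qed.

(** This is the derivative of q * step_div q = step q. The left side is half the curl of z^perp
    step_div(|z|^2), which is how the mollifier arises as a curl. *)
Lemma step_div_derive q : step_div q + q * 'D_1 step_div q = bump q.
Proof.
have dk : derivable step_div q 1 by apply: smooth_derivable; exact: smooth_step_div.
have di : derivable (fun s : R => s) q 1 by exact: derivable_id.
have := deriveM di dk; rewrite derive_id /GRing.scale/= => H.
rewrite -(step_derive q).2 derive1E.
have <- : (fun s : R => s) * step_div = step by apply/funext => s; exact: step_div_mul.
by rewrite H mulr1 addrC.
Qed.

End radial_profile.

(** * Mollifiers and kernels *)

Section kernels.
Context (R : realType).
Implicit Types (z : plane R) (d e s : R).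

Definition sqn z : R := z.1 ^+ 2 + z.2 ^+ 2.
Definition coord (j : 'I_2) z : R := if j == 0 then z.1 else z.2.
Definition perp (j : 'I_2) z : R := if j == 0 then - z.2 else z.1.

Lemma sqn_ge0 z : 0 <= sqn z. Proof. by rewrite addr_ge0 ?sqr_ge0. Qed.

Lemma smooth_coord j : smooth (coord j).
Proof.
rewrite /coord; case: (j == 0); [exact: smooth_coord1|exact: smooth_coord2].
Qed.

Lemma smooth_perp j : smooth (perp j).
Proof.
rewrite /perp; case: (j == 0); [apply: smoothN; exact: smooth_coord2|exact: smooth_coord1].
Qed.

Lemma derive_coord (i j : 'I_2) z : pderiv j (coord i) z = (i == j)%:R.
Proof.
rewrite /pderiv /coord.
have [i0|i1] := ord2_cases i.
- rewrite i0; have := @derive_affine R (plane R) R fst fst (fun _ _ _ => erefl) (fun x : R => x) z (basis j).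
  have [|_ ->] := @derive_scale R (fun x : R => x) z.1 (basis j).1; first exact: derivable_id.
  rewrite derive_id mulr1 => ->; rewrite /Defs.basis eq_sym.
  by case: eqP.
- rewrite i1; have := @derive_affine R (plane R) R snd snd (fun _ _ _ => erefl) (fun x : R => x) z (basis j).
  have [|_ ->] := @derive_scale R (fun x : R => x) z.2 (basis j).2; first exact: derivable_id.
  rewrite derive_id mulr1 => ->; rewrite /Defs.basis eq_sym.
  by case: j => -[|[|//]] jl.
Qed.

Lemma smooth_sqn : smooth sqn.
Proof.
have h1 : smooth (fun z : plane R => z.1 ^+ 2) by exact: (smoothM (@smooth_coord1 R) (@smooth_coord1 R)).
have h2 : smooth (fun z : plane R => z.2 ^+ 2) by exact: (smoothM (@smooth_coord2 R) (@smooth_coord2 R)).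
exact: (smoothD h1 h2).
Qed.

Lemma sqnE z : sqn z = coord 0 z * coord 0 z + coord 1 z * coord 1 z.
Proof. by rewrite /sqn !expr2. Qed.

Lemma derive_sqn j z : pderiv j sqn z = 2 * coord j z.
Proof.
have c i := smooth_C1 (smooth_coord i).
have -> : sqn = (fun z => coord 0 z * coord 0 z + coord 1 z * coord 1 z).
  by apply/funext => y; exact: sqnE.
rewrite (pderivD j (C1M (c 0) (c 0)) (C1M (c 1) (c 1))).
rewrite (pderivM j (c 0) (c 0)) (pderivM j (c 1) (c 1)) !derive_coord.
have [->|->] := ord2_cases j.
  by rewrite /=; ring.
by rewrite /=; ring.
Qed.

(** A function of |z|^2 and not of |z|, hence smooth at the origin as well; [s] stands for d^-2. *)
Definition radial (f : R -> R) s z : R := f (sqn z * s).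

Lemma smooth_radial f s : smooth f -> smooth (radial f s).
Proof.
move=> sf; apply: (smooth_comp (g := fun z => sqn z * s)) sf _.
by apply: smoothM; [exact: smooth_sqn|exact: smooth_cst].
Qed.

Lemma derive_radial f s j z : smooth f ->
  pderiv j (radial f s) z = 2 * s * coord j z * 'D_1 f (sqn z * s).
Proof.
move=> sf; have cs := smooth_C1 smooth_sqn.
have ss : smooth (fun z => s * sqn z) by apply: smoothZ; exact: smooth_sqn.
have df : derivable f (s * sqn z) 1 by exact: smooth_derivable.
have ds : derivable (fun z => s * sqn z) z (basis j) by exact: smooth_derivable.
have [_] := @derive_comp1 R (plane R) f (fun z => s * sqn z) z (basis j) df ds.
have -> : (fun x => f (s * sqn x)) = radial f s by apply/funext => y; rewrite /radial mulrC.
rewrite -!/(pderiv _ _ _) (pderivZ s j cs) derive_sqn /pderiv => ->.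
by rewrite (mulrC s (sqn z)); ring.
Qed.

(** The factor 2 anticipates [kap_curl], where the curl of the radial kernel produces 2 * bump. *)
Definition mass : R := \int[leb2]_z (2 * radial (@bump R) 1 z).

Lemma radial_bump_supp d : 0 < d -> box_supp d (radial (@bump R) (d ^- 2)).
Proof.
move=> d0 z H; rewrite /radial bump_eq0//; right.
rewrite ler_pdivlMr ?exprn_gt0// mul1r /sqn.
case: H => H.
  rewrite ler_wpDr ?sqr_ge0// -(real_normK (num_real z.1)) lerXn2r ?nnegrE// ltW//.
rewrite ler_wpDl ?sqr_ge0// -(real_normK (num_real z.2)) lerXn2r ?nnegrE// ltW//.
Qed.

Lemma L1_radial_bump d : 0 < d -> L1 leb2 (radial (@bump R) (d ^- 2)).
Proof.
move=> d0; apply: (box_supp_L1 _ (radial_bump_supp d0)).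
apply: smooth_continuous; apply: smooth_radial; exact: smooth_bump.
Qed.

Lemma mass_gt0 : 0 < mass.
Proof.
(* On this rectangle, of area 1/80, |z|^2 lies between 9/16 and 0.7025, hence in [1/2, 3/4], where
   [bump_ge] applies. *)
pose K : set (plane R) := `[3 / 4, 4 / 5]%classic `*` `[0, 1 / 4]%classic.
have mK : measurable K by apply: measurableX; exact: measurable_itv.
have KE : (leb2 K = (1 / 80)%:E)%E.
  rewrite [LHS]product_measure1E//= !lebesgue_measure_itv/=.
  rewrite !lte_fin; have -> : (3 / 4 < 4 / 5 :> R) by lra.
  have -> : (0 < 1 / 4 :> R) by lra.
  by rewrite -!EFinD -EFinM; congr (_%:E); field.
have iK : L1 leb2 (fun z => \1_K z : R).
  have Koo : (leb2 K < +oo)%E by rewrite KE ltry.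
  exact: (@L1_indic _ _ R leb2 K mK Koo).
have f4 : 0 < flat 0 (1 / 4 : R) by apply: flat_gt0; lra.
pose c : R := 2 * flat 0 (1 / 4) ^+ 2.
have c0 : 0 < c by rewrite mulr_gt0// exprn_gt0.
have H : \int[leb2]_z (c * (\1_K z : R)) <= mass.
  apply: (Int_le (mu := leb2)).
  - exact: (L1Zl (mu := leb2)).
  - apply: (L1Zl (mu := leb2)); have := L1_radial_bump (ltr01 : (0 : R) < 1).
    by rewrite expr1n invr1.
  - move=> z; rewrite indicE; case: (boolP (z \in K)) => zK; last first.
      by rewrite mulr0 mulr_ge0// bump_ge0.
    rewrite mulr1 /c ler_pM2l// /radial mulr1; apply: bump_ge.
    move: zK; rewrite inE => -[]; rewrite /= !in_itv/= => /andP[a1 a2] /andP[b1 b2].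
    by rewrite /sqn; apply/andP; split; nra.
apply: lt_le_trans H.
rewrite (IntZl (mu := leb2))// mulr_gt0//.
have -> : \int[leb2]_z (\1_K z : R) = 1 / 80.
  have E := @integral_indic _ _ R leb2 setT measurableT K mK.
  rewrite /Rintegral; apply: (etrans (congr1 fine E)).
  by rewrite setIT; apply: (etrans (congr1 fine KE)).
by lra.
Qed.

Definition rho d z : R := 2 * mass^-1 * d ^- 2 * radial (@bump R) (d ^- 2) z.

(** Regularized Biot-Savart kernel: a solenoidal field whose curl is [rho d]. Beyond distance d it
    is a multiple of z^perp / |z|^2 that does not depend on d. *)
Definition kap d (i : 'I_2) z : R :=
  perp i z * (mass^-1 * d ^- 2 * radial (@step_div R) (d ^- 2) z).

Lemma smooth_rho d : smooth (rho d).
Proof. by apply: smoothZ; apply: smooth_radial; exact: smooth_bump. Qed.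

Lemma smooth_kap d i : smooth (kap d i).
Proof.
apply: smoothM; first exact: smooth_perp.
by apply: smoothZ; apply: smooth_radial; exact: smooth_step_div.
Qed.

Lemma derive_kap d i j z : pderiv j (kap d i) z =
  mass^-1 * d ^- 2 * (pderiv j (perp i) z * step_div (sqn z * d ^- 2) +
    2 * d ^- 2 * perp i z * coord j z * 'D_1 (@step_div R) (sqn z * d ^- 2)).
Proof.
have c1 := smooth_C1 (smooth_perp i).
have c2 := smooth_C1 (smooth_radial (d ^- 2) (@smooth_step_div R)).
rewrite (pderivM j c1 (C1Z (mass^-1 * d ^- 2) c2)) (pderivZ _ j c2).
rewrite (derive_radial _ _ _ (@smooth_step_div R)) /radial; ring.
Qed.

Lemma derive_perp0 j z : pderiv j (perp 0) z = - pderiv j (coord 1) z.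
Proof.
have -> : perp 0 = (fun z => - coord 1 z) by [].
by rewrite (pderivN j (smooth_C1 (smooth_coord 1))).
Qed.

Lemma derive_perp1 j z : pderiv j (perp 1) z = pderiv j (coord 0) z.
Proof. by []. Qed.

Lemma kap_div d z : pderiv 0 (kap d 0) z + pderiv 1 (kap d 1) z = 0.
Proof.
rewrite !derive_kap derive_perp0 derive_perp1 !derive_coord /= /perp /coord /=.
by ring.
Qed.

Lemma kap_curl d z : pderiv 0 (kap d 1) z - pderiv 1 (kap d 0) z = rho d z.
Proof.
rewrite !derive_kap derive_perp0 derive_perp1 !derive_coord /= /perp /coord /=.
rewrite /rho /radial -(step_div_derive (sqn z * d ^- 2)) /sqn.
by ring.
Qed.

Lemma rho_ge0 d z : 0 <= rho d z.
Proof.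
rewrite /rho mulr_ge0 ?bump_ge0// mulr_ge0// ?invr_ge0 ?exprn_even_ge0//.
by rewrite mulr_ge0// invr_ge0 ltW// mass_gt0.
Qed.

Lemma rho_supp d z : 0 < d -> d ^+ 2 <= sqn z -> rho d z = 0.
Proof.
move=> d0 H; rewrite /rho /radial bump_eq0 ?mulr0//; right.
by rewrite ler_pdivlMr ?exprn_gt0// mul1r.
Qed.

Lemma rho_box d : 0 < d -> box_supp d (rho d).
Proof. by move=> d0 z H; rewrite /rho (radial_bump_supp d0)// mulr0. Qed.

Lemma L1_rho d : 0 < d -> L1 leb2 (rho d).
Proof. by move=> d0; apply: (L1Zl (mu := leb2)); exact: L1_radial_bump. Qed.

Lemma sqnN z : sqn (- z) = sqn z.
Proof. by rewrite /sqn /= !sqrrN. Qed.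

Lemma rho_even d z : rho d (- z) = rho d z.
Proof. by rewrite /rho /radial sqnN. Qed.

Lemma kap_odd d i z : kap d i (- z) = - kap d i z.
Proof. by rewrite /kap /radial sqnN /perp /=; case: ifP => _; ring. Qed.

Lemma kap_far d i z : 0 < d -> d ^+ 2 <= sqn z ->
  kap d i z = perp i z * (mass^-1 * step 1 / sqn z).
Proof.
move=> d0 H; have d20 : 0 < d ^+ 2 by rewrite exprn_gt0.
have s0 : 0 < sqn z by exact: lt_le_trans H.
rewrite /kap /radial /step_div step_ge1; last by rewrite ler_pdivlMr// mul1r.
by congr (_ * _); field; rewrite !gt_eqF// mass_gt0.
Qed.

(** In polar coordinates [mass] is 2 pi step 1, so this is 1 / (2 pi), the constant of the
    Biot-Savart law. *)
Definition kconst : R := mass^-1 * step 1.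

Lemma kconst_ge0 : 0 <= kconst.
Proof. by rewrite mulr_ge0 ?step_ge0// invr_ge0 ltW// mass_gt0. Qed.

Lemma perp_le i z : `|perp i z| ^+ 2 <= sqn z.
Proof.
rewrite real_normK ?num_real// /perp /sqn; case: ifP => _.
  by rewrite sqrrN lerDr sqr_ge0.
by rewrite lerDl sqr_ge0.
Qed.

Lemma perp_sqrt i z : `|perp i z| <= Num.sqrt (sqn z).
Proof.
by rewrite -[leLHS]ger0_norm// -sqrtr_sqr ler_sqrt ?sqn_ge0// perp_le.
Qed.

Lemma kap_norm d i z : 0 < d -> `|kap d i z| =
  `|perp i z| * (mass^-1 * d ^- 2 * step_div (sqn z * d ^- 2)).
Proof.
move=> d0; rewrite /kap normrM (ger0_norm (x := _ * radial _ _ _))// mulr_ge0//.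
  by rewrite mulr_ge0 ?invr_ge0 ?exprn_ge0 ?(ltW mass_gt0)// ltW.
by apply: step_div_ge0; rewrite mulr_ge0 ?sqn_ge0// invr_ge0 exprn_ge0// ltW.
Qed.

Lemma kap_bound_far d i z : 0 < d -> `|kap d i z| * Num.sqrt (sqn z) <= kconst.
Proof.
move=> d0; rewrite kap_norm//.
have q0 : 0 <= sqn z * d ^- 2 by rewrite mulr_ge0 ?sqn_ge0// invr_ge0 exprn_ge0// ltW.
have m0 : 0 <= mass^-1 by rewrite invr_ge0 ltW// mass_gt0.
have k0 := step_div_ge0 q0.
have d20 : 0 <= d ^- 2 by rewrite invr_ge0 exprn_ge0// ltW.
apply: (@le_trans _ _ (sqn z * (mass^-1 * d ^- 2 * step_div (sqn z * d ^- 2)))).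
  have c0 : 0 <= mass^-1 * d ^- 2 * step_div (sqn z * d ^- 2).
    by apply: mulr_ge0 => //; exact: mulr_ge0.
  rewrite mulrAC ler_wpM2r//.
  apply: (@le_trans _ _ (Num.sqrt (sqn z) * Num.sqrt (sqn z))).
    by rewrite ler_wpM2r ?sqrtr_ge0// perp_sqrt.
  by rewrite -expr2 sqr_sqrtr ?sqn_ge0.
have -> : sqn z * (mass^-1 * d ^- 2 * step_div (sqn z * d ^- 2)) =
  mass^-1 * (sqn z * d ^- 2 * step_div (sqn z * d ^- 2)) by ring.
by rewrite step_div_mul /kconst ler_wpM2l// step_le1.
Qed.

Lemma kap_bound_near d i z : 0 < d -> `|kap d i z| * d <= 2 * kconst.
Proof.
move=> d0; rewrite kap_norm//.
have m0 : 0 <= mass^-1 by rewrite invr_ge0 ltW// mass_gt0.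
set q := sqn z * d ^- 2.
have q0 : 0 <= q by rewrite /q mulr_ge0 ?sqn_ge0// invr_ge0 exprn_ge0// ltW.
have [q4|q4] := leP q (1 / 4).
  by rewrite /step_div step_eq0// mul0r !mulr0 mul0r mulr_ge0// kconst_ge0.
pose a := `|perp i z| / d.
have a0 : 0 <= a by rewrite divr_ge0// ltW.
have aq : a ^+ 2 <= q.
  by rewrite /a /q expr_div_n ler_wpM2r ?perp_le// invr_ge0 exprn_ge0// ltW.
(* Since q > 1/4, sqrt q <= 2 q; for smaller q the kernel was 0. *)
have a2q : a <= 2 * q by rewrite leNgt; apply/negP => H; nra.
have -> : `|perp i z| * (mass^-1 * d ^- 2 * step_div q) * d = mass^-1 * (a * step_div q).
  by rewrite /a; field; rewrite !gt_eqF// mass_gt0.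
rewrite /kconst [leRHS]mulrCA ler_wpM2l//.
apply: (@le_trans _ _ (2 * q * step_div q)); first by rewrite ler_wpM2r// step_div_ge0.
by rewrite -mulrA step_div_mul ler_pM2l// step_le1.
Qed.

(** Both kernels coincide beyond the larger radius, so their difference has compact support; its
    curl is [rho e] - [rho d], which makes the comparison of two mollifications local. *)
Definition Gker e d (i : 'I_2) z : R := kap e i z - kap d i z.

Lemma smooth_Gker e d i : smooth (Gker e d i).
Proof. by apply: smoothB; exact: smooth_kap. Qed.

Lemma Gker_supp e d i z : 0 < e -> e <= d -> d ^+ 2 <= sqn z -> Gker e d i z = 0.
Proof.
move=> e0 ed H; have d0 : 0 < d by exact: lt_le_trans ed.
rewrite /Gker !kap_far ?subrr//; apply: le_trans H.
by rewrite lerXn2r ?nnegrE// ltW.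
Qed.

Lemma Gker_box e d i : 0 < e -> e <= d -> box_supp d (Gker e d i).
Proof.
move=> e0 ed z H; have d0 : 0 < d by exact: lt_le_trans ed.
apply: Gker_supp => //; rewrite /sqn.
case: H => H.
  rewrite ler_wpDr ?sqr_ge0// -(real_normK (num_real z.1)) lerXn2r ?nnegrE// ltW//.
rewrite ler_wpDl ?sqr_ge0// -(real_normK (num_real z.2)) lerXn2r ?nnegrE// ltW//.
Qed.

Lemma Gker_odd e d i z : Gker e d i (- z) = - Gker e d i z.
Proof. by rewrite /Gker !kap_odd; ring. Qed.

Lemma Gker_bound_far e d i z : 0 < e -> 0 < d ->
  `|Gker e d i z| * Num.sqrt (sqn z) <= 2 * kconst.
Proof.
move=> e0 d0; apply: (@le_trans _ _ ((`|kap e i z| + `|kap d i z|) * Num.sqrt (sqn z))).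
  by rewrite ler_wpM2r ?sqrtr_ge0// ler_normB.
by rewrite mulrDl mulr2n mulrDl mul1r lerD// kap_bound_far.
Qed.

Lemma Gker_bound_near e d i z : 0 < e -> e <= d -> `|Gker e d i z| * e <= 4 * kconst.
Proof.
move=> e0 ed; have d0 : 0 < d by exact: lt_le_trans ed.
apply: (@le_trans _ _ ((`|kap e i z| + `|kap d i z|) * e)).
  by rewrite ler_wpM2r ?ler_normB// ltW.
have := kap_bound_near i z e0; have := kap_bound_near i z d0 => h1 h2.
have : `|kap d i z| * e <= `|kap d i z| * d by rewrite ler_wpM2l.
by rewrite mulrDl; lra.
Qed.

Lemma pderiv_Gker e d i j z :
  pderiv j (Gker e d i) z = pderiv j (kap e i) z - pderiv j (kap d i) z.
Proof.
by rewrite (pderivD j (smooth_C1 (smooth_kap e i)) (C1N (smooth_C1 (smooth_kap d i))))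
  (pderivN j (smooth_C1 (smooth_kap d i))).
Qed.

Lemma Gker_div e d z : pderiv 0 (Gker e d 0) z + pderiv 1 (Gker e d 1) z = 0.
Proof. by have := kap_div e z; have := kap_div d z; rewrite !pderiv_Gker; lra. Qed.

Lemma Gker_curl e d z :
  pderiv 0 (Gker e d 1) z - pderiv 1 (Gker e d 0) z = rho e z - rho d z.
Proof. by have := kap_curl e z; have := kap_curl d z; rewrite !pderiv_Gker; lra. Qed.

(** True at d = 1 by the choice of [mass]. Other radii follow without a change of variables: [rho a]
    - [rho b] is the curl of the compactly supported field [Gker], so its integral is 0. *)
Lemma Int_rho d : 0 < d -> \int[leb2]_z rho d z = 1.
Proof.
have R1 : \int[leb2]_z rho 1 z = 1.
  have -> : \int[leb2]_z rho 1 z = \int[leb2]_z (mass^-1 * (2 * radial (@bump R) 1 z)).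
    by apply: Int_ext => z; rewrite /rho expr1n invr1; ring.
  rewrite (IntZl (mu := leb2)); first by rewrite -/mass mulVf// gt_eqF// mass_gt0.
  by apply: (L1Zl (mu := leb2)); have := L1_radial_bump (ltr01 : (0 : R) < 1); rewrite expr1n invr1.
suff H (a b : R) : 0 < a -> a <= b -> \int[leb2]_z rho a z = \int[leb2]_z rho b z.
  move=> d0; have [d1|/ltW d1] := leP d 1; first by rewrite (H _ 1).
  by rewrite -(H 1).
move=> a0 ab; have b0 : 0 < b by exact: lt_le_trans ab.
apply/eqP; rewrite -subr_eq0 -(IntB (mu := leb2)); [|exact: L1_rho..].
have cG i := smooth_C1 (smooth_Gker a b i).
have iG i j : L1 leb2 (pderiv j (Gker a b i)).
  apply: (@box_supp_L1 R (b + 1)); first exact: C1_continuousD.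
  by apply: box_supp_pderiv; exact: Gker_box.
under Int_ext do rewrite -Gker_curl.
rewrite (IntB (mu := leb2)); [|exact: iG..].
by rewrite !(@Int_pderiv R b) ?subrr//; [exact: Gker_box|exact: Gker_box].
Qed.

End kernels.

(** * Convolution *)

Section convolution.
Context (R : realType).
Implicit Types (K f g : plane R -> R) (x y z : plane R).

Definition n1 x : R := `|x.1| + `|x.2|.

Lemma n1_ge0 x : 0 <= n1 x. Proof. by rewrite addr_ge0. Qed.

Lemma n1D x y : n1 (x + y) <= n1 x + n1 y.
Proof.
rewrite /n1 /=; have := ler_normD x.1 y.1; have := ler_normD x.2 y.2; lra.
Qed.

Lemma n1_sqrt x : n1 x <= 2 * Num.sqrt (sqn x).
Proof.
have h1 := perp_sqrt 0 x; have h2 := perp_sqrt 1 x.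
by move: h1 h2; rewrite /perp /= normrN /n1; lra.
Qed.

Lemma n1_sqn x (d : R) : 0 < d -> sqn x < d ^+ 2 -> n1 x <= 2 * d.
Proof.
move=> d0 H; apply: (le_trans (n1_sqrt x)); rewrite ler_pM2l//.
by rewrite -[leRHS]ger0_norm ?(ltW d0)// -sqrtr_sqr ler_sqrt ?sqr_ge0// ltW.
Qed.

Lemma measurable_sub2 : measurable_fun setT (fun z : plane R * plane R => z.1 - z.2).
Proof.
have h1 : measurable_fun setT (fun z : plane R * plane R => z.1.1 - z.2.1).
  apply: measurable_funB.
    exact: (measurableT_comp measurable_fst measurable_fst).
  exact: (measurableT_comp measurable_fst measurable_snd).
have h2 : measurable_fun setT (fun z : plane R * plane R => z.1.2 - z.2.2).
  apply: measurable_funB.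
    exact: (measurableT_comp measurable_snd measurable_fst).
  exact: (measurableT_comp measurable_snd measurable_snd).
exact: (measurable_fun_pair h1 h2).
Qed.

Lemma measurable_kernel K : continuous K ->
  measurable_fun setT (fun z : plane R * plane R => K (z.1 - z.2)).
Proof.
move=> cK; apply: (measurableT_comp (f := K)); last exact: measurable_sub2.
exact: measurable_continuous_plane.
Qed.

Lemma measurable_kernel1 K x : continuous K ->
  measurable_fun setT (fun y : plane R => K (x - y)).
Proof.
move=> cK; apply: (measurableT_comp (f := K)); last exact: measurable_reflect2.
exact: measurable_continuous_plane.
Qed.

Definition conv K f x : R := \int[leb2]_y (K (x - y) * f y).

Definition nice (M : R) K := smooth K /\ box_supp M K.

Lemma nice_C1 M K : nice M K -> C1 K. Proof. by case=> /smooth_C1. Qed.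

Lemma nice_continuous M K : nice M K -> continuous K.
Proof. by case=> /smooth_continuous. Qed.

Lemma nice_pderiv M K j : nice M K -> nice (M + 1) (pderiv j K).
Proof. by case=> sK bK; split; [exact: smooth_pderiv|exact: box_supp_pderiv]. Qed.

Lemma nice_bounded M K : nice M K -> exists2 C : R, 0 <= C & forall x, `|K x| <= C.
Proof. by move=> nK; apply: box_supp_bounded nK.2; exact: nice_continuous nK. Qed.

Lemma nice_bounded_pderiv M K : nice M K ->
  exists2 C : R, 0 <= C & forall j x, `|pderiv j K x| <= C.
Proof.
move=> nK; have [C0 h0 H0] := nice_bounded (nice_pderiv 0 nK).
have [C1 h1 H1] := nice_bounded (nice_pderiv 1 nK).
exists (C0 + C1); first exact: addr_ge0.
move=> j x; have [->|->] := ord2_cases j.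
  by apply: (le_trans (H0 x)); rewrite lerDl.
by apply: (le_trans (H1 x)); rewrite lerDr.
Qed.

Lemma L1_conv (C : R) K f x : continuous K -> (forall z, `|K z| <= C) -> L1 leb2 f ->
  L1 leb2 (fun y : plane R => K (x - y) * f y).
Proof.
move=> cK KC fi; apply: (L1_bmul (mu := leb2) (c := C)) => //.
exact: measurable_kernel1.
Qed.

Lemma L1_conv_nice M K f x : nice M K -> L1 leb2 f ->
  L1 leb2 (fun y : plane R => K (x - y) * f y).
Proof.
move=> nK fi; have [C _ HC] := nice_bounded nK.
by apply: (L1_conv _ _ HC fi); exact: nice_continuous nK.
Qed.

Lemma conv_bound (C : R) K f x : continuous K -> (forall z, `|K z| <= C) -> L1 leb2 f ->
  `|conv K f x| <= C * \int[leb2]_y `|f y|.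
Proof.
move=> cK KC fi; rewrite /conv -(IntZl (mu := leb2)); last exact: (L1_abs (mu := leb2)).
apply: (Int_norm_le (mu := leb2)).
- by have := L1_measurable (mu := leb2) (L1_conv x cK KC fi).
- by apply: (L1Zl (mu := leb2)); exact: (L1_abs (mu := leb2)).
- by move=> y; rewrite normrM ler_wpM2r.
Qed.

Lemma conv_lipschitz (C : R) M K f x y : nice M K ->
  (forall j z, `|pderiv j K z| <= C) -> L1 leb2 f ->
  `|conv K f x - conv K f y| <= C * n1 (x - y) * \int[leb2]_z `|f z|.
Proof.
move=> nK KC fi.
have i1 := L1_conv_nice x nK fi; have i2 := L1_conv_nice y nK fi.
rewrite /conv -(IntB (mu := leb2) i1 i2) -(IntZl (mu := leb2)); last exact: (L1_abs (mu := leb2)).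
apply: (Int_norm_le (mu := leb2)).
- by have := L1_measurable (mu := leb2) (L1B (mu := leb2) i1 i2).
- by apply: (L1Zl (mu := leb2)); exact: (L1_abs (mu := leb2)).
- move=> z; rewrite -mulrBl normrM ler_wpM2r//.
  have := C1_lipschitz (nice_C1 nK) KC (x - z) (y - z).
  have -> : (x - z).1 - (y - z).1 = (x - y).1 by rewrite /=; ring.
  by have -> : (x - z).2 - (y - z).2 = (x - y).2 by rewrite /=; ring.
Qed.

Lemma lipschitz_continuous (h : plane R -> R) (C : R) :
  (forall x y, `|h x - h y| <= C * n1 (x - y)) -> continuous h.
Proof.
move=> H x; apply/cvgrPdist_le => e e0.
have C0 : 0 < `|C| + 1 by rewrite ltr_wpDl.
have d0 : 0 < e / (2 * (`|C| + 1)) by rewrite divr_gt0// mulr_gt0.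
exists (ball x.1 (e / (2 * (`|C| + 1))), ball x.2 (e / (2 * (`|C| + 1)))).
  by split; exact: nbhsx_ballx.
move=> y [] /=; rewrite /ball /= => /ltW h1 /ltW h2.
apply: (le_trans (H x y)).
apply: (@le_trans _ _ ((`|C| + 1) * (e / (2 * (`|C| + 1)) + e / (2 * (`|C| + 1))))).
  apply: (@le_trans _ _ ((`|C| + 1) * n1 (x - y))).
    by rewrite ler_wpM2r ?n1_ge0// (le_trans (ler_norm C))// lerDl.
  by rewrite ler_pM2l// lerD.
have -> : (`|C| + 1) * (e / (2 * (`|C| + 1)) + e / (2 * (`|C| + 1))) = e; last by [].
by field; rewrite gt_eqF.
Qed.

End convolution.

Lemma sum_ord2 (V : nmodType) (F : 'I_2 -> V) : \sum_(i < 2) F i = F 0 + F 1.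
Proof. by rewrite big_ord_recl big_ord1; congr (_ + F _); exact: val_inj. Qed.

Section convolution_derivative.
Context (R : realType).
Implicit Types (K f g : plane R -> R) (x y z : plane R).

(** Differentiation under the integral along the line x + s * basis j: the derivative of the
    integrand is at most a multiple of |f|, uniformly in s. *)
Lemma conv_derive M K f j x : nice M K -> L1 leb2 f ->
  derivable (conv K f) x (basis j) /\ pderiv j (conv K f) x = conv (pderiv j K) f x.
Proof.
move=> nK fi; have [C C0 HC] := nice_bounded_pderiv nK.
pose F (s : R) (y : plane R) : R := K (x + s *: basis j - y) * f y.
have E s y : x + s *: basis j - y = (x - y) + s *: basis j by rewrite addrAC.
have dK s y : derivable (fun s : R => K (x + s *: basis j - y)) s 1 /\
    'D_1 (fun s : R => K (x + s *: basis j - y)) s = pderiv j K (x + s *: basis j - y).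
  have -> : (fun s : R => K (x + s *: basis j - y)) = (fun s : R => K ((x - y) + s *: basis j)).
    by apply/funext => r; rewrite E.
  rewrite (derive_line K (x - y)) E; split=> //.
  by apply/derivable_line; apply: smooth_derivable; exact: nK.1.
have dF s y : derivable (F ^~ y) s 1 /\
    derive1 (F ^~ y) s = pderiv j K (x + s *: basis j - y) * f y.
  have [d1 d2] := dK s y; rewrite derive1E.
  have dc : derivable (fun _ : R => f y) s 1 by exact: derivable_cst.
  split; first exact: (derivableM d1 dc).
  by rewrite (deriveM d1 dc) derive_cst d2 /GRing.scale/= mulr0 add0r mulrC.
have I0 : `]-1, 1[%classic (0 : R) by rewrite /= in_itv/= oppr_lt0 ltr01.
have intF s : `]-1, 1[%classic s -> leb2.-integrable setT (EFin \o F s).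
  by move=> _; exact: (L1_conv_nice (x + s *: basis j) nK fi).
have derF s y : `]-1, 1[%classic s -> setT y -> derivable (F ^~ y) s 1.
  by move=> _ _; have [] := dF s y.
have Fge0 y : 0 <= C * `|f y| by rewrite mulr_ge0.
have intG : leb2.-integrable setT (EFin \o (fun y => C * `|f y|)).
  by apply: (L1Zl (mu := leb2)); exact: (L1_abs (mu := leb2)).
have Gub s y : `]-1, 1[%classic s -> setT y -> `|derive1 (F ^~ y) s| <= C * `|f y|.
  by move=> _ _; rewrite (dF s y).2 normrM ler_wpM2r.
have D1 := @derivable_under_integral R _ _ leb2 F setT measurableT 0 (-1) 1 I0 intF derF _ Fge0 intG Gub.
have D2 := @differentiation_under_integral R _ _ leb2 F setT measurableT 0 (-1) 1 I0 intF derF _ Fge0 intG Gub.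
have x0 : x + (0 : R) *: basis j = x by rewrite scale0r addr0.
split.
  have := (derivable_line (conv K f) x (basis j) 0).1; rewrite x0; apply.
  exact: D1.
have := derive_line (conv K f) x (basis j) 0; rewrite x0 /pderiv => <-.
rewrite -derive1E; apply: (etrans D2); apply: Int_ext => y.
by apply: (etrans (dF 0 y).2); rewrite x0.
Qed.

Lemma conv_continuous M K f : nice M K -> L1 leb2 f -> continuous (conv K f).
Proof.
move=> nK fi; have [C C0 HC] := nice_bounded_pderiv nK.
apply: (@lipschitz_continuous _ _ (C * \int[leb2]_z `|f z|)) => x y.
by rewrite [leRHS]mulrAC; exact: (conv_lipschitz x y nK HC fi).
Qed.

Lemma conv_C1 M K f : nice M K -> L1 leb2 f -> C1 (conv K f).
Proof.
move=> nK fi; split; first exact: conv_continuous nK fi.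
move=> j; split=> [x|]; first by have [] := conv_derive j x nK fi.
have -> : pderiv j (conv K f) = conv (pderiv j K) f.
  by apply/funext => x; have [] := conv_derive j x nK fi.
exact: conv_continuous (nice_pderiv j nK) fi.
Qed.

Lemma pderiv_conv M K f j x : nice M K -> L1 leb2 f ->
  pderiv j (conv K f) x = conv (pderiv j K) f x.
Proof. by move=> nK fi; have [] := conv_derive j x nK fi. Qed.

Lemma conv_fubini M K f g : nice M K -> L1 leb2 f -> L1 leb2 g ->
  \int[leb2]_x (g x * conv K f x) =
  \int[leb2]_y (f y * \int[leb2]_x (K (x - y) * g x)).
Proof.
move=> nK fi gi; have [C C0 HC] := nice_bounded nK.
have := @fubini_kernel _ _ _ _ R (lebp R) (lebp R) g f (fun z : plane R * plane R => K (z.1 - z.2)) C gi fi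
  (measurable_kernel (nice_continuous nK)) (fun z : plane R * plane R => HC (z.1 - z.2)).
by [].
Qed.

Definition cbox x (d : R) : set (plane R) :=
  [set y | `|x.1 - y.1| <= d /\ `|x.2 - y.2| <= d].

Lemma cbox_compact x d : compact (cbox x d) /\ closed (cbox x d).
Proof.
have E : cbox x d = `[x.1 - d, x.1 + d]%classic `*` `[x.2 - d, x.2 + d]%classic.
  apply/seteqP; split=> y; rewrite /cbox /= => -[].
    rewrite !ler_norml => /andP[h1 h2] /andP[h3 h4].
    by split; rewrite /= in_itv/=; apply/andP; split; lra.
  rewrite !in_itv/= => /andP[h1 h2] /andP[h3 h4].
  by split; rewrite ler_norml; apply/andP; split; lra.
have cE : compact (cbox x d) by rewrite E; apply: compact_setX; exact: segment_compact.
by split=> //; apply: compact_closed.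
Qed.

(** Using the reflected kernel as a test function turns weak identities into pointwise identities
    between convolutions, at the points x whose square of half-side d stays in U. *)
Lemma test_function_reflect d K (U : set (plane R)) x : nice d K -> cbox x d `<=` U ->
  test_function U (fun y : plane R => K (x - y)).
Proof.
move=> nK sU; split; first by apply: smooth_reflect; exact: nK.1.
have [cB clB] := cbox_compact x d.
have sub : closure [set y : plane R | K (x - y) != 0] `<=` cbox x d.
  rewrite (closure_id (cbox x d)).1//; apply: closure_subset => y /= /eqP Ky.
  split; rewrite leNgt; apply/negP => H; apply: Ky; apply: nK.2; [left|right]; exact: ltW.
split; last by apply: subset_trans sub sU.
by apply: subclosed_compact cB sub; exact: closed_closure.
Qed.

End convolution_derivative.

Section kernel_nice.
Context (R : realType).

Lemma nice_rho (d : R) : 0 < d -> nice d (rho d).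
Proof. by move=> d0; split; [exact: smooth_rho|exact: rho_box]. Qed.

Lemma nice_Gker (e d : R) i : 0 < e -> e <= d -> nice d (Gker e d i).
Proof. by move=> e0 ed; split; [exact: smooth_Gker|exact: Gker_box]. Qed.

End kernel_nice.

Section weak_forms.
Context (R : realType) (U : set (plane R)) (v : 'I_2 -> plane R -> R) (w : plane R -> R).
Hypothesis vi : forall i, L1 leb2 (v i).
Hypothesis wi : L1 leb2 w.

(** Integrals run over the whole plane because [v] will be a field already extended by 0; [U]
    restricts the test functions and may be smaller than the domain. *)
Definition weak_div0 := forall phi, test_function U phi ->
  \int[leb2]_x (\sum_(i < 2) v i x * pderiv i phi x) = 0.

Definition weak_rot := forall phi, test_function U phi ->
  \int[leb2]_x (w x * phi x) =
  \int[leb2]_x (v 0 x * pderiv 1 phi x - v 1 x * pderiv 0 phi x).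

Lemma conv_weak_div0 d K x : weak_div0 -> nice d K -> cbox x d `<=` U ->
  conv (pderiv 0 K) (v 0) x + conv (pderiv 1 K) (v 1) x = 0.
Proof.
move=> H nK /(test_function_reflect nK)/H.
have n i := L1_conv_nice x (nice_pderiv i nK) (vi i).
have -> : \int[leb2]_x0 (\sum_(i < 2) v i x0 * pderiv i (fun y : plane R => K (x - y)) x0) =
  \int[leb2]_y (- (pderiv 0 K (x - y) * v 0 y + pderiv 1 K (x - y) * v 1 y)).
  apply: Int_ext => y; rewrite sum_ord2 !(pderiv_reflect _ _ _ nK.1).
  by ring.
rewrite (IntN (mu := leb2)); last exact: (L1D (mu := leb2)).
rewrite (IntD (mu := leb2)) // => /eqP; rewrite oppr_eq0 => /eqP.
by [].
Qed.

Lemma conv_weak_rot d K x : weak_rot -> nice d K -> cbox x d `<=` U ->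
  conv K w x = conv (pderiv 0 K) (v 1) x - conv (pderiv 1 K) (v 0) x.
Proof.
move=> H nK /(test_function_reflect nK)/H.
have n i j := L1_conv_nice x (nice_pderiv i nK) (vi j).
rewrite /conv -(IntB (mu := leb2)) //.
have -> : \int[leb2]_x0 (w x0 * K (x - x0)) = \int[leb2]_y (K (x - y) * w y).
  by apply: Int_ext => y; exact: mulrC.
move=> ->; apply: Int_ext => y; rewrite !(pderiv_reflect _ _ _ nK.1).
by ring.
Qed.

(** A localized Biot-Savart law. The difference of the two mollifications is (curl G) * v_i; as G
    and v are both solenoidal, derivatives can be exchanged between components until curl v appears,
    convolved with G_i. *)
Lemma conv_decomp (e d : R) i x : weak_div0 -> weak_rot -> 0 < e -> e <= d -> cbox x d `<=` U ->
  conv (rho e) (v i) x = conv (rho d) (v i) x + conv (Gker e d i) w x.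
Proof.
move=> Hd Hr e0 ed xU; have d0 : 0 < d := lt_le_trans e0 ed.
have nG k := nice_Gker k e0 ed.
have cG k j l := L1_conv_nice x (nice_pderiv j (nG k)) (vi l).
have re := L1_conv_nice x (nice_rho e0) (vi i).
have rd := L1_conv_nice x (nice_rho d0) (vi i).
apply/eqP; rewrite addrC -subr_eq; apply/eqP.
have -> : conv (rho e) (v i) x - conv (rho d) (v i) x =
    conv (pderiv 0 (Gker e d 1)) (v i) x - conv (pderiv 1 (Gker e d 0)) (v i) x.
  rewrite /conv -(IntB (mu := leb2) re rd) -(IntB (mu := leb2)) //.
  by apply: Int_ext => y; rewrite -!mulrBl Gker_curl.
have Gdiv l : conv (pderiv 0 (Gker e d 0)) (v l) x = - conv (pderiv 1 (Gker e d 1)) (v l) x.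
  rewrite /conv -(IntN (mu := leb2)) //; apply: Int_ext => y.
  by have := Gker_div e d (x - y) => /eqP; rewrite addr_eq0 => /eqP ->; ring.
have [->|->] := ord2_cases i.
- rewrite (conv_weak_rot Hr (nG 0) xU).
  congr (_ - _); rewrite (Gdiv 1); apply/eqP; rewrite -addr_eq0; apply/eqP.
  exact: (conv_weak_div0 Hd (nG 1) xU).
- rewrite (conv_weak_rot Hr (nG 1) xU).
  congr (_ - _); have := conv_weak_div0 Hd (nG 0) xU; rewrite (Gdiv 0).
  by move/eqP; rewrite addrC subr_eq0 => /eqP.
Qed.

End weak_forms.

(** * Delort's symmetrization *)

Section quadratic_form.
Context (R : realType).
Implicit Types (Phi a : 'I_2 -> plane R -> R) (x y z : plane R).

Definition quad Phi a : R := \int[leb2]_x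
  (\sum_(i < 2) \sum_(j < 2) pderiv j (Phi i) x * a i x * a j x).

Definition curlf a x : R := pderiv 0 (a 1) x - pderiv 1 (a 0) x.

(** This is the scalar product of [Phi] with a^perp = (- a 1, a 0). *)
Definition cross Phi a x : R := Phi 1 x * a 0 x - Phi 0 x * a 1 x.

Lemma box_suppM M (f g : plane R -> R) : box_supp M f -> box_supp M (fun x => f x * g x).
Proof. by move=> H x /H ->; rewrite mul0r. Qed.

Lemma box_suppD M (f g : plane R -> R) : box_supp M f -> box_supp M g ->
  box_supp M (fun x => f x + g x).
Proof. by move=> H1 H2 x h; rewrite H1// H2// addr0. Qed.

Lemma box_suppB M (f g : plane R -> R) : box_supp M f -> box_supp M g ->
  box_supp M (fun x => f x - g x).
Proof. by move=> H1 H2 x h; rewrite H1// H2// subr0. Qed.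

(** The divergence of [a] is assumed to vanish only where [Phi] does not: a mollified field is
    solenoidal only away from the boundary. Where both components of [Phi] are 0, its derivatives
    remain and cancel by div Phi = 0. *)
Lemma flux_identity (P0 P1 a0 a1 P00 P01 P10 P11 a00 a01 a10 a11 : R) :
  P00 + P11 = 0 -> (P0 != 0 -> a00 + a11 = 0) -> (P1 != 0 -> a00 + a11 = 0) ->
  P00 * a0 * a0 + P01 * a0 * a1 + (P10 * a1 * a0 + P11 * a1 * a1) +
  (a10 - a01) * (P1 * a0 - P0 * a1) =
  (P0 * a0 + P1 * a1) * a00 + a0 * (P0 * a00 + a0 * P00 + (P1 * a10 + a1 * P10)) -
  (P0 * (2^-1 * (a0 * a00 + a0 * a00 + (a1 * a10 + a1 * a10))) +
   2^-1 * (a0 * a0 + a1 * a1) * P00) +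
  ((P0 * a0 + P1 * a1) * a11 + a1 * (P0 * a01 + a0 * P01 + (P1 * a11 + a1 * P11)) -
  (P1 * (2^-1 * (a0 * a01 + a0 * a01 + (a1 * a11 + a1 * a11))) +
   2^-1 * (a0 * a0 + a1 * a1) * P11)).
Proof.
move=> /eqP; rewrite addr_eq0 => /eqP -> H0 H1.
have [p0|/H0] := eqVneq P0 0; last first.
  by move=> /eqP; rewrite addr_eq0 => /eqP ->; field.
have [p1|/H1] := eqVneq P1 0; last first.
  by move=> /eqP; rewrite addr_eq0 => /eqP ->; field.
by rewrite p0 p1; field.
Qed.

(* The flux is the sum of (Phi . a) a and of - |a|^2/2 Phi; its divergence is
   computed pointwise, and a . grad a = grad (|a|^2/2) + curl a a^perp. *)
Lemma quad_curl Phi a M : (forall i, C1 (Phi i)) -> (forall i, box_supp M (Phi i)) ->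
  (forall i, C1 (a i)) -> (forall x, divergence Phi x = 0) ->
  (forall i x, Phi i x != 0 -> divergence a x = 0) ->
  quad Phi a = - \int[leb2]_x (curlf a x * cross Phi a x).
Proof.
move=> cP bP ca dP da.
pose S := fun x => Phi 0 x * a 0 x + Phi 1 x * a 1 x.
pose h := fun x => a 0 x * a 0 x + a 1 x * a 1 x.
pose W j := fun x => S x * a j x - Phi j x * (2^-1 * h x).
have cS : C1 S by exact: (C1D (C1M (cP 0) (ca 0)) (C1M (cP 1) (ca 1))).
have ch : C1 h by exact: (C1D (C1M (ca 0) (ca 0)) (C1M (ca 1) (ca 1))).
have ch2 : C1 (fun x => 2^-1 * h x) by exact: (C1Z _ ch).
have cW j : C1 (W j) by exact: (C1B (C1M cS (ca j)) (C1M (cP j) ch2)).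
have bS : box_supp M S by apply: box_suppD; apply: box_suppM; exact: bP.
have bW j : box_supp M (W j) by apply: box_suppB; apply: box_suppM; [exact: bS|exact: bP].
have key x : \sum_(i < 2) \sum_(j < 2) pderiv j (Phi i) x * a i x * a j x +
    curlf a x * cross Phi a x = pderiv 0 (W 0) x + pderiv 1 (W 1) x.
  have D j k : pderiv k (W j) x = S x * pderiv k (a j) x + a j x *
     ((Phi 0 x * pderiv k (a 0) x + a 0 x * pderiv k (Phi 0) x) +
      (Phi 1 x * pderiv k (a 1) x + a 1 x * pderiv k (Phi 1) x)) -
     (Phi j x * (2^-1 * ((a 0 x * pderiv k (a 0) x + a 0 x * pderiv k (a 0) x) +
        (a 1 x * pderiv k (a 1) x + a 1 x * pderiv k (a 1) x))) +
      (2^-1 * h x) * pderiv k (Phi j) x).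
    rewrite (pderivD k (C1M cS (ca j)) (C1N (C1M (cP j) ch2))).
    rewrite (pderivN k (C1M (cP j) ch2)) (pderivM k cS (ca j)) (pderivM k (cP j) ch2).
    rewrite (pderivD k (C1M (cP 0) (ca 0)) (C1M (cP 1) (ca 1))).
    rewrite (pderivM k (cP 0) (ca 0)) (pderivM k (cP 1) (ca 1)) (pderivZ _ k ch).
    rewrite (pderivD k (C1M (ca 0) (ca 0)) (C1M (ca 1) (ca 1))).
    by rewrite (pderivM k (ca 0) (ca 0)) (pderivM k (ca 1) (ca 1)).
  rewrite !D !sum_ord2 /curlf /cross /h /S; apply: flux_identity.
  - by have := dP x; rewrite /divergence sum_ord2.
  - by move=> P0; have := da _ _ P0; rewrite /divergence sum_ord2.
  - by move=> P0; have := da _ _ P0; rewrite /divergence sum_ord2.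
have iW j : L1 leb2 (pderiv j (W j)).
  apply: (@box_supp_L1 R (M + 1)); first exact: C1_continuousD.
  by apply: box_supp_pderiv; exact: bW.
have cC : continuous (fun x => curlf a x * cross Phi a x).
  have c1 : continuous (pderiv 0 (a 1)) by exact: C1_continuousD.
  have c2 : continuous (pderiv 1 (a 0)) by exact: C1_continuousD.
  have c3 : continuous (curlf a) by move=> x; apply: cvgB; [exact: c1|exact: c2].
  have c4 := C1_continuous (C1B (C1M (cP 1) (ca 0)) (C1M (cP 0) (ca 1))).
  by move=> x; apply: cvgM; [exact: c3|exact: c4].
have iC : L1 leb2 (fun x => curlf a x * cross Phi a x).
  apply: (box_supp_L1 (M := M) cC) => x Hx.
  by rewrite /cross !bP// !mul0r subr0 mulr0.
apply/eqP; rewrite -subr_eq0 opprK /quad.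
have E : \int[leb2]_x (\sum_(i < 2) \sum_(j < 2) pderiv j (Phi i) x * a i x * a j x) =
  \int[leb2]_x (pderiv 0 (W 0) x + pderiv 1 (W 1) x - curlf a x * cross Phi a x).
  by apply: Int_ext => x; rewrite -key addrK.
rewrite E (IntB (mu := leb2)) //; last exact: (L1D (mu := leb2)).
rewrite (IntD (mu := leb2)) // (Int_pderiv 0 (cW 0) (bW 0)) (Int_pderiv 1 (cW 1) (bW 1)).
by rewrite addr0 sub0r addNr.
Qed.

End quadratic_form.

Section delort.
Context (R : realType).
Implicit Types (w Psi g : plane R -> R) (x y z : plane R) (e d L : R).

(** Radius 2 d: two points within d of a common point are that close. *)
Definition near d z : R := if sqn z < (2 * d) ^+ 2 then 1 else 0.

Lemma near_ge0 d z : 0 <= near d z.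
Proof. by rewrite /near; case: ifP. Qed.

Lemma near_le1 d z : near d z <= 1.
Proof. by rewrite /near; case: ifP. Qed.

Lemma measurable_near d : measurable_fun setT (near d).
Proof.
apply: measurable_fun_ifT => //; apply: measurable_fun_ltr => //.
have h : smooth (@sqn R) by exact: smooth_sqn.
exact: (measurable_continuous_plane (smooth_continuous h)).
Qed.

Lemma measurable_near2 d : measurable_fun setT (fun q : plane R * plane R => near d (q.1 - q.2)).
Proof.
apply: (measurableT_comp (f := near d)); last exact: measurable_sub2.
exact: measurable_near.
Qed.

(** The mass that |w| (x) |w| gives to the pairs at distance less than 2 d. *)
Definition near_mass d w : R :=
  \int[leb2]_z (`|w z| * \int[leb2]_y (near d (z - y) * `|w y|)).

Lemma reflect_subr x y z : y + z - x - z = - (x - y).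
Proof. by rewrite opprB -addrA -opprD [x + z]addrC opprD addrA addrK. Qed.

Lemma reflect_subl x y z : y + z - x - y = - (x - z).
Proof. by rewrite [y + z]addrC reflect_subr. Qed.

Lemma sub_reflect x y z : x - (y + z - x) = (x - y) + (x - z).
Proof. by rewrite !opprD opprK -!addrA; congr (_ + (_ + _)); rewrite addrC. Qed.

(** Parallelogram identity: |z - y|^2 <= 2 |x - z|^2 + 2 |x - y|^2. *)
Lemma sqn_sub_lt x y z e d : 0 < e -> e <= d -> sqn (x - z) < e ^+ 2 ->
  sqn (x - y) < d ^+ 2 -> sqn (z - y) < (2 * d) ^+ 2.
Proof.
move=> e0 ed; rewrite /sqn /= => h1 h2.
have h3 : e ^+ 2 <= d ^+ 2 by clear -e0 ed; nra.
have p1 := sqr_ge0 (x.1 - z.1 + (x.1 - y.1)); have p2 := sqr_ge0 (x.2 - z.2 + (x.2 - y.2)).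
by nra.
Qed.

Lemma Int_rho_shift e z : 0 < e ->
  L1 leb2 (fun x : plane R => rho e (x - z)) /\ \int[leb2]_x rho e (x - z) = 1.
Proof.
move=> e0; have [h1 h2] := L1_reflect z (L1_rho e0).
have E : (fun x : plane R => rho e (x - z)) = (fun x : plane R => rho e (z - x)).
  by apply/funext => x; rewrite -(rho_even e (x - z)) opprB.
by rewrite E h2 Int_rho.
Qed.

Lemma kernel_constant (A B k : R) : A <= 2 * k -> B <= 4 * k -> 2 * A + 2 * B <= 12 * k.
Proof. lra. Qed.

Lemma kernel_inner_L1 w (K : plane R * plane R -> R) C z : L1 leb2 w ->
  measurable_fun setT K -> (forall p, `|K p| <= C) ->
  L1 leb2 (fun y : plane R => K (z, y) * w y).
Proof.
move=> wi mK HC; apply: (L1_bmul (mu := leb2) (c := C)) => //.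
by apply: (measurableT_comp mK); exact: measurable_pair1.
Qed.

Lemma kernel_L1 w (K : plane R * plane R -> R) C : L1 leb2 w ->
  measurable_fun setT K -> (forall p, `|K p| <= C) ->
  L1 leb2 (fun z : plane R => w z * \int[leb2]_y (K (z, y) * w y)).
Proof.
move=> wi mK HC; under [X in L1 _ X]eq_fun do rewrite mulrC.
have mw : measurable_fun setT w by have := L1_measurable (mu := leb2) wi.
apply: (L1_bmul (mu := leb2) (c := C * \int[leb2]_y `|w y|)) => //.
  apply: (@fubini_measurable1 _ _ (measurableTypeR R * measurableTypeR R)%type
    (measurableTypeR R * measurableTypeR R)%type R (lebp R)
    (fun q : plane R * plane R => K q * w q.2)).
  by apply: measurable_funM => //; exact: (measurableT_comp mw measurable_snd).
move=> z; rewrite -(IntZl (mu := leb2)); last exact: (L1_abs (mu := leb2)).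
apply: (Int_norm_le (mu := leb2)).
- by have := L1_measurable (mu := leb2) (kernel_inner_L1 z wi mK HC).
- by apply: (L1Zl (mu := leb2)); exact: (L1_abs (mu := leb2)).
- by move=> y; rewrite normrM ler_wpM2r.
Qed.

Lemma near_norm d (p : plane R * plane R) : `|near d (p.1 - p.2)| <= 1.
Proof. by rewrite ger0_norm ?near_ge0// near_le1. Qed.

Lemma near_mass_inner d w z : L1 leb2 w ->
  L1 leb2 (fun y : plane R => near d (z - y) * `|w y|).
Proof.
move=> wi.
exact: (kernel_inner_L1 z (L1_abs (mu := leb2) wi) (measurable_near2 d) (near_norm d)).
Qed.

Lemma near_mass_L1 d w : L1 leb2 w -> L1 leb2 (fun z : plane R => `|w z| *
  \int[leb2]_y (near d (z - y) * `|w y|)).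
Proof.
move=> wi.
exact: (kernel_L1 (L1_abs (mu := leb2) wi) (measurable_near2 d) (near_norm d)).
Qed.

(** Fubini exchanges the variables, so twice the double integral sees only the symmetrized kernel.
    This is how a cancellation in K(z, y) + K(y, z) becomes a bound on the quadratic form. *)
Lemma symmetrized_kernel_le d w (K : plane R * plane R -> R) C A : L1 leb2 w ->
  measurable_fun setT K -> (forall p, `|K p| <= C) -> 
  (forall y z, `|K (z, y) + K (y, z)| <= near d (z - y) * A) ->
  `|\int[leb2]_z (w z * \int[leb2]_y (K (z, y) * w y))| *+ 2 <= A * near_mass d w.
Proof.
move=> wi mK HC KA; set T := \int[leb2]_z _.
have T2 : T = \int[leb2]_z (w z * \int[leb2]_y (K (y, z) * w y)).
  exact: (@fubini_kernel _ _ _ _ R (lebp R) (lebp R) w w K C wi wi mK HC).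
pose K' (q : plane R * plane R) := K (q.2, q.1).
have mK' : measurable_fun setT K'.
  apply: (measurableT_comp mK (g := fun q : plane R * plane R => (q.2, q.1))).
  exact: measurable_fun_pair.
have HC' q : `|K' q| <= C by exact: HC.
have iK z := kernel_inner_L1 z wi mK HC; have iK' z := kernel_inner_L1 z wi mK' HC'.
have iKK := kernel_L1 wi mK HC; have iKK' := kernel_L1 wi mK' HC'.
have inner z : \int[leb2]_y (K (z, y) * w y) + \int[leb2]_y (K' (z, y) * w y) =
    \int[leb2]_y ((K (z, y) + K' (z, y)) * w y).
  have := IntD (mu := leb2) (iK z) (iK' z) => <-; apply: Int_ext => y.
  by rewrite mulrDl.
have TT : T + T = \int[leb2]_z (w z * \int[leb2]_y ((K (z, y) + K' (z, y)) * w y)).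
  rewrite [X in _ + X]T2; have := IntD (mu := leb2) iKK iKK' => <-; apply: Int_ext => z.
  by rewrite -mulrDr inner.
rewrite -normrMn mulr2n TT /near_mass -(IntZl (mu := leb2)); last exact: near_mass_L1.
have bound z : `|\int[leb2]_y ((K (z, y) + K' (z, y)) * w y)| <=
    A * \int[leb2]_y (near d (z - y) * `|w y|).
  rewrite -(IntZl (mu := leb2)); last exact: near_mass_inner.
  apply: (Int_norm_le (mu := leb2)).
  - have := L1_measurable (mu := leb2) (L1D (mu := leb2) (iK z) (iK' z)).
    by apply: eq_measurable_fun => y _; rewrite mulrDl.
  - by apply: (L1Zl (mu := leb2)); exact: near_mass_inner.
  - move=> y; rewrite normrM [leRHS]mulrA ler_wpM2r//.
    by rewrite [leRHS]mulrC; exact: KA.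
apply: (Int_norm_le (mu := leb2)).
- have := L1_measurable (mu := leb2) (L1D (mu := leb2) iKK iKK').
  by apply: eq_measurable_fun => z _; rewrite -mulrDr inner.
- by apply: (L1Zl (mu := leb2)); exact: near_mass_L1.
- by move=> z; rewrite normrM mulrCA ler_wpM2l.
Qed.

Lemma kernel_half (t l k m : R) : t *+ 2 <= 12 * l * k * m -> t <= 6 * l * k * m.
Proof. rewrite mulr2n; lra. Qed.

Section symmetrization.
Variables (e d L : R) (i : 'I_2) (w Psi : plane R -> R).
Hypotheses (e0 : 0 < e) (ed : e <= d) (L0 : 0 <= L).
Hypotheses (wi : L1 leb2 w) (Pi : L1 leb2 Psi) (cP : continuous Psi).
Hypothesis PL : forall x y, `|Psi x - Psi y| <= L * n1 (x - y).

Let G := Gker e d i.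
Let nG : nice d G. Proof. exact: nice_Gker. Qed.
Let nr : nice e (rho e). Proof. exact: nice_rho. Qed.
(** Kernel of the flux difference as a quadratic form in w: the first variable comes from the
    convolution with [rho e], the second from the one with [G]. *)
Let H (p : plane R * plane R) : R :=
  \int[leb2]_x (G (x - p.2) * (rho e (x - p.1) * Psi x)).

Let measG : measurable_fun setT (fun z : plane R * plane R => G (z.1 - z.2)).
Proof. exact: measurable_kernel (nice_continuous nG). Qed.

Let measr : measurable_fun setT (fun z : plane R * plane R => rho e (z.1 - z.2)).
Proof. exact: measurable_kernel (nice_continuous nr). Qed.

Let L1rP z : L1 leb2 (fun x : plane R => rho e (x - z) * Psi x).
Proof.
have [C C0 HC] := nice_bounded nr.
apply: (L1_bmul (mu := leb2) (c := C)) => //.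
have E : (fun x : plane R => rho e (x - z)) = (fun x : plane R => rho e (z - x)).
  by apply/funext => x; rewrite -(rho_even e (x - z)) opprB.
by rewrite E; apply: measurable_kernel1; exact: nice_continuous nr.
Qed.

Let L1GrP y z : L1 leb2 (fun x : plane R => G (x - y) * (rho e (x - z) * Psi x)).
Proof.
have [C C0 HC] := nice_bounded nG.
apply: (L1_bmul (mu := leb2) (c := C)) => //.
have E : (fun x : plane R => G (x - y)) = (fun x : plane R => - G (y - x)).
  by apply/funext => x; rewrite -(Gker_odd e d i (y - x)) opprB.
rewrite E; apply: measurableT_comp => //; apply: measurable_kernel1.
exact: nice_continuous nG.
Qed.

Let mH : measurable_fun setT H.
Proof.
have mP := measurable_continuous_plane cP.
apply: (@fubini_measurable1 _ _ (plane R * plane R)%type (measurableTypeR R * measurableTypeR R)%type R (lebp R)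
   (fun q : (plane R * plane R) * plane R => G (q.2 - q.1.2) * (rho e (q.2 - q.1.1) * Psi q.2))).
apply: measurable_funM.
  apply: (measurableT_comp measG (g := fun q : (plane R * plane R) * plane R => (q.2, q.1.2))).
  apply: measurable_fun_pair => //.
  exact: (measurableT_comp measurable_snd measurable_fst).
apply: measurable_funM.
  apply: (measurableT_comp measr (g := fun q : (plane R * plane R) * plane R => (q.2, q.1.1))).
  apply: measurable_fun_pair => //.
  exact: (measurableT_comp measurable_fst measurable_fst).
exact: (measurableT_comp mP measurable_snd).
Qed.

Let bH : exists C : R, forall p, `|H p| <= C.
Proof.
have [C C0 HC] := nice_bounded nG; have [C' C0' HC'] := nice_bounded nr.
exists (\int[leb2]_x (C * (C' * `|Psi x|))) => p.
apply: (Int_norm_le (mu := leb2)).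
- by have := L1_measurable (mu := leb2) (L1GrP p.2 p.1).
- by apply: (L1Zl (mu := leb2)); apply: (L1Zl (mu := leb2)); exact: (L1_abs (mu := leb2)).
- move=> x; rewrite normrM; apply: ler_pM => //; rewrite normrM.
  by apply: ler_wpM2r.
Qed.

(** The reflection x -> y + z - x exchanges x - y and x - z up to sign. As [rho e] is even and [G]
    odd, the two terms combine into a difference of values of [Psi], whose Lipschitz bound
    compensates the 1/|x - y| singularity of [G]. *)
Let symH y z : `|H (z, y) + H (y, z)| <=
  near d (z - y) * (12 * L * kconst R).
Proof.
have d0 : 0 < d := lt_le_trans e0 ed.
have [r1 r2] := Int_rho_shift z e0.
have E : H (z, y) + H (y, z) = \int[leb2]_x
    (G (x - y) * rho e (x - z) * (Psi x - Psi (y + z - x))).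
  have := Int_reflect (y + z) (L1GrP z y); have := L1_reflect (y + z) (L1GrP z y).
  move=> [i2 _] E2; rewrite /H /= -E2 -(IntD (mu := leb2)) //.
  apply: Int_ext => x.
  rewrite reflect_subr reflect_subl.
  by rewrite rho_even /G Gker_odd; ring.
have pw x : `|G (x - y) * rho e (x - z) * (Psi x - Psi (y + z - x))| <=
  near d (z - y) * (12 * L * kconst R) * rho e (x - z).
  have k0 := kconst_ge0 R.
  have rhs0 : 0 <= near d (z - y) * (12 * L * kconst R) * rho e (x - z).
    apply: mulr_ge0; last exact: rho_ge0.
    by apply: mulr_ge0; [exact: near_ge0|rewrite mulr_ge0// mulr_ge0].
  have [h1|h1] := leP (e ^+ 2) (sqn (x - z)).
    by rewrite (rho_supp e0 h1) !mulr0 mul0r normr0.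
  have [h2|h2] := leP (d ^+ 2) (sqn (x - y)).
    by rewrite {1}/G (Gker_supp _ e0 ed h2) !mul0r normr0.
  rewrite /near (sqn_sub_lt e0 ed h1 h2) mul1r normrM normrM (ger0_norm (rho_ge0 _ _)).
  rewrite mulrAC ler_wpM2r ?rho_ge0//.
  have b1 := Gker_bound_far i (x - y) e0 d0; have b2 := Gker_bound_near i (x - y) e0 ed.
  have s1 := n1_sqrt (x - y); have s2 := n1_sqn e0 h1.
  have t : n1 (x - (y + z - x)) <= n1 (x - y) + n1 (x - z).
    rewrite sub_reflect.
    exact: n1D.
  have P1 := PL x (y + z - x); rewrite -/G in b1 b2.
  have g0 : 0 <= `|G (x - y)| by [].
  (* The displacement is at most 2 |x - y| + 2 e in l^1 norm. The first part meets the bound 2 k /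
     |x - y| on G, the second the bound 4 k / e, with k = [kconst]; hence 12 = 2 * 2 + 2 * 4. *)
  apply: (@le_trans _ _ (`|G (x - y)| * (L * (2 * Num.sqrt (sqn (x - y)) + 2 * e)))).
    rewrite ler_wpM2l//; apply: (le_trans P1); rewrite ler_wpM2l//.
    by apply: (le_trans t); exact: lerD.
  have -> : `|G (x - y)| * (L * (2 * Num.sqrt (sqn (x - y)) + 2 * e)) =
    L * (2 * (`|G (x - y)| * Num.sqrt (sqn (x - y))) + 2 * (`|G (x - y)| * e)) by ring.
  rewrite [12 * L]mulrC -mulrA ler_wpM2l//.
  exact: (kernel_constant b1 b2).
have -> : near d (z - y) * (12 * L * kconst R) =
    \int[leb2]_x (near d (z - y) * (12 * L * kconst R) * rho e (x - z)).
  by rewrite (IntZl (mu := leb2)) // r2 mulr1.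
rewrite E.
apply: (Int_norm_le (mu := leb2)) => //; last exact: (L1Zl (mu := leb2)).
have ii := L1_reflect (y + z) (L1GrP z y).
have := L1_measurable (mu := leb2) (L1D (mu := leb2) (L1GrP y z) ii.1).
apply: eq_measurable_fun => x _.
rewrite reflect_subr reflect_subl.
by rewrite rho_even /G Gker_odd; ring.
Qed.

Lemma delort_symmetrization :
  `|\int[leb2]_x (conv (rho e) w x * (Psi x * conv G w x))| <= 6 * L * kconst R * near_mass d w.
Proof.
have [CG CG0 HCG] := nice_bounded nG; have [C HC] := bH.
have cC := conv_continuous nG wi.
have gi : L1 leb2 (fun x => Psi x * conv G w x).
  under [X in L1 _ X]eq_fun do rewrite mulrC.
  apply: (L1_bmul (mu := leb2) (c := CG * \int[leb2]_y `|w y|)) => //.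
    exact: measurable_continuous_plane.
  by move=> x; exact: (conv_bound x (nice_continuous nG) HCG wi).
set T := (X in `|X|).
have T1 : T = \int[leb2]_z (w z * \int[leb2]_y (H (z, y) * w y)).
  rewrite /T.
  have -> : \int[leb2]_x (conv (rho e) w x * (Psi x * conv G w x)) =
     \int[leb2]_x ((Psi x * conv G w x) * conv (rho e) w x) by apply: Int_ext => x; exact: mulrC.
  rewrite (conv_fubini nr wi gi); apply: Int_ext => z; congr (_ * _).
  have -> : \int[leb2]_x (rho e (x - z) * (Psi x * conv G w x)) =
     \int[leb2]_x ((rho e (x - z) * Psi x) * conv G w x) by apply: Int_ext => x; exact: mulrA.
  by rewrite (conv_fubini nG wi (L1rP z)); apply: Int_ext => y; exact: mulrC.
apply: kernel_half; rewrite T1.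
exact: (symmetrized_kernel_le wi mH HC symH).
Qed.

End symmetrization.
End delort.

(** * Fluxes of one field at different scales *)

Section static_estimate.
Context (R : realType).
Implicit Types (w g : plane R -> R) (v Phi : 'I_2 -> plane R -> R) (x y z : plane R).

Lemma cbox_sub x (e d : R) : e <= d -> cbox x e `<=` cbox x d.
Proof. by move=> ed y [h1 h2]; split; exact: le_trans ed. Qed.

(** By evenness the mollifier passes from w to g, and a Lipschitz g moves by at most 2 e C when
    averaged at scale e. The 2 compares the l^1 norm with the Euclidean one. *)
Lemma moll_lipschitz w g (e C : R) : 0 < e -> L1 leb2 w -> L1 leb2 g -> 0 <= C ->
  (forall x y, `|g x - g y| <= C * n1 (x - y)) ->
  `|\int[leb2]_x (conv (rho e) w x * g x) - \int[leb2]_x (w x * g x)| <=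
  2 * e * C * \int[leb2]_x `|w x|.
Proof.
move=> e0 wi gi C0 HC; have nr := nice_rho e0; have [Cr Cr0 HCr] := nice_bounded nr.
have cg : continuous g by exact: lipschitz_continuous HC.
have E1 : \int[leb2]_x (conv (rho e) w x * g x) =
    \int[leb2]_y (w y * \int[leb2]_x (rho e (x - y) * g x)).
  by rewrite -(conv_fubini nr wi gi); apply: Int_ext => x; exact: mulrC.
have i1 y : L1 leb2 (fun x : plane R => rho e (x - y) * g x).
  have -> : (fun x : plane R => rho e (x - y) * g x) = (fun x : plane R => rho e (y - x) * g x).
    by apply/funext => x; rewrite -(rho_even e (x - y)) opprB.
  exact: (L1_conv_nice y nr gi).
have bd y : `|\int[leb2]_x (rho e (x - y) * g x) - g y| <= 2 * e * C.
  have [r1 r2] := Int_rho_shift y e0.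
  have E : \int[leb2]_x (rho e (x - y) * g x) - g y =
      \int[leb2]_x (rho e (x - y) * g x - rho e (x - y) * g y).
    rewrite (IntB (mu := leb2) (i1 y)); last exact: (L1Zr (mu := leb2)).
    by rewrite (IntZr (mu := leb2) _ r1) r2 mul1r.
  have -> : 2 * e * C = \int[leb2]_x (rho e (x - y) * (2 * e * C)).
    by rewrite (IntZr (mu := leb2) _ r1) r2 mul1r.
  rewrite E; apply: (Int_norm_le (mu := leb2)).
  - have := L1B (mu := leb2) (i1 y) (L1Zr (mu := leb2) (g y) r1).
    exact: L1_measurable.
  - exact: (L1Zr (mu := leb2)).
  move=> x; rewrite -mulrBr normrM (ger0_norm (rho_ge0 _ _)).
  have [h|h] := leP (e ^+ 2) (sqn (x - y)); first by rewrite rho_supp// !mul0r.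
  rewrite ler_wpM2l ?rho_ge0//; apply: (le_trans (HC _ _)).
  by rewrite mulrC ler_wpM2r//; exact: n1_sqn.
have mI : measurable_fun setT (fun y : plane R => \int[leb2]_x (rho e (x - y) * g x)).
  have -> : (fun y : plane R => \int[leb2]_x (rho e (x - y) * g x)) = conv (rho e) g.
    apply/funext => y; apply: Int_ext => x.
    by rewrite -(rho_even e (x - y)) opprB.
  by apply: measurable_continuous_plane; exact: conv_continuous nr gi.
have cr : measurable_fun setT (fun y : plane R => \int[leb2]_x (rho e (x - y) * g x) - g y).
  by apply: measurable_funB => //; exact: measurable_continuous_plane.
have i2 : L1 leb2 (fun y : plane R => w y * (\int[leb2]_x (rho e (x - y) * g x) - g y)).
  under [X in L1 _ X]eq_fun do rewrite mulrC.
  exact: (L1_bmul (mu := leb2) cr bd wi).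
have i3 : L1 leb2 (fun y : plane R => w y * \int[leb2]_x (rho e (x - y) * g x)).
  under [X in L1 _ X]eq_fun do rewrite mulrC.
  apply: (L1_bmul (mu := leb2) (c := Cr * \int[leb2]_x `|g x|)) => // y.
  have -> : \int[leb2]_x (rho e (x - y) * g x) = conv (rho e) g y.
    by apply: Int_ext => x; rewrite -(rho_even e (x - y)) opprB.
  exact: (conv_bound y (nice_continuous nr) HCr gi).
have i4 : L1 leb2 (fun y : plane R => w y * g y).
  have := L1B (mu := leb2) i3 i2; rewrite /L1; congr (integrable _ _ _).
  by apply/funext => y /=; congr EFin; ring.
rewrite E1 -(IntB (mu := leb2) i3 i4).
rewrite -(IntZl (mu := leb2)); last exact: (L1_abs (mu := leb2)).
apply: (Int_norm_le (mu := leb2)).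
- exact: (L1_measurable (L1B (mu := leb2) i3 i4)).
- by apply: (L1Zl (mu := leb2)); exact: (L1_abs (mu := leb2)).
- by move=> y; rewrite -mulrBr normrM mulrC ler_wpM2r.
Qed.

Definition moll (e : R) v i := conv (rho e) (v i).

Lemma curlf_moll (U : set (plane R)) v w (e : R) x : (forall i, L1 leb2 (v i)) ->
  weak_rot U v w -> 0 < e -> cbox x e `<=` U ->
  curlf (moll e v) x = conv (rho e) w x.
Proof.
move=> vi vw e0 xU; rewrite (conv_weak_rot vi vw (nice_rho e0) xU) /curlf.
by rewrite !(pderiv_conv _ _ (nice_rho e0) (vi _)).
Qed.

Lemma div_moll (U : set (plane R)) v (e : R) x : (forall i, L1 leb2 (v i)) ->
  weak_div0 U v -> 0 < e -> cbox x e `<=` U -> divergence (moll e v) x = 0.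
Proof.
move=> vi vd e0 xU; rewrite /divergence sum_ord2.
rewrite !(pderiv_conv _ _ (nice_rho e0) (vi _)).
exact: (conv_weak_div0 vi vd (nice_rho e0) xU).
Qed.

Lemma quad_moll (U : set (plane R)) Phi v M (e : R) : (forall i, nice M (Phi i)) ->
  (forall x, divergence Phi x = 0) -> (forall i, L1 leb2 (v i)) -> weak_div0 U v ->
  0 < e -> (forall i x, Phi i x != 0 -> cbox x e `<=` U) ->
  quad Phi (moll e v) = - \int[leb2]_x (curlf (moll e v) x * cross Phi (moll e v) x).
Proof.
move=> nP dP vi vd e0 PU; apply: (@quad_curl R Phi (moll e v) M) => //.
- by move=> i; exact: nice_C1 (nP i).
- by move=> i; exact: (nP i).2.
- by move=> i; exact: conv_C1 (nice_rho e0) (vi i).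
- by move=> i x /PU; exact: div_moll.
Qed.

Lemma lip_prod (p p' a a' B L C C' n I : R) : `|p| <= B -> `|a - a'| <= C' * n * I ->
  `|p - p'| <= L * n -> `|a'| <= C * I -> `|p * a - p' * a'| <= (B * C' + L * C) * I * n.
Proof.
move=> h1 h2 h3 h4; have -> : p * a - p' * a' = p * (a - a') + (p - p') * a' by ring.
apply: (le_trans (ler_normD _ _)); rewrite !normrM.
have k1 := ler_pM (normr_ge0 _) (normr_ge0 _) h1 h2.
have k2 := ler_pM (normr_ge0 _) (normr_ge0 _) h3 h4.
by apply: (le_trans (lerD k1 k2)); rewrite le_eqVlt; apply/orP; left; apply/eqP; ring.
Qed.

Lemma lip_sub (a a' b b' c V W n : R) : `|a - a'| <= c * V * n -> `|b - b'| <= c * W * n ->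
  `|(a - b) - (a' - b')| <= c * (V + W) * n.
Proof.
move=> h1 h2; have -> : a - b - (a' - b') = (a - a') - (b - b') by ring.
by apply: (le_trans (ler_normB _ _)); lra.
Qed.

Lemma decomp_combine (r p0 p1 a0 a1 b0 b1 : R) :
  r * (p1 * (a0 + b0) - p0 * (a1 + b1)) =
  r * (p1 * a0 - p0 * a1) + (r * (p1 * b0) - r * (p0 * b1)).
Proof. ring. Qed.

Lemma static_combine (e c V W L k N A1 A2 A3 A4 : R) :
  `|A1 - A2| <= 2 * e * (c * V) * W -> `|A4| <= 6 * L * k * N -> `|A3| <= 6 * L * k * N ->
  `|- (A1 + (A3 - A4)) + A2| <= 12 * L * k * N + e * (2 * c * V * W).
Proof.
move=> h1 h2 h3; have -> : - (A1 + (A3 - A4)) + A2 = A4 - (A1 - A2) - A3 by ring.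
apply: (le_trans (ler_normB _ _)); have := ler_normB A4 (A1 - A2); lra.
Qed.

Lemma cross_zero (c r a0 a1 b0 b1 g0 g1 : R) :
  c * (0 * a0 - 0 * a1) = r * (0 * b0 - 0 * b1) + (r * (0 * g0) - r * (0 * g1)).
Proof. ring. Qed.

(** All scales e <= d are compared with one reference quantity, the pairing of w with [cross Phi] of
    the mollification at scale d. As C is chosen before the field and e, one can let e tend to 0 for
    a fixed field and still be uniform along the sequence. *)
Lemma static_estimate (d B L M : R) : 0 < d -> 0 <= B -> 0 <= L ->
  exists2 C : R, 0 <= C & forall (U : set (plane R)) Phi v w (e : R),
  (forall i, nice M (Phi i)) -> (forall x, divergence Phi x = 0) ->
  (forall i x, `|Phi i x| <= B) -> (forall i j x, `|pderiv j (Phi i) x| <= L) ->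
  (forall i, L1 leb2 (v i)) -> L1 leb2 w -> weak_div0 U v -> weak_rot U v w ->
  (forall i x, Phi i x != 0 -> cbox x d `<=` U) -> 0 < e -> e <= d ->
  `|quad Phi (moll e v) + \int[leb2]_x (w x * cross Phi (moll d v) x)| <=
  12 * L * kconst R * near_mass d w +
  e * (C * (\int[leb2]_x `|v 0 x| + \int[leb2]_x `|v 1 x|) * \int[leb2]_x `|w x|).
Proof.
move=> d0 B0 L0; have nd := nice_rho d0.
have [Cd Cd0 HCd] := nice_bounded nd; have [Cd' Cd'0 HCd'] := nice_bounded_pderiv nd.
(* Product rule: B * Cd' + L * Cd, times the L^1 norm of v, is a Lipschitz constant of [cross]; the
   2 is that of [moll_lipschitz]. *)
exists (2 * (B * Cd' + L * Cd)); first by rewrite mulr_ge0// addr_ge0// mulr_ge0.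
move=> U Phi v w e nP dP PB PL vi wi vd vr PU e0 ed.
have PUe i x : Phi i x != 0 -> cbox x e `<=` U.
  by move=> /PU; apply: subset_trans; exact: cbox_sub.
have nr := nice_rho e0; have [Cr Cr0 HCr] := nice_bounded nr.
have ne i := nice_Gker i e0 ed.
have cP i := nice_continuous (nP i).
have LP i x y : `|Phi i x - Phi i y| <= L * n1 (x - y).
  exact: (C1_lipschitz (nice_C1 (nP i)) (PL i)).
have Lv i x y : `|moll d v i x - moll d v i y| <= Cd' * n1 (x - y) * \int[leb2]_z `|v i z|.
  exact: (conv_lipschitz x y nd HCd' (vi i)).
have Bv i x : `|moll d v i x| <= Cd * \int[leb2]_z `|v i z|.
  exact: (conv_bound x (nice_continuous nd) HCd (vi i)).
have V0 i : 0 <= \int[leb2]_z `|v i z| by apply: Int_ge0.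
have cv i : continuous (moll d v i) by exact: (conv_continuous nd (vi i)).
have cPv i j : continuous (fun x => Phi i x * moll d v j x).
  by move=> x; apply: cvgM; [exact: cP|exact: cv].
set g := cross Phi (moll d v).
have gi : L1 leb2 g.
  by apply: (L1B (mu := leb2)); apply: (box_supp_L1 (M := M)) => //; apply: box_suppM;
    exact: (nP _).2.
have prodL i j x y : `|Phi i x * moll d v j x - Phi i y * moll d v j y| <=
    (B * Cd' + L * Cd) * \int[leb2]_z `|v j z| * n1 (x - y).
  exact: (lip_prod (PB i x) (Lv j x y) (LP i x y) (Bv j y)).
have gL x y : `|g x - g y| <=
   (B * Cd' + L * Cd) * (\int[leb2]_x `|v 0 x| + \int[leb2]_x `|v 1 x|) * n1 (x - y).
  exact: (lip_sub (prodL 1 0 x y) (prodL 0 1 x y)).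
have Lg0 : 0 <= (B * Cd' + L * Cd) * (\int[leb2]_x `|v 0 x| + \int[leb2]_x `|v 1 x|).
  by apply: mulr_ge0; apply: addr_ge0 => //; apply: mulr_ge0.
have mm := moll_lipschitz e0 wi gi Lg0 gL.
have PGi i j : L1 leb2 (fun x => Phi i x * conv (Gker e d j) w x).
  apply: (box_supp_L1 (M := M)); last by apply: box_suppM; exact: (nP _).2.
  by move=> x; apply: cvgM; [exact: cP|exact: (conv_continuous (ne j) wi)].
have PI i : L1 leb2 (Phi i) by exact: (box_supp_L1 (cP i) (nP i).2).
have sy i j := delort_symmetrization j e0 ed L0 wi (PI i) (cP i) (LP i).
have mw : measurable_fun setT (conv (rho e) w).
  by apply: measurable_continuous_plane; exact: (conv_continuous nr wi).
have bw x : `|conv (rho e) w x| <= Cr * \int[leb2]_y `|w y|.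
  exact: (conv_bound x (nice_continuous nr) HCr wi).
have wgi h : L1 leb2 h -> L1 leb2 (fun x => conv (rho e) w x * h x).
  exact: (L1_bmul (mu := leb2) mw bw).
have Q : quad Phi (moll e v) = - (\int[leb2]_x (conv (rho e) w x * g x) +
   (\int[leb2]_x (conv (rho e) w x * (Phi 1 x * conv (Gker e d 0) w x)) -
    \int[leb2]_x (conv (rho e) w x * (Phi 0 x * conv (Gker e d 1) w x)))).
  rewrite (quad_moll nP dP vi vd e0 PUe); congr (- _).
  have j1 := wgi _ (PGi 1 0); have j2 := wgi _ (PGi 0 1).
  rewrite -(IntB (mu := leb2) j1 j2) -(IntD (mu := leb2) (wgi _ gi) (L1B (mu := leb2) j1 j2)).
  apply: Int_ext => x.
  (* The decomposition of the velocity is available only where [Phi] is non-zero; elsewhere both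
     sides vanish. *)
  have [h|h] := boolP ((Phi 0 x != 0) || (Phi 1 x != 0)); last first.
    move: h; rewrite negb_or !negbK => /andP[/eqP p0 /eqP p1].
    by rewrite /g /cross p0 p1; exact: cross_zero.
  have xd : cbox x d `<=` U by case/orP: h => /PU.
  have xe : cbox x e `<=` U by case/orP: h => /PUe.
  rewrite (curlf_moll vi vr e0 xe) /cross.
  rewrite /g /cross /moll !(conv_decomp vi _ vd vr e0 ed xd).
  exact: decomp_combine.
have := sy 1 0; have := sy 0 1; move: mm; rewrite Q.
move: (\int[leb2]_x (conv (rho e) w x * g x)) (\int[leb2]_x (w x * g x)) => A1 A2.
move: (\int[leb2]_x (conv (rho e) w x * (Phi 1 x * conv (Gker e d 0) w x))) => A3.
move: (\int[leb2]_x (conv (rho e) w x * (Phi 0 x * conv (Gker e d 1) w x))) => A4.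
move: (near_mass d w) (kconst R) (\int[leb2]_x `|w x|) => N k W.
move: (\int[leb2]_x `|v 0 x| + \int[leb2]_x `|v 1 x|) => V.
exact: static_combine.
Qed.

End static_estimate.

(** * Mollification of square-integrable functions *)

Section L2_mollification.
Context (R : realType) (M : R).
Implicit Types (f g h : plane R -> R) (x y z : plane R) (e : R).

Definition L2 f := L1 leb2 f /\ L1 leb2 (fun x => f x ^+ 2).

Lemma L2_measurable f : L2 f -> measurable_fun setT f.
Proof. by case=> fi _; have := L1_measurable (mu := leb2) fi. Qed.

Lemma sqrD_le (a b : R) : (a + b) ^+ 2 <= 2 * a ^+ 2 + 2 * b ^+ 2.
Proof. by have := sqr_ge0 (a - b); rewrite !expr2; lra. Qed.

Lemma L2D f g : L2 f -> L2 g -> L2 (fun x => f x + g x).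
Proof.
move=> Hf Hg; have mf := L2_measurable Hf; have mg := L2_measurable Hg.
split; first exact: (L1D (mu := leb2) Hf.1 Hg.1).
apply: (L1_le (mu := leb2) (g := fun x => 2 * f x ^+ 2 + 2 * g x ^+ 2)).
- by apply: measurable_funX; exact: measurable_funD.
- by apply: (L1D (mu := leb2)); apply: (L1Zl (mu := leb2)); [exact: Hf.2|exact: Hg.2].
- by move=> x; rewrite ger0_norm ?sqr_ge0// sqrD_le.
Qed.

Lemma L2Z (c : R) f : L2 f -> L2 (fun x => c * f x).
Proof.
move=> Hf; split; first exact: (L1Zl (mu := leb2) _ Hf.1).
by under [X in L1 _ X]eq_fun do rewrite exprMn; exact: (L1Zl (mu := leb2) _ Hf.2).
Qed.

Lemma L2B f g : L2 f -> L2 g -> L2 (fun x => f x - g x).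
Proof.
move=> Hf /(L2Z (-1)) Hg; have := L2D Hf Hg.
by rewrite (_ : (fun x => f x + -1 * g x) = (fun x => f x - g x))//; apply/funext => x; rewrite mulN1r.
Qed.

Lemma convD K f g x N : nice N K -> L1 leb2 f -> L1 leb2 g ->
  conv K (fun y => f y + g y) x = conv K f x + conv K g x.
Proof.
move=> nK fi gi; have i1 := L1_conv_nice x nK fi; have i2 := L1_conv_nice x nK gi.
rewrite /conv -(IntD (mu := leb2) i1 i2); apply: Int_ext => y; exact: mulrDr.
Qed.

Lemma convZ K f x N (c : R) : nice N K -> L1 leb2 f ->
  conv K (fun y => c * f y) x = c * conv K f x.
Proof.
move=> nK fi; have i1 := L1_conv_nice x nK fi.
rewrite /conv -(IntZl (mu := leb2) _ i1); apply: Int_ext => y; exact: mulrCA.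
Qed.

Lemma Int_rho_reflect e x : 0 < e ->
  L1 leb2 (fun y : plane R => rho e (x - y)) /\ \int[leb2]_y rho e (x - y) = 1.
Proof.
by move=> e0; have [h1 h2] := L1_reflect x (L1_rho e0); rewrite h2 Int_rho.
Qed.

Lemma variance_ge0 (a c : R) : 0 <= a + (c ^+ 2 * 1 - 2 * c * c) -> c ^+ 2 <= a.
Proof. rewrite expr2; lra. Qed.

(* Jensen's inequality, from the positivity of the variance. *)
Lemma conv_sqr_le e f x : 0 < e -> L2 f ->
  conv (rho e) f x ^+ 2 <= conv (rho e) (fun y => f y ^+ 2) x.
Proof.
move=> e0 [fi f2i]; have nr := nice_rho e0; have [r1 r2] := Int_rho_reflect x e0.
set c := conv (rho e) f x.
have i1 := L1_conv_nice x nr fi; have i2 := L1_conv_nice x nr f2i.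
have : 0 <= \int[leb2]_y (rho e (x - y) * (f y - c) ^+ 2).
  by apply: (Int_ge0) => y; rewrite mulr_ge0 ?rho_ge0 ?sqr_ge0.
have -> : \int[leb2]_y (rho e (x - y) * (f y - c) ^+ 2) =
  \int[leb2]_y (rho e (x - y) * f y ^+ 2 + (c ^+ 2 * rho e (x - y) - (2 * c) * (rho e (x - y) * f y))).
  by apply: Int_ext => y; ring.
have j1 := L1Zl (mu := leb2) (c ^+ 2) r1; have j2 := L1Zl (mu := leb2) (2 * c) i1.
rewrite (IntD (mu := leb2) i2 (L1B (mu := leb2) j1 j2)) (IntB (mu := leb2) j1 j2).
rewrite (IntZl (mu := leb2) _ r1) (IntZl (mu := leb2) _ i1) r2.
exact: variance_ge0.
Qed.

(** [rho e] is transposed onto g, and the mollification of g still takes its values in [0, 1]. *)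
Lemma Int_conv_le e f g : 0 < e -> L1 leb2 f -> (forall x, 0 <= f x) -> L1 leb2 g ->
  (forall x, 0 <= g x <= 1) -> \int[leb2]_x (g x * conv (rho e) f x) <= \int[leb2]_x f x.
Proof.
move=> e0 fi f0 gi g01; have nr := nice_rho e0; rewrite (conv_fubini nr fi gi).
have E y : \int[leb2]_x (rho e (x - y) * g x) = conv (rho e) g y.
  by apply: Int_ext => x; rewrite -(rho_even e (x - y)) opprB.
have c01 y : 0 <= conv (rho e) g y <= 1.
  have [r1 r2] := Int_rho_reflect y e0; have i1 := L1_conv_nice y nr gi.
  apply/andP; split.
    by apply: (Int_ge0) => x; rewrite mulr_ge0 ?rho_ge0//; case/andP: (g01 x).
  rewrite -r2; apply: (Int_le (mu := leb2) i1 r1) => x.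
  by rewrite ler_piMr ?rho_ge0//; case/andP: (g01 x).
under Int_ext do rewrite E.
have mc : measurable_fun setT (conv (rho e) g).
  by apply: measurable_continuous_plane; exact: conv_continuous nr gi.
apply: (Int_le (mu := leb2)) => //.
  under [X in L1 _ X]eq_fun do rewrite mulrC.
  apply: (L1_bmul (mu := leb2) (c := 1) mc _ fi) => y.
  by case/andP: (c01 y) => h1 h2; rewrite ger0_norm.
by move=> y; case/andP: (c01 y) => h1 h2; rewrite ler_piMr.
Qed.

Definition obox : set (plane R) := [set x | `|x.1| < M /\ `|x.2| < M].
Local Notation Q := obox.

Lemma box_open : open Q.
Proof.
have -> : Q = (fun x : plane R => `|x.1|) @^-1` `]-oo, M[%classic `&`
              (fun x : plane R => `|x.2|) @^-1` `]-oo, M[%classic.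
  by apply/seteqP; split => x /=; rewrite /obox /= !in_itv.
apply: openI; apply: open_comp => //= x _.
- by apply: continuous_comp; [exact: cvg_fst|exact: norm_continuous].
- by apply: continuous_comp; [exact: cvg_snd|exact: norm_continuous].
Qed.

Lemma box_measurable : measurable Q.
Proof. exact: open_measurable_plane box_open. Qed.

Lemma box_finite (A : set (plane R)) : measurable A -> A `<=` Q -> (leb2 A < +oo :> \bar R)%E.
Proof.
move=> mA AQ; apply: leb2_bounded => //; exists M; split; first exact: num_real.
move=> x Mx y /AQ [h1 h2] /=; rewrite prod_normE ge_max.
by apply/andP; split; apply: ltW; [exact: lt_trans h1 Mx|exact: lt_trans h2 Mx].
Qed.

Lemma L2_indic (A : set (plane R)) : measurable A -> A `<=` Q -> L2 \1_A.
Proof.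
move=> mA AQ; have i1 := L1_indic (mu := leb2) mA (box_finite mA AQ); split; first exact: i1.
apply: etrans i1; congr (integrable _ _ _); apply/funext => x /=; congr EFin.
by rewrite indicE; case: (_ \in _); rewrite ?expr1n ?expr0n.
Qed.

Let L1Q := L1_indic (mu := leb2) box_measurable (box_finite box_measurable (@subset_refl _ _)).

Let Q01 x : 0 <= (\1_Q x : R) <= 1.
Proof. by rewrite indicE; case: (_ \in _); rewrite /= ?lexx ?ler01. Qed.

Definition moll_err e f := \int[leb2]_x (\1_Q x * (conv (rho e) f x - f x) ^+ 2).

Lemma L1_moll_sqr e f : 0 < e -> L2 f -> L1 leb2 (fun x : plane R => \1_Q x * conv (rho e) f x ^+ 2).
Proof.
move=> e0 [fi f2i]; have nr := nice_rho e0; have [C C0 HC] := nice_bounded nr.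
under [X in L1 _ X]eq_fun do rewrite mulrC.
apply: (L1_bmul (mu := leb2) (c := (C * \int[leb2]_y `|f y|) ^+ 2)) => //.
  by apply: measurable_funX; apply: measurable_continuous_plane; exact: conv_continuous nr fi.
move=> x; rewrite normrX lerXn2r ?nnegrE ?mulr_ge0//; first exact: Int_ge0.
exact: (conv_bound x (nice_continuous nr) HC fi).
Qed.

Lemma moll_sqr_le e f : 0 < e -> L2 f ->
  \int[leb2]_x (\1_Q x * conv (rho e) f x ^+ 2) <= \int[leb2]_x f x ^+ 2.
Proof.
move=> e0 Hf; have [fi f2i] := Hf; have nr := nice_rho e0.
have s0 x : 0 <= f x ^+ 2 by exact: sqr_ge0.
apply: le_trans (Int_conv_le e0 f2i s0 L1Q Q01).
apply: (Int_le (mu := leb2)); first exact: L1_moll_sqr.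
  have [C C0 HC] := nice_bounded nr.
  under [X in L1 _ X]eq_fun do rewrite mulrC.
  apply: (L1_bmul (mu := leb2) (c := C * \int[leb2]_y `|f y ^+ 2|)) => //.
    by apply: measurable_continuous_plane; exact: conv_continuous nr f2i.
  by move=> x; exact: (conv_bound x (nice_continuous nr) HC f2i).
by move=> x; rewrite ler_wpM2l ?conv_sqr_le.
Qed.

Lemma L1_moll_err e f : 0 < e -> L2 f ->
  L1 leb2 (fun x : plane R => \1_Q x * (conv (rho e) f x - f x) ^+ 2).
Proof.
move=> e0 Hf; have nr := nice_rho e0; have mf := L2_measurable Hf.
apply: (L1_le (mu := leb2) (g := fun x => 2 * (\1_Q x * conv (rho e) f x ^+ 2) + 2 * f x ^+ 2)).
- apply: measurable_funM; first exact: measurable_indic box_measurable.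
  apply: measurable_funX; apply: measurable_funB => //.
  by apply: measurable_continuous_plane; exact: conv_continuous nr Hf.1.
- by apply: (L1D (mu := leb2)); apply: (L1Zl (mu := leb2)); [exact: L1_moll_sqr|exact: Hf.2].
- move=> x; rewrite indicE; case: (_ \in _); rewrite /= ?(mul1r, mul0r, mulr0, add0r, normr0).
    have := sqrD_le (conv (rho e) f x) (- f x); rewrite sqrrN => h.
    by rewrite ger0_norm ?sqr_ge0.
  by rewrite mulr_ge0// sqr_ge0.
Qed.

Lemma moll_err_ge0 e f : 0 <= moll_err e f.
Proof.
by apply: (Int_ge0) => x; rewrite mulr_ge0 ?sqr_ge0//; case/andP: (Q01 x).
Qed.

Lemma moll_errD e f g : 0 < e -> L2 f -> L2 g ->
  moll_err e (fun x => f x + g x) <= 2 * moll_err e f + 2 * moll_err e g.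
Proof.
move=> e0 Hf Hg; have i1 := L1_moll_err e0 Hf; have i2 := L1_moll_err e0 Hg.
have j1 := L1Zl (mu := leb2) 2 i1; have j2 := L1Zl (mu := leb2) 2 i2.
rewrite /moll_err -(IntZl (mu := leb2) _ i1) -(IntZl (mu := leb2) _ i2) -(IntD (mu := leb2) j1 j2).
apply: (Int_le (mu := leb2)); [exact: (L1_moll_err e0 (L2D Hf Hg))|exact: (L1D (mu := leb2))|].
move=> x; rewrite (convD x (nice_rho e0) Hf.1 Hg.1).
have := sqrD_le (conv (rho e) f x - f x) (conv (rho e) g x - g x).
rewrite -addrACA -opprD; have /andP[q0 _] := Q01 x.
by move=> /(ler_wpM2l q0); rewrite mulrDr ![\1_Q x * (2 * _)]mulrCA.
Qed.

Lemma moll_errZ e f (c : R) : 0 < e -> L2 f -> moll_err e (fun x => c * f x) = c ^+ 2 * moll_err e f.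
Proof.
move=> e0 Hf; rewrite /moll_err -(IntZl (mu := leb2) _ (L1_moll_err e0 Hf)).
by apply: Int_ext => x; rewrite (convZ x _ (nice_rho e0) Hf.1) -mulrBr exprMn mulrCA.
Qed.

Lemma moll_err_le e f : 0 < e -> L2 f -> moll_err e f <= 4 * \int[leb2]_x f x ^+ 2.
Proof.
move=> e0 Hf; have i1 := L1Zl (mu := leb2) 2 (L1_moll_sqr e0 Hf).
have i2 := L1Zl (mu := leb2) 2 Hf.2.
apply: (@le_trans _ _ (\int[leb2]_x (2 * (\1_Q x * conv (rho e) f x ^+ 2) + 2 * f x ^+ 2))).
  apply: (Int_le (mu := leb2)); [exact: L1_moll_err|exact: (L1D (mu := leb2))|].
  move=> x; rewrite indicE; case: (_ \in _); rewrite /= ?(mul1r, mul0r, mulr0, add0r).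
    by have := sqrD_le (conv (rho e) f x) (- f x); rewrite sqrrN.
  by rewrite mulr_ge0// sqr_ge0.
rewrite (IntD (mu := leb2) i1 i2) (IntZl (mu := leb2) _ (L1_moll_sqr e0 Hf)).
rewrite (IntZl (mu := leb2) _ Hf.2); have := moll_sqr_le e0 Hf; lra.
Qed.

Let e_ (k : nat) : R := k.+1%:R^-1.
Let e_gt0 k : 0 < e_ k. Proof. by rewrite invr_gt0 ltr0n. Qed.
Let e_cvg : e_ k @[k --> \oo] --> 0. Proof. exact: cvg_harmonic. Qed.

(** The class of functions whose mollifications converge in L^2 of the square [obox]. Being closed
    under sums, multiples and L^2 limits, it grows from indicators of open sets to those of
    measurable sets, to simple functions and finally to L^2. *)
Definition moll_good f := moll_err (e_ k) f @[k --> \oo] --> 0.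

Lemma moll_goodP f : (forall d : R, 0 < d -> \forall k \near \oo, moll_err (e_ k) f <= d) ->
  moll_good f.
Proof.
move=> H; apply/cvgrPdist_le => d d0; near=> k.
by rewrite sub0r normrN ger0_norm ?moll_err_ge0//; near: k; exact: H.
Unshelve. all: by end_near. Qed.

Lemma moll_good_near f : moll_good f ->
  forall d : R, 0 < d -> \forall k \near \oo, moll_err (e_ k) f <= d.
Proof.
move=> /cvgrPdist_le H d /H; apply: filterS => k.
by rewrite sub0r normrN ger0_norm ?moll_err_ge0.
Qed.

Lemma moll_good_approx f : L2 f ->
  (forall d : R, 0 < d -> exists h, [/\ L2 h, moll_good h & \int[leb2]_x (f x - h x) ^+ 2 <= d]) ->
  moll_good f.
Proof.
move=> Hf H; apply: moll_goodP => d d0.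
(* The total is 2 * (d / 4) + 2 * 4 * (d / 16) = d, the 4 being that of [moll_err_le]. *)
have [h [Hh gh fh]] := H (d / 16) ltac:(by rewrite divr_gt0).
have := moll_good_near gh (d := d / 4) ltac:(by rewrite divr_gt0); apply: filterS => k hk.
have -> : f = (fun x => h x + (f x - h x)) by apply/funext => x; ring.
have h1 := moll_errD (e_gt0 k) Hh (L2B Hf Hh).
have h2 := moll_err_le (e_gt0 k) (L2B Hf Hh); lra.
Qed.

Lemma moll_goodD f g : L2 f -> L2 g -> moll_good f -> moll_good g ->
  moll_good (fun x => f x + g x).
Proof.
move=> Hf Hg gf gg; apply: moll_goodP => d d0.
have := moll_good_near gf (d := d / 4) ltac:(by rewrite divr_gt0).
have := moll_good_near gg (d := d / 4) ltac:(by rewrite divr_gt0).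
apply: filterS2 => k h1 h2; have h3 := moll_errD (e_gt0 k) Hf Hg; lra.
Qed.

Lemma moll_goodZ f (c : R) : L2 f -> moll_good f -> moll_good (fun x => c * f x).
Proof.
move=> Hf gf; rewrite /moll_good.
have -> : (fun k => moll_err (e_ k) (fun x => c * f x)) = (fun k => c ^+ 2 * moll_err (e_ k) f).
  by apply/funext => k; rewrite moll_errZ.
by rewrite -[X in _ --> X](mulr0 (c ^+ 2)); apply: cvgMr.
Qed.

End L2_mollification.

Lemma Int_cvg d (T : measurableType d) (R : realType)
  (mu : {measure set T -> \bar R}) (F : nat -> T -> R) (f g : T -> R) :
  (forall n, measurable_fun setT (F n)) -> L1 mu g ->
  (forall x, F ^~ x @ \oo --> f x) -> (forall x n, `|F n x| <= g x) ->
  \int[mu]_x F n x @[n --> \oo] --> \int[mu]_x f x.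
Proof. by move=> mF gi Ff Fg; have [] := Int_DCT' mF gi Ff Fg. Qed.

Section indicator_values.
Context (R : realType) (T : Type) (A : set T) (x : T).

Lemma indic_in : A x -> \1_A x = 1 :> R.
Proof. by move=> Ax; rewrite indicE mem_set. Qed.

Lemma indic_out : ~ A x -> \1_A x = 0 :> R.
Proof. by move=> Ax; rewrite indicE memNset. Qed.

End indicator_values.

Section L2_mollification_density.
Import HBSimple HBNNSimple.
Context (R : realType) (M : R).
Implicit Types (f g h : plane R -> R) (x y z : plane R) (e : R).
Local Notation Q := (obox M).

Let e_ (k : nat) : R := k.+1%:R^-1.
Let e_gt0 k : 0 < e_ k. Proof. by rewrite invr_gt0 ltr0n. Qed.
Let e_cvg : e_ k @[k --> \oo] --> 0. Proof. exact: cvg_harmonic. Qed.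

Lemma open_cbox (V : set (plane R)) x : open V -> V x -> exists2 r : R, 0 < r & cbox x r `<=` V.
Proof.
move=> oV Vx; have /nbhs_ballP[r r0 rV] := open_nbhs_nbhs (conj oV Vx).
exists (r / 2); first by rewrite divr_gt0.
move=> y [h1 h2]; apply: rV; rewrite plane_ballE; split; rewrite /= /ball /=.
- by apply: (le_lt_trans h1); rewrite ltr_pdivrMr// ltr_pMr// ltr1n.
- by apply: (le_lt_trans h2); rewrite ltr_pdivrMr// ltr_pMr// ltr1n.
Qed.

Lemma rho_cbox e x y : 0 < e -> ~ cbox x e y -> rho e (x - y) = 0.
Proof.
move=> e0 H; apply: (rho_box e0) => /=.
have [h|h] := leP e `|x.1 - y.1|; first by left.
have [h'|h'] := leP e `|x.2 - y.2|; first by right.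
by exfalso; apply: H; split; exact: ltW.
Qed.

Lemma conv_rho_local f g e x : 0 < e -> (forall y, cbox x e y -> f y = g y) ->
  conv (rho e) f x = conv (rho e) g x.
Proof.
move=> e0 H; apply: Int_ext => y.
by have [/H ->//|h] := pselect (cbox x e y); rewrite rho_cbox// !mul0r.
Qed.

Lemma conv_rho_cst (c : R) e x : 0 < e -> conv (rho e) (fun=> c) x = c.
Proof.
move=> e0; have [r1 r2] := Int_rho_reflect x e0.
by rewrite /conv (IntZr (mu := leb2) _ r1) r2 mul1r.
Qed.

(** At each point of V the mollified indicator is eventually exactly 1. What it leaks outside V is
    controlled because mollification does not increase the L^2 norm. *)
Lemma moll_good_open (V : set (plane R)) : open V -> V `<=` Q -> moll_good M \1_V.
Proof.
move=> oV VQ; have mV := open_measurable_plane oV.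
have HV := L2_indic mV VQ; have Vi := HV.1.
have V2 x : \1_V x ^+ 2 = \1_V x :> R.
  by rewrite indicE; case: (_ \in _); rewrite ?expr1n ?expr0n.
have Voo : L1 leb2 (fun x : plane R => (\1_V x : R)) by exact: Vi.
have i1 k : L1 leb2 (fun x : plane R => \1_V x * conv (rho (e_ k)) \1_V x).
  have nr := nice_rho (e_gt0 k); have [C C0 HC] := nice_bounded nr.
  under [X in L1 _ X]eq_fun do rewrite mulrC.
  apply: (L1_bmul (mu := leb2) (c := C * \int[leb2]_y `|\1_V y|)) => //.
    by apply: measurable_continuous_plane; exact: conv_continuous nr Vi.
  by move=> x; exact: (conv_bound x (nice_continuous nr) HC Vi).
have c1 k x : conv (rho (e_ k)) \1_V x <= 1 :> R.
  rewrite -(conv_rho_cst 1 x (e_gt0 k)).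
  have [r1 r2] := Int_rho_reflect x (e_gt0 k).
  apply: (Int_le (mu := leb2)); [exact: (L1_conv_nice x (nice_rho (e_gt0 k)) Vi)|by apply: (L1Zr (mu := leb2))|].
  move=> y; rewrite ler_wpM2l ?rho_ge0// indicE; by case: (_ \in _); rewrite ?lexx ?ler01.
have c0 k x : 0 <= conv (rho (e_ k)) \1_V x :> R.
  by apply: Int_ge0 => y; rewrite mulr_ge0 ?rho_ge0// indicE; case: (_ \in _).
(* the squared error is at most 2 (|V| - int_V (1_V)_e) *)
have bd k : moll_err M (e_ k) \1_V <=
    2 * (\int[leb2]_x \1_V x - \int[leb2]_x (\1_V x * conv (rho (e_ k)) \1_V x)).
  have ek := e_gt0 k.
  have E1 := moll_sqr_le M ek HV; have E0 := L1_moll_sqr M ek HV.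
  have -> : 2 * (\int[leb2]_x \1_V x - \int[leb2]_x (\1_V x * conv (rho (e_ k)) \1_V x)) =
    \int[leb2]_x (\1_V x ^+ 2) + (\int[leb2]_x \1_V x -
     \int[leb2]_x (2 * (\1_V x * conv (rho (e_ k)) \1_V x))) :> R.
    have -> : \int[leb2]_x (\1_V x ^+ 2) = \int[leb2]_x \1_V x :> R by exact: Int_ext.
    rewrite (IntZl (mu := leb2) _ (i1 k)); ring.
  apply: (le_trans _ (lerD E1 (lexx _))).
  have j := L1Zl (mu := leb2) 2 (i1 k).
  rewrite -(IntB (mu := leb2) Vi j) -(IntD (mu := leb2) E0 (L1B (mu := leb2) Vi j)).
  apply: (Int_le (mu := leb2)); [exact: L1_moll_err|exact: (L1D (mu := leb2) E0 (L1B (mu := leb2) Vi j))|].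
  move=> x; rewrite -{2}(V2 x); have [Vx|Vx] := pselect (V x).
    have -> : \1_V x = 1 :> R by rewrite indicE mem_set.
    have -> : \1_Q x = 1 :> R by rewrite indicE mem_set//; exact: VQ.
    by rewrite le_eqVlt; apply/orP; left; apply/eqP; ring.
  have -> : \1_V x = 0 :> R by rewrite indicE memNset.
  by rewrite subr0 !(mul0r, expr0n, mulr0, subr0, addr0).
have cv : \int[leb2]_x (\1_V x * conv (rho (e_ k)) \1_V x) @[k --> \oo] -->
    (\int[leb2]_x \1_V x : R).
  apply: (Int_cvg (mu := leb2) (F := fun k (x : plane R) => \1_V x * conv (rho (e_ k)) \1_V x) (g := \1_V)) => //.
  - by move=> k; have := L1_measurable (mu := leb2) (i1 k).
  - move=> x; have [Vx|Vx] := pselect (V x); last first.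
      have -> : \1_V x = 0 :> R by rewrite indicE memNset.
      by under eq_fun do rewrite mul0r; exact: cvg_cst.
    have -> : \1_V x = 1 :> R by rewrite indicE mem_set.
    have [r r0 rV] := open_cbox oV Vx.
    apply: cvg_near_cst.
    have /cvgrPdist_lt/(_ r r0) := e_cvg; apply: filterS => k.
    rewrite sub0r normrN (ger0_norm (ltW (e_gt0 k))) => kr.
    rewrite mul1r -[RHS](conv_rho_cst 1 x (e_gt0 k)).
    apply: (conv_rho_local (e_gt0 k)) => y xy; rewrite indicE mem_set//.
    by apply: rV; apply: cbox_sub xy; exact: ltW.
  - move=> x k; rewrite normrM (ger0_norm (c0 k x)) indicE.
    by case: (_ \in _); rewrite ?normr1 ?mul1r// normr0 mul0r.
apply: moll_goodP => d d0.
have /cvgrPdist_le/(_ (d / 2) ltac:(by rewrite divr_gt0)) := cv.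
apply: filterS => k /(le_trans (ler_norm _)) h; have := bd k; lra.
Qed.

(** Coordinates are continuous, so cylinders are Borel. The open sets thus become a generating
    family stable under intersection, on which a monotone class argument can start. *)
Lemma open_gen_measurable (A : set (plane R)) : measurable A -> <<s open >> A.
Proof.
rewrite measurable_prod_measurableType; apply: smallest_sub.
  exact: smallest_sigma_algebra.
have sG := smallest_sigma_algebra setT (@open (plane R)).
have cyl (p : plane R -> R) : continuous p -> forall B : set (measurableTypeR R), measurable B ->
    <<s open >> (p @^-1` B).
  move=> cp B; rewrite -[B]setTI -[_ @^-1` _]setTI setTI.
  rewrite RGenOpens.measurableE => mB.
  have := sigma_algebra_image p sG; rewrite /image_set_system /= => sI.
  apply: (smallest_sub sI _ mB) => _ [a [b ->]].
  by rewrite /= setTI; apply: sub_sigma_algebra; apply: open_comp => // x _; exact: cp.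
move=> _ [B1 mB1 [B2 mB2 <-]].
have -> : B1 `*` B2 = fst @^-1` B1 `&` snd @^-1` B2 by [].
have c1 : continuous (fst : plane R -> R) by move=> x; exact: cvg_fst.
have c2 : continuous (snd : plane R -> R) by move=> x; exact: cvg_snd.
exact: (@measurableI _ (g_sigma_algebraType (@open (plane R))) _ _ (cyl _ c1 _ mB1) (cyl _ c2 _ mB2)).
Qed.

Lemma moll_good_set (A : set (plane R)) : measurable A -> moll_good M \1_(A `&` Q).
Proof.
have mQ := box_measurable M; have oQ := @box_open R M.
move=> /open_gen_measurable; set H := [set A | measurable A /\ moll_good M \1_(A `&` Q)].
suff : <<s open >> `<=` H by move=> /[apply] -[].
apply: lambda_system_subset => //.
- by move=> X Y oX oY; exact: openI.
- split.
  + by [].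
  + by split; [exact: measurableT|rewrite setTI; exact: moll_good_open].
  + move=> X Y YX [mX gX] [mY gY]; split; first exact: measurableD.
    have HX := L2_indic (measurableI _ _ mX mQ) (@subIsetr _ X Q).
    have HY := L2_indic (measurableI _ _ mY mQ) (@subIsetr _ Y Q).
    have -> : \1_((X `\` Y) `&` Q) = (fun x => \1_(X `&` Q) x + (-1) * \1_(Y `&` Q) x) :> (plane R -> R).
      apply/funext => x; have [Qx|Qx] := pselect (Q x); last first.
        by rewrite !indic_out ?mulr0 ?addr0// => -[].
      have [Yx|Yx] := pselect (Y x).
        have Xx := YX _ Yx.
        rewrite indic_out; last by case=> -[].
        by rewrite (@indic_in R _ (X `&` Q) x (conj Xx Qx)) (@indic_in R _ (Y `&` Q) x (conj Yx Qx)); ring.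
      rewrite (@indic_out _ _ (Y `&` Q) x) ?mulr0 ?addr0; last by case.
      have [Xx|Xx] := pselect (X x).
        by rewrite (@indic_in R _ ((X `\` Y) `&` Q) x (conj (conj Xx Yx) Qx)) (@indic_in R _ (X `&` Q) x (conj Xx Qx)).
      by rewrite !indic_out// => -[]// -[].
    exact: (moll_goodD HX (L2Z (-1) HY) gX (moll_goodZ (-1) HY gY)).
  + move=> F ndF HF; have mF k := (HF k).1; have mU := bigcupT_measurable _ mF.
    split=> //; have HU := L2_indic (measurableI _ _ mU mQ) (@subIsetr _ (\bigcup_i F i) Q).
    have HFk k := L2_indic (measurableI _ _ (mF k) mQ) (@subIsetr _ (F k) Q).
    apply: (moll_good_approx HU) => d d0.
    have cv : \int[leb2]_x (\1_(\bigcup_i F i `&` Q) x - \1_(F k `&` Q) x) ^+ 2 @[k --> \oo] --> (0 : R).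
      rewrite -[X in _ --> X](Int_0 leb2).
      apply: (Int_cvg (mu := leb2) (F := fun k x => (\1_(\bigcup_i F i `&` Q) x - \1_(F k `&` Q) x) ^+ 2) (g := \1_Q)).
      * by move=> k; apply: measurable_funX; exact: L2_measurable (L2B HU (HFk k)).
      * exact: (L2_indic mQ (@subset_refl _ Q)).1.
      * move=> x; have [[[i _ Fx] Qx]|ux] := pselect ((\bigcup_i F i `&` Q) x).
          apply: cvg_near_cst; exists i => // k /= ik.
          have Fk : F k x by move: ik => /ndF /subsetPset; apply.
          have UFx : (\bigcup_i F i) x by exists i.
          by rewrite (@indic_in R _ (\bigcup_i F i `&` Q) x (conj UFx Qx)) (@indic_in R _ (F k `&` Q) x (conj Fk Qx)) subrr expr0n.
        apply: cvg_near_cst; apply: nearW => k.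
        rewrite !indic_out ?subrr ?expr0n// => -[Fx Qx]; apply: ux; split=> //.
        by exists k.
      * move=> x k; rewrite !indicE ger0_norm ?sqr_ge0//.
        have [Qx|Qx] := pselect (Q x); last first.
          by rewrite !memNset ?subrr ?expr0n// => -[].
        rewrite (mem_set (A := Q))//.
        by case: (_ \in _); case: (_ \in _) => /=; rewrite ?(subrr, subr0, sub0r, sqrrN, expr1n, expr0n)//= ?lexx ?ler01.
    have /cvgrPdist_le/(_ d d0) := cv => -[k _ /(_ k (leqnn k))]; rewrite /= sub0r normrN => hk.
    exists \1_(F k `&` Q); split; [exact: HFk|exact: (HF k).2|exact: le_trans (ler_norm _) hk].
- move=> X oX; split; first exact: open_measurable_plane.
  by apply: moll_good_open; [exact: openI|exact: subIsetr].
Qed.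

Lemma moll_good_sum (s : seq R) (A : R -> set (plane R)) : (forall r, measurable (A r)) ->
  L2 (fun x => \sum_(r <- s) r * \1_(A r `&` Q) x) /\
  moll_good M (fun x => \sum_(r <- s) r * \1_(A r `&` Q) x).
Proof.
move=> mA; have mQ := box_measurable M.
have HA r := L2_indic (measurableI _ _ (mA r) mQ) (@subIsetr _ (A r) Q).
elim: s => [|r s [IH1 IH2]].
  have -> : (fun x : plane R => \sum_(r <- [::]) r * \1_(A r `&` Q) x) = (fun x => 0 * \1_Q x).
    by apply/funext => x; rewrite big_nil mul0r.
  have HQ := L2_indic mQ (@subset_refl _ Q).
  split; first exact: L2Z.
  by apply: moll_goodZ => //; rewrite -[X in \1_X]setTI; exact: moll_good_set.
have -> : (fun x : plane R => \sum_(r <- r :: s) r * \1_(A r `&` Q) x) =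
   (fun x => r * \1_(A r `&` Q) x + \sum_(r <- s) r * \1_(A r `&` Q) x).
  by apply/funext => x; rewrite big_cons.
split; first by apply: L2D => //; exact: L2Z.
by apply: moll_goodD => //; [exact: L2Z|apply: moll_goodZ => //; exact: moll_good_set].
Qed.

Lemma moll_good_ge0 f : L2 f -> (forall x, 0 <= f x) -> (forall x, ~ Q x -> f x = 0) -> moll_good M f.
Proof.
move=> Hf f0 fQ; have mf := L2_measurable Hf.
have mEf : measurable_fun setT (EFin \o f) by exact/measurable_EFinP.
pose g := nnsfun_approx measurableT mEf.
have gc x : (g k x : R) @[k --> \oo] --> f x.
  have := @cvg_nnsfun_approx _ _ _ _ measurableT _ mEf (fun x _ => f0 x) x I.
  by move=> /fine_cvgP[_].
have gf k x : 0 <= g k x <= f x.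
  rewrite fun_ge0 /=; have := @le_approx _ _ R setT (EFin \o f) k x (fun x _ => f0 x) I.
  by rewrite /g nnsfun_approxE lee_fin.
have gE k : (g k : plane R -> R) = (fun x => \sum_(r <- finmap.enum_fset (fset_set (range (g k)))) r * \1_(g k @^-1` [set r] `&` Q) x).
  apply/funext => x; rewrite {1}(fimfunE (g k) x) fsbig_finite//=.
  have [Qx|Qx] := pselect (Q x).
    by apply: eq_bigr => r _; congr (_ * _); rewrite !indicE in_setI (mem_set Qx) andbT.
  have gx : g k x = 0 by have := gf k x; rewrite (fQ _ Qx) => h; apply/eqP; rewrite eq_le andbC.
  apply: eq_bigr => r _; rewrite [in RHS]indic_out ?mulr0; last by case.
  have [->|r0] := eqVneq r 0; first by rewrite mul0r.
  by rewrite indic_out ?mulr0//= gx => /esym/eqP; rewrite (negbTE r0).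
have mg k r : measurable (g k @^-1` [set r]) by exact: measurable_funPTI.
have Hg k : L2 (g k) /\ moll_good M (g k) by rewrite gE; exact: moll_good_sum.
apply: (moll_good_approx Hf) => d d0.
have cv : \int[leb2]_x (f x - g k x) ^+ 2 @[k --> \oo] --> (0 : R).
  rewrite -[X in _ --> X](Int_0 leb2).
  apply: (Int_cvg (mu := leb2) (F := fun k x => (f x - g k x) ^+ 2) (g := fun x => f x ^+ 2)).
  - by move=> k; apply: measurable_funX; exact: L2_measurable (L2B Hf (Hg k).1).
  - exact: Hf.2.
  - move=> x; have h : f x - g k x @[k --> \oo] --> (0 : R).
      by rewrite -(subrr (f x)); apply: cvgB; [exact: cvg_cst|exact: gc].
    by rewrite -(mulr0 (0 : R)); apply: cvgM.
  - move=> x k; have /andP[h1 h2] := gf k x.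
    by rewrite ger0_norm ?sqr_ge0// lerXn2r ?nnegrE ?subr_ge0// lerBlDr lerDl.
have /cvgrPdist_le/(_ d d0) := cv => -[k _ /(_ k (leqnn k))]; rewrite /= sub0r normrN => hk.
by exists (g k); split; [exact: (Hg k).1|exact: (Hg k).2|exact: le_trans (ler_norm _) hk].
Qed.

Lemma moll_good_L2 f : L2 f -> (forall x, ~ Q x -> f x = 0) -> moll_good M f.
Proof.
move=> Hf fQ; have mf := L2_measurable Hf.
pose p (b : R) x := Num.max (b * f x) 0.
have Hp b : b ^+ 2 = 1 -> L2 (p b).
  move=> b2; have mp : measurable_fun setT (p b) by apply: measurable_funrpos; exact: measurable_funM.
  have pf x : p b x ^+ 2 <= f x ^+ 2.
    rewrite /p /Num.max; case: ifP => _; first by rewrite expr0n sqr_ge0.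
    by rewrite exprMn b2 mul1r.
  have pf1 x : `|p b x| <= `|f x|.
    by rewrite -ler_sqr ?nnegrE// !real_normK ?num_real.
  split; first exact: (L1_le (mu := leb2) mp (L1_abs (mu := leb2) Hf.1)).
  apply: (L1_le (mu := leb2) _ Hf.2); first exact: measurable_funX.
  by move=> x; rewrite ger0_norm ?sqr_ge0.
have gp b : b ^+ 2 = 1 -> moll_good M (p b).
  move=> b2; apply: moll_good_ge0; [exact: Hp|by move=> x; rewrite le_max lexx orbT|].
  by move=> x /fQ; rewrite /p => ->; rewrite mulr0 maxxx.
have p1 : (1 : R) ^+ 2 = 1 by rewrite expr1n.
have n1' : (-1 : R) ^+ 2 = 1 by rewrite sqrrN expr1n.
have -> : f = (fun x => p 1 x + (-1) * p (-1) x).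
  apply/funext => x; rewrite /p mul1r !mulN1r.
  have [h|h] := leP 0 (f x); first by rewrite [in RHS](max_r (x := - f x)) ?oppr_le0// subr0.
  by rewrite (max_l (x := - f x)) ?oppr_ge0 ?(ltW h)// sub0r opprK.
exact: (moll_goodD (Hp _ p1) (L2Z (-1) (Hp _ n1')) (gp _ p1) (moll_goodZ (-1) (Hp _ n1') (gp _ n1'))).
Qed.

End L2_mollification_density.

(** * Convergence of the flux under mollification *)

Section quadratic_mollification.
Context (R : realType) (M : R).
Implicit Types (f g h Psi : plane R -> R) (x y z : plane R) (e : R) (Phi v : 'I_2 -> plane R -> R).
Local Notation Q := (obox M).

(** Used in place of the Cauchy-Schwarz inequality: it integrates term by term, and the weight is
    chosen afterwards. *)
Lemma young_le (a b D : R) : 0 < D -> 2 * `|a * b| <= D * a ^+ 2 + D^-1 * b ^+ 2.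
Proof.
move=> D0; have D1 : D != 0 by rewrite gt_eqF.
have : 0 <= D^-1 * (D * `|a| - `|b|) ^+ 2 by rewrite mulr_ge0 ?sqr_ge0// invr_ge0 ltW.
rewrite normrM -(real_normK (num_real a)) -(real_normK (num_real b)).
move: `|a| `|b| => s t; have -> : D^-1 * (D * s - t) ^+ 2 = D * s ^+ 2 + D^-1 * t ^+ 2 - 2 * (s * t).
  by field.
by rewrite subr_ge0.
Qed.

(** The weight separates two roles: 1/D multiplies fixed energies and is made small first; then 1 +
    D multiplies the errors, which tend to 0. *)
Lemma product_difference_le (a b f g D : R) : 0 < D ->
  `|a * b - f * g| <= (1 + D) * ((a - f) ^+ 2 + (b - g) ^+ 2) + D^-1 * (f ^+ 2 + g ^+ 2).
Proof.
move=> D0; have -> : a * b - f * g = (a - f) * (b - g) + (a - f) * g + (b - g) * f by ring.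
have h1 := young_le (a - f) (b - g) ltr01; rewrite invr1 !mul1r in h1.
have h2 := young_le (a - f) g D0; have h3 := young_le (b - g) f D0.
apply: (le_trans (ler_normD _ _)); have := ler_normD ((a - f) * (b - g)) ((a - f) * g).
have D1 : 0 < D^-1 by rewrite invr_gt0.
have s1 := mulr_ge0 (ltW D0) (sqr_ge0 (a - f)); have s2 := mulr_ge0 (ltW D0) (sqr_ge0 (b - g)).
have s3 := mulr_ge0 (ltW D1) (sqr_ge0 f); have s4 := mulr_ge0 (ltW D1) (sqr_ge0 g).
have s5 := sqr_ge0 (a - f); have s6 := sqr_ge0 (b - g).
move: h1 h2 h3 s1 s2 s3 s4 s5 s6; rewrite !mulrDr !mulrDl !mul1r.
move: ((a - f) ^+ 2) ((b - g) ^+ 2) (f ^+ 2) (g ^+ 2) => A B F G.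
move: `|(a - f) * (b - g)| `|(a - f) * g| `|(b - g) * f| => n1 n2 n3.
move: `|(a - f) * (b - g) + (a - f) * g| (D * A) (D * B) (D^-1 * F) (D^-1 * G) => n4 x1 x2 x3 x4.
lra.
Qed.

Lemma cvg_sum2 (u : nat -> 'I_2 -> 'I_2 -> R) (l : 'I_2 -> 'I_2 -> R) :
  (forall i j, u k i j @[k --> \oo] --> l i j) ->
  \sum_(i < 2) \sum_(j < 2) u k i j @[k --> \oo] --> \sum_(i < 2) \sum_(j < 2) l i j.
Proof.
move=> H; have -> : (fun k => \sum_(i < 2) \sum_(j < 2) u k i j) =
  (fun k => (u k 0 0 + u k 0 1) + (u k 1 0 + u k 1 1)).
  by apply/funext => k; rewrite !sum_ord2.
by rewrite !sum_ord2; do 2 apply: cvgD => //; apply: H.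
Qed.

Lemma triangle_pair (q q' S B e e' C : R) : `|q + S| <= B + e * C -> `|q' + S| <= B + e' * C ->
  `|q - q'| <= 2 * B + e * C + e' * C.
Proof.
move=> h1 h2; have -> : q - q' = (q + S) - (q' + S) by ring.
by apply: (le_trans (ler_normB _ _)); lra.
Qed.

Lemma sum4_le (a b c d L V W : R) : `|a| <= L * (V + V) -> `|b| <= L * (V + W) ->
  `|c| <= L * (W + V) -> `|d| <= L * (W + W) -> `|(a + b) + (c + d)| <= 4 * L * (V + W).
Proof.
move=> h1 h2 h3 h4; apply: (le_trans (ler_normD _ _)).
have := ler_normD a b; have := ler_normD c d; lra.
Qed.

(** D is so large that the energy term takes at most half of d, and d', given D, so small that the
    error term takes the other half; the added 1s guard against L = 0 and E = 0. *)
Lemma bilinear_choice (L E d a b : R) : 0 <= L -> 0 <= E -> 0 < d ->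
  let D := 2 * (L + 1) * (E + 1) / d in let d' := d / (4 * (L + 1) * (1 + D)) in
  b <= d' -> a <= d' -> L * ((1 + D) * (a + b) + D^-1 * E) <= d.
Proof.
move=> L0 E0 d0 D d' ha hb; have L1 : 0 < L + 1 by rewrite ltr_wpDl.
have E1 : 0 < E + 1 by rewrite ltr_wpDl.
have D0 : 0 < D by rewrite divr_gt0// !mulr_gt0.
have D1 : 0 < 1 + D by rewrite addr_gt0.
have e1 : (1 + D) * (a + b) <= d / (2 * (L + 1)).
  apply: (@le_trans _ _ ((1 + D) * (d' + d'))); first by rewrite ler_wpM2l ?(ltW D1)// lerD.
  by rewrite le_eqVlt; apply/orP; left; apply/eqP; rewrite /d'; field; rewrite !gt_eqF.
have e2 : D^-1 * E <= d / (2 * (L + 1)).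
  have -> : D^-1 * E = d / (2 * (L + 1)) * (E / (E + 1)).
    by rewrite /D; field; rewrite !gt_eqF.
  by rewrite ler_piMr ?divr_ge0 ?mulr_ge0 ?(ltW d0) ?(ltW L1)// ler_pdivrMr// mul1r lerDl ler01.
apply: (@le_trans _ _ (L * (d / (2 * (L + 1)) + d / (2 * (L + 1))))).
  by rewrite ler_wpM2l// lerD.
have -> : L * (d / (2 * (L + 1)) + d / (2 * (L + 1))) = d * (L / (L + 1)).
  by field; rewrite gt_eqF.
by rewrite ler_piMr ?(ltW d0)// ler_pdivrMr// mul1r lerDl ler01.
Qed.

Lemma L2_prod f g : L2 f -> L2 g -> L1 leb2 (fun x => f x * g x).
Proof.
move=> Hf Hg; apply: (L1_le (mu := leb2) (g := fun x => f x ^+ 2 + g x ^+ 2)).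
- by apply: measurable_funM; exact: L2_measurable.
- exact: (L1D (mu := leb2) Hf.2 Hg.2).
- move=> x; have := young_le (f x) (g x) ltr01; rewrite invr1 !mul1r.
  have := normr_ge0 (f x * g x); lra.
Qed.

Lemma bilinear_norm_le Psi f g (L : R) : 0 <= L -> (forall x, `|Psi x| <= L) ->
  (forall x, ~ Q x -> Psi x = 0) -> measurable_fun setT Psi ->
  measurable_fun setT f -> measurable_fun setT g ->
  L1 leb2 (fun x => \1_Q x * f x ^+ 2) -> L1 leb2 (fun x => \1_Q x * g x ^+ 2) ->
  L1 leb2 (fun x => Psi x * f x * g x) /\
  `|\int[leb2]_x (Psi x * f x * g x)| <=
     L * (\int[leb2]_x (\1_Q x * f x ^+ 2) + \int[leb2]_x (\1_Q x * g x ^+ 2)).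
Proof.
move=> L0 PL PQ mP mf mg If Ig.
have m : measurable_fun setT (fun x => Psi x * f x * g x).
  by apply: measurable_funM => //; exact: measurable_funM.
have J := L1D (mu := leb2) If Ig; have J2 := L1Zl (mu := leb2) L J.
have b x : `|Psi x * f x * g x| <= L * (\1_Q x * f x ^+ 2 + \1_Q x * g x ^+ 2).
  have [Qx|Qx] := pselect (Q x); last first.
    by rewrite PQ// !mul0r normr0 indic_out// !mul0r addr0 mulr0.
  rewrite indic_in// !mul1r -mulrA normrM; apply: ler_pM => //.
  have := young_le (f x) (g x) ltr01; rewrite invr1 !mul1r.
  have := normr_ge0 (f x * g x); lra.
split; first exact: (L1_le (mu := leb2) m J2).
rewrite -(IntD (mu := leb2) If Ig) -(IntZl (mu := leb2) _ J).
exact: (Int_norm_le (mu := leb2)).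
Qed.

Lemma L1_indic_sqr f : L2 f -> L1 leb2 (fun x => \1_Q x * f x ^+ 2) /\
  \int[leb2]_x (\1_Q x * f x ^+ 2) <= \int[leb2]_x (f x ^+ 2).
Proof.
move=> Hf; have mf := L2_measurable Hf.
have i1 : L1 leb2 (fun x => \1_Q x * f x ^+ 2).
  apply: (L1_bmul (mu := leb2) (c := 1)); [exact: measurable_indic (box_measurable M)| |exact: Hf.2].
  by move=> x; rewrite indicE; case: (_ \in _); rewrite ?normr1 ?normr0 ?lexx ?ler01.
split=> //; apply: (Int_le (mu := leb2) i1 Hf.2) => x.
by rewrite indicE; case: (_ \in _); rewrite ?mul1r ?lexx// mul0r sqr_ge0.
Qed.

Lemma bilinear_moll Psi f g (L e D : R) : 0 <= L -> (forall x, `|Psi x| <= L) ->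
  (forall x, ~ Q x -> Psi x = 0) -> measurable_fun setT Psi -> L2 f -> L2 g -> 0 < e -> 0 < D ->
  `|\int[leb2]_x (Psi x * conv (rho e) f x * conv (rho e) g x) - \int[leb2]_x (Psi x * f x * g x)|
  <= L * ((1 + D) * (moll_err M e f + moll_err M e g) +
          D^-1 * (\int[leb2]_x (f x ^+ 2) + \int[leb2]_x (g x ^+ 2))).
Proof.
move=> L0 PL PQ mP Hf Hg e0 D0; have nr := nice_rho e0.
have mf := L2_measurable Hf; have mg := L2_measurable Hg.
have mcf : measurable_fun setT (conv (rho e) f).
  by apply: measurable_continuous_plane; exact: conv_continuous nr Hf.1.
have mcg : measurable_fun setT (conv (rho e) g).
  by apply: measurable_continuous_plane; exact: conv_continuous nr Hg.1.
have [j1 _] := bilinear_norm_le L0 PL PQ mP mcf mcg (L1_moll_sqr M e0 Hf) (L1_moll_sqr M e0 Hg).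
have [qf lf] := L1_indic_sqr Hf; have [qg lg] := L1_indic_sqr Hg.
have [j2 _] := bilinear_norm_le L0 PL PQ mP mf mg qf qg.
have If := L1_moll_err M e0 Hf; have Ig := L1_moll_err M e0 Hg.
rewrite -(IntB (mu := leb2) j1 j2).
apply: (@le_trans _ _ (\int[leb2]_x (L * ((1 + D) * (\1_Q x * (conv (rho e) f x - f x) ^+ 2 +
   \1_Q x * (conv (rho e) g x - g x) ^+ 2) + D^-1 * (\1_Q x * f x ^+ 2 + \1_Q x * g x ^+ 2))))).
  apply: (Int_norm_le (mu := leb2)).
  - by have := L1_measurable (mu := leb2) (L1B (mu := leb2) j1 j2).
  - apply: (L1Zl (mu := leb2)); apply: (L1D (mu := leb2)); apply: (L1Zl (mu := leb2)).
      exact: (L1D (mu := leb2) If Ig).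
    exact: (L1D (mu := leb2) qf qg).
  move=> x; have [Qx|Qx] := pselect (Q x); last first.
    by rewrite PQ// !mul0r subr0 normr0 indic_out// !mul0r !addr0 !mulr0 addr0 mulr0.
  rewrite indic_in// !mul1r -!mulrA -mulrBr normrM; apply: ler_pM => //.
  exact: product_difference_le.
have J1 := L1D (mu := leb2) If Ig; have J2 := L1D (mu := leb2) qf qg.
have K1 := L1Zl (mu := leb2) (1 + D) J1; have K2 := L1Zl (mu := leb2) D^-1 J2.
rewrite (IntZl (mu := leb2) _ (L1D (mu := leb2) K1 K2)) (IntD (mu := leb2) K1 K2).
rewrite (IntZl (mu := leb2) _ J1) (IntZl (mu := leb2) _ J2).
rewrite (IntD (mu := leb2) If Ig) (IntD (mu := leb2) qf qg).
by rewrite ler_wpM2l// lerD2l ler_wpM2l ?invr_ge0 ?(ltW D0)// lerD.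
Qed.

Section quad_cvg.
Variables (Phi v : 'I_2 -> plane R -> R) (L : R).
Hypotheses (L0 : 0 <= L) (nP : forall i, nice M (Phi i)).
Hypotheses (PQ : forall i j x, ~ Q x -> pderiv j (Phi i) x = 0).
Hypothesis PL : forall i j x, `|pderiv j (Phi i) x| <= L.
Hypothesis Hv : forall i, L2 (v i).

Let mP i j : measurable_fun setT (pderiv j (Phi i)).
Proof. by apply: measurable_continuous_plane; exact: nice_continuous (nice_pderiv j (nP i)). Qed.

Definition energy v := \int[leb2]_x (v 0 x ^+ 2) + \int[leb2]_x (v 1 x ^+ 2).

Lemma quadE a : (forall i j, L1 leb2 (fun x => pderiv j (Phi i) x * a i x * a j x)) ->
  quad Phi a = \sum_(i < 2) \sum_(j < 2) \int[leb2]_x (pderiv j (Phi i) x * a i x * a j x).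
Proof.
move=> H; rewrite /quad.
have H2 i : L1 leb2 (fun x => \sum_(j < 2) pderiv j (Phi i) x * a i x * a j x).
  by apply: (L1_sum (mu := leb2)).
apply: (etrans (Int_sum (mu := leb2) _ H2)); apply: eq_bigr => i _.
exact: (Int_sum (mu := leb2) _ (H i)).
Qed.

Let vj i j : L1 leb2 (fun x => pderiv j (Phi i) x * v i x * v j x) /\
  `|\int[leb2]_x (pderiv j (Phi i) x * v i x * v j x)| <=
  L * (\int[leb2]_x (v i x ^+ 2) + \int[leb2]_x (v j x ^+ 2)).
Proof.
have [i1 l1] := L1_indic_sqr (Hv i); have [i2 l2] := L1_indic_sqr (Hv j).
have [h1 h2] := bilinear_norm_le L0 (PL i j) (@PQ i j) (mP i j) (L2_measurable (Hv i)) (L2_measurable (Hv j)) i1 i2.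
by split=> //; apply: (le_trans h2); rewrite ler_wpM2l// lerD.
Qed.

Let mj e i j : 0 < e -> L1 leb2 (fun x => pderiv j (Phi i) x * moll e v i x * moll e v j x) /\
  `|\int[leb2]_x (pderiv j (Phi i) x * moll e v i x * moll e v j x)| <=
  L * (\int[leb2]_x (v i x ^+ 2) + \int[leb2]_x (v j x ^+ 2)).
Proof.
move=> e0; have nr := nice_rho e0.
have mc k : measurable_fun setT (moll e v k).
  by apply: measurable_continuous_plane; exact: conv_continuous nr (Hv k).1.
have [h1 h2] := bilinear_norm_le L0 (PL i j) (@PQ i j) (mP i j) (mc i) (mc j)
  (L1_moll_sqr M e0 (Hv i)) (L1_moll_sqr M e0 (Hv j)).
split=> //; apply: (le_trans h2); rewrite ler_wpM2l//.
by apply: lerD; exact: moll_sqr_le.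
Qed.

Lemma quad_le : `|quad Phi v| <= 4 * L * energy v.
Proof.
rewrite quadE; last by move=> i j; exact: (vj i j).1.
rewrite sum_ord2 [X in X + _]sum_ord2 [X in _ + X]sum_ord2.
exact: (sum4_le (vj 0 0).2 (vj 0 1).2 (vj 1 0).2 (vj 1 1).2).
Qed.

Lemma quad_moll_le e : 0 < e -> `|quad Phi (moll e v)| <= 4 * L * energy v.
Proof.
move=> e0; rewrite quadE; last by move=> i j; exact: (mj i j e0).1.
rewrite sum_ord2 [X in X + _]sum_ord2 [X in _ + X]sum_ord2.
exact: (sum4_le (mj 0 0 e0).2 (mj 0 1 e0).2 (mj 1 0 e0).2 (mj 1 1 e0).2).
Qed.

Lemma quad_moll_cvg : (forall i x, ~ Q x -> v i x = 0) ->
  quad Phi (moll k.+1%:R^-1 v) @[k --> \oo] --> quad Phi v.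
Proof.
move=> vQ; rewrite quadE; last by move=> i j; exact: (vj i j).1.
have e0 k : 0 < k.+1%:R^-1 :> R by rewrite invr_gt0 ltr0n.
have -> : (fun k => quad Phi (moll k.+1%:R^-1 v)) = (fun k => \sum_(i < 2) \sum_(j < 2)
    \int[leb2]_x (pderiv j (Phi i) x * moll k.+1%:R^-1 v i x * moll k.+1%:R^-1 v j x)).
  by apply/funext => k; rewrite quadE// => i j; exact: (mj i j (e0 k)).1.
apply: cvg_sum2 => i j; apply/cvgrPdist_le => d d0.
set E := \int[leb2]_x (v i x ^+ 2) + \int[leb2]_x (v j x ^+ 2).
have E0 : 0 <= E by apply: addr_ge0; apply: Int_ge0 => x; exact: sqr_ge0.
pose D := 2 * (L + 1) * (E + 1) / d.
have D0 : 0 < D by rewrite divr_gt0// !mulr_gt0// ltr_wpDl.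
pose d' := d / (4 * (L + 1) * (1 + D)).
have d'0 : 0 < d' by rewrite divr_gt0// !mulr_gt0// ?ltr_wpDl// addr_gt0.
have := moll_good_near (moll_good_L2 (Hv i) (@vQ i)) d'0.
have := moll_good_near (moll_good_L2 (Hv j) (@vQ j)) d'0.
apply: filterS2 => k h1 h2; rewrite distrC.
apply: (le_trans (bilinear_moll L0 (PL i j) (@PQ i j) (mP i j) (Hv i) (Hv j) (e0 k) D0)).
rewrite -/E; exact: bilinear_choice.
Qed.

(** The scales e and e' are both compared with the same reference, then e' tends to 0: the flux at
    scale e' becomes the flux of v itself and the term e' * C disappears. *)
Lemma concentration_estimate w (d e B C : R) :
  (forall i x, ~ Q x -> v i x = 0) -> 0 < e -> e <= d ->
  (forall e', 0 < e' -> e' <= d ->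
   `|quad Phi (moll e' v) + \int[leb2]_x (w x * cross Phi (moll d v) x)| <= B + e' * C) ->
  `|quad Phi (moll e v) - quad Phi v| <= 2 * B + e * C.
Proof.
move=> vQ e0 ed H; set S := \int[leb2]_x _ in H.
have c := quad_moll_cvg vQ.
have ek0 : (k.+1%:R^-1 : R) @[k --> \oo] --> 0 by exact: cvg_harmonic.
have d0 : 0 < d := lt_le_trans e0 ed.
have c2 : 2 * B + e * C + k.+1%:R^-1 * C @[k --> \oo] --> 2 * B + e * C.
  rewrite -[X in _ --> X]addr0; apply: cvgD; first exact: cvg_cst.
  by rewrite -(mul0r C); apply: cvgM => //; exact: cvg_cst.
have c1 : `|quad Phi (moll e v) - quad Phi (moll k.+1%:R^-1 v)| @[k --> \oo] -->
    `|quad Phi (moll e v) - quad Phi v|.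
  by apply: cvg_norm; apply: cvgB => //; exact: cvg_cst.
apply: (ler_cvg_to c1 c2).
have /cvgrPdist_le/(_ d d0) := ek0; apply: filterS => k.
rewrite sub0r normrN => /(le_trans (ler_norm _)) hk.
have ekk : 0 < k.+1%:R^-1 :> R by rewrite invr_gt0 ltr0n.
have h1 := H _ e0 ed; have h2 := H _ ekk hk.
exact: triangle_pair h1 h2.
Qed.

End quad_cvg.
End quadratic_mollification.

(** * Extension by zero *)

Section zero_extension.
Context (R : realType) (T : R) (Om : set (plane R)).
Implicit Types (f g : plane R -> R) (v : 'I_2 -> plane R -> R) (x y : plane R) (t : R).
Local Notation leb := (@lebesgue_measure R).

Definition ext0 (A : set (plane R)) f x : R := if x \in A then f x else 0.

Lemma ext0_in (A : set (plane R)) f x : A x -> ext0 A f x = f x.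
Proof. by move=> Ax; rewrite /ext0 mem_set. Qed.

Lemma ext0_out (A : set (plane R)) f x : ~ A x -> ext0 A f x = 0.
Proof. by move=> Ax; rewrite /ext0 memNset. Qed.

Lemma ext0_restrict (A : set (plane R)) f : f \_ A = ext0 A f.
Proof. by apply/funext => x; rewrite patchE. Qed.

Lemma L2normsqE f : L2normsq Om f = (\int[leb2]_x ((ext0 Om f x) ^+ 2)%:E)%E.
Proof.
rewrite /L2normsq (integral_mkcond (mu := leb2)); apply: eq_integral => x _.
by rewrite patchE /ext0; case: ifP; rewrite ?expr0n.
Qed.

Lemma Int_ext0 (A : set (plane R)) (F : plane R -> R) : \int[leb2]_(x in A) F x = \int[leb2]_x ext0 A F x.
Proof. by rewrite (Rintegral_mkcond leb2) ext0_restrict. Qed.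

Lemma L2_supp M f : measurable_fun setT f -> (forall x, ~ obox M x -> f x = 0) ->
  L1 leb2 (fun x => f x ^+ 2) -> L2 f.
Proof.
move=> mf fQ f2; split=> //.
have mQ := box_measurable M.
have L1Q := L1_indic (mu := leb2) mQ (box_finite mQ (@subset_refl _ (obox M))).
apply: (L1_le (mu := leb2) (g := fun x => \1_(obox M) x + f x ^+ 2)) => //.
  exact: (L1D (mu := leb2)).
move=> x; have [Qx|Qx] := pselect (obox M x); last first.
  by rewrite fQ// normr0 indic_out// add0r sqr_ge0.
rewrite indic_in//; have := young_le (f x) 1 ltr01.
by rewrite mulr1 invr1 !mul1r expr1n; have := normr_ge0 (f x); lra.
Qed.

Lemma L2normsq_vec_le M v (c : R) : Om `<=` obox M ->
  (forall i, measurable_fun setT (ext0 Om (v i))) -> (L2normsq_vec Om v <= c%:E)%E ->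
  (forall i, L2 (ext0 Om (v i))) /\ energy (fun i => ext0 Om (v i)) <= c.
Proof.
move=> OQ mv; rewrite /L2normsq_vec sum_ord2 !L2normsqE => vc.
have n0 i : (0 <= \int[leb2]_x ((ext0 Om (v i) x) ^+ 2)%:E)%E.
  by apply: integral_ge0 => x _; rewrite lee_fin sqr_ge0.
have i2 i : (\int[leb2]_x ((ext0 Om (v i) x) ^+ 2)%:E <= c%:E)%E.
  apply: le_trans vc; have [->|->] := ord2_cases i.
  - exact: leeDl.
  - exact: leeDr.
have L i : L2 (ext0 Om (v i)).
  apply: (@L2_supp M) => //; first by move=> x Qx; rewrite ext0_out// => /OQ.
  by have [] := Int_le_EFin (mu := leb2) (measurable_funX 2 (mv i)) (fun x => sqr_ge0 _) (i2 i).
split=> //; move: vc.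
by rewrite -(EFin_Int (mu := leb2) (L 0).2) -(EFin_Int (mu := leb2) (L 1).2) -EFinD lee_fin.
Qed.

Lemma L2normsq_fin M f : Om `<=` obox M -> measurable_fun setT (ext0 Om f) ->
  (L2normsq Om f < +oo)%E -> L2 (ext0 Om f).
Proof.
move=> OQ mf; rewrite L2normsqE => foo; apply: (@L2_supp M) => //.
  by move=> x Qx; rewrite ext0_out// => /OQ.
apply: (L1_ge0P (mu := leb2)) => //; first exact: measurable_funX.
by move=> x; exact: sqr_ge0.
Qed.

Lemma ext0_div v : weakly_divergence_free Om v -> weak_div0 Om (fun i => ext0 Om (v i)).
Proof.
move=> H phi tp; apply: etrans (H _ tp); rewrite (Int_ext0 Om); apply: Int_ext => x.
by rewrite /ext0; case: ifP => // _; rewrite big1// => i _; exact: mul0r.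
Qed.

Lemma test_function_sub (K U : set (plane R)) phi : K `<=` U -> test_function K phi -> test_function U phi.
Proof. by move=> KU [s [c sub]]; split=> //; split=> //; exact: subset_trans KU. Qed.

Lemma test_function_out (K : set (plane R)) phi x : test_function K phi -> ~ K x -> phi x = 0.
Proof.
move=> [_ [_ sub]] Kx; apply/eqP/negPn/negP => H; apply: Kx; apply: sub.
exact: subset_closure.
Qed.

(** The vorticity is only locally integrable, so it is cut off to K; test functions supported in K
    do not see the cut. *)
Lemma ext0_rot (K : set (plane R)) v w : K `<=` Om -> weak_curl Om v w ->
  weak_rot K (fun i => ext0 Om (v i)) (ext0 K w).
Proof.
move=> KO [_ H] phi tp; have E := H _ (test_function_sub KO tp).
have E1 : \int[leb2]_x (ext0 K w x * phi x) = \int[leb2]_(x in Om) (w x * phi x).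
  rewrite (Int_ext0 Om); apply: Int_ext => x; rewrite /ext0; have [Kx|Kx] := pselect (K x).
    by rewrite !mem_set//; exact: KO.
  by rewrite (test_function_out tp Kx) !mulr0; case: ifP.
have E2 : \int[leb2]_x (ext0 Om (v 0) x * pderiv 1 phi x - ext0 Om (v 1) x * pderiv 0 phi x) =
    \int[leb2]_(x in Om) (v 0 x * pderiv 1 phi x - v 1 x * pderiv 0 phi x).
  rewrite (Int_ext0 Om); apply: Int_ext => x.
  by rewrite /ext0; case: ifP => // _; rewrite !mul0r subr0.
by rewrite E1 E E2.
Qed.

Implicit Types (D : set R) (A : set (plane R)) (F : R -> plane R -> R).

(** [D] will be a set of good times of full measure. With the value 0 at the other times, what is
    known at almost every time holds at every time for the extension. *)
Definition ext D A F t x : R :=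
  if t \in D then ext0 A (F t) x else 0.

Lemma ext_in D A F t : D t -> ext D A F t = ext0 A (F t).
Proof. by move=> Dt; apply/funext => x; rewrite /ext mem_set. Qed.

Lemma ext_out D A F t x : ~ D t -> ext D A F t x = 0.
Proof. by move=> Dt; rewrite /ext memNset. Qed.

Definition jmeas F := measurable_fun setT (fun z : R * plane R => F z.1 z.2).

Lemma jmeas_ext D A F : measurable Om -> measurable D -> D `<=` `]0, T[ -> measurable A -> A `<=` Om ->
  spacetime_measurable T Om F -> jmeas (ext D A F).
Proof.
move=> mO mD DT mA AO mf; have mDA : measurable (D `*` A) by exact: measurableX.
have sub : D `*` A `<=` `]0, T[ `*` Om by move=> z [/DT h1 /AO h2].
have := (measurable_restrict (fun z : R * plane R => F z.1 z.2) mDA measurableT).1.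
have mTO : measurable (`]0, T[%classic `*` Om) by apply: measurableX.
rewrite setTI => /(_ (measurable_funS mTO sub mf)).
rewrite /jmeas => H; suff : (fun z : R * plane R => ext D A F z.1 z.2) =
  ((fun z : R * plane R => F z.1 z.2) \_ (D `*` A)) by move=> ->; apply: H.
apply/funext => -[t x]; rewrite patchE /ext /ext0 /= in_setX /=.
by case: (t \in D); case: (x \in A).
Qed.

Lemma jmeas_slice F t : jmeas F -> measurable_fun setT (F t).
Proof. by move=> mf; apply: (measurableT_comp mf (g := fun x => (t, x))); exact: measurable_pair1. Qed.

Lemma jmeas_Int F : jmeas F -> measurable_fun setT (fun t => \int[leb2]_x F t x).
Proof.
move=> mf; exact: (@fubini_measurable1 _ _ (measurableTypeR R)
  (measurableTypeR R * measurableTypeR R)%type R (lebp R) (fun z : R * plane R => F z.1 z.2)).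
Qed.

(** Bridge from the weak formulations on ]0, T[ x Om to integrals over the whole line; the space
    integral has to be computed at good times only. *)
Lemma Int2_transfer D F (g : R -> R) :
  measurable `]0, T[%classic -> measurable Om ->
  {ae leb, forall t, t \in `]0, T[ -> D t} -> spacetime_measurable T Om F ->
  measurable_fun setT g -> (forall t, ~ D t -> g t = 0) -> D `<=` `]0, T[ ->
  (forall t, D t -> \int[leb2]_(x in Om) F t x = g t) ->
  \int[leb]_(t in `]0, T[) \int[leb2]_(x in Om) F t x = \int[leb]_t g t.
Proof.
move=> mT mO aD mf mg gD DT fg; rewrite (Rintegral_mkcond leb).
have E t : ((fun t => \int[leb2]_(x in Om) F t x) \_ `]0, T[) t =
    \int[leb2]_x ext `]0, T[ Om F t x.
  rewrite patchE; case: ifPn => h.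
    by have ht := set_mem h; rewrite (ext_in _ _ ht) (Int_ext0 Om).
  have h' : ~ `]0, T[%classic t by move=> h'; rewrite mem_set in h.
  by under Int_ext do rewrite (ext_out _ _ _ h'); rewrite (Int_0 leb2).
apply: (Int_ae_eq (mu := leb)) => //.
- rewrite (funext E); apply: jmeas_Int; exact: jmeas_ext.
- have FF := ae_filter_ringOfSetsType leb; apply: filterS aD => t H; rewrite patchE; case: ifPn => h.
    by apply: fg; apply: H; move/set_mem: h.
  by rewrite gD// => /DT/mem_set; rewrite (negbTE h).
Qed.

End zero_extension.

(** * Compactness in time *)

Section time_kernel.
Context (R : realType).
Implicit Types (s t r a b C : R) (p q phi : R -> R).
Local Notation leb := (@lebesgue_measure R).

Lemma Int_derive1_FTC (g : R -> R) a b : a < b ->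
  (forall s, derivable g s 1) -> continuous (derive1 g) ->
  (forall s, ~ (s \in `[a, b]) -> derive1 g s = 0) -> \int[leb]_s (derive1 g) s = g b - g a.
Proof.
move=> ab dg cg dg0.
have -> : \int[leb]_s (derive1 g) s = \int[leb]_(s in `[a, b]) (derive1 g) s.
  rewrite [RHS]Rintegral_mkcond; apply: Int_ext => s; rewrite patchE.
  by case: ifPn => //; rewrite notin_setE => /dg0.
have cgs s : {for s, continuous g}.
  by apply: differentiable_continuous; exact/derivable1_diffP.
have cg' : {within `[a, b], continuous (derive1 g)} by exact: continuous_subspaceT.
have dg' : derivable_oo_LRcontinuous g a b.
  split; first by move=> x _; exact: dg.
  - by apply: cvg_at_right_filter; exact: cgs.
  - by apply: cvg_at_left_filter; exact: cgs.
have E := continuous_FTC2 ab cg' dg' (fun x _ => erefl).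
by rewrite /Rintegral E.
Qed.

Lemma Int_norm_le_ae (f g : R -> R) : measurable_fun setT f -> L1 leb f -> L1 leb g ->
  (forall x, 0 <= g x) -> {ae leb, forall x, `|f x| <= g x} -> `|\int[leb]_x f x| <= \int[leb]_x g x.
Proof.
move=> mf fi gi g0 fg; apply: (le_trans (Int_norm (mu := leb) fi)).
rewrite -lee_fin (EFin_Int (mu := leb) (L1_abs (mu := leb) fi)) (EFin_Int (mu := leb) gi).
apply: ae_ge0_le_integral => //.
- by apply/measurable_EFinP; exact: measurableT_comp.
- by move=> x _; rewrite lee_fin.
- by apply/measurable_EFinP; exact: L1_measurable gi.
- have FF := ae_filter_ringOfSetsType leb.
  by apply: filterS fg => x h _; rewrite lee_fin.
Qed.

Lemma leb_segment a b : a <= b -> (leb `[a, b]%classic = (b - a)%:E)%E.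
Proof.
move=> ab; apply: (etrans (lebesgue_measure_itv _)); rewrite /= lte_fin.
case: ltP => h; first by rewrite -EFinD.
have -> : a = b by apply/eqP; rewrite eq_le ab.
by rewrite subrr.
Qed.

Lemma leb_segment_fin a b : a <= b -> (leb `[a, b]%classic < +oo)%E.
Proof. by move=> ab; rewrite (leb_segment ab) ltry. Qed.

(** A one-sided kernel: the average at t looks back over [t - s, t] only, so with t >= a and s < a
    it involves positive times alone. *)
Definition tker s t : R := bump (t / s) / s / step 1.

(** Primitive, up to sign, of the averaging kernel in the past variable t': it falls from 1 to 0 on
    [t - s, t] and serves to build the time factor of test fields. *)
Definition tramp s t t' : R := step ((t - t') / s) / step 1.

Lemma tker_ge0 s t : 0 < s -> 0 <= tker s t.
Proof. by move=> s0; rewrite /tker !divr_ge0 ?bump_ge0 ?(ltW s0) ?(ltW (step1_gt0 R)). Qed.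

Lemma tker_supp s t : 0 < s -> t <= 0 \/ s <= t -> tker s t = 0.
Proof.
move=> s0 H; rewrite /tker bump_eq0 ?mul0r//; case: H => H; [left|right].
  by apply: (@le_trans _ _ 0); [rewrite pmulr_lle0 ?invr_gt0|lra].
by rewrite ler_pdivlMr// mul1r.
Qed.

Lemma tramp_smooth s t : smooth (tramp s t).
Proof.
apply: smoothM; last exact: smooth_cst.
apply: smooth_comp; first exact: smooth_step.
apply: smoothM; last exact: smooth_cst.
by apply: smoothB; [exact: smooth_cst|exact: smooth_id].
Qed.

Lemma tramp_derive s t t' : 0 < s -> derivable (tramp s t) t' 1 /\
  derive1 (tramp s t) t' = - tker s (t - t').
Proof.
move=> s0; have d : derivable (tramp s t) t' 1 by apply: smooth_derivable; exact: tramp_smooth.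
split=> //; have aff (h v x : R) : (t - (h *: v + x)) / s = h *: (- v / s) + (t - x) / s.
  by rewrite /GRing.scale /=; field; rewrite gt_eqF.
pose F (x : R) := step x / step 1.
have E : tramp s t = (fun x => F ((t - x) / s)) by [].
have dst : derivable (@step R) ((t - t') / s) 1 by exact: (step_derive _).1.
have dc : derivable (cst (step 1)^-1 : R -> R) ((t - t') / s) 1 by exact: derivable_cst.
have dF : derivable F ((t - t') / s) 1 by exact: (derivableM dst dc).
have dF1 : 'D_1 F ((t - t') / s) = bump ((t - t') / s) / step 1.
  rewrite /F (deriveM dst dc) derive_cst scaler0 add0r -derive1E (step_derive _).2.
  by rewrite /GRing.scale /= mulrC.
rewrite derive1E E (@derive_affine R R R (fun x => (t - x) / s) (fun v => - v / s) aff F).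
rewrite (derive_scale _ dF).2 dF1 /tker; field.
by rewrite !gt_eqF// step1_gt0.
Qed.

Lemma tramp01 s t t' : 0 <= tramp s t t' <= 1.
Proof.
by rewrite /tramp divr_ge0 ?step_ge0//= ler_pdivrMr ?step1_gt0// mul1r step_le1.
Qed.

Lemma tramp_after s t t' : 0 < s -> t <= t' -> tramp s t t' = 0.
Proof.
move=> s0 tt; rewrite /tramp step_eq0 ?mul0r//.
by apply: (@le_trans _ _ 0); [rewrite pmulr_lle0 ?invr_gt0// subr_le0|lra].
Qed.

Lemma tramp_before s t t' : 0 < s -> t' <= t - s -> tramp s t t' = 1.
Proof.
move=> s0 tt; rewrite /tramp step_ge1 ?divff ?gt_eqF ?step1_gt0//.
by rewrite ler_pdivlMr// mul1r; lra.
Qed.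

Lemma tker_continuous s : continuous (tker s).
Proof.
have sb : smooth (fun t : R => bump (t / s) / s / step 1).
  do 2 (apply: smoothM; last exact: smooth_cst).
  apply: smooth_comp; first exact: smooth_bump.
  by apply: smoothM; [exact: smooth_id|exact: smooth_cst].
exact: (smooth_continuous sb).
Qed.

Lemma tker_bound : exists2 B : R, 0 <= B & forall s t, 0 < s -> tker s t <= B / s.
Proof.
have cb : continuous (@bump R) by apply: smooth_continuous; exact: smooth_bump.
have [B B0 HB] := bounded_on_compact cb (@segment_compact R 0 1).
have st1 := step1_gt0 R.
exists (B / step 1); first by rewrite divr_ge0// ltW.
move=> s t s0; rewrite /tker mulrAC ler_pM2r ?invr_gt0// ler_pM2r ?invr_gt0//.
have [h1|h1] := leP (t / s) (1 / 4); first by rewrite bump_eq0//; left.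
have [h2|h2] := leP 1 (t / s); first by rewrite bump_eq0//; right.
apply: le_trans (ler_norm _) (HB _ _); rewrite /= in_itv /=; apply/andP; split; lra.
Qed.

Lemma tker_measurable s t : measurable_fun setT (fun t' => tker s (t - t')).
Proof.
apply: (measurableT_comp (f := tker s)); last exact: measurable_reflect1.
by apply: continuous_measurable_fun; exact: tker_continuous.
Qed.

Lemma L1_tker s t : 0 < s -> L1 leb (fun t' => tker s (t - t')) /\
  \int[leb]_t' tker s (t - t') = 1.
Proof.
move=> s0; have st : t - s < t by lra.
have [B B0 HB] := tker_bound.
have i1 : L1 leb (fun t' => tker s (t - t')).
  apply: (@L1_bounded_supp _ _ R leb `[t - s, t]%classic (B / s)) => //.
  - exact: leb_segment_fin (ltW st).
  - exact: tker_measurable.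
  - by move=> t'; rewrite ger0_norm ?tker_ge0// HB.
  - move=> t' H; apply: tker_supp => //.
    have [h1|h1] := leP t t'; first by left; lra.
    have [h2|h2] := leP t' (t - s); first by right; lra.
    by exfalso; apply: H; rewrite /= in_itv/= !ltW.
split=> //; have E t' : derive1 (tramp s t) t' = - tker s (t - t').
  exact: (tramp_derive t t' s0).2.
have := @Int_derive1_FTC (tramp s t) (t - s) t st (fun t' => (tramp_derive t t' s0).1).
rewrite (funext E) (tramp_after s0 (lexx t)) (tramp_before s0 (lexx (t - s))) sub0r.
rewrite (IntN (mu := leb) i1) => H; apply: oppr_inj; apply: H.
  move=> t'; apply: cvgN; apply: (@cvg_comp _ _ _ (fun t' => t - t') (tker s) _ (nbhs (t - t'))).
    by apply: cvgB; [exact: cvg_cst|exact: cvg_id].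
  exact: tker_continuous.
move=> t' H; rewrite tker_supp ?oppr0//.
have [h1|h1] := leP t t'; first by left; lra.
have [h2|h2] := leP t' (t - s); first by right; lra.
by exfalso; apply: H; rewrite /= in_itv/= !ltW.
Qed.

Definition tavg s p t : R := \int[leb]_t' (tker s (t - t') * p t').

Section tavg_bounded.
Variables (s : R) (p : R -> R) (C : R).
Hypotheses (s0 : 0 < s) (mp : measurable_fun setT p) (pC : forall t, `|p t| <= C).

Lemma L1_tavg t : L1 leb (fun t' => tker s (t - t') * p t').
Proof.
under [X in L1 _ X]eq_fun do rewrite mulrC.
exact: (L1_bmul (mu := leb) mp pC (L1_tker t s0).1).
Qed.

Lemma tavg_le t : `|tavg s p t| <= C.
Proof.
have [i1 i2] := L1_tker t s0; rewrite -[leRHS]mul1r -i2 -(IntZr (mu := leb) _ i1).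
apply: (Int_norm_le (mu := leb)); [exact: (L1_measurable (L1_tavg t))|exact: (L1Zr (mu := leb))|].
by move=> t'; rewrite normrM ger0_norm ?tker_ge0// ler_wpM2l ?tker_ge0.
Qed.

Lemma tavg_measurable : measurable_fun setT (tavg s p).
Proof.
apply: (@fubini_measurable1 _ _ (measurableTypeR R) (measurableTypeR R) R leb
  (fun z : R * R => tker s (z.1 - z.2) * p z.2)).
apply: measurable_funM; last exact: (measurableT_comp mp measurable_snd).
apply: (measurableT_comp (f := tker s)); last exact: measurable_funB.
by apply: continuous_measurable_fun; exact: tker_continuous.
Qed.

End tavg_bounded.

(** The kernel is at most B / s and lives in the ball of radius 2 s, of length 4 s. The error is
    thus at most 4 B times the mean oscillation of p, which tends to 0 at Lebesgue points. *)
Lemma tavg_lebesgue_pt p C : L1 leb p -> (forall t, `|p t| <= C) ->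
  {ae leb, forall t, tavg k.+1%:R^-1 p t @[k --> \oo] --> p t}.
Proof.
move=> pi pC; have mp := L1_measurable (mu := leb) pi.
have FF := ae_filter_ringOfSetsType leb.
have LI := open_integrable_locally openT pi.
have := lebesgue_differentiation LI; apply: filterS => t Lt.
have [B B0 HB] := tker_bound.
have key s : 0 < s -> (`|tavg s p t - p t|%:E <= (4 * B)%:E * davg p t (2 * s))%E.
  move=> s0; have s20 : 0 <= 2 * s by rewrite mulr_ge0// ltW.
  have [i1 i2] := L1_tker t s0; have it := L1_tavg s0 mp pC t.
  have E : tavg s p t - p t = \int[leb]_t' (tker s (t - t') * (p t' - p t)).
    rewrite -[X in _ - X]mul1r -i2 -(IntZr (mu := leb) _ i1) -(IntB (mu := leb) it (L1Zr (mu := leb) _ i1)).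
    by apply: Int_ext => t'; rewrite mulrBr.
  have ii : L1 leb (fun t' => tker s (t - t') * (p t' - p t)).
    have := L1B (mu := leb) it (L1Zr (mu := leb) (p t) i1).
    by under [X in L1 _ X -> _]eq_fun do rewrite -mulrBr.
  have mpt : measurable_fun setT (fun t' => p t' - p t) by exact: measurable_funB.
  have le1 : (`|tavg s p t - p t|%:E <= \int[leb]_t' `|(tker s (t - t') * (p t' - p t))%:E|)%E.
    rewrite E; have := Int_norm (mu := leb) ii; rewrite -lee_fin => /le_trans; apply.
    by rewrite (EFin_Int (mu := leb) (L1_abs (mu := leb) ii)).
  apply: (le_trans le1); rewrite /davg /iavg lebesgue_measure_ball//.
  have -> : ((4 * B)%:E * (((2 * s) *+ 2)%:E^-1 * \int[leb]_(y in ball t (2 * s)) `|((shift (- p t) \o p) y)%:E|) =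
     (B / s)%:E * \int[leb]_(y in ball t (2 * s)) `|(p y - p t)%:E|)%E.
    rewrite muleA; congr (_ * _)%E.
    rewrite inver; case: ifPn => [|n0]; first by rewrite mulrn_eq0 /= mulf_eq0 !gt_eqF.
    by rewrite -EFinM; congr EFin; field; rewrite gt_eqF.
  have mb : measurable (ball t (2 * s)) by exact: measurable_ball.
  rewrite -(@ge0_integralZl_EFin _ _ R leb) ?divr_ge0 ?(ltW s0)//; last first.
    apply/measurable_EFinP; apply: measurableT_comp => //; exact: measurable_funTS.
  rewrite [leRHS]integral_mkcond; apply: ge0_le_integral => //.
  - apply/measurable_EFinP; apply: measurableT_comp => //; exact: L1_measurable ii.
  - apply/(measurable_restrictT _ mb); apply: measurable_funTS.
    have -> : (fun x => ((B / s)%:E * `|(p x - p t)%:E|)%E) = EFin \o (fun x => B / s * `|p x - p t|) by [].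
    apply/measurable_EFinP; apply: measurable_funM => //; exact: measurableT_comp.
  move=> x _; rewrite patchE; case: ifPn => [xb|].
    rewrite /= -EFinM lee_fin normrM ler_wpM2r// ger0_norm ?tker_ge0//.
    exact: HB.
  rewrite notin_setE => xb; have tz : tker s (t - x) = 0.
    apply: tker_supp => //; have [h1|h1] := leP (t - x) 0; first by left.
    have [h2|h2] := leP s (t - x); first by right.
    by exfalso; apply: xb; rewrite /ball /= ger0_norm; lra.
  by rewrite tz mul0r /= normr0; exact: lexx.
have r0 k : 0 < 2 * k.+1%:R^-1 :> R by rewrite mulr_gt0// invr_gt0 ltr0n.
have rc : (2 * k.+1%:R^-1 : R) @[k --> \oo] --> 0.
  by rewrite -[X in _ --> X](mulr0 (2 : R)); apply: cvgM; [exact: cvg_cst|exact: cvg_harmonic].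
have := Lt; rewrite /lebesgue_pt => /cvge_at_rightP/(_ (fun k => 2 * k.+1%:R^-1) (conj r0 rc)).
move=> /fine_cvgP[fin_near /cvgrPdist_le cv]; apply/cvgrPdist_le => d d0.
have B4 : 0 < 4 * B + 1 by rewrite ltr_wpDl// mulr_ge0.
have dB : 0 < d / (4 * B + 1) by rewrite divr_gt0.
have := cv _ dB; apply: filterS2 fin_near => k fk hk.
rewrite distrC -lee_fin; apply: (le_trans (key _ _)); first by rewrite invr_gt0 ltr0n.
rewrite -(fineK fk) -EFinM lee_fin.
move: hk; rewrite /= sub0r normrN => /(le_trans (ler_norm _)) hk.
apply: (@le_trans _ _ (4 * B * (d / (4 * B + 1)))); first by rewrite ler_wpM2l// mulr_ge0.
by rewrite mulrCA ler_piMr ?(ltW d0)// ler_pdivrMr// mul1r lerDl ler01.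
Qed.

Lemma four_steps (x y x1 y1 y2 d e : R) : e <= d / 4 -> `|y - y1| <= e -> `|y1 - y2| <= d / 4 ->
  `|x1 - y2| <= d / 4 -> `|x - x1| <= e -> `|y - x| <= d.
Proof.
move=> e4 h1 h2 h3 h4.
have -> : y - x = (y - y1) + (y1 - y2) - (x1 - y2) - (x - x1) by ring.
apply: (le_trans (ler_normB _ _)); have := ler_normB (y - y1 + (y1 - y2)) (x1 - y2).
have := ler_normD (y - y1) (y1 - y2); lra.
Qed.

Section compactness.
Variables (p q : nat -> R -> R) (poo qoo phi : R -> R) (a b s0 C Cp Cq Cphi : R).
Hypotheses (ab : a <= b) (s0_gt0 : 0 < s0) (C0 : 0 <= C).
Hypotheses (pi : forall n, L1 leb (p n)) (pooi : L1 leb poo).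
Hypotheses (pC : forall n t, `|p n t| <= Cp) (pooC : forall t, `|poo t| <= Cp).
Hypotheses (mq : forall n, measurable_fun setT (q n)) (mqoo : measurable_fun setT qoo).
Hypotheses (qC : forall n t, `|q n t| <= Cq) (qooC : forall t, `|qoo t| <= Cq).
Hypotheses (mphi : measurable_fun setT phi) (phiC : forall t, `|phi t| <= Cphi).
Hypothesis phi0 : forall t, ~ (a <= t <= b) -> phi t = 0.
Hypothesis H1 : forall s t, 0 < s -> s <= s0 -> a <= t <= b ->
  tavg s (p n) t @[n --> \oo] --> tavg s poo t.
Hypothesis H2 : forall n s s' t, 0 < s' -> s' <= s -> s <= s0 -> a <= t <= b ->
  `|tavg s' (p n) t - tavg s (p n) t| <= C * s.
Hypothesis H3 : forall (g : R -> R) Cg, measurable_fun setT g -> (forall t, `|g t| <= Cg) ->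
  (forall t, ~ (a <= t <= b) -> g t = 0) ->
  \int[leb]_t (g t * q n t) @[n --> \oo] --> \int[leb]_t (g t * qoo t).

Let Cp0 : 0 <= Cp. Proof. exact: le_trans (normr_ge0 _) (pooC 0). Qed.
Let Cq0 : 0 <= Cq. Proof. exact: le_trans (normr_ge0 _) (qooC 0). Qed.
Let Cphi0 : 0 <= Cphi. Proof. exact: le_trans (normr_ge0 _) (phiC 0). Qed.
Let mp n : measurable_fun setT (p n). Proof. by have := L1_measurable (mu := leb) (pi n). Qed.
Let mpoo : measurable_fun setT poo. Proof. by have := L1_measurable (mu := leb) pooi. Qed.

Let win (t : R) : R := \1_(`[a, b]%classic) t.

Let win_in t : a <= t <= b -> win t = 1.
Proof. by move=> h; rewrite /win indic_in//= in_itv. Qed.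

Let win_out t : ~ (a <= t <= b) -> win t = 0.
Proof. by move=> h; rewrite /win indic_out//= in_itv. Qed.

Let win_ge0 t : 0 <= win t. Proof. by rewrite /win indicE. Qed.

Let win_L1 : L1 leb win /\ \int[leb]_t win t = b - a.
Proof.
split; first by apply: (L1_indic (mu := leb)) => //; exact: leb_segment_fin.
rewrite /Rintegral integral_indic// setIT; exact: (congr1 fine (leb_segment ab)).
Qed.

Let H2oo s s' t : 0 < s' -> s' <= s -> s <= s0 -> a <= t <= b ->
  `|tavg s' poo t - tavg s poo t| <= C * s.
Proof.
move=> h1 h2 h3 h4.
have c : `|tavg s' (p n) t - tavg s (p n) t| @[n --> \oo] --> `|tavg s' poo t - tavg s poo t|.
  apply: cvg_norm; apply: cvgB; apply: H1 => //; first exact: le_trans h3.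
  exact: lt_le_trans h2.
apply: (ler_cvg_to c (cvg_cst (C * s))); apply: nearW => n; exact: H2.
Qed.

Let close_ae (f : R -> R) s : L1 leb f -> (forall t, `|f t| <= Cp) -> 0 < s -> s <= s0 ->
  (forall s' t, 0 < s' -> s' <= s -> a <= t <= b -> `|tavg s' f t - tavg s f t| <= C * s) ->
  {ae leb, forall t, a <= t <= b -> `|f t - tavg s f t| <= C * s}.
Proof.
move=> fi fC s1 s2 H; have FF := ae_filter_ringOfSetsType leb.
have := tavg_lebesgue_pt fi fC; apply: filterS => t ct tab.
have c : `|tavg k.+1%:R^-1 f t - tavg s f t| @[k --> \oo] --> `|f t - tavg s f t|.
  by apply: cvg_norm; apply: cvgB => //; exact: cvg_cst.
apply: (ler_cvg_to c (cvg_cst (C * s))).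
have h0 : (k.+1%:R^-1 : R) @[k --> \oo] --> 0 by exact: cvg_harmonic.
have /cvgrPdist_le/(_ s s1) := h0; apply: filterS => k.
rewrite sub0r normrN => /(le_trans (ler_norm _)) hk.
by apply: H => //; rewrite invr_gt0 ltr0n.
Qed.

Let window_product (f g h : R -> R) (Cf : R) : measurable_fun setT f -> (forall t, `|f t| <= Cf) ->
  measurable_fun setT h -> (forall t, `|h t| <= Cq) -> L1 leb (fun t => phi t * f t * h t).
Proof.
move=> mf fC mh hC; have Cf0 : 0 <= Cf := le_trans (normr_ge0 _) (fC 0).
apply: (L1_le (mu := leb) (g := fun t => Cphi * Cf * Cq * win t)).
- by apply: measurable_funM => //; exact: measurable_funM.
- exact: (L1Zl (mu := leb) _ win_L1.1).
move=> t; have [h1|h1] := boolP (a <= t <= b).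
  by rewrite win_in// mulr1 !normrM !ler_pM ?mulr_ge0.
by rewrite phi0 ?mul0r ?normr0 ?mulr_ge0//; exact/negP.
Qed.

Let error_le (f h : R -> R) s : L1 leb f -> (forall t, `|f t| <= Cp) -> 0 < s -> s <= s0 ->
  (forall s' t, 0 < s' -> s' <= s -> a <= t <= b -> `|tavg s' f t - tavg s f t| <= C * s) ->
  measurable_fun setT h -> (forall t, `|h t| <= Cq) ->
  `|\int[leb]_t (phi t * f t * h t) - \int[leb]_t (phi t * tavg s f t * h t)| <=
  C * s * (Cphi * Cq * (b - a)).
Proof.
move=> fi fC s1 s2 H mh hC; have mf := L1_measurable (mu := leb) fi.
have mT := tavg_measurable s mf; have TC := tavg_le s1 mf fC.
have i1 := window_product f mf fC mh hC; have i2 := window_product f mT TC mh hC.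
have i3 := L1B (mu := leb) i1 i2.
rewrite -(IntB (mu := leb) i1 i2).
have [wi wI] := win_L1.
have -> : C * s * (Cphi * Cq * (b - a)) = \int[leb]_t (C * s * (Cphi * Cq) * win t).
  by rewrite (IntZl (mu := leb) _ wi) wI; ring.
apply: Int_norm_le_ae => //.
- exact: L1_measurable i3.
- exact: (L1Zl (mu := leb) _ wi).
- by move=> t; rewrite !mulr_ge0// ltW.
have FF := ae_filter_ringOfSetsType leb.
have := close_ae fi fC s1 s2 H; apply: filterS => t ht.
have [h1|h1] := boolP (a <= t <= b); last first.
  by rewrite phi0 ?mul0r ?subrr ?normr0 ?mulr_ge0 ?(ltW s1)//; exact/negP.
rewrite win_in// mulr1 -mulrBl -mulrBr !normrM mulrAC [leRHS]mulrC.
by rewrite !ler_pM ?mulr_ge0//; exact: ht.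
Qed.

(** Plays the role of an Aubin-Lions argument for scalar functions of time. Replacing p by its
    average at scale s costs C s uniformly in n; at fixed s the averages converge pointwise and
    boundedly, hence strongly, and their product with the weakly convergent q passes to the
    limit. *)
Lemma time_compactness :
  \int[leb]_t (phi t * p n t * q n t) @[n --> \oo] --> \int[leb]_t (phi t * poo t * qoo t).
Proof.
have [wi wI] := win_L1.
set K := Cphi * Cq * (b - a).
have K0 : 0 <= K by rewrite !mulr_ge0// subr_ge0.
apply/cvgrPdist_le => d d0.
have CK : 0 < 4 * (C * K + 1) by rewrite mulr_gt0// ltr_wpDl// mulr_ge0.
(* This s makes each replacement of p by its average cost at most d / 4; the minimum keeps [H1] and
   [H2] applicable. *)
pose s := Num.min s0 (d / (4 * (C * K + 1))).
have s_gt0 : 0 < s by rewrite lt_min s0_gt0 divr_gt0.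
have ss0 : s <= s0 by rewrite ge_min lexx.
have sCK : C * s * K <= d / 4.
  have h : s <= d / (4 * (C * K + 1)) by rewrite ge_min lexx orbT.
  rewrite mulrAC; apply: (@le_trans _ _ (C * K * (d / (4 * (C * K + 1))))).
    by rewrite ler_wpM2l// mulr_ge0.
  have -> : C * K * (d / (4 * (C * K + 1))) = d / 4 * (C * K / (C * K + 1)).
    by field; rewrite gt_eqF// ltr_wpDl// mulr_ge0.
  rewrite ler_piMr ?divr_ge0 ?(ltW d0)// ler_pdivrMr ?mul1r ?lerDl ?ler01//.
  by rewrite ltr_wpDl// mulr_ge0.
have mTn n := tavg_measurable s (mp n); have TnC n := tavg_le s_gt0 (mp n) (pC n).
have mT := tavg_measurable s mpoo; have TC := tavg_le s_gt0 mpoo pooC.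
have e1 n := error_le (pi n) (pC n) s_gt0 ss0 (fun s' t h1 h2 h3 => H2 n h1 h2 ss0 h3) (mq n) (qC n).
have e2 := error_le pooi pooC s_gt0 ss0 (fun s' t h1 h2 h3 => H2oo h1 h2 ss0 h3) mqoo qooC.
have c1 : \int[leb]_t (win t * `|tavg s (p n) t - tavg s poo t|) @[n --> \oo] --> (0 : R).
  rewrite -[X in _ --> X](Int_0 leb).
  apply: (Int_cvg (mu := leb) (F := fun n t => win t * `|tavg s (p n) t - tavg s poo t|)
     (g := fun t => win t * (2 * Cp))).
  - move=> n; apply: measurable_funM; first exact: L1_measurable wi.
    by apply: measurableT_comp => //; exact: measurable_funB (mTn n) mT.
  - exact: (L1Zr (mu := leb) _ wi).
  - move=> t; have [h1|h1] := boolP (a <= t <= b).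
      rewrite -[X in _ --> X](mulr0 (win t)); apply: cvgM; first exact: cvg_cst.
      rewrite -(normr0 R) -(subrr (tavg s poo t)); apply: cvg_norm.
      by apply: cvgB; [exact: H1|exact: cvg_cst].
    have h1' : ~ (a <= t <= b) by exact/negP.
    by under eq_fun do rewrite (win_out h1') mul0r; exact: cvg_cst.
  - move=> t n; rewrite normrM normr_id (ger0_norm (win_ge0 t)) ler_wpM2l//.
    by apply: (le_trans (ler_normB _ _)); have := TnC n t; have := TC t; lra.
have e3 n : `|\int[leb]_t (phi t * tavg s (p n) t * q n t) - \int[leb]_t (phi t * tavg s poo t * q n t)|
    <= Cphi * Cq * \int[leb]_t (win t * `|tavg s (p n) t - tavg s poo t|).
  have i1 := window_product (p n) (mTn n) (TnC n) (mq n) (qC n).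
  have i2 := window_product (p n) mT TC (mq n) (qC n).
  have i3 : L1 leb (fun t => win t * `|tavg s (p n) t - tavg s poo t|).
    under [X in L1 _ X]eq_fun do rewrite mulrC.
    apply: (L1_bmul (mu := leb) (c := 2 * Cp) _ _ wi).
      by apply: measurableT_comp => //; exact: measurable_funB (mTn n) mT.
    move=> t; rewrite normr_id.
    by apply: (le_trans (ler_normB _ _)); have := TnC n t; have := TC t; lra.
  rewrite -(IntB (mu := leb) i1 i2) -(IntZl (mu := leb) _ i3).
  apply: (Int_norm_le (mu := leb)); first exact: L1_measurable (L1B (mu := leb) i1 i2).
    exact: (L1Zl (mu := leb)).
  move=> t; have [h1|h1] := boolP (a <= t <= b); last first.
    by rewrite phi0 ?mul0r ?subrr ?normr0 ?mulr_ge0//; exact/negP.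
  rewrite win_in// mul1r -mulrBl -mulrBr !normrM mulrAC.
  by rewrite ler_wpM2r// ler_pM.
have c2 : \int[leb]_t (phi t * tavg s poo t * q n t) @[n --> \oo] -->
    \int[leb]_t (phi t * tavg s poo t * qoo t).
  apply: (H3 (Cg := Cphi * Cp)).
  - exact: measurable_funM.
  - by move=> t; rewrite normrM ler_pM.
  - by move=> t /phi0 ->; rewrite mul0r.
have KK : 0 < Cphi * Cq + 1 by rewrite ltr_wpDl// mulr_ge0.
have /cvgrPdist_le/(_ (d / 4) ltac:(by rewrite divr_gt0)) := c2.
have /cvgrPdist_le/(_ (d / 4 / (Cphi * Cq + 1)) ltac:(by rewrite !divr_gt0)) := c1.
apply: filterS2 => n; rewrite sub0r normrN => /(le_trans (ler_norm _)) h1 h2.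
have h3 : Cphi * Cq * \int[leb]_t (win t * `|tavg s (p n) t - tavg s poo t|) <= d / 4.
  apply: (@le_trans _ _ (Cphi * Cq * (d / 4 / (Cphi * Cq + 1)))).
    by rewrite ler_wpM2l// mulr_ge0.
  by rewrite mulrCA ler_piMr ?divr_ge0 ?(ltW d0)// ler_pdivrMr// mul1r lerDl ler01.
have h4 := le_trans (e3 n) h3; have h5 := e1 n; rewrite /K in sCK.
exact: (four_steps sCK e2 h2 h4 h5).
Qed.

End compactness.

End time_kernel.

(** * Uniform boundedness *)

Section gliding_hump.
Context (R : realType).
Implicit Types (s t C D : R) (a b : 'I_2 -> plane R -> R).
Local Notation leb := (@lebesgue_measure R).

(** The sign e_k is that of the preceding partial sum times that of b_kk, so the diagonal term adds
    to the earlier ones in absolute value instead of cancelling. Lists record the earlier signs, on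
    all of which e_k depends. *)
Lemma sign_choice (b : nat -> nat -> R) : exists e : nat -> R,
  (forall j, `|e j| = 1) /\ forall k, `|b k k| <= `|\sum_(j < k.+1) e j * b k j|.
Proof.
pose sg (x : R) : R := if 0 <= x then 1 else -1.
have sg1 x : `|sg x| = 1 by rewrite /sg; case: ifP; rewrite ?normrN normr1.
have sgx x : sg x * x = `|x|.
  rewrite /sg; case: ifPn => h; first by rewrite mul1r ger0_norm.
  by rewrite mulN1r ltr0_norm// ltNge.
pose fix L k : seq R := if k is k'.+1 then
  rcons (L k') (sg (\sum_(j < k') (L k')`_j * b k' j) * sg (b k' k')) else [::].
have sL k : size (L k) = k by elim: k => // k IH /=; rewrite size_rcons IH.
pose e j := (L j.+1)`_j.
have Le k j : (j < k)%N -> (L k)`_j = e j.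
  elim: k => // k IH; rewrite ltnS leq_eqVlt => /orP[/eqP -> //|jk].
  by rewrite [L k.+1]/= nth_rcons sL jk IH.
have eE k : e k = sg (\sum_(j < k) e j * b k j) * sg (b k k).
  rewrite {1}/e /= nth_rcons sL ltnn eqxx; congr (sg _ * _).
  by apply: eq_bigr => j _; rewrite Le.
exists e; split=> [j|k]; first by rewrite eE normrM !sg1 mulr1.
rewrite big_ord_recr /= eE; set S := \sum_(j < k) _.
have -> : S + sg S * sg (b k k) * b k k = sg S * (`|S| + `|b k k|).
  by rewrite mulrDr -mulrA sgx -{1}(sgx S) mulrA -expr2 -[sg S ^+ 2]real_normK ?num_real// sg1 expr1n mul1r.
by rewrite normrM sg1 mul1r ger0_norm ?lerDr// addr_ge0.
Qed.

(** Cut [0, oo[ into intervals of length D: countably many null pieces would make B null. *)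
Lemma small_subset (B : set R) D : measurable B -> (forall t, B t -> 0 <= t) ->
  leb B != 0 -> 0 < D -> exists A, [/\ measurable A, A `<=` B, leb A != 0 & (leb A <= D%:E)%E].
Proof.
move=> mB B0 Bn D0.
pose F (i : nat) : set R := B `&` `[i%:R * D, i.+1%:R * D[%classic.
have mF i : measurable (F i) by apply: measurableI.
have [i Fi] : exists i, leb (F i) != 0.
  apply: contrapT => H; have N : leb.-negligible (\bigcup_i F i).
    apply: negligible_bigcup => i; apply/negligibleP; first exact: mF.
    by apply: contrapT => h; apply: H; exists i; apply/eqP => h'; exact: h.
  have BF : B `<=` \bigcup_i F i.
    move=> t Bt; have t0 := B0 _ Bt; have tD0 : 0 <= t / D by rewrite divr_ge0// ltW.
    have /andP[h1 h2] := truncn_itv tD0; exists (Num.truncn (t / D)) => //; split => //=.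
    by rewrite in_itv /= -ler_pdivlMr// h1 -ltr_pdivrMr.
  move/eqP: Bn; apply; apply/negligibleP; first exact: mB.
  by case: N => Z [mZ Z0 sZ]; exists Z; split => //; exact: subset_trans sZ.
exists (F i); split => //; first by move=> t [].
have E : leb `[i%:R * D, i.+1%:R * D[%classic = D%:E.
  apply: (etrans (lebesgue_measure_itv _)); rewrite /= lte_fin ltr_pM2r// ltr_nat ltnSn.
  by rewrite -EFinD -mulrBl -natrB// subSnn mul1r.
apply: (@le_trans _ _ (leb `[(i%:R * D)%R, (i.+1%:R * D)%R[%classic)); last by rewrite E.
by apply: le_measure; rewrite ?inE; [exact: mF|exact: measurable_itv|move=> t []].
Qed.

(** Each set loses all the later ones. Since the measures decrease by a factor of at least 4, the
    later sets have total measure at most half that of A_j. *)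
Lemma disjointification (A : nat -> set R) (m : nat -> R) :
  (forall j, measurable (A j)) -> (forall j, leb (A j) = (m j)%:E) ->
  (forall j, 0 < m j) -> (forall j, m j.+1 <= m j / 4) ->
  exists A' : nat -> set R, [/\ forall j, measurable (A' j), forall j, A' j `<=` A j,
    forall i j t, A' i t -> A' j t -> i = j & forall j, ((m j / 2)%:E <= leb (A' j))%E].
Proof.
move=> mA lA m0 m4; pose U j := \bigcup_i A (j.+1 + i)%N.
have mU j : measurable (U j) by exact: bigcupT_measurable.
exists (fun j => A j `\` U j); split.
- by move=> j; exact: measurableD.
- by move=> j t [].
- have lt i j t : (i < j)%N -> (A i `\` U i) t -> (A j `\` U j) t -> False.
    move=> ij [_ Ui] [Aj _]; apply: Ui; exists (j - i.+1)%N => //.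
    by rewrite subnKC.
  move=> i j t h1 h2; have [ij|ij|//] := ltngtP i j; exfalso; [exact: lt ij h1 h2|exact: lt ij h2 h1].
move=> j.
have mi i : m (j.+1 + i)%N <= m j / 2 / (2 ^ i.+1)%:R.
  elim: i => [|i IH]; first by rewrite addn0 expn1; have := m4 j; lra.
  rewrite addnS; apply: (le_trans (m4 _)); rewrite expnS natrM invfM mulrA.
  have p := m0 (j.+1 + i)%N; lra.
have lU : (leb (U j) <= (m j / 2)%:E)%E.
  apply: (@le_trans _ _ (\big[+%E/0%R]_(0 <= i <oo) leb (A (j.+1 + i)%N))%E).
    exact: (@measure_sigma_subadditive _ R _ leb (U j) (fun i => A (j.+1 + i)%N) (fun i => mA _) (mU j) (@subset_refl _ (U j))).
  apply: le_trans (@epsilon_trick0 R (m j / 2) xpredT _); last by rewrite divr_ge0// ltW.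
  by apply: lee_nneseries => // i _; rewrite lA lee_fin.
have sub : A j `<=` (A j `\` U j) `|` U j.
  by move=> t At; have [h|h] := pselect (U j t); [right|left].
have mD : measurable (A j `\` U j) by exact: measurableD.
have mDU : measurable ((A j `\` U j) `|` U j) by apply: measurableU => //; exact: mU.
have l1 : ((m j)%:E <= leb (A j `\` U j) + leb (U j))%E.
  have h1 : (leb (A j) <= leb ((A j `\` U j) `|` U j))%E.
    by apply: le_measure; rewrite ?inE//; exact: mA.
  rewrite -lA; apply: (le_trans h1).
  by apply: measureU2 => //; exact: mU.
have := le_trans l1 (leeD2l _ lU).
case: (leb (A j `\` U j)) => [r| |]; rewrite ?leey//.
by rewrite -EFinD !lee_fin; lra.
Qed.

Definition inner a b : R := \int[leb2]_x (a 0 x * b 0 x) + \int[leb2]_x (a 1 x * b 1 x).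

Lemma inner_norm_le a b D : (forall i, L2 (a i)) -> (forall i, L2 (b i)) -> 0 < D ->
  2 * `|inner a b| <= D * energy a + D^-1 * energy b.
Proof.
move=> a2 b2 D0.
have h i : 2 * `|\int[leb2]_x (a i x * b i x)| <=
    D * \int[leb2]_x (a i x ^+ 2) + D^-1 * \int[leb2]_x (b i x ^+ 2).
  have i1 := L1Zl (mu := leb2) D (a2 i).2; have i2 := L1Zl (mu := leb2) D^-1 (b2 i).2.
  rewrite -(IntZl (mu := leb2) _ (a2 i).2) -(IntZl (mu := leb2) _ (b2 i).2) -(IntD (mu := leb2) i1 i2).
  rewrite -(ger0_norm (ler0n R 2)) -normrM -(IntZl (mu := leb2) _ (L2_prod (a2 i) (b2 i))).
  apply: (Int_norm_le (mu := leb2)).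
  - exact: L1_measurable (L1Zl (mu := leb2) 2 (L2_prod (a2 i) (b2 i))).
  - exact: (L1D (mu := leb2) i1 i2).
  - by move=> x; rewrite normrM (ger0_norm (ler0n R 2)); exact: young_le.
rewrite /inner /energy; have := h 0; have := h 1.
have := ler_normD (\int[leb2]_x (a 0 x * b 0 x)) (\int[leb2]_x (a 1 x * b 1 x)); lra.
Qed.

Lemma energy_ge0 a : 0 <= energy a.
Proof. by apply: addr_ge0; apply: Int_ge0 => x; exact: sqr_ge0. Qed.

Lemma innerZ a b c : (forall i, L2 (a i)) -> (forall i, L2 (b i)) ->
  inner a (fun i x => c * b i x) = c * inner a b.
Proof.
move=> a2 b2; rewrite /inner mulrDr -!(IntZl (mu := leb2) _ (L2_prod (a2 _) (b2 _))).
by congr (_ + _); apply: Int_ext => x; exact: mulrCA.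
Qed.

Lemma energyZ b c : (forall i, L2 (b i)) -> energy (fun i x => c * b i x) = c ^+ 2 * energy b.
Proof.
move=> b2; rewrite /energy mulrDr -!(IntZl (mu := leb2) _ (b2 _).2).
by congr (_ + _); apply: Int_ext => x; exact: exprMn.
Qed.

(** [inner_norm_le] with the optimal weight q / p. *)
Lemma inner_cs a b (p q : R) : (forall i, L2 (a i)) -> (forall i, L2 (b i)) -> 0 < p -> 0 < q ->
  energy a <= p ^+ 2 -> energy b <= q ^+ 2 -> `|inner a b| <= p * q.
Proof.
move=> a2 b2 p0 q0 ap bq; have D0 : 0 < q / p by rewrite divr_gt0.
have := inner_norm_le a2 b2 D0.
have h1 : q / p * energy a <= q * p.
  apply: (@le_trans _ _ (q / p * p ^+ 2)); first by rewrite ler_wpM2l// ltW.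
  by rewrite expr2 mulrA divfK ?gt_eqF.
have h2 : (q / p)^-1 * energy b <= q * p.
  rewrite invf_div; apply: (@le_trans _ _ (p / q * q ^+ 2)); first by rewrite ler_wpM2l// divr_ge0// ltW.
  by rewrite expr2 mulrA divfK ?gt_eqF// mulrC.
by rewrite [p * q]mulrC; lra.
Qed.

Lemma jmeas_inner (f g : 'I_2 -> R -> plane R -> R) : (forall i, jmeas (f i)) -> (forall i, jmeas (g i)) ->
  measurable_fun setT (fun t => inner (f ^~ t) (g ^~ t)).
Proof.
move=> mf mg; have m i : measurable_fun setT (fun t => \int[leb2]_x (f i t x * g i t x)).
  by apply: (jmeas_Int (F := fun t x => f i t x * g i t x)); exact: measurable_funM (mf i) (mg i).
by apply: measurable_funD.
Qed.

End gliding_hump.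

Section uniform_bound.
Context (R : realType) (T : R) (u : nat -> 'I_2 -> R -> plane R -> R).
Implicit Types (s t : R).
Local Notation leb := (@lebesgue_measure R).
Local Notation at_time f t := (fun i => f i t).
Hypotheses (mu_ : forall n i, jmeas (u n i)) (u2 : forall n t i, L2 (u n i t)).
Hypothesis uT : forall n i t x, ~ `]0, T[%classic t -> u n i t x = 0.
Hypothesis uC : forall n, exists C : R, forall t, energy (at_time (u n) t) <= C.
Hypothesis weak_bound : forall psi : 'I_2 -> R -> plane R -> R, (forall i, jmeas (psi i)) ->
  (forall t i, L2 (psi i t)) -> (forall i t, exists c n, psi i t = (fun x => c * u n i t x)) ->
  (\int[leb]_t (Num.sqrt (energy (at_time psi t)))%:E < +oo)%E ->
  exists B : R, forall n, `|\int[leb]_t inner (at_time (u n) t) (at_time psi t)| <= B.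

Let E n t : R := energy (at_time (u n) t).

Let mE n : measurable_fun setT (E n).
Proof. exact: (jmeas_inner (mu_ n) (mu_ n)). Qed.

Let E0 n t : ~ `]0, T[%classic t -> E n t = 0.
Proof.
move=> tT; have z i : \int[leb2]_x (u n i t x ^+ 2) = 0.
  rewrite -[RHS](Int_0 leb2); apply: Int_ext => x; by rewrite uT// expr0n.
by rewrite /E /energy !z addr0.
Qed.

(* Times at which the energy of u n is within a factor 4 of its (large) essential
   supremum. *)
Let piece (B D : R) (X : nat * R * set R) := [/\ B <= X.1.2, {ae leb, forall t, E X.1.1 t <= X.1.2},
  measurable X.2, (forall t, X.2 t -> X.1.2 / 4 < E X.1.1 t <= X.1.2) &
  leb X.2 != 0 /\ (leb X.2 <= D%:E)%E].

Let piece_exists : ~ (exists C : R, forall n, {ae leb, forall t, E n t <= C}) ->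
  forall B D : R, 0 < B -> 0 < D -> exists X, piece B D X.
Proof.
move=> unb B D B0 D0.
have [n Hn] : exists n, ~ {ae leb, forall t, E n t <= B}.
  by apply: contrapT => H; apply: unb; exists B => n; apply: contrapT => h; apply: H; exists n.
(* For the least m such that B 4^m is an essential bound, a quarter of that bound is exceeded on a
   set of positive measure. *)
pose P m := `[< {ae leb, forall t, E n t <= B * 4 ^+ m} >].
have exP : exists m, P m.
  have [C HC] := uC n; have CB0 : 0 <= `|C| / B by rewrite divr_ge0// ltW.
  have /andP[_ h] := truncn_itv CB0; exists (Num.truncn (`|C| / B)).+1; apply/asboolP.
  apply: aeW => t; apply: (le_trans (HC t)); apply: (le_trans (ler_norm _)).
  rewrite ltr_pdivrMr// in h; apply: (le_trans (ltW h)); rewrite mulrC ler_wpM2l ?(ltW B0)//.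
  rewrite -natrX ler_nat; exact: ltnW (ltn_expl _ _).
have [m /asboolP Pm mmin] := ex_minnP exP.
have m0 : (0 < m)%N.
  by rewrite lt0n; apply/eqP => m0; apply: Hn; move: Pm; rewrite m0 expr0 mulr1.
have a4 : B * 4 ^+ m / 4 = B * 4 ^+ m.-1 by rewrite -[in LHS](prednK m0) exprSr mulrA mulfK.
have nP : ~ {ae leb, forall t, E n t <= B * 4 ^+ m / 4}.
  rewrite a4 => h; have := mmin m.-1; rewrite /P => /(_ (introT (asboolP _) h)).
  by rewrite -[X in (X <= _)%N](prednK m0) ltnn.
pose S := [set t | B * 4 ^+ m / 4 < E n t <= B * 4 ^+ m].
have mS : measurable S.
  have -> : S = setT `&` [set t | B * 4 ^+ m / 4 < E n t] `&` (setT `&` [set t | E n t <= B * 4 ^+ m]).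
    by rewrite !setTI; apply/seteqP; split => t; [by move=> /andP|by move=> ?; apply/andP].
  apply: measurableI; first exact: (measurable_fun_ltr (measurable_cst _) (mE n)).
  exact: (measurable_fun_ler (mE n) (measurable_cst _)).
have S0 : leb S != 0.
  apply/eqP => S0; apply: nP; have FF := ae_filter_ringOfSetsType leb.
  have nS : {ae leb, forall t, ~ S t}.
    by exists S; split=> // t /= /contrapT.
  apply: filterS2 Pm nS => t h1 h2; rewrite leNgt; apply/negP => h3; apply: h2.
  by rewrite /S /= h3 h1.
have St t : S t -> 0 <= t.
  move=> St; have [tT|/E0 Et] := pselect (`]0, T[%classic t).
    by move: tT; rewrite /= in_itv /= => /andP[/ltW].
  by move: St; rewrite /S /= Et ltNge divr_ge0// mulr_ge0 ?(ltW B0)// exprn_ge0.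
have [A [mA AS A0 AD]] := small_subset mS St S0 D0.
exists (n, B * 4 ^+ m, A); split=> //=.
by rewrite ler_peMr ?(ltW B0)// exprn_ege1// ler1n.
Qed.

(** A Banach-Steinhaus theorem by hand. Without a uniform bound there are disjoint sets of times A_j
    and indices n_j such that the norm of u_{n_j} on A_j grows at least like 32^j; one field psi,
    equal on A_j to a multiple of u_{n_j}, then has unbounded pairings. Since psi is at each time a
    multiple of some u n, [weak_bound] can be restricted to such fields. *)
Lemma weak_star_bounded : exists C : R, forall n, {ae leb, forall t, E n t <= C}.
Proof.
apply: contrapT => unb.
(* The norms grow at least like 32^j and the weights in psi decay like 16^-j: the products are at
   least 2^j, while the weights are summable with a tail that the diagonal term dominates. *)
have [q q32] : exists q : R, q = 32 by exists 32.
have [r r16] : exists r : R, r = 16^-1 by exists 16^-1.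
have q0 : 0 < q by rewrite q32.
have r0 : 0 < r by rewrite r16 invr_gt0.
have rj0 j : 0 <= r ^+ j by rewrite exprn_ge0// ltW.
have q2j j : 0 < (q ^+ 2) ^+ j by rewrite !exprn_gt0.
have /choice[F HF] : forall q : R * R, exists X, 0 < q.1 -> 0 < q.2 -> piece q.1 q.2 X.
  move=> [B D]; have [/andP[B0 D0]|h] := boolP ((0 < B) && (0 < D)).
    by have [X HX] := piece_exists unb B0 D0; exists X.
  by exists (0%N, 0, set0) => /= B0 D0; move: h; rewrite B0 D0.
(* Each set of times gets at most a quarter of the measure of the previous one, as
   [disjointification] requires. *)
pose fix X j : nat * R * set R := if j is j'.+1 then
  F ((q ^+ 2) ^+ j'.+1, fine (leb (X j').2) / 4) else F (1, 1).
pose m j := fine (leb (X j).2).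
have pos j : (exists D, piece ((q ^+ 2) ^+ j) D (X j)) -> leb (X j).2 = (m j)%:E /\ 0 < m j.
  move=> [D [_ _ mA _ [l0 lD]]].
  have fn : leb (X j).2 \is a fin_num.
    by rewrite ge0_fin_numE// (le_lt_trans lD)// ltry.
  rewrite /m fineK//; split=> //; rewrite lt0r fine_ge0// andbT; apply: contra l0 => /eqP l0.
  by rewrite -(fineK fn) l0.
have HX j : piece ((q ^+ 2) ^+ j) (if j is j'.+1 then m j' / 4 else 1) (X j).
  elim: j => [|j IH]; first exact: (HF (1, 1) ltr01 ltr01).
  have exD : exists D, piece ((q ^+ 2) ^+ j) D (X j) by eexists; exact: IH.
  have [_ mj] := pos j exD.
  by apply: (HF ((q ^+ 2) ^+ j.+1, m j / 4) (q2j _)); rewrite /= divr_gt0.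
have lX j : leb (X j).2 = (m j)%:E /\ 0 < m j by apply: pos; eexists; exact: HX.
have m4 j : m j.+1 <= m j / 4.
  have [_ _ _ _ [_]] := HX j.+1; by rewrite (lX _).1 lee_fin.
have mX j : measurable (X j).2 by have [] := HX j.
have [A [mA AX Adisj Abig]] := disjointification mX (fun j => (lX j).1) (fun j => (lX j).2) m4.
pose n j := (X j).1.1; pose a j := (X j).1.2; pose N j := Num.sqrt (a j).
have aB j : (q ^+ 2) ^+ j <= a j by have [] := HX j.
have a0 j : 0 < a j by exact: lt_le_trans (q2j j) (aB j).
have N0 j : 0 < N j by rewrite sqrtr_gt0.
have N2 j : N j ^+ 2 = a j by rewrite sqr_sqrtr// ltW.
have NB j : q ^+ j <= N j.
  rewrite -(ler_pXn2r (n := 2)) ?nnegrE ?exprn_ge0 ?(ltW q0) ?(ltW (N0 j))// N2 exprAC.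
  exact: aB.
have EA j t : A j t -> a j / 4 < E (n j) t <= a j by move=> /AX; have [_ _ _ + _] := HX j; apply.
have Eae j : {ae leb, forall t, E (n j) t <= N j ^+ 2} by rewrite N2; have [] := HX j.
have lA j : leb (A j) \is a fin_num.
  rewrite ge0_fin_numE//; apply: (@le_lt_trans _ _ (leb (X j).2)).
    by apply: le_measure; rewrite ?inE; [exact: mA|exact: mX|exact: AX].
  by rewrite (lX j).1 ltry.
pose l j := fine (leb (A j)).
have lE j : leb (A j) = (l j)%:E by rewrite fineK.
have l0 j : 0 < l j.
  have := Abig j; rewrite lE lee_fin; apply: lt_le_trans.
  by rewrite divr_gt0//; exact: (lX j).2.
pose one j t : R := \1_(A j) t.
pose I k j t := inner (at_time (u (n k)) t) (at_time (u (n j)) t).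
have mI k j : measurable_fun setT (I k j) by exact: jmeas_inner.
(* Contribution of A_j to the pairing of u_{n_k} with psi, up to the sign e_j still to be chosen. *)
pose b k j := \int[leb]_t (one j t * I k j t) * (r ^+ j / (N j * l j)).
have Nl j : 0 < N j * l j by rewrite mulr_gt0.
have cs k : {ae leb, forall t, forall j, A j t -> `|I k j t| <= N k * N j}.
  have FF := ae_filter_ringOfSetsType leb; apply: filterS (Eae k) => t h j Aj.
  apply: inner_cs => //; rewrite -/(E _ _) ?N2//.
  by case/andP: (EA _ _ Aj).
pose h j t : R := one j t * (r ^+ j / l j).
have h0 j t : 0 <= h j t by rewrite mulr_ge0// ?divr_ge0 ?rj0 ?(ltW (l0 j))// /one indicE.
have Int_one j : \int[leb]_t one j t = l j.
  have E1 : (\int[leb]_t (one j t)%:E)%E = leb (A j).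
    apply: (etrans (integral_indic leb measurableT (mA j))); congr (leb _); exact: setIT.
  exact: (congr1 fine E1).
have mone j : measurable_fun setT (one j) by exact: measurable_indic.
have mh j : measurable_fun setT (h j) by apply: measurable_funM.
have Ih j : (\int[leb]_t (h j t)%:E = (r ^+ j)%:E)%E.
  have i1 : L1 leb (one j) by apply: (L1_indic (mu := leb)); [exact: mA|rewrite -ge0_fin_numE//; exact: lA].
  rewrite -(EFin_Int (mu := leb) (L1Zr (mu := leb) _ i1)) (IntZr (mu := leb) _ i1); congr EFin.
  rewrite Int_one.
  by rewrite mulrC divfK// gt_eqF.
pose H J t := (\big[+%E/0%R]_(0 <= i <oo) (h (J + i)%N t)%:E)%E.
have IH J : (\int[leb]_t H J t <= (2 * r ^+ J)%:E)%E.
  rewrite /H integral_nneseries//; last 2 first.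
  - by move=> i; apply/measurable_EFinP; exact: mh.
  - by move=> i t _; rewrite lee_fin.
  apply: le_trans (@epsilon_trick0 R (2 * r ^+ J) xpredT _); last first.
    by rewrite mulr_ge0// rj0.
  apply: lee_nneseries => // i _; first by rewrite integral_ge0// => t _; rewrite lee_fin.
  rewrite Ih lee_fin exprD mulrAC mulrC ler_wpM2r ?rj0//.
  have -> : 2 / (2 ^ i.+1)%:R = (2^-1 : R) ^+ i.
    by rewrite expnS natrM invfM mulrA divff// mul1r natrX exprVn.
  by rewrite lerXn2r ?nnegrE ?invr_ge0 ?(ltW r0)// r16 lef_pV2 ?posrE// ler_nat.
have hH J j t : (J <= j)%N -> ((h j t)%:E <= H J t)%E.
  move=> Jj; apply: le_trans (@nneseries_lim_ge R (fun i => (h (J + i)%N t)%:E) xpredT 0 (j - J).+1 _); last first.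
    by move=> i _ _; rewrite lee_fin.
  rewrite big_nat_recr //= subnKC// leeDr// sume_ge0// => i _.
  by rewrite lee_fin.
have mH J : measurable_fun setT (H J).
  by apply: ge0_emeasurable_sum => i *; [rewrite lee_fin|apply/measurable_EFinP; exact: mh].
have [e [e1 eb]] := sign_choice b.
(* On A_j, of measure l_j, the norm of psi is then at most r^j / l_j, so A_j contributes at most r^j
   to the L^1(L^2) norm of psi. *)
pose c j := e j * (r ^+ j / (N j * l j)).
pose psiJ J i t x := \sum_(j < J) one j t * (c j * u (n j) i t x).
pose U := \bigcup_j A j.
(* The index of the only A_j containing t; the default 0 has no effect because [psi] vanishes off
   U. *)
pose ix t := xget 0%N [set j | A j t].
have ixA j t : A j t -> ix t = j.
  by move=> Aj; apply: (Adisj _ _ t _ Aj); exact: (@xgetPex _ 0%N [set j | A j t] (ex_intro _ j Aj)).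
pose psi i t x := \1_U t * c (ix t) * u (n (ix t)) i t x.
have psiA j i t x : A j t -> psi i t x = c j * u (n j) i t x.
  by move=> Aj; rewrite /psi (ixA _ _ Aj) indic_in ?mul1r//; exists j.
have psiU i t x : ~ U t -> psi i t x = 0 by move=> Ut; rewrite /psi indic_out// !mul0r.
have oneA j t k : A j t -> one k t = (k == j)%:R.
  move=> Aj; have [->|kj] := eqVneq k j; first by rewrite /one indic_in.
  by rewrite /one indic_out// => Ak; move/eqP: kj; apply; exact: Adisj Ak Aj.
have oneU t k : ~ U t -> one k t = 0 by move=> Ut; rewrite /one indic_out// => Ak; apply: Ut; exists k.
have sumA (G : nat -> R) j t J : A j t -> \sum_(k < J) one k t * G k = (j < J)%:R * G j.
  move=> Aj; elim: J => [|J IHJ]; first by rewrite big_ord0 mul0r.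
  rewrite big_ord_recr /= IHJ (oneA _ _ _ Aj) ltnS [(j <= J)%N]leq_eqVlt [j == J]eq_sym.
  by case: eqVneq => [->|_]; rewrite /= ?ltnn ?mul0r ?add0r ?addr0.
have sumU (G : nat -> R) t J : ~ U t -> \sum_(k < J) one k t * G k = 0.
  by move=> Ut; rewrite big1// => k _; rewrite oneU// mul0r.
have mpsi i : jmeas (psi i).
  have mJ J : measurable_fun setT (fun z : R * plane R => psiJ J i z.1 z.2).
    apply: measurable_sum => j; apply: measurable_funM.
      by apply: (measurableT_comp (f := one j)) => //; exact: measurable_fst.
    by apply: measurable_funM => //; exact: mu_.
  apply: (measurable_fun_cvg mJ) => -[t x] _ /=; apply: cvg_near_cst; have [[j _ Aj]|Ut] := pselect (U t).
    exists j.+1 => // J /= jJ; rewrite /psiJ (sumA (fun j => c j * u (n j) i t x) _ _ _ Aj) jJ mul1r.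
    by rewrite (psiA _ _ _ _ Aj).
  by apply: nearW => J; rewrite psiU// /psiJ (sumU (fun j => c j * u (n j) i t x)).
have psi2 t i : L2 (psi i t) by apply: (L2Z _ (u2 _ _ _)).
have psiu i t : exists c n, psi i t = (fun x => c * u n i t x) by exists (\1_U t * c (ix t)), (n (ix t)).
have nrm t : ((Num.sqrt (energy (at_time psi t)))%:E <= H 0%N t)%E.
  have [[j _ Aj]|Ut] := pselect (U t).
    apply: le_trans (hH 0%N j t _) => //; rewrite lee_fin /h (oneA _ _ _ Aj) eqxx mul1r.
    have -> : at_time psi t = (fun i x => c j * u (n j) i t x).
      by apply/funext => i; apply/funext => x; exact: psiA.
    rewrite energyZ// sqrtrM ?sqr_ge0// sqrtr_sqr /c normrM e1 mul1r ger0_norm ?divr_ge0 ?rj0 ?(ltW (Nl j))//.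
    have h1 : Num.sqrt (E (n j) t) <= N j by rewrite ler_sqrt ?(ltW (a0 j))//; case/andP: (EA _ _ Aj).
    apply: (@le_trans _ _ (r ^+ j / (N j * l j) * N j)).
      by rewrite ler_wpM2l// divr_ge0 ?rj0 ?(ltW (Nl j)).
    by rewrite le_eqVlt; apply/orP; left; apply/eqP; field; rewrite !gt_eqF.
  have -> : at_time psi t = (fun i x => 0 * u (n 0%N) i t x).
    by apply/funext => i; apply/funext => x; rewrite psiU// mul0r.
  rewrite energyZ// expr0n mul0r sqrtr0.
  by apply: le_trans (hH 0%N 0%N t _) => //; rewrite lee_fin.
have mnrm : measurable_fun setT (fun t => Num.sqrt (energy (at_time psi t))).
  apply: (measurableT_comp (f := @Num.sqrt R)); last exact: (jmeas_inner mpsi mpsi).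
  by apply: continuous_measurable_fun; exact: sqrt_continuous.
have H_ge0 J t : (0 <= H J t)%E.
  by apply: le_trans (hH J J t (leqnn _)); rewrite lee_fin.
have fin : (\int[leb]_t (Num.sqrt (energy (at_time psi t)))%:E < +oo)%E.
  apply: (@le_lt_trans _ _ (\int[leb]_t H 0%N t)%E); last by apply: le_lt_trans (IH 0%N) _; rewrite ltry.
  by apply: ge0_le_integral => //; [apply/measurable_EFinP|exact: mH].
have [B HB] := weak_bound mpsi psi2 psiu fin.
pose Fk k t := inner (at_time (u (n k)) t) (at_time psi t).
have mFk k : measurable_fun setT (Fk k) by exact: jmeas_inner.
have FkA k j t : A j t -> Fk k t = c j * I k j t.
  move=> Aj; rewrite /Fk /I -innerZ//; congr inner.
  by apply/funext => i; apply/funext => x; exact: psiA.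
have FkU k t : ~ U t -> Fk k t = 0.
  move=> Ut; rewrite /Fk; have -> : at_time psi t = (fun i x => 0 * u (n 0%N) i t x).
    by apply/funext => i; apply/funext => x; rewrite psiU// mul0r.
  by rewrite innerZ// mul0r.
have cI k j t : `|I k j t| <= N k * N j -> `|c j * I k j t| <= N k * (r ^+ j / l j).
  move=> h1; rewrite normrM /c normrM e1 mul1r ger0_norm ?divr_ge0 ?rj0 ?(ltW (Nl j))//.
  apply: (@le_trans _ _ (r ^+ j / (N j * l j) * (N k * N j))).
    by rewrite ler_wpM2l// divr_ge0 ?rj0 ?(ltW (Nl j)).
  by rewrite le_eqVlt; apply/orP; left; apply/eqP; field; rewrite !gt_eqF.
have tail_le k J (G : R -> R) : measurable_fun setT G ->
    (forall j t, A j t -> (j < J)%N -> G t = 0) -> (forall t, ~ U t -> G t = 0) ->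
    (forall j t, A j t -> (J <= j)%N -> G t = c j * I k j t) ->
    (\int[leb]_t `|(G t)%:E| <= (N k * (2 * r ^+ J))%:E)%E.
  move=> mG GJ GU GA.
  apply: (@le_trans _ _ (\int[leb]_t ((N k)%:E * H J t))%E).
    apply: ae_ge0_le_integral => //.
    - by apply/measurable_EFinP; exact: measurableT_comp.
    - by move=> t _; rewrite mule_ge0// lee_fin ltW.
    - by apply: measurable_funeM; exact: mH.
    have FF := ae_filter_ringOfSetsType leb; apply: filterS (cs k) => t ht _.
    have [[j _ Aj]|Ut] := pselect (U t); last first.
      by rewrite GU//= normr0 mule_ge0// lee_fin ltW.
    have [jJ|Jj] := ltnP j J; first by rewrite (GJ _ _ Aj jJ)/= normr0 mule_ge0// lee_fin ltW.
    rewrite (GA _ _ Aj Jj) /=; apply: (@le_trans _ _ ((N k)%:E * (h j t)%:E)%E).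
      by rewrite -EFinM lee_fin /h (oneA _ _ _ Aj) eqxx mul1r; apply: cI; exact: ht.
    by rewrite lee_wpmul2l ?lee_fin ?(ltW (N0 k))// hH.
  rewrite (ge0_integralZl_EFin leb measurableT (fun t _ => H_ge0 J t) (mH J) (ltW (N0 k))).
  by rewrite [leRHS]EFinM lee_wpmul2l ?lee_fin ?(ltW (N0 k)).
have iFk k : L1 leb (Fk k).
  apply/integrableP; split; first by apply/measurable_EFinP; exact: mFk.
  apply: le_lt_trans (tail_le k 0%N (Fk k) (mFk k) _ _ _) _ => //; first exact: FkU.
    by move=> j t Aj _; exact: FkA.
  by rewrite ltry.
pose F1 k t := \sum_(j < k.+1) one j t * (c j * I k j t).
have i1 k j : L1 leb (fun t => one j t * I k j t).
  have i0 : L1 leb (fun t => one j t * (c j * I k j t)).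
    have m0 : measurable_fun setT (fun t => one j t * (c j * I k j t)).
      by apply: measurable_funM; [exact: mone|exact: measurable_funM (measurable_cst _) (mI k j)].
    apply/integrableP; split; first by apply/measurable_EFinP.
    apply: (@le_lt_trans _ _ (\int[leb]_t `|(Fk k t)%:E|)%E); last by have /integrableP[] := iFk k.
    apply: ge0_le_integral => //.
    - by apply/measurable_EFinP; exact: measurableT_comp.
    - by apply/measurable_EFinP; apply: measurableT_comp => //; exact: mFk.
    move=> t _ /=; rewrite lee_fin; have [Aj|Aj] := pselect (A j t).
      by rewrite (FkA _ _ _ Aj) (oneA _ _ _ Aj) eqxx mul1r.
    by rewrite /one indic_out// mul0r normr0.
  have cj : c j != 0.
    rewrite /c !mulf_neq0 ?invr_neq0 ?expf_neq0 ?(gt_eqF (Nl j)) ?(gt_eqF r0)//.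
    by rewrite -normr_eq0 e1 oner_neq0.
  have := L1Zl (mu := leb) (c j)^-1 i0; rewrite /L1; congr (integrable _ _ _).
  by apply/funext => t /=; congr EFin; field.
have I1 k : \int[leb]_t F1 k t = \sum_(j < k.+1) e j * b k j.
  rewrite /F1 (Int_sum (mu := leb)); last first.
    move=> j; have := L1Zl (mu := leb) (c j) (i1 k j).
    by under [X in L1 _ X -> _]eq_fun do rewrite mulrCA.
  apply: eq_bigr => j _; rewrite /b mulrCA mulrC.
  have -> : \int[leb]_t (one j t * (c j * I k j t)) = \int[leb]_t (c j * (one j t * I k j t)).
    by apply: Int_ext => t; exact: mulrCA.
  by rewrite (IntZl (mu := leb) _ (i1 k j)) /c; ring.
have iF1 k : L1 leb (F1 k).
  apply: (L1_sum (mu := leb)) => j; have := L1Zl (mu := leb) (c j) (i1 k j).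
  by under [X in L1 _ X -> _]eq_fun do rewrite mulrCA.
(* The sets after A_k contribute at most 2 r^(k+1) N_k = N_k r^k / 8, half of the lower bound N_k
   r^k / 4 on the diagonal term; what remains is at least 2^k / 8. *)
have rem k : `|\int[leb]_t Fk k t - \int[leb]_t F1 k t| <= N k * (2 * r ^+ k.+1).
  have iB := L1B (mu := leb) (iFk k) (iF1 k); rewrite -(IntB (mu := leb) (iFk k) (iF1 k)).
  apply: (le_trans (Int_norm (mu := leb) iB)).
  rewrite -lee_fin (EFin_Int (mu := leb) (L1_abs (mu := leb) iB)).
  apply: (tail_le k k.+1 (fun t => Fk k t - F1 k t)).
  - by have := L1_measurable (mu := leb) iB.
  - by move=> j t Aj jk; rewrite (FkA _ _ _ Aj) /F1 (sumA (fun j => c j * I k j t) _ _ _ Aj) jk mul1r subrr.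
  - by move=> t Ut; rewrite FkU// /F1 (sumU (fun j => c j * I k j t))// subrr.
  - move=> j t Aj kj; rewrite (FkA _ _ _ Aj) /F1 (sumA (fun j => c j * I k j t) _ _ _ Aj).
    by rewrite ltnNge kj mul0r subr0.
have bkk k : N k / 4 * r ^+ k <= `|b k k|.
  apply: le_trans (ler_norm _); rewrite /b.
  have ione : L1 leb (one k) by apply: (L1_indic (mu := leb)); [exact: mA|rewrite -ge0_fin_numE//; exact: lA].
  have Ione := Int_one k.
  have low : a k / 4 * l k <= \int[leb]_t (one k t * I k k t).
    rewrite -Ione -(IntZl (mu := leb) _ ione); apply: (Int_le (mu := leb)) => //.
      exact: (L1Zl (mu := leb)).
    move=> t; have [Ak|Ak] := pselect (A k t); last by rewrite /one indic_out// mulr0 mul0r.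
    by rewrite (oneA _ _ _ Ak) eqxx mulr1 mul1r; case/andP: (EA _ _ Ak) => /ltW.
  apply: (@le_trans _ _ (a k / 4 * l k * (r ^+ k / (N k * l k)))); last first.
    by rewrite ler_wpM2r// divr_ge0 ?rj0 ?(ltW (Nl k)).
  rewrite -N2 le_eqVlt; apply/orP; left; apply/eqP; field; rewrite !gt_eqF//.
have final k : 2 ^+ k / 8 <= B.
  have hB := HB (n k); rewrite -/(Fk k _) in hB.
  have := le_trans (bkk k) (eb k); rewrite -I1 => h1.
  have := rem k; move: hB h1; rewrite exprS.
  have -> : (fun t => inner (at_time (u (n k)) t) (at_time psi t)) = Fk k by [].
  move: (\int[leb]_t Fk k t) (\int[leb]_t F1 k t) => x y hB h1 h2.
  have h3 : N k * r ^+ k / 8 <= B.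
    have := ler_normB x (x - y); rewrite (_ : x - (x - y) = y); last by ring.
    have rr : r * r ^+ k = r ^+ k / 16 by rewrite {1}r16 mulrC.
    move: h1 h2; rewrite rr; lra.
  apply: le_trans h3; rewrite ler_pM2r ?invr_gt0//.
  have -> : 2 ^+ k = q ^+ k * r ^+ k :> R by rewrite -exprMn q32 r16; congr (_ ^+ _); field.
  by rewrite ler_wpM2r// rj0.
have B0 : 0 <= B by have := final 0%N; rewrite expr0; lra.
have /andP[_ hB] := truncn_itv (mulr_ge0 (ler0n R 8) B0).
have := final (Num.truncn (8 * B)).+1.
have : (Num.truncn (8 * B)).+1%:R <= 2 ^+ (Num.truncn (8 * B)).+1 :> R.
  by rewrite -natrX ler_nat ltnW// ltn_expl.
lra.
Qed.

End uniform_bound.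

(** * Test fields *)

Section test_fields.
Context (R : realType).

(** Read off the explicit second derivatives of a radial function; it is what makes [curl_obs]
    solenoidal. *)
Lemma rho_pderiv_sym (d : R) z :
  pderiv 0 (pderiv 1 (rho d)) z = pderiv 1 (pderiv 0 (rho d)) z.
Proof.
set C := 2 * (mass R)^-1 * d ^- 2; set s := d ^- 2.
have sb := @smooth_bump R; have sb' : smooth ('D_1 (@bump R)) by exact: smooth_derive.
have cr := smooth_C1 (smooth_radial s sb); have cr' := smooth_C1 (smooth_radial s sb').
have cc j := smooth_C1 (@smooth_coord R j).
have cp j := C1M (cc j) cr'.
have D j : pderiv j (rho d) = (fun z => C * (2 * s) * (coord j z * radial ('D_1 (@bump R)) s z)).
  have -> : pderiv j (rho d) = (fun z => C * pderiv j (radial (@bump R) s) z).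
    by rewrite -(pderivZ C j cr).
  by apply/funext => y; rewrite (derive_radial _ _ _ sb) /radial; ring.
have DD i j : pderiv i (pderiv j (rho d)) z = C * (2 * s) *
    (coord j z * (2 * s * coord i z * 'D_1 ('D_1 (@bump R)) (sqn z * s)) +
     radial ('D_1 (@bump R)) s z * (j == i)%:R).
  rewrite D (pderivZ _ i (cp j)) (pderivM i (cc j) cr').
  by rewrite (derive_radial _ _ _ sb') derive_coord.
by rewrite !DD /=; ring.
Qed.

Section support.
Variables (V : normedModType R) (U : set V).
Implicit Types F : V -> R.

Lemma test_function_derive F v : test_function U F -> test_function U ('D_v F).
Proof.
move=> [sF [cF sub]]; split; first exact: smooth_derive.
have h : closure [set x | 'D_v F x != 0] `<=` closure [set x | F x != 0].
  rewrite [X in _ `<=` X]((closure_id _).1 (@closed_closure _ _)); apply: closure_subset => x /= Dx.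
  apply: contrapT => nx; move/eqP: Dx; apply; apply: derive_near0.
  have oC : open (~` closure [set x | F x != 0]) by apply: closed_openC; exact: closed_closure.
  have := open_nbhs_nbhs (conj oC nx); apply: filterS => y ny.
  by apply/eqP/negPn/negP => Fy; apply: ny; exact: subset_closure.
split; last exact: subset_trans sub.
by apply: subclosed_compact cF h; exact: closed_closure.
Qed.

Lemma test_function_bounded F : test_function U F -> exists2 C : R, 0 <= C & forall x, `|F x| <= C.
Proof.
by move=> [sF [cF _]]; apply: bounded_compact_support cF; exact: smooth_continuous sF.
Qed.

End support.

(** A positive distance from a compact set to the complement of an open one, from the covering form
    of compactness applied along r -> 0. *)
Lemma uniform_cbox (S U : set (plane R)) : compact S -> open U -> S `<=` U ->
  exists2 r : R, 0 < r & forall x, S x -> cbox x r `<=` U.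
Proof.
move=> cS oU SU.
have nc : near_covering S by exact/compact_near_coveringP.
have FF : Filter (0 : R)^'+ by exact: at_right_proper_filter.
have H := nc R (0 : R)^'+ (fun r x => cbox x r `<=` U) FF.
have : \forall r \near (0 : R)^'+, S `<=` (fun x => cbox x r `<=` U).
  apply: H => x Sx; have [r r0 rU] := open_cbox oU (SU _ Sx).
  have h1 : \forall x' \near x, cbox x (r / 2) x'.
    have r20 : 0 < r / 2 by rewrite divr_gt0.
    exists (ball x.1 (r / 2), ball x.2 (r / 2)).
      by split; apply: nbhsx_ballx.
    by move=> [y1 y2] [] /= /ltW h1 /ltW h2.
  have h2 : \forall r' \near (0 : R)^'+, r' <= r / 2.
    by apply: nbhs_right_le; rewrite divr_gt0.
  exists ([set x' | cbox x (r / 2) x'], [set r' | r' <= r / 2]); first by split.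
  move=> [x' r'] [/= [a1 a2] hr] y [b1 b2]; apply: rU; split.
    have := ler_distD x'.1 x.1 y.1; lra.
  have := ler_distD x'.2 x.2 y.2; lra.
move=> H2; have H3 : \forall r \near (0 : R)^'+, 0 < r by exact: nbhs_right_gt.
have [r [h1 h2]] := @filter_ex _ _ (at_right_proper_filter 0) _ (filterI H2 H3).
by exists r.
Qed.

Lemma compact_in_itv (K : set R) (T : R) : 0 < T -> compact K -> K `<=` `]0, T[ ->
  exists a b, [/\ 0 < a, a <= b, b < T & K `<=` `[a, b]].
Proof.
move=> T0 cK KT; have clK : closed K by apply: compact_closed.
have away (p : R) : ~ K p -> exists2 r : R, 0 < r & forall t, K t -> r <= `|p - t|.
  move=> np; have oC : open (~` K) by exact: closed_openC.
  have /nbhs_ballP[r r0 rC] := open_nbhs_nbhs (conj oC np).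
  exists r => // t Kt; rewrite leNgt; apply/negP => h; exact: (rC t h).
have [|r1 r10 h1] := away 0; first by move=> /KT /=; rewrite in_itv /= ltxx.
have [|r2 r20 h2] := away T; first by move=> /KT /=; rewrite in_itv /= ltxx andbF.
exists (Num.min r1 (T / 2)), (Num.max (T - r2) (T / 2)); split.
- by rewrite lt_min r10 divr_gt0.
- by rewrite (@le_trans _ _ (T / 2))// ?ge_min ?lexx ?orbT// le_max lexx orbT.
- by rewrite gt_max; apply/andP; split; lra.
move=> t Kt; have := KT _ Kt; rewrite /= !in_itv /= => /andP[t0 tT].
have := h1 _ Kt; rewrite sub0r normrN (gtr0_norm t0) => g1.
have := h2 _ Kt; rewrite gtr0_norm ?subr_gt0// => g2.
by rewrite ge_min le_max g1 /=; apply/orP; left; lra.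
Qed.

Section field.
Variables (T : R) (Om : set (plane R)) (F : R * plane R -> R).
Hypotheses (T0 : 0 < T) (tF : test_function (`]0, T[ `*` Om) F).

Let A := closure [set z | F z != 0].

Let F_out z : ~ A z -> F z = 0.
Proof. by move=> nz; apply/eqP/negPn/negP => Fz; apply: nz; exact: subset_closure. Qed.

Lemma field_support : exists a b (S : set (plane R)),
  [/\ [/\ 0 < a, a <= b & b < T], compact S, S `<=` Om,
    forall t x, ~ (a <= t <= b) -> F (t, x) = 0 & forall t x, ~ S x -> F (t, x) = 0].
Proof.
have [sF [cA sub]] := tF.
have cK : compact (fst @` A).
  by apply: continuous_compact cA; apply: continuous_subspaceT => z; exact: cvg_fst.
have cS : compact (snd @` A).
  by apply: continuous_compact cA; apply: continuous_subspaceT => z; exact: cvg_snd.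
have KT : fst @` A `<=` `]0, T[ by move=> t [z /sub[h _] <-].
have [a [b [a0 ab bT Kab]]] := compact_in_itv T0 cK KT.
exists a, b, (snd @` A); split=> //; first by move=> x [z /sub[_ h] <-].
- move=> t x nt; apply: F_out => At; apply: nt.
  by have := Kab t (ex_intro2 _ _ (t, x) At erefl); rewrite /= in_itv.
- by move=> t x nx; apply: F_out => Ax; apply: nx; exists (t, x).
Qed.

Lemma field_measurable : jmeas (fun t x => F (t, x)).
Proof.
have [sF _] := tF; have m := measurable_continuous_spacetime (smooth_continuous sF).
by rewrite /jmeas; move: m; congr (measurable_fun _ _); apply/funext => -[].
Qed.

Lemma field_pderiv j t x : pderiv j (fun x => F (t, x)) x = 'D_(0, basis j) F (t, x).
Proof. exact: derive_slice. Qed.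

End field.

End test_fields.

(** * Pairings of the flow with test fields *)

Section observables.
Context (R : realType) (T M : R) (Om : set (plane R)).
Implicit Types (s t a b c E : R) (x y : plane R) (k kap : 'I_2 -> plane R -> R).
Implicit Types (V psi : 'I_2 -> R -> plane R -> R) (f : plane R -> R) (g phi : R -> R).
Local Notation leb := (@lebesgue_measure R).
Local Notation at_time f t := (fun i => f i t).
Hypotheses (OQ : Om `<=` obox M) (mO : measurable Om) (T0 : 0 < T).

(** The energy bound and the divergence condition are required at every time: solutions enter here
    after being set to 0 on a null set of times. *)
Definition flow E V := [/\ forall i, jmeas (V i), forall t i, L2 (V i t),
  forall t, energy (at_time V t) <= E,
  forall i t x, ~ (`]0, T[%classic t /\ Om x) -> V i t x = 0 &
  forall t, weak_div0 Om (at_time V t)].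

Definition test_vector k := forall i, test_function Om (k i).

(** The viscous term is carried entirely by the test field, so that the energy alone bounds it. *)
Definition vlap k : 'I_2 -> plane R -> R :=
  fun i x => \sum_(j < 2) pderiv j (pderiv j (k i)) x.

Lemma test_measurable f : test_function Om f -> measurable_fun setT f.
Proof. by move=> [sf _]; apply: measurable_continuous_plane; exact: smooth_continuous sf. Qed.

Lemma test_box f : test_function Om f -> box_supp M f.
Proof.
move=> tf x H; apply: (test_function_out tf) => /OQ[h1 h2].
by case: H; rewrite leNgt ?h1 ?h2.
Qed.

Lemma test_nice f : test_function Om f -> nice M f.
Proof. by move=> tf; split; [exact: tf.1|exact: test_box]. Qed.

Lemma bounded_L2 f c : measurable_fun setT f -> (forall x, `|f x| <= c) ->
  (forall x, ~ Om x -> f x = 0) -> L2 f.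
Proof.
move=> mf fc f0; have Oo := box_finite mO OQ.
have i1 := @L1_bounded_supp _ _ R leb2 Om c f mO Oo mf fc f0.
split=> //; apply: (@L1_bounded_supp _ _ R leb2 Om (c ^+ 2)) => //.
- exact: measurable_funX.
- move=> x; rewrite normrX lerXn2r ?nnegrE//.
  exact: le_trans (normr_ge0 _) (fc x).
- by move=> x /f0 ->; rewrite expr0n.
Qed.

Lemma test_L2 f : test_function Om f -> L2 f.
Proof.
move=> tf; have [c _ fc] := test_function_bounded tf.
by apply: (bounded_L2 (test_measurable tf) fc) => x; exact: test_function_out.
Qed.

Lemma test_pderiv j f : test_function Om f -> test_function Om (pderiv j f).
Proof. exact: test_function_derive. Qed.

Lemma vlap_scale k c : (forall i, smooth (k i)) ->
  vlap (fun i x => c * k i x) = (fun i x => c * vlap k i x).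
Proof.
move=> sk; apply/funext => i; apply/funext => x; rewrite /vlap mulr_sumr; apply: eq_bigr => j _.
have c1 := smooth_C1 (sk i); have c2 := smooth_C1 (smooth_pderiv j (sk i)).
by rewrite (pderivZ c j c1) (pderivZ c j c2).
Qed.

Lemma vlap_L2 k : test_vector k -> forall i, L2 (vlap k i).
Proof.
move=> tk i; have -> : vlap k i = (fun x => pderiv 0 (pderiv 0 (k i)) x + pderiv 1 (pderiv 1 (k i)) x).
  by apply/funext => x; rewrite /vlap sum_ord2.
by apply: L2D; apply: test_L2; do 2 apply: test_pderiv.
Qed.

Lemma inner_le V k E t : flow E V -> (forall i, L2 (k i)) ->
  `|inner (at_time V t) k| <= (E + energy k) / 2.
Proof.
move=> [_ V2 VE _ _] k2; have := inner_norm_le (V2 t) k2 (ltr01).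
have := VE t; rewrite invr1 !mul1r; lra.
Qed.

Lemma inner_out V k E t : flow E V -> ~ `]0, T[%classic t -> inner (at_time V t) k = 0.
Proof.
move=> [_ _ _ V0 _] nt; have z i : \int[leb2]_x (V i t x * k i x) = 0.
  by rewrite -[RHS](Int_0 leb2); apply: Int_ext => x; rewrite V0 ?mul0r// => -[].
by rewrite /inner !z addr0.
Qed.

Lemma jmeas_cst f : measurable_fun setT f -> jmeas (fun _ : R => f).
Proof. by move=> mf; exact: (measurableT_comp mf measurable_snd). Qed.

Lemma inner_measurable V k E : flow E V -> (forall i, L2 (k i)) ->
  measurable_fun setT (fun t => inner (at_time V t) k).
Proof.
move=> [mV _ _ _ _] k2; apply: (jmeas_inner (g := fun i _ => k i) mV) => i.
by apply: jmeas_cst; exact: L2_measurable (k2 i).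
Qed.

Lemma inner_L1 V k E : flow E V -> (forall i, L2 (k i)) -> L1 leb (fun t => inner (at_time V t) k).
Proof.
move=> fV k2; apply: (@L1_bounded_supp _ _ R leb `]0, T[%classic ((E + energy k) / 2)) => //.
- have := lebesgue_measure_itv `]0, T[; rewrite /= lte_fin T0 => h.
  by apply: (@le_lt_trans _ _ (T%:E - 0%:E)%E); [rewrite -h; exact: lexx|rewrite -EFinD ltry].
- exact: inner_measurable fV k2.
- by move=> t; exact: inner_le.
- by move=> t; exact: inner_out fV.
Qed.

Section compactness.
Variables (E N : R) (nu : nat -> R) (U : nat -> 'I_2 -> R -> plane R -> R) (Uoo : 'I_2 -> R -> plane R -> R).
Hypotheses (fU : forall n, flow E (U n)) (foo : flow E Uoo) (nuN : forall n, `|nu n| <= N).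
Hypothesis weak : forall psi c, (forall i, jmeas (psi i)) -> (forall i t x, `|psi i t x| <= c) ->
  \int[leb]_t inner (at_time (U n) t) (at_time psi t) @[n --> \oo] -->
  \int[leb]_t inner (at_time Uoo t) (at_time psi t).
Hypothesis ns : forall n Psi, solenoidal_test_field `]0, T[ Om Psi ->
  \int[leb]_t inner (at_time (U n) t) (fun i x => derive1 (Psi i ^~ x) t) +
  \int[leb]_t quad (at_time Psi t) (at_time (U n) t) +
  nu n * \int[leb]_t inner (at_time (U n) t) (vlap (at_time Psi t)) = 0.

Lemma weak_obs k g c : test_vector k -> measurable_fun setT g -> (forall t, `|g t| <= c) ->
  \int[leb]_t (g t * inner (at_time (U n) t) k) @[n --> \oo] -->
  \int[leb]_t (g t * inner (at_time Uoo t) k).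
Proof.
move=> tk mg gc; pose psi i t x := g t * k i x.
have c0 : 0 <= c := le_trans (normr_ge0 _) (gc 0).
have [c1 c10 k1] := test_function_bounded (tk 0); have [c2 c20 k2] := test_function_bounded (tk 1).
have kc i x : `|k i x| <= c1 + c2.
  have [->|->] := ord2_cases i.
    by rewrite (le_trans (k1 x))// lerDl.
  by rewrite (le_trans (k2 x))// lerDr.
have := @weak psi (c * (c1 + c2)).
have E1 V : flow E V -> forall t, inner (at_time V t) (at_time psi t) = g t * inner (at_time V t) k.
  by move=> [_ V2 _ _ _] t; rewrite -innerZ// => i; exact: test_L2.
have -> : (fun n => \int[leb]_t inner (at_time (U n) t) (at_time psi t)) =
   (fun n => \int[leb]_t (g t * inner (at_time (U n) t) k)).
  by apply/funext => n; apply: Int_ext => t; exact: E1.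
rewrite (Int_ext leb (E1 _ foo)); apply.
  move=> i; apply: measurable_funM; first exact: (measurableT_comp mg measurable_fst).
  exact: (measurableT_comp (test_measurable (tk i)) measurable_snd).
by move=> i t x; rewrite normrM ler_pM.
Qed.

Lemma separated_field k (th : R -> R) a b : 0 < a -> b < T -> smooth th ->
  (forall t, ~ (a <= t <= b) -> th t = 0) -> test_vector k -> (forall x, divergence k x = 0) ->
  solenoidal_test_field `]0, T[ Om (fun i t x => th t * k i x).
Proof.
move=> a0 bT sth th0 tk dk; split=> [i|t x]; last first.
  have := dk x; rewrite /divergence !sum_ord2 !(pderivZ _ _ (smooth_C1 (tk _).1)) -mulrDr => ->.
  by rewrite mulr0.
have [sk [ck sub]] := tk i; split.
  by apply: smoothM; [exact: smooth_fst sth|exact: smooth_snd sk].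
pose K := `[a, b]%classic `*` closure [set x | k i x != 0].
have cK : compact K by apply: compact_setX => //; exact: segment_compact.
have clK : closed K by apply: compact_closed.
have sK : closure [set z : R * plane R | th z.1 * k i z.2 != 0] `<=` K.
  rewrite [X in _ `<=` X]((closure_id _).1 clK); apply: closure_subset => -[t x] /= h; split=> /=.
    rewrite in_itv /=; apply: contrapT => nt; move/eqP: h; apply.
    by rewrite th0// mul0r.
  apply: subset_closure => /=; apply: contraNN h => /eqP ->; rewrite mulr0//.
split; first by apply: subclosed_compact cK sK; exact: closed_closure.
move=> z /sK [h1 /sub h2]; split=> //; move: h1; rewrite /= !in_itv /= => /andP[h1 h3].
by rewrite (lt_le_trans a0)//= (le_lt_trans h3).
Qed.

Lemma separated_quad_le k (th : R) (L : R) V t : flow E V -> test_vector k -> 0 <= L ->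
  (forall i j x, `|pderiv j (k i) x| <= L) ->
  `|quad (fun i x => th * k i x) (at_time V t)| <= 4 * (`|th| * L) * E.
Proof.
move=> [_ V2 VE _ _] tk L0 kL; have sk i := smooth_C1 (tk i).1.
apply: (@le_trans _ _ (4 * (`|th| * L) * energy (at_time V t))); last first.
  by rewrite ler_wpM2l// !mulr_ge0.
apply: (@quad_le R M).
- by rewrite mulr_ge0.
- move=> i; split; first by apply: smoothZ; exact: (tk i).1.
  by move=> x h; rewrite (test_box (tk i) h) mulr0.
- move=> i j x nQ; rewrite pderivZ// (test_function_out (test_pderiv j (tk i))) ?mulr0//.
  by move=> /OQ.
- by move=> i j x; rewrite pderivZ// normrM ler_wpM2l.
- by move=> i; exact: V2.
Qed.

Lemma quad_measurable Phi V : (forall i, jmeas (V i)) -> (forall i j, jmeas (fun t => pderiv j (Phi i t))) ->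
  measurable_fun setT (fun t => quad (at_time Phi t) (at_time V t)).
Proof.
move=> mV mP; rewrite /quad.
apply: (jmeas_Int (F := fun t x => \sum_(i < 2) \sum_(j < 2) pderiv j (Phi i t) x * V i t x * V j t x)).
rewrite /jmeas; apply: measurable_sum => i; apply: measurable_sum => j.
by apply: measurable_funM; [apply: measurable_funM; [exact: mP|exact: mV]|exact: mV].
Qed.

(** The equation is tested with th(t') k, where th is the difference of the two ramps: its
    derivative yields the difference of the two averages, and since |th| <= 1 is supported in
    [t - s, t] the nonlinear and viscous terms are O(s), uniformly in n. *)
Lemma tavg_increment k a b : 0 < a -> b < T -> test_vector k -> (forall x, divergence k x = 0) ->
  exists2 C : R, 0 <= C & forall n s s' t, 0 < s' -> s' <= s -> s <= a / 2 -> a <= t <= b ->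
  `|tavg s' (fun t => inner (at_time (U n) t) k) t - tavg s (fun t => inner (at_time (U n) t) k) t|
   <= C * s.
Proof.
move=> a0 bT tk dk; have k2 i := test_L2 (tk i); have l2 := vlap_L2 tk.
have bd i j : exists2 C : R, 0 <= C & forall x, `|pderiv j (k i) x| <= C.
  exact: test_function_bounded (test_pderiv j (tk i)).
have [L L0 HL] : exists2 L : R, 0 <= L & forall i j x, `|pderiv j (k i) x| <= L.
  have [L1 p1 h1] := bd 0 0; have [L2 p2 h2] := bd 0 1; have [L3 p3 h3] := bd 1 0; have [L4 p4 h4] := bd 1 1.
  exists (L1 + L2 + L3 + L4); first by rewrite !addr_ge0.
  move=> i j x.
  have [->|->] := ord2_cases i.
    have [->|->] := ord2_cases j.
      by have := h1 x; lra.
    by have := h2 x; lra.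
  have [->|->] := ord2_cases j.
    by have := h3 x; lra.
  by have := h4 x; lra.
have E0 : 0 <= E by case: foo => _ _ h _ _; exact: le_trans (energy_ge0 _) (h 0).
have N0 : 0 <= N := le_trans (normr_ge0 _) (nuN 0%N).
have e0 := energy_ge0 (vlap k).
have C0 : 0 <= 4 * L * E + N * ((E + energy (vlap k)) / 2).
  apply: addr_ge0; first by rewrite !mulr_ge0.
  by rewrite mulr_ge0// divr_ge0// addr_ge0.
exists (4 * L * E + N * ((E + energy (vlap k)) / 2)) => //.
move=> n s s' t s'0 s's sa /andP[at_ tb]; have s0 := lt_le_trans s'0 s's.
pose th t' := tramp s' t t' - tramp s t t'.
have sth : smooth th by apply: smoothB; exact: tramp_smooth.
have th_out t' : ~ (t - s <= t' <= t) -> th t' = 0.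
  move=> h; have [h1|h1] := leP t t'; first by rewrite /th !tramp_after// subrr.
  have [h2|h2] := leP t' (t - s); last by exfalso; apply: h; rewrite !ltW.
  by rewrite /th !tramp_before ?subrr//; lra.
have th1 t' : `|th t'| <= 1.
  have /andP[h1 h2] := tramp01 s' t t'; have /andP[h3 h4] := tramp01 s t t'.
  by rewrite /th ler_norml; apply/andP; split; lra.
(* The bound s <= a / 2 keeps the support of the test field away from time 0. *)
have a20 : 0 < t - s by lra.
have tT : t < T by exact: le_lt_trans bT.
have sol := separated_field a20 tT sth th_out tk dk.
have := ns n sol; set p := fun t => inner (at_time (U n) t) k.
have [_ V2 _ _ _] := fU n; have pL := inner_L1 (fU n) k2; have mp := L1_measurable (mu := leb) pL.
have pC t' := inner_le t' (fU n) k2.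
have i1 := L1_tavg s'0 mp pC t; have i2 := L1_tavg s0 mp pC t.
have dth t' : derivable th t' 1 /\ derive1 th t' = tker s (t - t') - tker s' (t - t').
  have [d1 e1] := tramp_derive t t' s'0; have [d2 e2] := tramp_derive t t' s0.
  split; first exact: derivableB.
  by move: e1 e2; rewrite !derive1E /th (deriveB d1 d2) => -> ->; ring.
have -> : \int[leb]_t0 inner (at_time (U n) t0) (fun i x => derive1 (fun t1 => th t1 * k i x) t0) =
    tavg s p t - tavg s' p t.
  rewrite /tavg -(IntB (mu := leb) i2 i1); apply: Int_ext => t'.
  rewrite -mulrBl -(dth t').2 -innerZ//; congr inner; apply/funext => i; apply/funext => x.
  have dc : derivable (cst (k i x) : R -> R) t' 1 by exact: derivable_cst.
  rewrite !derive1E (deriveM (dth t').1 dc) derive_cst scaler0 add0r.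
  by rewrite /GRing.scale /= mulrC.
have sk i := smooth_C1 (tk i).1.
have lapE t' : vlap (fun i x => th t' * k i x) = (fun i x => th t' * vlap k i x).
  by apply: vlap_scale => i; exact: (tk i).1.
have -> : \int[leb]_t0 inner (at_time (U n) t0) (vlap (fun i x => th t0 * k i x)) =
    \int[leb]_t' (th t' * inner (at_time (U n) t') (vlap k)).
  by apply: Int_ext => t'; rewrite lapE innerZ.
have ts : t - s <= t by rewrite lerBlDr lerDl ltW.
pose win t' : R := \1_(`[t - s, t]%classic) t'.
have wi : L1 leb win by apply: (L1_indic (mu := leb)) => //; exact: leb_segment_fin.
have wI : \int[leb]_t' win t' = s.
  have E1 : (\int[leb]_t' (win t')%:E)%E = leb `[t - s, t]%classic.
    apply: (etrans (integral_indic leb measurableT _)) => //; congr (leb _); exact: setIT.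
  by rewrite /Rintegral E1 leb_segment//=; ring.
have thw t' : `|th t'| <= win t'.
  have [h|h] := boolP (t - s <= t' <= t).
    by rewrite /win indic_in//= in_itv.
  by rewrite th_out ?normr0; [rewrite /win indicE|exact/negP].
have mth : measurable_fun setT th.
  by apply: continuous_measurable_fun; exact: smooth_continuous sth.
have b1 : `|\int[leb]_t' quad (fun i x => th t' * k i x) (at_time (U n) t')| <= 4 * L * E * s.
  rewrite -wI -(IntZl (mu := leb) _ wi); apply: (Int_norm_le (mu := leb)).
  - apply: (@quad_measurable (fun i t' x => th t' * k i x)); first by case: (fU n).
    move=> i j; have -> : (fun t' => pderiv j (fun x => th t' * k i x)) = (fun t' x => th t' * pderiv j (k i) x).
      by apply/funext => t'; rewrite (pderivZ _ _ (sk i)).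
    apply: measurable_funM; first exact: (measurableT_comp mth measurable_fst).
    exact: (measurableT_comp (test_measurable (test_pderiv j (tk i))) measurable_snd).
  - exact: (L1Zl (mu := leb)).
  move=> t'; apply: (le_trans (separated_quad_le (th t') t' (fU n) tk L0 HL)).
  have -> : 4 * (`|th t'| * L) * E = 4 * L * E * `|th t'| by ring.
  by rewrite ler_wpM2l ?thw// !mulr_ge0.
have b2 : `|nu n * \int[leb]_t' (th t' * inner (at_time (U n) t') (vlap k))| <=
    N * ((E + energy (vlap k)) / 2) * s.
  rewrite normrM -mulrA ler_pM// -wI -(IntZl (mu := leb) _ wi); apply: (Int_norm_le (mu := leb)).
  - by apply: measurable_funM => //; exact: inner_measurable (fU n) l2.
  - exact: (L1Zl (mu := leb)).
  move=> t'; rewrite normrM mulrC ler_pM//.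
  exact: inner_le.
move: b1 b2.
move: (\int[leb]_t' quad _ _) (nu n * _) (tavg s p t) (tavg s' p t) => A B C D b1 b2 id0.
have -> : D - C = A + B by lra.
by apply: (le_trans (ler_normD _ _)); rewrite mulrDl lerD.
Qed.

(** Only [k] has to be solenoidal: the equation controls its pairing in time with no pressure term.
    The pairing with [kap] merely converges weakly. *)
Lemma curl_compactness k kap phi a b c : 0 < a -> a <= b -> b < T -> test_vector k ->
  (forall x, divergence k x = 0) -> test_vector kap -> measurable_fun setT phi ->
  (forall t, `|phi t| <= c) -> (forall t, ~ (a <= t <= b) -> phi t = 0) ->
  \int[leb]_t (phi t * inner (at_time (U n) t) k * inner (at_time (U n) t) kap) @[n --> \oo] -->
  \int[leb]_t (phi t * inner (at_time Uoo t) k * inner (at_time Uoo t) kap).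
Proof.
move=> a0 ab bT tk dk tkap mphi phic phi0.
have k2 i := test_L2 (tk i); have kap2 i := test_L2 (tkap i).
have [C C0 HC] := tavg_increment a0 bT tk dk.
have [B B0 HB] := tker_bound R.
apply: (@time_compactness R (fun n t => inner (at_time (U n) t) k) (fun n t => inner (at_time (U n) t) kap)
  (fun t => inner (at_time Uoo t) k) (fun t => inner (at_time Uoo t) kap) phi a b (a / 2) C
  ((E + energy k) / 2) ((E + energy kap) / 2) c) => //.
- by rewrite divr_gt0.
- by move=> n; exact: inner_L1 (fU n) k2.
- exact: inner_L1 foo k2.
- by move=> n t; exact: inner_le (fU n) k2.
- by move=> t; exact: inner_le foo k2.
- by move=> n; exact: inner_measurable (fU n) kap2.
- exact: inner_measurable foo kap2.
- by move=> n t; exact: inner_le (fU n) kap2.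
- by move=> t; exact: inner_le foo kap2.
- move=> s t s0 _ _; apply: (weak_obs (c := B / s) tk); first exact: tker_measurable.
  by move=> t'; rewrite ger0_norm ?tker_ge0// HB.
- by move=> g Cg mg gC _; exact: weak_obs tkap mg gC.
Qed.

End compactness.
End observables.

Section test_field_slices.
Context (R : realType) (T : R) (Om : set (plane R)).
Hypothesis T0 : 0 < T.
Implicit Types (F : R * plane R -> R) (f : plane R -> R).

Lemma test_scale (c : R) f : test_function Om f -> test_function Om (fun x => c * f x).
Proof.
move=> [sf [cf sub]]; split; first exact: smoothZ.
have h : closure [set x | c * f x != 0] `<=` closure [set x | f x != 0].
  by apply: closure_subset => x /=; apply: contraNN => /eqP ->; rewrite mulr0.
split; last exact: subset_trans sub.
by apply: subclosed_compact cf h; exact: closed_closure.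
Qed.

Lemma field_slice F t : test_function (`]0, T[ `*` Om) F -> test_function Om (fun x => F (t, x)).
Proof.
move=> tF; have [a [b [S [_ cS SO _ outS]]]] := field_support T0 tF.
split; first by apply: smooth_slice; exact: tF.1.
have clS : closed S by apply: compact_closed.
have h : closure [set x | F (t, x) != 0] `<=` S.
  rewrite [X in _ `<=` X]((closure_id _).1 clS); apply: closure_subset => x /= Fx.
  by apply: contrapT => nS; move/eqP: Fx; apply; exact: outS.
split; last exact: subset_trans SO.
by apply: subclosed_compact cS h; exact: closed_closure.
Qed.

Section vector.
Variable Phi : 'I_2 -> R -> plane R -> R.
Hypothesis sol : solenoidal_test_field `]0, T[ Om Phi.

Lemma field_test_vector t : forall i, test_function Om (Phi i t).
Proof. by move=> i; exact: (field_slice t (sol.1 i)). Qed.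

Lemma field_jmeas i : jmeas (Phi i).
Proof. exact: field_measurable (sol.1 i). Qed.

Lemma field_pderiv_jmeas i j : jmeas (fun t => pderiv j (Phi i t)).
Proof.
have t' := test_function_derive (0, basis j) (sol.1 i).
have -> : (fun t => pderiv j (Phi i t)) =
   (fun t x => 'D_(0, basis j) (fun z : R * plane R => Phi i z.1 z.2) (t, x)).
  apply/funext => t; apply/funext => x.
  exact: (field_pderiv (fun z : R * plane R => Phi i z.1 z.2)).
exact: field_measurable t'.
Qed.

Lemma field_bounded i : exists2 B, 0 <= B & forall t x, `|Phi i t x| <= B.
Proof. by have [B B0 h] := test_function_bounded (sol.1 i); exists B => // t x; exact: (h (t, x)). Qed.

Lemma field_pderiv_bounded i j : exists2 B, 0 <= B & forall t x, `|pderiv j (Phi i t) x| <= B.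
Proof.
have [B B0 h] := test_function_bounded (test_function_derive (0, basis j) (sol.1 i)).
exists B => // t x.
by rewrite (field_pderiv (fun z : R * plane R => Phi i z.1 z.2)).
Qed.

Lemma field_derive1 i : jmeas (fun t x => derive1 (Phi i ^~ x) t) /\
  exists2 B, 0 <= B & forall t x, `|derive1 (Phi i ^~ x) t| <= B.
Proof.
have t' := test_function_derive ((1, 0) : R * plane R) (sol.1 i).
have E t x : derive1 (Phi i ^~ x) t = 'D_((1, 0) : R * plane R) (fun z : R * plane R => Phi i z.1 z.2) (t, x).
  exact: (derive_time_slice (fun z : R * plane R => Phi i z.1 z.2)).
split; last by have [B B0 h] := test_function_bounded t'; exists B => // t x; rewrite E.
have -> : (fun t x => derive1 (Phi i ^~ x) t) =
   (fun t x => 'D_((1, 0) : R * plane R) (fun z : R * plane R => Phi i z.1 z.2) (t, x)).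
  by apply/funext => t; apply/funext => x.
exact: field_measurable t'.
Qed.

Lemma field_pderiv2 i j : jmeas (fun t => pderiv j (pderiv j (Phi i t))) /\
  exists2 B, 0 <= B & forall t x, `|pderiv j (pderiv j (Phi i t)) x| <= B.
Proof.
have t1 := test_function_derive (0, basis j) (sol.1 i).
have t' := test_function_derive (0, basis j) t1.
set F := (fun z : R * plane R => Phi i z.1 z.2) in t1 t'.
have E t x : pderiv j (pderiv j (Phi i t)) x = 'D_(0, basis j) ('D_(0, basis j) F) (t, x).
  have -> : pderiv j (Phi i t) = (fun y => 'D_(0, basis j) F (t, y)).
    by apply/funext => y; exact: (field_pderiv F).
  exact: (field_pderiv ('D_(0, basis j) F)).
split; last by have [B B0 h] := test_function_bounded t'; exists B => // t x; rewrite E.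
have -> : (fun t => pderiv j (pderiv j (Phi i t))) =
   (fun t x => 'D_(0, basis j) ('D_(0, basis j) F) (t, x)).
  by apply/funext => t; apply/funext => x.
exact: field_measurable t'.
Qed.

Lemma field_supports : exists a b (S : set (plane R)),
  [/\ [/\ 0 < a, a <= b & b < T], compact S, S `<=` Om,
    forall i t x, ~ (a <= t <= b) -> Phi i t x = 0 & forall i t x, ~ S x -> Phi i t x = 0].
Proof.
have [a [b [S [[a0 ab bT] cS SO oT oS]]]] := field_support T0 (sol.1 0).
have [a' [b' [S' [[a0' ab' bT'] cS' SO' oT' oS']]]] := field_support T0 (sol.1 1).
exists (Num.min a a'), (Num.max b b'), (S `|` S'); split.
- split; first by rewrite lt_min a0.
    by rewrite (@le_trans _ _ a)// ?ge_min ?lexx// le_max ab.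
  by rewrite gt_max bT.
- exact: compactU.
- by move=> x []; [exact: SO|exact: SO'].
- move=> i t x h; have [->|->] := ord2_cases i.
    apply: oT => /andP[h1 h2]; apply: h; rewrite ge_min le_max h1 h2//.
  apply: oT' => /andP[h1 h2]; apply: h; rewrite ge_min le_max h1 h2 !orbT//.
- move=> i t x h; have [->|->] := ord2_cases i.
    by apply: oS => Sx; apply: h; left.
  by apply: oS' => Sx; apply: h; right.
Qed.

End vector.
End test_field_slices.

(** * Passage to the limit *)

Section mollified_convergence.
Context (R : realType) (T M : R) (Om : set (plane R)).
Implicit Types (t a b c e : R) (x y : plane R) (V Phi : 'I_2 -> R -> plane R -> R).
Local Notation leb := (@lebesgue_measure R).
Local Notation at_time f t := (fun i => f i t).
Hypotheses (OQ : Om `<=` obox M) (mO : measurable Om) (T0 : 0 < T).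
Variable E : R.

Let A0 := \int[leb2]_x (\1_(obox M) x : R) + E.

(** From |v| <= 1 + v^2 on the square. *)
Lemma flow_L1_le V i t : flow T Om E V -> \int[leb2]_x `|V i t x| <= A0.
Proof.
move=> [_ V2 VE V0 _]; have mQ := box_measurable M.
have L1Q := L1_indic (mu := leb2) mQ (box_finite mQ (@subset_refl _ (obox M))).
apply: (@le_trans _ _ (\int[leb2]_x (\1_(obox M) x + V i t x ^+ 2))).
  apply: (Int_le (mu := leb2)); first exact: (L1_abs (mu := leb2) (V2 t i).1).
    by apply: (L1D (mu := leb2)) => //; exact: (V2 t i).2.
  move=> x; have [Qx|Qx] := pselect (obox M x); last first.
    by rewrite V0 ?normr0 ?addr_ge0 ?sqr_ge0// => -[_ /OQ].
  rewrite indic_in//; have := young_le (V i t x) 1 ltr01.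
  by rewrite mulr1 invr1 !mul1r expr1n; have := normr_ge0 (V i t x); lra.
rewrite (IntD (mu := leb2) L1Q (V2 t i).2) lerD2l; apply: le_trans (VE t).
have n0 j : 0 <= \int[leb2]_x (V j t x ^+ 2) by apply: Int_ge0 => x; exact: sqr_ge0.
have := n0 0; have := n0 1; rewrite /energy.
have [->|->] := ord2_cases i.
  by move=> h _; rewrite lerDl.
by move=> _ h; rewrite lerDr.
Qed.

Lemma jmeas_conv K f : continuous K -> jmeas f -> jmeas (fun t => conv K (f t)).
Proof.
move=> cK mf; rewrite /jmeas /conv.
apply: (@fubini_measurable1 _ _ (measurableTypeR R * (measurableTypeR R * measurableTypeR R))%type
  (measurableTypeR R * measurableTypeR R)%type R (lebp R)
  (fun q : (R * plane R) * plane R => K (q.1.2 - q.2) * f q.1.1 q.2)).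
apply: measurable_funM.
  apply: (measurableT_comp (measurable_kernel cK) (g := fun q : (R * plane R) * plane R => (q.1.2, q.2))).
  apply: measurable_fun_pair; last exact: measurable_snd.
  exact: (measurableT_comp measurable_snd measurable_fst).
apply: (measurableT_comp mf (g := fun q : (R * plane R) * plane R => (q.1.1, q.2))).
apply: measurable_fun_pair; last exact: measurable_snd.
exact: (measurableT_comp measurable_fst measurable_fst).
Qed.

Section obs.
Variables (e : R) (x : plane R).
Hypotheses (e0 : 0 < e) (xe : cbox x e `<=` Om).

Let g (y : plane R) := rho e (x - y).
Let tg : test_function Om g. Proof. exact: test_function_reflect (nice_rho e0) xe. Qed.

(** Minus the rotated gradient of y -> rho(x - y): pairing a field with it gives the curl of its
    mollification at x, and it is solenoidal because mixed derivatives commute. *)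
Definition curl_obs (i : 'I_2) y : R := if i == 0 then pderiv 1 g y else -1 * pderiv 0 g y.
Definition comp_obs (j i : 'I_2) y : R := (i == j)%:R * g y.

Lemma curl_obs_test : test_vector Om curl_obs.
Proof.
move=> i; rewrite /curl_obs; case: eqP => _; first exact: test_pderiv tg.
by apply: test_scale; exact: test_pderiv tg.
Qed.

Lemma comp_obs_test j : test_vector Om (comp_obs j).
Proof. by move=> i; exact: test_scale tg. Qed.

Let pg j y : pderiv j g y = - pderiv j (rho e) (x - y).
Proof. exact: pderiv_reflect (smooth_rho e). Qed.

Lemma curl_obs_div y : divergence curl_obs y = 0.
Proof.
have pp i j : pderiv i (pderiv j g) y = pderiv i (pderiv j (rho e)) (x - y).
  have sr := smooth_pderiv j (smooth_rho e).
  have -> : pderiv j g = (fun y => - pderiv j (rho e) (x - y)) by apply/funext => z.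
  rewrite (pderivN i (smooth_C1 (smooth_reflect x sr))).
  by rewrite (pderiv_reflect x i y sr) opprK.
have sg := smooth_C1 (smooth_pderiv 0 tg.1).
have c0 : curl_obs 0 = pderiv 1 g by [].
have c1 : curl_obs 1 = (fun y => -1 * pderiv 0 g y) by [].
have d0 : pderiv 0 (curl_obs 0) y = pderiv 0 (pderiv 1 g) y.
  exact: (congr1 (fun f => pderiv 0 f y) c0).
have d1 : pderiv 1 (curl_obs 1) y = - pderiv 1 (pderiv 0 g) y.
  apply: etrans (congr1 (fun f => pderiv 1 f y) c1) _.
  apply: etrans (congr1 (fun f => f y) (pderivZ (-1) 1 sg)) _.
  exact: mulN1r.
rewrite /divergence sum_ord2.
apply: etrans (congr2 +%R (etrans d0 (pp 0 1)) (etrans d1 (congr1 -%R (pp 1 0)))) _.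
by rewrite rho_pderiv_sym subrr.
Qed.

Lemma curl_obsE v : (forall i, L1 leb2 (v i)) -> curlf (moll e v) x = inner v curl_obs.
Proof.
move=> vi; have nr := nice_rho e0; rewrite /curlf /moll !(pderiv_conv _ _ nr (vi _)) /conv /inner /curl_obs /=.
rewrite addrC; congr (_ + _); last first.
  by apply: Int_ext => y; rewrite pg; ring.
have i1 := L1_conv_nice x (nice_pderiv 1 nr) (vi 0).
rewrite -(IntN (mu := leb2) i1).
by apply: Int_ext => y; rewrite pg; ring.
Qed.

Lemma comp_obsE v j : (forall i, L1 leb2 (v i)) -> moll e v j x = inner v (comp_obs j).
Proof.
move=> vi; rewrite /inner /moll /conv /comp_obs.
have [->|->] := ord2_cases j.
  rewrite [X in _ = _ + X](_ : _ = 0) ?addr0; first by apply: Int_ext => y; rewrite /g /= mul1r mulrC.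
  by rewrite -[RHS](Int_0 leb2); apply: Int_ext => y; rewrite mul0r mulr0.
rewrite [X in _ = X + _](_ : _ = 0) ?add0r; first by apply: Int_ext => y; rewrite /g /= mul1r mulrC.
by rewrite -[RHS](Int_0 leb2); apply: Int_ext => y; rewrite mul0r mulr0.
Qed.

End obs.

Section fixed_scale.
Variables (Phi : 'I_2 -> R -> plane R -> R) (a b : R) (S : set (plane R)) (e : R).
Hypotheses (ab : a <= b) (sol : solenoidal_test_field `]0, T[ Om Phi) (SO : S `<=` Om)
  (outT : forall i t x, ~ (a <= t <= b) -> Phi i t x = 0)
  (outS : forall i t x, ~ S x -> Phi i t x = 0)
  (e0 : 0 < e) (Se : forall x, S x -> cbox x e `<=` Om).

Definition moll_flux V t x : R :=
  curlf (moll e (at_time V t)) x * cross (at_time Phi t) (moll e (at_time V t)) x.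

(** The bound is integrable in (t, x) and the same for all flows: it justifies Fubini, and it
    dominates the whole sequence as n grows. *)
Lemma flux_bound : exists2 C, 0 <= C & forall V, flow T Om E V -> forall t x,
  `|moll_flux V t x| <= (C * \1_(`[a, b]%classic) t) * \1_(obox M) x.
Proof.
have nr := nice_rho e0; have [C C0 HC] := nice_bounded nr; have [C' C'0 HC'] := nice_bounded_pderiv nr.
have [B0 B00 HB0] := field_bounded sol 0; have [B1 B10 HB1] := field_bounded sol 1.
pose A := Num.max A0 0.
have A00 : 0 <= A by rewrite le_max lexx orbT.
have AA : A0 <= A by rewrite le_max lexx.
exists ((2 * C' * A) * ((B1 + B0) * (C * A))).
  by rewrite !mulr_ge0// addr_ge0.
move=> V fV t x; have [h|h] := boolP (a <= t <= b); last first.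
  have z i : Phi i t x = 0 by apply: outT; exact/negP.
  rewrite /moll_flux /cross !z !mul0r subrr mulr0 normr0 !mulr_ge0// ?addr_ge0//.
have [Sx|Sx] := pselect (S x); last first.
  have z i : Phi i t x = 0 by exact: outS.
  rewrite /moll_flux /cross !z !mul0r subrr mulr0 normr0 !mulr_ge0// ?addr_ge0//.
rewrite indic_in ?indic_in ?mulr1; [|exact: OQ (SO Sx)|by rewrite /= in_itv].
have vi i : L1 leb2 (V i t) by case: fV => _ V2 _ _ _; exact: (V2 t i).1.
have mb i : `|moll e (at_time V t) i x| <= C * A.
  apply: (le_trans (conv_bound x (nice_continuous nr) HC (vi i))).
  by rewrite ler_wpM2l// (le_trans (flow_L1_le i t fV)).
have cb j i : `|conv (pderiv j (rho e)) (V i t) x| <= C' * A.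
  apply: (le_trans (conv_bound x (nice_continuous (nice_pderiv j nr)) (HC' j) (vi i))).
  by rewrite ler_wpM2l// (le_trans (flow_L1_le i t fV)).
rewrite /moll_flux normrM; apply: ler_pM => //.
  rewrite /curlf /moll !(pderiv_conv _ _ nr (vi _)); apply: (le_trans (ler_normB _ _)).
  by have := cb 0 1; have := cb 1 0; lra.
rewrite /cross; apply: (le_trans (ler_normB _ _)); rewrite !normrM mulrDl.
by apply: lerD; apply: ler_pM.
Qed.

Lemma flux_jmeas V : flow T Om E V -> jmeas (moll_flux V).
Proof.
move=> fV; have nr := nice_rho e0.
have vi i t : L1 leb2 (V i t) by case: fV => _ V2 _ _ _; exact: (V2 t i).1.
have mV i : jmeas (V i) by case: fV.
have m j : jmeas (fun t => moll e (at_time V t) j) by apply: jmeas_conv => //; exact: nice_continuous nr.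
have c j i : jmeas (fun t => conv (pderiv j (rho e)) (V i t)).
  by apply: jmeas_conv => //; exact: nice_continuous (nice_pderiv j nr).
have mP i := field_jmeas sol i.
have -> : moll_flux V = (fun t x => (conv (pderiv 0 (rho e)) (V 1 t) x - conv (pderiv 1 (rho e)) (V 0 t) x) *
   (Phi 1 t x * moll e (at_time V t) 0 x - Phi 0 t x * moll e (at_time V t) 1 x)).
  apply/funext => t; apply/funext => x.
  by rewrite /moll_flux /curlf {1 2}/moll !(pderiv_conv _ _ nr (vi _ _)).
apply: measurable_funM; first exact: (measurable_funB (c 0 1) (c 1 0)).
by apply: measurable_funB; apply: measurable_funM; [exact: mP|exact: m|exact: mP|exact: m].
Qed.

Let ind_t : L1 leb (fun t => \1_(`[a, b]%classic) t).
Proof. by apply: (L1_indic (mu := leb)) => //; exact: leb_segment_fin. Qed.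

Let ind_x : L1 leb2 (fun x : plane R => \1_(obox M) x).
Proof. have mQ := box_measurable M; exact: (L1_indic (mu := leb2) mQ (box_finite mQ (@subset_refl _ (obox M)))). Qed.

(** Integrating in time first reduces the limit in n to a fixed point x, where the flux density is a
    combination of products of two scalar functions of time. *)
Lemma flux_swap V : flow T Om E V ->
  \int[leb]_t quad (at_time Phi t) (moll e (at_time V t)) = - \int[leb2]_x \int[leb]_t moll_flux V t x.
Proof.
move=> fV; have [C C0 HC] := flux_bound.
have i12 : L1 (leb \x lebp R)%E (fun q : R * plane R => moll_flux V q.1 q.2).
  apply: (@L1_prod _ _ _ _ R leb (lebp R) _ (fun t => C * \1_(`[a, b]%classic) t) (fun x => \1_(obox M) x)).
  - exact: flux_jmeas fV.
  - exact: (L1Zl (mu := leb)).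
  - exact: ind_x.
  - by move=> t x; exact: HC.
have sw := fubini_swap i12; apply: etrans (congr1 -%R sw).
have i1 := fubini_L1 i12; rewrite -(IntN (mu := leb) i1); apply: Int_ext => t.
have vi i : L1 leb2 (V i t) by case: fV => _ V2 _ _ _; exact: (V2 t i).1.
have tv := field_test_vector T0 sol t.
apply: (quad_moll (U := Om) (M := M) _ _ vi _ e0) => //.
- by move=> i; exact: (test_nice OQ (tv i)).
- by move=> x; exact: sol.2.
- by case: fV => _ _ _ _; exact.
move=> i x Px; apply: Se; apply: contrapT => nS; move/eqP: Px; apply; exact: outS.
Qed.

End fixed_scale.
End mollified_convergence.

Section real_limits.
Variable R : realType.
Implicit Types (u v z s f g : nat -> R) (p q l eta : R).

Lemma cvg_opp_eq f g p q : (forall n, f n = - g n) -> p = - q ->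
  g n @[n --> \oo] --> q -> f n @[n --> \oo] --> p.
Proof. by move=> fg -> h; rewrite (funext fg : f = fun n => - g n); exact: cvgN. Qed.

Lemma cvg_sub_eq f u v p q1 q2 : (forall n, f n = u n - v n) -> p = q1 - q2 ->
  u n @[n --> \oo] --> q1 -> v n @[n --> \oo] --> q2 -> f n @[n --> \oo] --> p.
Proof. by move=> fg -> h1 h2; rewrite (funext fg : f = fun n => u n - v n); exact: cvgB. Qed.

Lemma cvg_sum_eq0 u v z s p q l : u n @[n --> \oo] --> p -> v n @[n --> \oo] --> q ->
  z n @[n --> \oo] --> 0 -> s n @[n --> \oo] --> l ->
  (forall n, u n + v n + z n * s n = 0) -> p + q = 0.
Proof.
move=> hu hv hz hs z0; have h : u n + v n + z n * s n @[n --> \oo] --> p + q + 0 * l.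
  by apply: cvgD; [exact: cvgD|exact: cvgM].
move: h; rewrite (funext z0 : (fun n => u n + v n + z n * s n) = fun=> 0) mul0r addr0 => h.
by rewrite -(cvg_unique _ h (cvg_cst 0)).
Qed.

Lemma fraction_quarter_le q eta : 0 < eta -> 0 <= q -> q * (eta / (4 * (q + 1))) <= eta / 4.
Proof.
move=> e0 q0; have q1 : 0 < q + 1 by lra.
rewrite mulrA ler_pdivrMr ?mulr_gt0//.
have -> : eta / 4 * (4 * (q + 1)) = q * eta + eta by field.
by rewrite lerDl ltW.
Qed.

Lemma four_quarters (eta x0 x1 x2 x3 x4 x5 : R) : x0 <= eta / 4 -> `|x1 - x2| <= eta / 4 ->
  `|x2 - x4| <= eta / 4 -> x3 <= eta / 4 -> `|x4 - x5| <= x3 + x0 -> `|x1 - x5| <= eta.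
Proof.
rewrite !ler_norml => h4 /andP[h5 h6] /andP[h7 h8] h9 /andP[h10 h11]; apply/andP; split; lra.
Qed.

End real_limits.

Section euler_limit.
Context (R : realType) (T M : R) (Om : set (plane R)).
Implicit Types (t a b c e : R) (x y : plane R) (V Phi : 'I_2 -> R -> plane R -> R).
Local Notation leb := (@lebesgue_measure R).
Local Notation at_time f t := (fun i => f i t).
Hypotheses (OQ : Om `<=` obox M) (mO : measurable Om) (T0 : 0 < T).
Variables (E N : R) (nu : nat -> R) (U : nat -> 'I_2 -> R -> plane R -> R) (Uoo : 'I_2 -> R -> plane R -> R).
Hypotheses (fU : forall n, flow T Om E (U n)) (foo : flow T Om E Uoo) (nuN : forall n, `|nu n| <= N).
Hypothesis weak : forall psi c, (forall i, jmeas (psi i)) -> (forall i t x, `|psi i t x| <= c) ->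
  \int[leb]_t inner (at_time (U n) t) (at_time psi t) @[n --> \oo] -->
  \int[leb]_t inner (at_time Uoo t) (at_time psi t).
Hypothesis ns : forall n Psi, solenoidal_test_field `]0, T[ Om Psi ->
  \int[leb]_t inner (at_time (U n) t) (fun i x => derive1 (Psi i ^~ x) t) +
  \int[leb]_t quad (at_time Psi t) (at_time (U n) t) +
  nu n * \int[leb]_t inner (at_time (U n) t) (vlap (at_time Psi t)) = 0.

Section fixed_field.
Variables (Phi : 'I_2 -> R -> plane R -> R) (a b L : R) (S : set (plane R)).
Hypotheses (sol : solenoidal_test_field `]0, T[ Om Phi) (SO : S `<=` Om)
  (a0 : 0 < a) (ab : a <= b) (bT : b < T)
  (outT : forall i t x, ~ (a <= t <= b) -> Phi i t x = 0)
  (outS : forall i t x, ~ S x -> Phi i t x = 0)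
  (L0 : 0 <= L) (PL : forall i j t x, `|pderiv j (Phi i t) x| <= L).

Let ind_t : L1 leb (fun t => \1_(`[a, b]%classic) t).
Proof. by apply: (L1_indic (mu := leb)) => //; exact: leb_segment_fin. Qed.

Let ind_x : L1 leb2 (fun x : plane R => \1_(obox M) x).
Proof. have mQ := box_measurable M; exact: (L1_indic (mu := leb2) mQ (box_finite mQ (@subset_refl _ (obox M)))). Qed.

Let E0 : 0 <= E.
Proof. by case: foo => _ _ h _ _; exact: le_trans (energy_ge0 _) (h 0). Qed.

Let mflux V e : flow T Om E V -> 0 < e -> measurable_fun setT (fun z : R * plane R => moll_flux Phi e V z.1 z.2).
Proof. by move=> fV e0; exact: (flux_jmeas sol e0 fV). Qed.

(** [curl_compactness] at each x of S, where both observables are admissible test fields, then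
    dominated convergence in x; off S the density is 0. *)
Lemma moll_quad_fields_cvg e : 0 < e -> (forall x, S x -> cbox x e `<=` Om) ->
  \int[leb]_t quad (at_time Phi t) (moll e (at_time (U n) t)) @[n --> \oo] -->
  \int[leb]_t quad (at_time Phi t) (moll e (at_time Uoo t)).
Proof.
move=> e0 Se; have sw V (fV : flow T Om E V) := flux_swap OQ T0 ab sol SO outT outS e0 Se fV.
apply: (cvg_opp_eq (fun n => sw _ (fU n)) (sw _ foo)).
have [C C0 HC] := flux_bound OQ E sol SO outT outS e0.
have vi V : flow T Om E V -> forall i t, L1 leb2 (V i t) by case=> _ V2 _ _ _ i t; exact: (V2 t i).1.
apply: (@Int_cvg _ _ R leb2 (fun n x => \int[leb]_t moll_flux Phi e (U n) t x)
  (fun x => \int[leb]_t moll_flux Phi e Uoo t x)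
  (fun x => (C * \int[leb]_t \1_(`[a, b]%classic) t) * \1_(obox M) x)).
- move=> n; exact: (@fubini_measurable2 _ _ (measurableTypeR R) (measurableTypeR R * measurableTypeR R)%type R
    leb (fun z : R * plane R => moll_flux Phi e (U n) z.1 z.2) (mflux (fU n) e0)).
- exact: (L1Zl (mu := leb2)).
- move=> x; have [Sx|Sx] := pselect (S x); last first.
    have z V : (fun t => moll_flux Phi e V t x) = (fun=> 0).
      by apply/funext => t; rewrite /moll_flux /cross !outS// !mul0r subrr mulr0.
    rewrite z; under eq_cvg do rewrite z.
    exact: cvg_cst.
  have xe := Se x Sx; have cx V (fV : flow T Om E V) t := curl_obsE x e0 (vi V fV ^~ t).
  have mx V (fV : flow T Om E V) t j := comp_obsE e x j (vi V fV ^~ t).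
  have [B0 B00 HB0] := field_bounded sol 0; have [B1 B10 HB1] := field_bounded sol 1.
  have mP i : measurable_fun setT (fun t => Phi i t x).
    exact: (measurableT_comp (field_jmeas sol i) (g := fun t => (t, x)) (measurable_pair2 x)).
  have cc := curl_compactness OQ mO T0 fU foo nuN weak ns a0 ab bT (curl_obs_test e0 xe) (curl_obs_div e0 xe).
  have c1 := cc _ _ _ (comp_obs_test e0 xe 0) (mP 1) (HB1 ^~ x) (fun t => @outT 1 t x).
  have c2 := cc _ _ _ (comp_obs_test e0 xe 1) (mP 0) (HB0 ^~ x) (fun t => @outT 0 t x).
  have co2 i := test_L2 OQ mO (curl_obs_test e0 xe i).
  have ca2 j i := test_L2 OQ mO (comp_obs_test e0 xe j i).
  have EV V : flow T Om E V -> \int[leb]_t moll_flux Phi e V t x =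
    \int[leb]_t (Phi 1 t x * inner (at_time V t) (curl_obs e x) * inner (at_time V t) (comp_obs e x 0)) -
    \int[leb]_t (Phi 0 t x * inner (at_time V t) (curl_obs e x) * inner (at_time V t) (comp_obs e x 1)).
    move=> fV; have li i j : L1 leb (fun t => Phi i t x * inner (at_time V t) (curl_obs e x) * inner (at_time V t) (comp_obs e x j)).
      have [B Bp HB] := field_bounded sol i.
      apply: (@L1_bounded_supp _ _ R leb `[a, b]%classic (B * ((E + energy (curl_obs e x)) / 2) * ((E + energy (comp_obs e x j)) / 2))) => //.
      - exact: leb_segment_fin.
      - apply: measurable_funM; last exact: inner_measurable fV (ca2 j).
        by apply: measurable_funM; [exact: mP|exact: inner_measurable fV co2].
      - move=> t; rewrite !normrM; apply: ler_pM => //.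
          by apply: ler_pM => //; exact: (inner_le t fV co2).
        exact: (inner_le t fV (ca2 j)).
      - by move=> t nt; rewrite outT ?mul0r//; move: nt; rewrite /= in_itv.
    rewrite -(IntB (mu := leb) (li 1 0) (li 0 1)); apply: Int_ext => t.
    rewrite /moll_flux (cx V fV t) /cross !(mx V fV t); ring.
  exact: (cvg_sub_eq (fun n => EV _ (fU n)) (EV _ foo) c1 c2).
- move=> x n; have iC := L1Zl (mu := leb) C ind_t.
  rewrite -(IntZl (mu := leb) C ind_t) -(IntZr (mu := leb) (\1_(obox M) x) iC).
  have m1 : measurable_fun setT (fun t => moll_flux Phi e (U n) t x).
    exact: (measurableT_comp (mflux (fU n) e0) (g := fun t => (t, x)) (measurable_pair2 x)).
  apply: (Int_norm_le (mu := leb)) => //; first exact: (L1Zr (mu := leb)).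
  by move=> t; exact: HC.
Qed.

Let quad_args t : [/\ forall i, nice M (Phi i t), forall i j x, ~ obox M x -> pderiv j (Phi i t) x = 0 &
   forall i j x, `|pderiv j (Phi i t) x| <= L].
Proof.
have tv := field_test_vector T0 sol t; split.
- by move=> i; exact: (test_nice OQ (tv i)).
- by move=> i j x nQ; apply: (test_function_out (test_pderiv j (tv i))) => /OQ.
- by move=> i j x; exact: PL.
Qed.

Let mquad V : flow T Om E V -> measurable_fun setT (fun t => quad (at_time Phi t) (at_time V t)).
Proof. by case=> mV _ _ _ _; apply: quad_measurable => // i j; exact: field_pderiv_jmeas sol i j. Qed.

Let mquadm V e : 0 < e -> flow T Om E V -> measurable_fun setT (fun t => quad (at_time Phi t) (moll e (at_time V t))).
Proof.
move=> e0 [mV _ _ _ _]; apply: (@quad_measurable R Phi (fun i t => moll e (at_time V t) i)).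
  by move=> i; apply: jmeas_conv => //; exact: nice_continuous (nice_rho e0).
by move=> i j; exact: field_pderiv_jmeas sol i j.
Qed.

Let quad_out t v : ~ (a <= t <= b) -> quad (at_time Phi t) v = 0.
Proof.
move=> nt; rewrite /quad -[RHS](Int_0 leb2); apply: Int_ext => x.
have z i j : pderiv j (Phi i t) x = 0.
  have -> : Phi i t = cst 0 by apply/funext => y; exact: outT.
  exact: derive_cst.
by apply: big1 => i _; apply: big1 => j _; rewrite z !mul0r.
Qed.

Lemma quad_time_L1 V : flow T Om E V -> L1 leb (fun t => quad (at_time Phi t) (at_time V t)).
Proof.
move=> fV; apply: (@L1_bounded_supp _ _ R leb `[a, b]%classic (4 * L * E)) => //.
- exact: leb_segment_fin.
- exact: mquad.
- move=> t; have [nP PQ PLt] := quad_args t; case: (fV) => _ V2 VE _ _.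
  by apply: (le_trans (quad_le L0 nP PQ PLt (V2 t))); rewrite ler_wpM2l// mulr_ge0.
- by move=> t nt; apply: quad_out; move: nt; rewrite /= in_itv.
Qed.

Let quad_mollE_le V e t : 0 < e -> flow T Om E V ->
  `|quad (at_time Phi t) (moll e (at_time V t))| <= 4 * L * E * \1_(`[a, b]%classic) t.
Proof.
move=> e0 fV; have [h|h] := boolP (a <= t <= b); last first.
  by rewrite quad_out ?normr0 ?mulr_ge0//; exact/negP.
rewrite indic_in ?mulr1 ?/= ?in_itv//.
have [nP PQ PLt] := quad_args t; case: (fV) => _ V2 VE _ _.
by apply: (le_trans (quad_moll_le L0 nP PQ PLt (V2 t) e0)); rewrite ler_wpM2l// mulr_ge0.
Qed.

Lemma quad_moll_time_L1 V e : 0 < e -> flow T Om E V ->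
  L1 leb (fun t => quad (at_time Phi t) (moll e (at_time V t))).
Proof.
move=> e0 fV; apply: (L1_le (mu := leb)) (mquadm e0 fV) (L1Zl (mu := leb) (4 * L * E) ind_t) _.
by move=> t; exact: quad_mollE_le.
Qed.

Lemma quad_moll_time_cvg V : flow T Om E V ->
  \int[leb]_t quad (at_time Phi t) (moll k.+1%:R^-1 (at_time V t)) @[k --> \oo] -->
  \int[leb]_t quad (at_time Phi t) (at_time V t).
Proof.
move=> fV; have e0 k : 0 < k.+1%:R^-1 :> R by rewrite invr_gt0 ltr0n.
apply: (@Int_cvg _ _ R leb (fun k t => quad (at_time Phi t) (moll k.+1%:R^-1 (at_time V t)))
  (fun t => quad (at_time Phi t) (at_time V t)) (fun t => 4 * L * E * \1_(`[a, b]%classic) t)).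
- by move=> k; exact: mquadm.
- exact: (L1Zl (mu := leb)).
- move=> t; have [nP PQ PLt] := quad_args t; case: (fV) => _ V2 _ V0 _.
  apply: (quad_moll_cvg L0 nP PQ PLt (V2 t)) => i x nQ; apply: V0 => -[_ /OQ]; exact: nQ.
- by move=> t k; exact: quad_mollE_le.
Qed.

Section vorticity.
Variables (K : set (plane R)) (CK r : R) (W : nat -> R -> plane R -> R).
Hypotheses (KO : K `<=` Om) (r0 : 0 < r) (SK : forall x, S x -> cbox x r `<=` K)
  (W1 : forall n t, L1 leb2 (W n t)) (WC : forall n t, \int[leb2]_x `|W n t x| <= CK)
  (Wrot : forall n t, weak_rot K (at_time (U n) t) (W n t)).
Hypothesis concentration : forall dlt d0 : R, 0 < dlt -> 0 < d0 -> exists d, [/\ 0 < d, d <= d0 &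
  forall n, L1 leb (fun t => near_mass d (W n t)) /\ \int[leb]_t near_mass d (W n t) <= dlt].

Lemma near_mass_ge0 d w : 0 <= near_mass d w :> R.
Proof.
apply: Int_ge0 => z; apply: mulr_ge0 => //; apply: Int_ge0 => y.
by apply: mulr_ge0 => //; exact: near_ge0.
Qed.

Lemma quad_moll_error d : 0 < d -> d <= r -> exists2 C, 0 <= C &
  forall e n, 0 < e -> e <= d -> L1 leb (fun t => near_mass d (W n t)) ->
  `|\int[leb]_t quad (at_time Phi t) (moll e (at_time (U n) t)) -
    \int[leb]_t quad (at_time Phi t) (at_time (U n) t)| <=
  24 * L * kconst R * \int[leb]_t near_mass d (W n t) + e * C.
Proof.
move=> d0 dr.
have [B0 B00 HB0] := field_bounded sol 0; have [B1 B10 HB1] := field_bounded sol 1.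
pose B := Num.max B0 B1; have BB i t x : `|Phi i t x| <= B.
  rewrite le_max; have [->|->] := ord2_cases i.
    by rewrite HB0.
  by rewrite HB1 orbT.
have Bp : 0 <= B by rewrite le_max B00.
have [C C0 HC] := static_estimate M d0 Bp L0.
pose A := Num.max (\int[leb2]_x (\1_(obox M) x : R) + E) 0.
have A0 : 0 <= A by rewrite le_max lexx orbT.
have CK0 : 0 <= CK by apply: le_trans (WC 0%N 0); exact: Int_ge0.
pose G := C * (A + A) * CK; have G0 : 0 <= G by rewrite !mulr_ge0// addr_ge0.
exists (G * \int[leb]_t \1_(`[a, b]%classic) t).
  by rewrite mulr_ge0//; apply: Int_ge0.
move=> e n e0 ed nL; have fV := fU n.
have k0 := kconst_ge0 R; have n0 t : 0 <= near_mass d (W n t) by exact: near_mass_ge0.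
rewrite -(IntB (mu := leb) (quad_moll_time_L1 e0 fV) (quad_time_L1 fV)).
rewrite mulrA -(IntZl (mu := leb) _ ind_t) -(IntZl (mu := leb) _ nL).
have l1 := L1Zl (mu := leb) (24 * L * kconst R) nL; have l2 := L1Zl (mu := leb) (e * G) ind_t.
rewrite -(IntD (mu := leb) l1 l2); apply: (Int_norm_le (mu := leb)).
- exact: measurable_funB (mquadm e0 fV) (mquad fV).
- exact: (L1D (mu := leb)).
move=> t; have h24 : 0 <= 24 * L * kconst R by rewrite mulr_ge0// mulr_ge0// ler0n.
have [h|h] := boolP (a <= t <= b); last first.
  have nt : ~ (a <= t <= b) by exact/negP.
  rewrite !quad_out// subrr normr0; apply: addr_ge0; first exact: mulr_ge0.
  by apply: mulr_ge0 => //; apply: mulr_ge0 => //; exact: ltW.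
rewrite indic_in ?mulr1 ?/= ?in_itv//.
have [nP PQ PLt] := quad_args t; case: (fV) => _ V2 _ V0 Vd.
have -> : 24 * L * kconst R * near_mass d (W n t) = 2 * (12 * L * kconst R * near_mass d (W n t)) by ring.
have vA i : \int[leb2]_x `|U n i t x| <= A.
  by apply: (le_trans (flow_L1_le OQ i t fV)); rewrite le_max lexx.
apply: (concentration_estimate (d := d) (w := W n t) L0 nP PQ PLt (V2 t)) => //.
  by move=> i x nQ; apply: V0 => -[_ /OQ]; exact: nQ.
move=> e' e'0 e'd.
have vd : weak_div0 K (at_time (U n) t) by move=> phi tp; apply: Vd; exact: test_function_sub tp.
have Kc i x : Phi i t x != 0 -> cbox x d `<=` K.
  move=> Px; apply: (subset_trans (cbox_sub dr)); apply: SK; apply: contrapT => nS.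
  by move/eqP: Px; apply; exact: outS.
apply: (le_trans (HC K (at_time Phi t) (at_time (U n) t) (W n t) e' nP (sol.2 t) (fun i => BB i t)
  PLt (fun i => (V2 t i).1) (W1 n t) vd (Wrot n t) Kc e'0 e'd)).
rewrite lerD2l ler_wpM2l ?(ltW e'0)//; apply: ler_pM => //.
- by rewrite mulr_ge0// addr_ge0//; apply: Int_ge0.
- by apply: Int_ge0.
- by rewrite ler_wpM2l// lerD.
Qed.

(** Four errors of eta / 4: concentration of vorticity, the term e C(d), mollification of the limit
    velocity, and convergence at the fixed scale e = 1/(k+1). Hence d is chosen first, then k, then
    n. *)
Lemma quad_fields_cvg :
  \int[leb]_t quad (at_time Phi t) (at_time (U n) t) @[n --> \oo] -->
  \int[leb]_t quad (at_time Phi t) (at_time Uoo t).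
Proof.
apply/cvgrPdist_le => eta eta0; have k0 := kconst_ge0 R.
pose q := 24 * L * kconst R; have q0 : 0 <= q by rewrite mulr_ge0// mulr_ge0// ler0n.
have dl : 0 < eta / (4 * (q + 1)) by rewrite divr_gt0// mulr_gt0// ltr_wpDl.
have [d [d0 dr nm]] := concentration dl r0.
have [C C0 HC] := quad_moll_error d0 dr.
have ek0 : (k.+1%:R^-1 : R) @[k --> \oo] --> 0 by exact: cvg_harmonic.
have h1 : \forall k \near \oo, k.+1%:R^-1 <= d.
  have /cvgrPdist_le/(_ d d0) := ek0; apply: filterS => k.
  by rewrite sub0r normrN => /(le_trans (ler_norm _)).
have h2 : \forall k \near \oo, k.+1%:R^-1 * C <= eta / 4.
  have cc : k.+1%:R^-1 * C @[k --> \oo] --> 0.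
    by rewrite -(mul0r C); apply: cvgM => //; exact: cvg_cst.
  have e4 : 0 < eta / 4 by rewrite divr_gt0.
  have /cvgrPdist_le/(_ _ e4) := cc; apply: filterS => k.
  by rewrite sub0r normrN => /(le_trans (ler_norm _)).
have e4 : 0 < eta / 4 by rewrite divr_gt0.
have /cvgrPdist_le/(_ _ e4) h3 := quad_moll_time_cvg foo.
have [k [hk1 [hk2 hk3]]] := @filter_ex _ _ _ _ (filterI h1 (filterI h2 h3)).
have ek : 0 < k.+1%:R^-1 :> R by rewrite invr_gt0 ltr0n.
have Se x : S x -> cbox x k.+1%:R^-1 `<=` Om.
  move=> Sx; apply: (subset_trans (cbox_sub (le_trans hk1 dr))).
  exact: subset_trans (SK Sx) KO.
have /cvgrPdist_le/(_ _ e4) := moll_quad_fields_cvg ek Se; apply: filterS => n hn.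
have [nL nI] := nm n; have := HC _ n ek hk1 nL; rewrite -/q.
have hq : q * \int[leb]_t near_mass d (W n t) <= eta / 4.
  by apply: (le_trans (ler_wpM2l q0 nI)); exact: fraction_quarter_le.
exact: (four_quarters hk2 hk3 hn hq).
Qed.

Lemma euler_identity (nu0 : nu n @[n --> \oo] --> 0) :
  \int[leb]_t inner (at_time Uoo t) (fun i x => derive1 (Phi i ^~ x) t) +
  \int[leb]_t quad (at_time Phi t) (at_time Uoo t) = 0.
Proof.
have bnd (psi : 'I_2 -> R -> plane R -> R) : (forall i, exists2 B, 0 <= B & forall t x, `|psi i t x| <= B) ->
    exists c, forall i t x, `|psi i t x| <= c.
  move=> h; have [B0 B00 HB0] := h 0; have [B1 B10 HB1] := h 1.
  exists (Num.max B0 B1) => i t x; rewrite le_max.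
  have [->|->] := ord2_cases i.
    by rewrite HB0.
  by rewrite HB1 orbT.
pose p1 (i : 'I_2) t x := derive1 (Phi i ^~ x) t.
pose p2 (i : 'I_2) t x := vlap (at_time Phi t) i x.
have [c1 hc1] : exists c, forall i t x, `|p1 i t x| <= c.
  by apply: bnd => i; exact: (field_derive1 sol i).2.
have [c2 hc2] : exists c, forall i t x, `|p2 i t x| <= c.
  apply: bnd => i; have [_ [B0 B00 HB0]] := field_pderiv2 sol i 0.
  have [_ [B1 B10 HB1]] := field_pderiv2 sol i 1.
  exists (B0 + B1); first exact: addr_ge0.
  by move=> t x; rewrite /p2 /vlap sum_ord2; apply: (le_trans (ler_normD _ _)); exact: lerD.
have m2 i : jmeas (p2 i).
  have -> : p2 i = (fun t x => pderiv 0 (pderiv 0 (Phi i t)) x + pderiv 1 (pderiv 1 (Phi i t)) x).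
    by apply/funext => t; apply/funext => x; rewrite /p2 /vlap sum_ord2.
  exact: (measurable_funD (field_pderiv2 sol i 0).1 (field_pderiv2 sol i 1).1).
have w1 := weak (fun i => (field_derive1 sol i).1) hc1.
have w2 := weak m2 hc2.
have w3 := quad_fields_cvg.
have nsn n := ns n sol.
have H := cvg_sum_eq0 w1 w3 nu0 w2.
exact: (H nsn).
Qed.

End vorticity.
End fixed_field.
End euler_limit.

Lemma sum_parts0 (R : realType) (a0 a1 c0 c1 s0 s1 : R) : s0 = a0 + c0 -> s1 = a1 + c1 ->
  s0 = 0 -> s1 = 0 -> c0 + c1 = 0 -> a0 + a1 = 0.
Proof. lra. Qed.

Lemma two_errors (R : realType) (a b c d p q s C0 C1 : R) : a + b = 0 ->
  `|a - c| <= 2 * s * C0 * p -> `|b - d| <= 2 * s * C1 * q ->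
  `|c + d| <= s * (2 * C0 * p + 2 * C1 * q).
Proof.
move=> ab h1 h2; have -> : c + d = - ((a - c) + (b - d)) by rewrite addrACA ab; ring.
rewrite normrN; apply: (le_trans (ler_normD _ _)).
have -> : s * (2 * C0 * p + 2 * C1 * q) = 2 * s * C0 * p + 2 * s * C1 * q by ring.
exact: lerD.
Qed.

(** * Divergence of the limit *)

Section weak_divergence.
Context (R : realType) (T M : R) (Om : set (plane R)).
Implicit Types (t c e : R) (x y : plane R) (phi : plane R -> R) (v : 'I_2 -> plane R -> R).
Local Notation leb := (@lebesgue_measure R).
Local Notation at_time f t := (fun i => f i t).
Hypotheses (OQ : Om `<=` obox M) (Oo : open Om) (T0 : 0 < T).

Definition grad phi : 'I_2 -> plane R -> R := fun i => pderiv i phi.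

Let grad2 phi : test_function Om phi -> forall i, L2 (grad phi i).
Proof.
have mO := open_measurable_plane Oo.
by move=> tp i; exact: (test_L2 OQ mO (test_pderiv i tp)).
Qed.

Lemma weak_div0_inner v : (forall i, L2 (v i)) ->
  (forall phi, test_function Om phi -> inner v (grad phi) = 0) -> weak_div0 Om v.
Proof.
move=> v2 H phi tp; have i0 := L2_prod (v2 0) (grad2 tp 0); have i1 := L2_prod (v2 1) (grad2 tp 1).
apply: etrans _ (H _ tp); rewrite /inner -(IntD (mu := leb2) i0 i1).
by apply: Int_ext => x; rewrite sum_ord2.
Qed.

(** Enumerates rational centres and scales 1/(k+1). Almost every time has to be good for all tests
    at once, so only countably many tests may be used. *)
Let rat_scale (n : nat) : (plane R * nat)%type :=
  if unpickle n is Some (p, q, k) then ((ratr p, ratr q), k) else ((0, 0), 0%N).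

Let rat_scaleP p q k : rat_scale (pickle (p, q, k)) = ((ratr p, ratr q), k).
Proof. by rewrite /rat_scale pickleK. Qed.

Lemma zero_of_rational (h : plane R -> R) y r : 0 < r -> continuous h ->
  (forall p q : rat, cbox y r (ratr p, ratr q) -> h (ratr p, ratr q) = 0) -> h y = 0.
Proof.
move=> r0 ch H; apply: contrapT => /eqP hy.
have hy0 : 0 < `|h y| by rewrite normr_gt0.
have /cvgrPdist_lt/(_ _ hy0) [[A B] [/nbhs_ballP[r1 r10 h1] /nbhs_ballP[r2 r20 h2]] AB] := ch y.
pose s := Num.min r (Num.min r1 r2).
have s0 : 0 < s by rewrite !lt_min r0 r10 r20.
have sr : s <= r by rewrite ge_min lexx.
have s1 : s <= r1 by rewrite !ge_min lexx orbT.
have s2 : s <= r2 by rewrite !ge_min lexx !orbT.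
have rt (a : R) : exists p : rat, `|a - ratr p| < s.
  have ss : a - s < a + s by lra.
  have [p] := rat_in_itvoo ss.
  by rewrite in_itv /= => /andP[h3 h4]; exists p; rewrite ltr_norml; apply/andP; split; lra.
have [p hp] := rt y.1; have [q hq] := rt y.2.
have h0 : h (ratr p, ratr q) = 0 by apply: H; split; apply: ltW; exact: lt_le_trans sr.
have k1 : ball y.1 r1 (ratr p) by exact: lt_le_trans s1.
have k2 : ball y.2 r2 (ratr q) by exact: lt_le_trans s2.
have := AB (ratr p, ratr q) (conj (h1 _ k1) (h2 _ k2)).
by rewrite /= h0 subr0 ltxx.
Qed.

Let g e x (y : plane R) := rho e (x - y).

Lemma moll_divergence v e x : 0 < e -> (forall i, L1 leb2 (v i)) ->
  inner v (grad (g e x)) = - divergence (moll e v) x.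
Proof.
move=> e0 vi; have nr := nice_rho e0.
rewrite /divergence sum_ord2 /moll !(pderiv_conv _ _ nr (vi _)) opprD /inner.
have E i : \int[leb2]_y (v i y * grad (g e x) i y) = - conv (pderiv i (rho e)) (v i) x.
  have i1 := L1_conv_nice x (nice_pderiv i nr) (vi i).
  rewrite /conv -(IntN (mu := leb2) i1); apply: Int_ext => y.
  by rewrite /grad (pderiv_reflect x i y (smooth_rho e)) mulrN mulrC.
exact: (congr2 +%R (E 0) (E 1)).
Qed.

Lemma integral_divergence_moll v e phi : 0 < e -> (forall i, L1 leb2 (v i)) -> test_function Om phi ->
  (forall x, phi x != 0 -> divergence (moll e v) x = 0) ->
  \int[leb2]_x (moll e v 0 x * pderiv 0 phi x) + \int[leb2]_x (moll e v 1 x * pderiv 1 phi x) = 0.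
Proof.
move=> e0 vi tp H; have nr := nice_rho e0; have cp := smooth_C1 tp.1.
have cm i : C1 (moll e v i) by exact: conv_C1 nr (vi i).
have bp := test_box OQ tp.
have z i : \int[leb2]_x (moll e v i x * pderiv i phi x + phi x * pderiv i (moll e v i) x) = 0.
  have bx : box_supp M (fun x => moll e v i x * phi x) by move=> x /bp ->; rewrite mulr0.
  have := Int_pderiv i (C1M (cm i) cp) bx; rewrite (pderivM i (cm i) cp); exact.
have i1 i : L1 leb2 (fun x => moll e v i x * pderiv i phi x).
  apply: (@box_supp_L1 R (M + 1)).
    have c1 := C1_continuous (cm i); have c2 := @C1_continuousD R phi i cp.
    by move=> x; exact: (cvgM (c1 x) (c2 x)).
  by move=> x h; rewrite (box_supp_pderiv i bp h) mulr0.
have i2 i : L1 leb2 (fun x => phi x * pderiv i (moll e v i) x).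
  apply: (@box_supp_L1 R M).
    have c1 := C1_continuous cp; have c2 := @C1_continuousD R _ i (cm i).
    by move=> x; exact: (cvgM (c1 x) (c2 x)).
  by move=> x /bp ->; rewrite mul0r.
have z' : \int[leb2]_x (phi x * pderiv 0 (moll e v 0) x) + \int[leb2]_x (phi x * pderiv 1 (moll e v 1) x) = 0.
  rewrite -(IntD (mu := leb2) (i2 0) (i2 1)) -[RHS](Int_0 leb2); apply: Int_ext => x.
  rewrite -mulrDr; have [->|px] := eqVneq (phi x) 0; first by rewrite mul0r.
  by have := H x px; rewrite /divergence sum_ord2 => ->; rewrite mulr0.
have e1 i := IntD (mu := leb2) (i1 i) (i2 i).
exact: (sum_parts0 (e1 0) (e1 1) (z 0) (z 1) z').
Qed.

(** Testing with y -> rho(x - y) at rational x says that the mollified field has divergence 0 there,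
    hence by continuity on the support of phi. Integration by parts against phi, then the limit of
    small scale, gives the weak identity. *)
Lemma weak_div0_rational v : (forall i, L2 (v i)) ->
  (forall p q k, cbox (ratr p, ratr q) k.+1%:R^-1 `<=` Om ->
     inner v (grad (g k.+1%:R^-1 (ratr p, ratr q))) = 0) -> weak_div0 Om v.
Proof.
move=> v2 H; have vi i := (v2 i).1; apply: weak_div0_inner => // phi tp.
set S := closure [set x | phi x != 0]; have [sp [cS SO]] := tp.
have [r r0 rO] := uniform_cbox cS Oo SO; have cp := smooth_C1 sp.
have ek k : 0 < k.+1%:R^-1 :> R by rewrite invr_gt0 ltr0n.
have z k x : k.+1%:R^-1 <= r / 2 -> phi x != 0 -> divergence (moll k.+1%:R^-1 v) x = 0.
  move=> kr px; have nr := nice_rho (ek k).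
  have r2 : 0 < r / 2 by rewrite divr_gt0.
  apply: (zero_of_rational (h := divergence (moll k.+1%:R^-1 v)) r2).
    have -> : divergence (moll k.+1%:R^-1 v) =
        (fun x => pderiv 0 (moll k.+1%:R^-1 v 0) x + pderiv 1 (moll k.+1%:R^-1 v 1) x).
      by apply/funext => y; rewrite /divergence sum_ord2.
    have c i : C1 (moll k.+1%:R^-1 v i) by exact: conv_C1 nr (vi i).
    have c1 := @C1_continuousD R _ 0 (c 0); have c2 := @C1_continuousD R _ 1 (c 1).
    by move=> z; exact: (cvgD (c1 z) (c2 z)).
  move=> p q [h1 h2]; apply: oppr_inj; rewrite oppr0 -(moll_divergence _ (ek k) vi).
  apply: H => y [h3 h4]; apply: (rO x); first exact: subset_closure.
  have half : r / 2 + k.+1%:R^-1 <= r by move: kr; move: (k.+1%:R^-1) => s; lra.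
  split; apply: le_trans half.
    exact: le_trans (ler_distD (ratr p) _ _) (lerD h1 h3).
  exact: le_trans (ler_distD (ratr q) _ _) (lerD h2 h4).
have lip i : exists2 C, 0 <= C & forall x y, `|pderiv i phi x - pderiv i phi y| <= C * n1 (x - y).
  have ci := smooth_C1 (smooth_pderiv i sp).
  have bb := nice_bounded_pderiv (test_nice OQ (test_pderiv i tp)).
  by have [C C0 HC] := bb; exists C => // x y; exact: (C1_lipschitz ci HC).
have [C0 C00 HC0] := lip 0; have [C1 C10 HC1] := lip 1.
have gi i : L1 leb2 (pderiv i phi) by exact: (grad2 tp i).1.
pose B := 2 * C0 * \int[leb2]_x `|v 0 x| + 2 * C1 * \int[leb2]_x `|v 1 x|.
apply/eqP; rewrite -normr_eq0; apply/eqP/le_anti; rewrite normr_ge0 andbT.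
have cB : (k.+1%:R^-1 : R) * B @[k --> \oo] --> 0.
  rewrite -(mul0r B); apply: cvgM; [exact: cvg_harmonic|exact: cvg_cst].
have c0 : (fun _ : nat => `|inner v (grad phi)|) @ \oo --> `|inner v (grad phi)| by exact: cvg_cst.
apply: (ler_cvg_to c0 cB).
have r2 : 0 < r / 2 by rewrite divr_gt0.
have ek0 : (k.+1%:R^-1 : R) @[k --> \oo] --> 0 by exact: cvg_harmonic.
have /cvgrPdist_le/(_ _ r2) := ek0; apply: filterS => k.
rewrite sub0r normrN => /(le_trans (ler_norm _)) kr.
have I := integral_divergence_moll (ek k) vi tp (fun x => z k x kr).
have m0 := moll_lipschitz (ek k) (vi 0) (gi 0) C00 HC0.
have m1 := moll_lipschitz (ek k) (vi 1) (gi 1) C10 HC1.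
exact: (two_errors I m0 m1).
Qed.

Variables (V : 'I_2 -> R -> plane R -> R) (E : R).
Hypotheses (mV : forall i, jmeas (V i)) (V2 : forall t i, L2 (V i t))
  (VE : forall t, energy (at_time V t) <= E)
  (V0 : forall i t x, ~ (`]0, T[%classic t /\ Om x) -> V i t x = 0).
Hypothesis orthogonal : forall phi (th : R -> R) (c : R), test_function Om phi -> measurable_fun setT th ->
  (forall t, `|th t| <= c) -> \int[leb]_t (th t * inner (at_time V t) (grad phi)) = 0.

(** Choosing the pairing itself as time weight [th] shows that its square has integral 0. *)
Lemma inner_grad_ae phi : test_function Om phi ->
  {ae leb, forall t, inner (at_time V t) (grad phi) = 0}.
Proof.
move=> tp; set p := fun t => inner (at_time V t) (grad phi).
have g2 := grad2 tp.
have mp : measurable_fun setT p.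
  by apply: jmeas_inner => // i; apply: jmeas_cst; exact: L2_measurable (g2 i).
have pc t : `|p t| <= (E + energy (grad phi)) / 2.
  by have := inner_norm_le (V2 t) g2 ltr01; have := VE t; rewrite invr1 !mul1r; lra.
have p0 t : ~ `]0, T[%classic t -> p t = 0.
  move=> nt; have z i : \int[leb2]_x (V i t x * grad phi i x) = 0.
    by rewrite -[RHS](Int_0 leb2); apply: Int_ext => x; rewrite V0 ?mul0r// => -[].
  by rewrite /p /inner !z addr0.
have := orthogonal tp mp pc; set J := \int[leb]_t _ => J0.
have pp : L1 leb (fun t => p t * p t).
  apply: (@L1_bounded_supp _ _ R leb `]0, T[%classic (((E + energy (grad phi)) / 2) * ((E + energy (grad phi)) / 2))) => //.
  - have := lebesgue_measure_itv `]0, T[; rewrite /= lte_fin T0 => h.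
    by apply: (@le_lt_trans _ _ (T%:E - 0%:E)%E); [rewrite -h; exact: lexx|rewrite -EFinD ltry].
  - exact: measurable_funM.
  - by move=> t; rewrite normrM ler_pM.
  - by move=> t /p0 ->; rewrite mul0r.
have mpp : measurable_fun setT (fun t => (p t * p t)%:E).
  by apply/measurable_EFinP; exact: measurable_funM.
have := (ae_eq_integral_abs leb measurableT mpp).1.
have -> : (\int[leb]_x `|(p x * p x)%:E| = 0)%E.
  have E1 : (\int[leb]_x `|(p x * p x)%:E| = \int[leb]_x (p x * p x)%:E)%E.
    by apply: eq_integral => t _; rewrite /= ger0_norm// -expr2 sqr_ge0.
  by rewrite E1 -(EFin_Int (mu := leb) pp) -/J J0.
move=> /(_ erefl); have FF := ae_filter_ringOfSetsType leb.
by apply: filterS => t /(_ Logic.I) [] /eqP; rewrite mulf_eq0 orbb => /eqP.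
Qed.

Lemma weak_div0_ae : {ae leb, forall t, weak_div0 Om (at_time V t)}.
Proof.
have H n : {ae leb, forall t, cbox (rat_scale n).1 (rat_scale n).2.+1%:R^-1 `<=` Om ->
   inner (at_time V t) (grad (g (rat_scale n).2.+1%:R^-1 (rat_scale n).1)) = 0}.
  have FF := ae_filter_ringOfSetsType leb.
  have [h|h] := pselect (cbox (rat_scale n).1 (rat_scale n).2.+1%:R^-1 `<=` Om); last first.
    by apply: filterE => t /h.
  have ek : 0 < (rat_scale n).2.+1%:R^-1 :> R by rewrite invr_gt0 ltr0n.
  have := inner_grad_ae (test_function_reflect (nice_rho ek) h).
  by apply: filterS => t.
have FF := ae_filter_ringOfSetsType leb; apply: filterS (ae_foralln H) => t Ht.
apply: weak_div0_rational => [i|p q k]; first exact: V2.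
by have := Ht (pickle (p, q, k)); rewrite rat_scaleP.
Qed.

End weak_divergence.

Lemma eq_cvg_lim (R : realType) (f g : nat -> R) (p q : R) : (forall n, f n = g n) -> p = q ->
  f n @[n --> \oo] --> p -> g n @[n --> \oo] --> q.
Proof. by move=> fg <- h; rewrite -(funext fg : f = g). Qed.

(** * From the weak formulations to flows defined at all times *)

Section extension.
Context (R : realType) (T M : R) (Om : set (plane R)).
Implicit Types (t c E : R) (x y : plane R) (D : set R) (v : 'I_2 -> plane R -> R).
Implicit Types (u V psi : 'I_2 -> R -> plane R -> R).
Local Notation leb := (@lebesgue_measure R).
Local Notation at_time f t := (fun i => f i t).
Hypotheses (OQ : Om `<=` obox M) (Oo : open Om) (T0 : 0 < T).

Let mO : measurable Om. Proof. exact: open_measurable_plane. Qed.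

Let leb_T : (leb `]0%R, T[%classic < +oo)%E.
Proof.
have := lebesgue_measure_itv `]0, T[; rewrite /= lte_fin T0 => h.
by apply: (@le_lt_trans _ _ (T%:E - 0%:E)%E); [rewrite -h; exact: lexx|rewrite -EFinD ltry].
Qed.

Definition full_time D := [/\ measurable D, D `<=` `]0, T[ &
  {ae leb, forall t, t \in `]0, T[ -> D t}].

Lemma good_times (P : R -> Prop) : {ae leb, forall t, t \in `]0, T[ -> P t} ->
  exists2 D, full_time D & forall t, D t -> P t.
Proof.
move=> /(measurable_ae_bad (mu := leb))[N [mN N0 HN]].
exists (`]0, T[%classic `\` N); last first.
  by move=> t [tT nN]; apply: HN => //; exact: mem_set.
split; first exact: measurableD.
  by move=> t [].
exists N; split=> // t /= h; apply: contrapT => nN; apply: h => tT; split=> //.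
Qed.

(** Separated from [flow] because the divergence of the limit field is only known after a first
    passage to the limit. *)
Definition preflow E V := [/\ forall i, jmeas (V i), forall t i, L2 (V i t),
  forall t, energy (at_time V t) <= E &
  forall i t x, ~ (`]0, T[%classic t /\ Om x) -> V i t x = 0].

Lemma flow_of E V : preflow E V -> (forall t, weak_div0 Om (at_time V t)) -> flow T Om E V.
Proof. by move=> [h1 h2 h3 h4] h5. Qed.

Lemma L2_0 : L2 (fun _ : plane R => 0 : R).
Proof.
have e : (fun _ : plane R => (0 : R) ^+ 2) = (fun=> 0) by apply/funext => x; rewrite expr0n.
by split; rewrite ?e; exact: (L1_0 leb2).
Qed.

Lemma ext_off D (f : R -> plane R -> R) t : ~ D t -> ext D Om f t = (fun=> 0).
Proof. by move=> nD; apply/funext => x; exact: ext_out. Qed.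

Lemma ext_preflow D u E : full_time D -> (forall i, spacetime_measurable T Om (u i)) -> 0 <= E ->
  (forall t, D t -> (L2normsq_vec Om (at_time u t) <= E%:E)%E) ->
  preflow E (fun i => ext D Om (u i)).
Proof.
move=> [mD DT _] mu_ E0 uE.
have m i : jmeas (ext D Om (u i)).
  exact: (jmeas_ext mO mD DT mO (@subset_refl _ Om) (mu_ i)).
have H t : (forall i, L2 (ext D Om (u i) t)) /\ energy (fun i => ext D Om (u i) t) <= E.
  have [Dt|nD] := pselect (D t).
    have e i : ext D Om (u i) t = ext0 Om (u i t) by exact: ext_in.
    rewrite (funext e); have [|h1 h2] := L2normsq_vec_le OQ _ (uE t Dt).
      by move=> i; rewrite -e; exact: jmeas_slice.
    by split=> // i; rewrite e.
  rewrite (funext (fun i => ext_off (u i) nD)); split=> [i|]; first by rewrite ext_off//; exact: L2_0.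
  have z : \int[leb2]_(x in [set: plane R]) ((0 : R) ^+ 2) = 0.
    by rewrite -[RHS](Int_0 leb2); apply: Int_ext => x; rewrite expr0n.
  by rewrite /energy z addr0.
split=> //; [by move=> t i; exact: (H t).1|by move=> t; exact: (H t).2|].
move=> i t x h; have [Dt|nD] := pselect (D t); last by rewrite ext_out.
by rewrite ext_in// ext0_out// => Ox; apply: h; split=> //; exact: DT.
Qed.

Lemma L2normsq_vec_energy v : (forall i, L2 (ext0 Om (v i))) ->
  L2normsq_vec Om v = (energy (fun i => ext0 Om (v i)))%:E.
Proof.
by move=> h; rewrite /L2normsq_vec sum_ord2 !L2normsqE /energy EFinD !(EFin_Int (mu := leb2) (h _).2).
Qed.

Lemma pairing_transfer D u psi E : full_time D -> (forall i, spacetime_measurable T Om (u i)) ->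
  preflow E (fun i => ext D Om (u i)) -> (forall i, jmeas (psi i)) ->
  (forall i t, L1 leb2 (fun x => ext D Om (u i) t x * psi i t x)) ->
  \int[leb]_(t in `]0, T[) \int[leb2]_(x in Om) (\sum_(i < 2) u i t x * psi i t x) =
  \int[leb]_t inner (fun i => ext D Om (u i) t) (at_time psi t).
Proof.
move=> [mD DT aD] mu_ [mV _ _ V0] mp L; apply: (Int2_transfer (D := D)) => //.
- rewrite /spacetime_measurable; apply: measurable_sum => i; apply: measurable_funM; first exact: mu_.
  by apply: measurable_funTS; exact: mp.
- exact: jmeas_inner mV mp.
- move=> t nD; have z i : \int[leb2]_x (ext D Om (u i) t x * psi i t x) = 0.
    by rewrite -[RHS](Int_0 leb2); apply: Int_ext => x; rewrite ext_out// mul0r.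
  by rewrite /inner !z addr0.
- move=> t Dt; rewrite (Int_ext0 Om) /inner -(IntD (mu := leb2) (L 0 t) (L 1 t)).
  apply: Int_ext => x; rewrite !ext_in// /ext0; case: ifP => _; last by rewrite !mul0r addr0.
  by rewrite sum_ord2.
Qed.

Lemma ext_energy_fin psi : (forall i, jmeas (psi i)) -> (forall i t, L2 (psi i t)) ->
  (forall i t x, ~ Om x -> psi i t x = 0) ->
  (\int[leb]_t (Num.sqrt (energy (at_time psi t)))%:E < +oo)%E ->
  (\int[leb]_(t in `]0%R, T[) sqrte (L2normsq_vec Om (fun i => psi i t)) < +oo)%E.
Proof.
move=> mp p2 p0 fin; apply: le_lt_trans fin.
have e t : sqrte (L2normsq_vec Om (fun i => psi i t)) = (Num.sqrt (energy (at_time psi t)))%:E.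
  have h i : ext0 Om (psi i t) = psi i t.
    by apply/funext => x; rewrite /ext0; case: ifPn => // /negP nx; rewrite p0// => /mem_set.
  rewrite L2normsq_vec_energy /=; last by move=> i; rewrite h.
  by rewrite (funext h).
under eq_integral do rewrite e.
have mnrm : measurable_fun setT (fun t => Num.sqrt (energy (at_time psi t))).
  apply: (measurableT_comp (f := @Num.sqrt R)); last exact: (jmeas_inner mp mp).
  by apply: continuous_measurable_fun; exact: sqrt_continuous.
have m1 : measurable_fun setT (fun t => (Num.sqrt (energy (at_time psi t)))%:E).
  exact/measurable_EFinP.
have p1 t : setT t -> (0 <= (Num.sqrt (energy (at_time psi t)))%:E)%E.
  by move=> _; rewrite lee_fin sqrtr_ge0.
have mT : measurable `]0, T[%classic by [].
exact: (@ge0_subset_integral _ _ R leb _ _ mT measurableT _ m1 p1 (@subsetT _ _)).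
Qed.

Section weak_limits.
Variables (u : nat -> 'I_2 -> R -> plane R -> R) (uoo : 'I_2 -> R -> plane R -> R)
  (D : nat -> set R) (Doo : set R).
Hypotheses (um : forall n i, spacetime_measurable T Om (u n i)) (u_cvg : weak_star_cvg T Om u uoo)
  (fD : forall n, full_time (D n)) (fDoo : full_time Doo).
Variables (E : nat -> R) (Eoo : R).
Hypotheses (pU : forall n, preflow (E n) (fun i => ext (D n) Om (u n i)))
  (poo : preflow Eoo (fun i => ext Doo Om (uoo i))).

Let U n i := ext (D n) Om (u n i).
Let Uoo i := ext Doo Om (uoo i).

Lemma weak_L2 psi : (forall i, jmeas (psi i)) -> (forall i t, L2 (psi i t)) ->
  (forall i t x, ~ Om x -> psi i t x = 0) ->
  (\int[leb]_t (Num.sqrt (energy (at_time psi t)))%:E < +oo)%E ->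
  \int[leb]_t inner (at_time (U n) t) (at_time psi t) @[n --> \oo] -->
  \int[leb]_t inner (at_time Uoo t) (at_time psi t).
Proof.
move=> mp p2 p0 fin; have [[mo _] H] := u_cvg.
have := H psi (fun i => measurable_funTS (mp i)) (ext_energy_fin mp p2 p0 fin).
have e n : \int[leb]_(t in `]0, T[) \int[leb2]_(x in Om) (\sum_(i < 2) u n i t x * psi i t x) =
    \int[leb]_t inner (at_time (U n) t) (at_time psi t).
  apply: (pairing_transfer (fD n) (um n) (pU n)) => // i t.
  by case: (pU n) => _ V2 _ _; exact: L2_prod (V2 t i) (p2 i t).
have eoo : \int[leb]_(t in `]0, T[) \int[leb2]_(x in Om) (\sum_(i < 2) uoo i t x * psi i t x) =
    \int[leb]_t inner (at_time Uoo t) (at_time psi t).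
  apply: (pairing_transfer fDoo mo poo) => // i t.
  by case: poo => _ V2 _ _; exact: L2_prod (V2 t i) (p2 i t).
exact: (eq_cvg_lim e eoo).
Qed.

Lemma weak_L2_bounded psi : (forall i, jmeas (psi i)) -> (forall i t, L2 (psi i t)) ->
  (forall i t x, ~ Om x -> psi i t x = 0) ->
  (\int[leb]_t (Num.sqrt (energy (at_time psi t)))%:E < +oo)%E ->
  exists B : R, forall n, `|\int[leb]_t inner (at_time (U n) t) (at_time psi t)| <= B.
Proof.
move=> mp p2 p0 fin; have h := weak_L2 mp p2 p0 fin.
have [B [_ HB]] := cvg_seq_bounded (cvgP _ h).
exists (B + 1) => n; apply: (HB (B + 1)) => //; rewrite ltrDl//.
Qed.

(** A bounded test becomes admissible once cut off to ]0, T[ x Om, of finite measure, and the cut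
    changes no pairing. *)
Lemma weak_bounded psi c : (forall i, jmeas (psi i)) -> (forall i t x, `|psi i t x| <= c) ->
  \int[leb]_t inner (at_time (U n) t) (at_time psi t) @[n --> \oo] -->
  \int[leb]_t inner (at_time Uoo t) (at_time psi t).
Proof.
move=> mp pc; pose q i := ext `]0, T[%classic Om (psi i).
have mT : measurable `]0, T[%classic by [].
have mq i : jmeas (q i).
  exact: (jmeas_ext mO mT (@subset_refl _ _) mO (@subset_refl _ Om) (measurable_funTS (mp i))).
have c0 : 0 <= c := le_trans (normr_ge0 _) (pc 0 0 (0, 0)).
have qc i t x : `|q i t x| <= c.
  by rewrite /q /ext; case: ifP => _; rewrite ?normr0// /ext0; case: ifP => _; rewrite ?normr0.
have q0 i t x : ~ Om x -> q i t x = 0.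
  by move=> nx; rewrite /q /ext; case: ifP => // _; rewrite ext0_out.
have q2 i t : L2 (q i t) by apply: (bounded_L2 OQ mO (jmeas_slice t (mq i)) (qc i t)) => x; exact: q0.
have io := L1_indic (mu := leb2) mO (box_finite mO OQ).
pose B := 2 * c ^+ 2 * \int[leb2]_x (\1_Om x : R).
have eB t : energy (at_time q t) <= B.
  have h i : \int[leb2]_x (q i t x ^+ 2) <= c ^+ 2 * \int[leb2]_x (\1_Om x : R).
    rewrite -(IntZl (mu := leb2) (c ^+ 2) io); apply: (Int_le (mu := leb2) (q2 i t).2).
      exact: (L1Zl (mu := leb2)).
    move=> x; have [Ox|nO] := pselect (Om x); last by rewrite q0// expr0n indic_out// mulr0.
    rewrite indic_in// mulr1 -real_normK ?num_real//.
    by rewrite lerXn2r ?nnegrE.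
  by rewrite /energy /B -mulrA mulr2n mulrDl !mul1r; exact: lerD.
have fin : (\int[leb]_t (Num.sqrt (energy (at_time q t)))%:E < +oo)%E.
  have : L1 leb (fun t => Num.sqrt (energy (at_time q t))).
    apply: (@L1_bounded_supp _ _ R leb `]0, T[%classic (Num.sqrt B)) => //.
    - apply: (measurableT_comp (f := @Num.sqrt R)); last exact: (jmeas_inner mq mq).
      by apply: continuous_measurable_fun; exact: sqrt_continuous.
    - by move=> t; rewrite ger0_norm ?sqrtr_ge0//; apply: ler_wsqrtr.
    - move=> t nt; have z i : \int[leb2]_x (q i t x ^+ 2) = 0.
        by rewrite -[RHS](Int_0 leb2); apply: Int_ext => x; rewrite /q ext_out// expr0n.
      by rewrite /energy !z addr0 sqrtr0.
  move=> iq; rewrite -(EFin_Int (mu := leb) iq); exact: ltry.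
have e (V : 'I_2 -> R -> plane R -> R) C : preflow C V ->
    \int[leb]_t inner (at_time V t) (at_time q t) = \int[leb]_t inner (at_time V t) (at_time psi t).
  move=> [_ _ _ V0]; apply: Int_ext => t; rewrite /inner; congr (_ + _); apply: Int_ext => x.
    have [[tT Ox]|h] := pselect (`]0, T[%classic t /\ Om x); last by rewrite V0// !mul0r.
    by rewrite /q ext_in// ext0_in.
  have [[tT Ox]|h] := pselect (`]0, T[%classic t /\ Om x); last by rewrite V0// !mul0r.
  by rewrite /q ext_in// ext0_in.
exact: (eq_cvg_lim (fun n => e _ _ (pU n)) (e _ _ poo) (weak_L2 mq q2 q0 fin)).
Qed.

End weak_limits.
End extension.

Lemma ord2_bounded (R : realType) (X : Type) (F : 'I_2 -> X -> R) :
  (forall i, exists2 B, 0 <= B & forall z, `|F i z| <= B) ->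
  exists2 B, 0 <= B & forall i z, `|F i z| <= B.
Proof.
move=> h; have [B0 B00 HB0] := h 0; have [B1 B10 HB1] := h 1.
exists (Num.max B0 B1) => [|i z]; first by rewrite le_max B00.
rewrite le_max; have [->|->] := ord2_cases i.
  by rewrite HB0.
by rewrite HB1 orbT.
Qed.

Section navier_stokes_transfer.
Context (R : realType) (T M : R) (Om : set (plane R)).
Implicit Types (t c : R) (x y : plane R).
Implicit Types (Phi psi : 'I_2 -> R -> plane R -> R).
Local Notation leb := (@lebesgue_measure R).
Local Notation at_time f t := (fun i => f i t).
Hypotheses (OQ : Om `<=` obox M) (Oo : open Om) (T0 : 0 < T).

Let mO : measurable Om. Proof. exact: open_measurable_plane. Qed.

Lemma field_pderiv_bound Phi : solenoidal_test_field `]0, T[ Om Phi ->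
  exists2 L, 0 <= L & forall i j t x, `|pderiv j (Phi i t) x| <= L.
Proof.
move=> sol; have h i : exists2 B, 0 <= B & forall z : 'I_2 * (R * plane R),
    `|pderiv z.1 (Phi i z.2.1) z.2.2| <= B.
  have [B B0 HB] := @ord2_bounded R (R * plane R)%type (fun j z => pderiv j (Phi i z.1) z.2) (fun j =>
    let: ex_intro2 B B0 HB := field_pderiv_bounded sol i j in ex_intro2 _ _ B B0 (fun z => HB z.1 z.2)).
  by exists B => // -[j [t x]]; exact: (HB j (t, x)).
by have [B B0 HB] := ord2_bounded h; exists B => // i j t x; exact: (HB i (j, (t, x))).
Qed.

Lemma flow_pairing_L1 E (V psi : 'I_2 -> R -> plane R -> R) c : flow T Om E V -> (forall i, jmeas (psi i)) ->
  (forall i t x, `|psi i t x| <= c) -> L1 leb (fun t => inner (at_time V t) (at_time psi t)).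
Proof.
move=> fV mp pc; have [mV V2 _ V0 _] := fV.
pose A := Num.max (\int[leb2]_x (\1_(obox M) x : R) + E) 0.
have c0 : 0 <= c := le_trans (normr_ge0 _) (pc 0 0 (0, 0)).
have li i t : `|\int[leb2]_x (V i t x * psi i t x)| <= c * A.
  apply: (@le_trans _ _ (c * \int[leb2]_x `|V i t x|)); last first.
    by rewrite ler_wpM2l// le_max (flow_L1_le OQ i t fV).
  have iV := L1_abs (mu := leb2) (V2 t i).1.
  rewrite -(IntZl (mu := leb2) c iV); apply: (Int_norm_le (mu := leb2)).
  - by apply: measurable_funM; [exact: L2_measurable (V2 t i)|exact: jmeas_slice].
  - exact: (L1Zl (mu := leb2)).
  - by move=> x; rewrite normrM mulrC ler_wpM2r.
apply: (@L1_bounded_supp _ _ R leb `]0, T[%classic (c * A + c * A)) => //.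
- have := lebesgue_measure_itv `]0, T[; rewrite /= lte_fin T0 => h.
  by apply: (@le_lt_trans _ _ (T%:E - 0%:E)%E); [rewrite -h; exact: lexx|rewrite -EFinD ltry].
- exact: jmeas_inner mV mp.
- by move=> t; apply: (le_trans (ler_normD _ _)); apply: lerD.
- move=> t nt; have z i : \int[leb2]_x (V i t x * psi i t x) = 0.
    by rewrite -[RHS](Int_0 leb2); apply: Int_ext => x; rewrite V0 ?mul0r// => -[].
  by rewrite /inner !z addr0.
Qed.

Lemma vlap_field Phi : solenoidal_test_field `]0, T[ Om Phi ->
  (forall i, jmeas (fun t => vlap (at_time Phi t) i)) /\
  exists c, forall i t x, `|vlap (at_time Phi t) i x| <= c.
Proof.
move=> sol; split=> [i|].
  have -> : (fun t => vlap (at_time Phi t) i) =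
      (fun t x => pderiv 0 (pderiv 0 (Phi i t)) x + pderiv 1 (pderiv 1 (Phi i t)) x).
    by apply/funext => t; apply/funext => x; rewrite /vlap sum_ord2.
  exact: (measurable_funD (field_pderiv2 sol i 0).1 (field_pderiv2 sol i 1).1).
have h i : exists2 B, 0 <= B & forall z : R * plane R, `|vlap (at_time Phi z.1) i z.2| <= B.
  have [_ [B0 B00 HB0]] := field_pderiv2 sol i 0; have [_ [B1 B10 HB1]] := field_pderiv2 sol i 1.
  exists (B0 + B1); first exact: addr_ge0.
  by move=> z; rewrite /vlap sum_ord2; apply: (le_trans (ler_normD _ _)); exact: lerD.
by have [B _ HB] := ord2_bounded h; exists B => i t x; exact: (HB i (t, x)).
Qed.

Lemma vderive1_field Phi : solenoidal_test_field `]0, T[ Om Phi ->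
  exists c, forall i t x, `|derive1 (Phi i ^~ x) t| <= c.
Proof.
move=> sol; have h i : exists2 B, 0 <= B & forall z : R * plane R, `|derive1 (Phi i ^~ z.2) z.1| <= B.
  by have [_ [B B0 HB]] := field_derive1 sol i; exists B => // z.
by have [B _ HB] := ord2_bounded h; exists B => i t x; exact: (HB i (t, x)).
Qed.

Section slice.
Variables (phi : 'I_2 -> plane R -> R) (p v : 'I_2 -> plane R -> R) (G : 'I_2 -> 'I_2 -> plane R -> R) (nu c : R).
Hypotheses (tphi : test_vector Om phi) (mp : forall i, measurable_fun setT (p i))
  (pc : forall i x, `|p i x| <= c)
  (vm : forall i, H10 Om (v i) (G i))
  (mv : forall i, measurable_fun setT (ext0 Om (v i)))
  (mG : forall i j, measurable_fun setT (ext0 Om (G i j))).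

(** The definition of the weak gradient, tested with pderiv j (phi i), removes [G] from the viscous
    term. *)
Lemma slice_identity : \int[leb2]_(x in Om) (\sum_(i < 2) v i x * p i x
   + \sum_(i < 2) \sum_(j < 2) v i x * v j x * pderiv j (phi i) x
   - nu * \sum_(i < 2) \sum_(j < 2) G i j x * pderiv j (phi i) x) =
  inner (fun i => ext0 Om (v i)) p + quad phi (fun i => ext0 Om (v i)) +
  nu * inner (fun i => ext0 Om (v i)) (vlap phi).
Proof.
pose V i := ext0 Om (v i); pose H i j := ext0 Om (G i j).
have V2 i : L2 (V i).
  by have [[_ vf] _ _ _] := vm i; exact: L2normsq_fin OQ (mv i) vf.
have H2 i j : L2 (H i j).
  have [_ [_ gf] _ _] := vm i; apply: (L2normsq_fin OQ (mG i j)); apply: le_lt_trans gf.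
  have n0 k : (0 <= L2normsq Om (G i k))%E by apply: integral_ge0 => x _; rewrite lee_fin sqr_ge0.
  rewrite /L2normsq_vec sum_ord2.
  have [->|->] := ord2_cases j.
    exact: leeDl.
  exact: leeDr.
have td i j := test_pderiv j (tphi i).
have iA i : L1 leb2 (fun x => V i x * p i x).
  have -> : (fun x => V i x * p i x) = (fun x => p i x * V i x) by apply/funext => x; rewrite mulrC.
  exact: (L1_bmul (mu := leb2) (mp i) (pc i) (V2 i).1).
have iQ i j : L1 leb2 (fun x => pderiv j (phi i) x * V i x * V j x).
  have -> : (fun x => pderiv j (phi i) x * V i x * V j x) = (fun x => pderiv j (phi i) x * (V i x * V j x)).
    by apply/funext => x; rewrite mulrA.
  have [B _ HB] := test_function_bounded (td i j).
  exact: (L1_bmul (mu := leb2) (test_measurable (td i j)) HB (L2_prod (V2 i) (V2 j))).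
have iD i j : L1 leb2 (fun x => H i j x * pderiv j (phi i) x).
  exact: L2_prod (H2 i j) (test_L2 OQ mO (td i j)).
have iL i j : L1 leb2 (fun x => V i x * pderiv j (pderiv j (phi i)) x).
  exact: L2_prod (V2 i) (test_L2 OQ mO (test_pderiv j (td i j))).
have byparts i j : \int[leb2]_x (H i j x * pderiv j (phi i) x) =
    - \int[leb2]_x (V i x * pderiv j (pderiv j (phi i)) x).
  have [_ _ h _] := vm i; have := h j _ (td i j); rewrite !(Int_ext0 Om).
  have -> : ext0 Om (fun x => v i x * pderiv j (pderiv j (phi i)) x) =
      (fun x => V i x * pderiv j (pderiv j (phi i)) x).
    by apply/funext => x; rewrite /V /ext0; case: ifP => _; rewrite ?mul0r.
  have -> : ext0 Om (fun x => G i j x * pderiv j (phi i) x) = (fun x => H i j x * pderiv j (phi i) x).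
    by apply/funext => x; rewrite /H /ext0; case: ifP => _; rewrite ?mul0r.
  by move=> ->; rewrite opprK.
pose FA x := \sum_(i < 2) V i x * p i x.
pose FQ x := \sum_(i < 2) \sum_(j < 2) pderiv j (phi i) x * V i x * V j x.
pose FD x := \sum_(i < 2) \sum_(j < 2) H i j x * pderiv j (phi i) x.
have lA : L1 leb2 FA by apply: (L1_sum (mu := leb2)).
have lQ : L1 leb2 FQ by apply: (L1_sum (mu := leb2)) => i; apply: (L1_sum (mu := leb2)).
have lDi i : L1 leb2 (fun x => \sum_(j < 2) H i j x * pderiv j (phi i) x) by apply: (L1_sum (mu := leb2)).
have lD : L1 leb2 FD by apply: (L1_sum (mu := leb2)).
have EA : \int[leb2]_x FA x = inner V p.
  by rewrite (Int_sum (mu := leb2) _ iA) sum_ord2.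
have ED : \int[leb2]_x FD x = - inner V (vlap phi).
  rewrite (Int_sum (mu := leb2) _ lDi) sum_ord2 /inner opprD.
  have e i : \int[leb2]_x (\sum_(j < 2) H i j x * pderiv j (phi i) x) = - \int[leb2]_x (V i x * vlap phi i x).
    rewrite (Int_sum (mu := leb2) _ (iD i)) sum_ord2 !byparts -opprD; congr (- _).
    rewrite -(IntD (mu := leb2) (iL i 0) (iL i 1)); apply: Int_ext => x.
    by rewrite /vlap sum_ord2 mulrDr.
  exact: (congr2 +%R (e 0) (e 1)).
have -> : nu * inner V (vlap phi) = - (nu * \int[leb2]_x FD x) by rewrite ED mulrN opprK.
rewrite -EA (Int_ext0 Om) -(IntZl (mu := leb2) nu lD).
rewrite /quad -(IntD (mu := leb2) lA lQ).
rewrite -(IntB (mu := leb2) (L1D (mu := leb2) lA lQ) (L1Zl (mu := leb2) nu lD)).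
apply: Int_ext => x; rewrite /FA /FQ /FD /V /H /ext0; case: ifP => _.
  congr (_ + _ - _); apply: eq_bigr => i _; apply: eq_bigr => j _.
  by rewrite [RHS]mulrC mulrA [RHS]mulrC mulrA.
have sA : \sum_(i < 2) 0 * p i x = 0 by apply: big1 => i _; rewrite mul0r.
have sQ : \sum_(i < 2) \sum_(j < 2) pderiv j (phi i) x * 0 * 0 = 0.
  by apply: big1 => i _; apply: big1 => j _; rewrite mulr0.
have sD : \sum_(i < 2) \sum_(j < 2) 0 * pderiv j (phi i) x = 0.
  by apply: big1 => i _; apply: big1 => j _; rewrite mul0r.
by rewrite sA sQ sD mulr0 subr0 addr0.
Qed.

End slice.

Section equation.
Variables (D : set R) (E nu : R) (u0 : 'I_2 -> plane R -> R) (u : 'I_2 -> R -> plane R -> R)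
  (Du : 'I_2 -> 'I_2 -> R -> plane R -> R).
Hypotheses (fD : full_time T D) (mu_ : forall i, spacetime_measurable T Om (u i))
  (mDu : forall i j, spacetime_measurable T Om (Du i j))
  (uH : forall t, D t -> forall i, H10 Om (u i t) (fun j => Du i j t))
  (fV : flow T Om E (fun i => ext D Om (u i))).
Hypothesis weak_equation : forall Phi, solenoidal_test_field `]-oo, T[ Om Phi ->
  \int[leb]_(t in `]0, T[) \int[leb2]_(x in Om)
    (\sum_(i < 2) u i t x * derive1 (Phi i ^~ x) t
     + \sum_(i < 2) \sum_(j < 2) u i t x * u j t x * pderiv j (Phi i t) x
     - nu * \sum_(i < 2) \sum_(j < 2) Du i j t x * pderiv j (Phi i t) x)
  + \int[leb2]_(x in Om) (\sum_(i < 2) u0 i x * Phi i 0 x) = 0.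

Lemma navier_stokes_flow Phi : solenoidal_test_field `]0, T[ Om Phi ->
  \int[leb]_t inner (fun i => ext D Om (u i) t) (fun i x => derive1 (Phi i ^~ x) t) +
  \int[leb]_t quad (at_time Phi t) (fun i => ext D Om (u i) t) +
  nu * \int[leb]_t inner (fun i => ext D Om (u i) t) (vlap (at_time Phi t)) = 0.
Proof.
move=> sol; have [mD DT aD] := fD; set V := fun i => ext D Om (u i).
have [a [b [S [[a0 ab bT] _ _ outT _]]]] := field_supports T0 sol.
have sol' : solenoidal_test_field `]-oo, T[ Om Phi.
  split; last exact: sol.2.
  move=> i; have [s [c sub]] := sol.1 i; split=> //; split=> //.
  move=> z /sub[h1 h2]; split=> //; move: h1; rewrite /= !in_itv /= => /andP[]//.
(* A field supported in [a, b] with a > 0 does not see the initial velocity. *)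
have z0 : \int[leb2]_(x in Om) (\sum_(i < 2) u0 i x * Phi i 0 x) = 0.
  rewrite (Int_ext0 Om) -[RHS](Int_0 leb2); apply: Int_ext => x; rewrite /ext0; case: ifP => // _.
  by apply: big1 => i _; rewrite outT ?mulr0// => /andP[/(lt_le_trans a0)]; rewrite ltxx.
have := weak_equation sol'; rewrite z0 addr0 => H0.
have [L L0 PL] := field_pderiv_bound sol.
have [c1 hc1] := vderive1_field sol; have [ml [c2 hc2]] := vlap_field sol.
have m1 i := (field_derive1 sol i).1.
have [mV V2 _ V0 _] := fV.
have l1 := flow_pairing_L1 fV m1 hc1; have l2 := flow_pairing_L1 fV ml hc2.
have l3 := quad_time_L1 OQ T0 sol ab outT L0 PL fV.
rewrite -(IntZl (mu := leb) nu l2) -(IntD (mu := leb) l1 l3).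
rewrite -(IntD (mu := leb) (L1D (mu := leb) l1 l3) (L1Zl (mu := leb) nu l2)).
apply: etrans H0; apply: esym; apply: (Int2_transfer (D := D)) => //.
- have mP (f : R -> plane R -> R) : jmeas f -> spacetime_measurable T Om f by exact: measurable_funTS.
  have md i j := mP _ (field_pderiv_jmeas sol i j).
  rewrite /spacetime_measurable; apply: measurable_funB; first apply: measurable_funD.
  + by apply: measurable_sum => i; apply: measurable_funM; [exact: mu_|exact: mP (m1 i)].
  + apply: measurable_sum => i; apply: measurable_sum => j.
    by apply: measurable_funM; [apply: measurable_funM; exact: mu_|exact: md].
  + apply: measurable_funM => //; apply: measurable_sum => i; apply: measurable_sum => j.
    by apply: measurable_funM; [exact: mDu|exact: md].
- exact: (L1_measurable (L1D (mu := leb) (L1D (mu := leb) l1 l3) (L1Zl (mu := leb) nu l2))).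
- move=> t nD; have zi (k : 'I_2 -> plane R -> R) : inner (at_time V t) k = 0.
    have z i : \int[leb2]_x (V i t x * k i x) = 0.
      by rewrite -[RHS](Int_0 leb2); apply: Int_ext => x; rewrite /V ext_out// mul0r.
    by rewrite /inner !z addr0.
  rewrite !zi mulr0 addr0 add0r /quad -[RHS](Int_0 leb2); apply: Int_ext => x.
  by apply: big1 => i _; apply: big1 => j _; rewrite /V !ext_out// mulr0.
move=> t Dt; have e i : ext D Om (u i) t = ext0 Om (u i t) by exact: ext_in.
have mG i j : measurable_fun setT (ext0 Om (Du i j t)).
  rewrite -(ext_in _ _ Dt); apply: jmeas_slice.
  exact: (jmeas_ext mO mD DT mO (@subset_refl _ Om) (mDu i j)).
have mv i : measurable_fun setT (ext0 Om (u i t)) by rewrite -e; exact: jmeas_slice (mV i).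
rewrite /V (funext e).
exact: (slice_identity nu (field_test_vector T0 sol t) (fun i => jmeas_slice t (m1 i))
  (fun i x => hc1 i t x) (uH Dt) mv mG).
Qed.

End equation.
End navier_stokes_transfer.

Lemma sqrB_sym (R : realType) (a b : R) : (a - b) ^+ 2 = (b - a) ^+ 2.
Proof. by rewrite -sqrrN opprB. Qed.

(** Monotonicity straight from the definition by suprema over simple functions, hence also for
    functions whose measurability is not known, such as the supremum over x of the vorticity mass of
    balls as a function of t. *)
Lemma ge0_le_integral_any d (X : measurableType d) (R : realType) (mu : {measure set X -> \bar R})
  (f g : X -> \bar R) : (forall x, 0 <= f x)%E -> (forall x, f x <= g x)%E ->
  (\int[mu]_x f x <= \int[mu]_x g x)%E.
Proof.
move=> f0 fg; have g0 x : (0 <= g x)%E by exact: le_trans (f0 x) (fg x).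
rewrite !ge0_integralTE//; apply: le_ereal_sup => _ [h hf <-].
by exists h => // x; exact: le_trans (hf x) (fg x).
Qed.

(** * Absence of concentrations *)

Section concentration.
Context (R : realType) (T M : R) (Om : set (plane R)).
Implicit Types (t d r c : R) (x y z : plane R) (f : plane R -> R) (K : set (plane R)).
Local Notation leb := (@lebesgue_measure R).
Hypotheses (OQ : Om `<=` obox M) (Oo : open Om).

(** The inner integral of [near_mass] at a point of K is at most the mass of the ball of radius 2 d
    around it, and off K the outer factor is 0. *)
Lemma near_mass_le K f d (CK s : R) : K `<=` Om -> L1 leb2 (ext0 K f) ->
  \int[leb2]_x `|ext0 K f x| <= CK -> 0 <= s ->
  (forall x, K x -> (\int[leb2]_(y in eball x (2 * d) `&` Om) `|f y|%:E <= s%:E)%E) ->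
  near_mass d (ext0 K f) <= CK * s.
Proof.
move=> KO Lf fC s0 H; set g := ext0 K f in Lf fC *.
have Lg := L1_abs (mu := leb2) Lf.
have inr z : K z -> \int[leb2]_y (near d (z - y) * `|g y|) <= s.
  move=> Kz; have i1 := near_mass_inner d z Lf.
  rewrite -lee_fin (EFin_Int (mu := leb2) i1); apply: le_trans (H z Kz).
  rewrite [leRHS](integral_mkcond (mu := leb2)).
  apply: ge0_le_integral_any => y; first by rewrite lee_fin mulr_ge0// near_ge0.
  rewrite patchE; case: ifPn => h.
    rewrite lee_fin /g /ext0; case: ifP => _; last by rewrite normr0 mulr0.
    by rewrite ler_piMl// near_le1.
  rewrite lee_fin /near; case: ifPn => hn; last by rewrite mul0r.
  rewrite mul1r /g /ext0; case: ifPn => hK; last by rewrite normr0.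
  exfalso; move/negP: h; apply; apply: mem_set; split; last by apply: KO; exact: set_mem.
  by move: hn; rewrite /sqn /eball /= sqrB_sym (sqrB_sym z.2).
apply: (@le_trans _ _ (\int[leb2]_z (`|g z| * s))).
  apply: (Int_le (mu := leb2)); [exact: near_mass_L1|exact: (L1Zr (mu := leb2))|].
  move=> z; have [Kz|nK] := pselect (K z); last by rewrite /g ext0_out// normr0 !mul0r.
  by rewrite ler_wpM2l// inr.
by rewrite (IntZr (mu := leb2) s Lg) ler_wpM2r.
Qed.

Lemma near_mass_measurable d (W : R -> plane R -> R) : jmeas W ->
  measurable_fun setT (fun t => near_mass d (W t)).
Proof.
move=> mW; have mA : jmeas (fun t x => `|W t x|) by exact: measurableT_comp mW.
apply: (jmeas_Int (F := fun t z => `|W t z| * \int[leb2]_y (near d (z - y) * `|W t y|))).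
apply: measurable_funM => //.
apply: (@fubini_measurable1 _ _ (measurableTypeR R * (measurableTypeR R * measurableTypeR R))%type
  (measurableTypeR R * measurableTypeR R)%type R (lebp R)
  (fun q : (R * plane R) * plane R => near d (q.1.2 - q.2) * `|W q.1.1 q.2|)).
apply: measurable_funM.
  apply: (measurableT_comp (measurable_near2 d) (g := fun q : (R * plane R) * plane R => (q.1.2, q.2))).
  apply: measurable_fun_pair; last exact: measurable_snd.
  exact: (measurableT_comp measurable_snd measurable_fst).
apply: (measurableT_comp mA (g := fun q : (R * plane R) * plane R => (q.1.1, q.2))).
apply: measurable_fun_pair; last exact: measurable_snd.
exact: (measurableT_comp measurable_fst measurable_fst).
Qed.

(** K is the r/2-neighbourhood of S and x0, where r is a uniform distance to the complement of Om.
    The point x0 keeps K non-empty even if S is empty, for the sake of suprema over K. *)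
Lemma compact_neighborhood (S : set (plane R)) x0 : compact S -> S `<=` Om -> Om x0 ->
  exists K r, [/\ measurable K, relatively_compact_in K Om, K `<=` Om, K !=set0 &
    0 < r /\ forall x, S x -> cbox x r `<=` K].
Proof.
move=> cS SO Ox0; pose S' := S `|` [set x0].
have cS' : compact S' by apply: compactU => //; exact: compact_set1.
have SO' : S' `<=` Om by move=> x [/SO//|->].
have [r r0 rO] := uniform_cbox cS' Oo SO'.
pose K := [set y | exists2 x, S' x & ball x (r / 2) y].
have r20 : 0 < r / 2 by rewrite divr_gt0.
have r40 : 0 < r / 4 by rewrite divr_gt0.
have oK : open K.
  have -> : K = \bigcup_(x in S') ball x (r / 2) by apply/seteqP; split=> y [x Sx h]; exists x.
  by apply: bigcup_open => x _; exact: ball_open.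
have clK : closure K `<=` Om.
  move=> y cy; have nb : nbhs y (ball y (r / 4)) by exact: nbhsx_ballx.
  have [z [[x Sx [h1 h2]] [h3 h4]]] := cy _ nb.
  apply: (rO x Sx); move: h1 h2 h3 h4; rewrite /ball /= => h1 h2 h3 h4.
  split.
    by have := ler_distD z.1 x.1 y.1; rewrite (distrC z.1); lra.
  by have := ler_distD z.2 x.2 y.2; rewrite (distrC z.2); lra.
exists K, (r / 4); split.
- exact: open_measurable_plane.
- split=> //; have [cb _] := cbox_compact (0 : plane R) M.
  apply: (subclosed_compact (@closed_closure _ K) cb) => y /clK/OQ[h1 h2].
  by split; rewrite /= sub0r normrN ltW.
- exact: subset_trans (@subset_closure _ K) clK.
- by exists x0; exists x0; [right|exact: ballxx].
split=> // x Sx y [h1 h2]; exists x; first by left.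
by split; rewrite /ball /=; lra.
Qed.

End concentration.

(** * The vanishing viscosity limit *)

Section vanishing_viscosity.
Context (R : realType) (T M : R) (Om : set (plane R)).
Implicit Types (t d r c E : R) (x y z : plane R) (K : set (plane R)).
Local Notation leb := (@lebesgue_measure R).
Local Notation at_time f t := (fun i => f i t).
Hypotheses (OQ : Om `<=` obox M) (Oo : open Om) (T0 : 0 < T).
Variables (nu : nat -> R) (u0 : nat -> 'I_2 -> plane R -> R) (u : nat -> 'I_2 -> R -> plane R -> R)
  (uoo : 'I_2 -> R -> plane R -> R).
Hypotheses (u_leray_hopf : forall n, leray_hopf T Om (nu n) (u0 n) (u n))
  (u_cvg : weak_star_cvg T Om u uoo).

Let mO : measurable Om. Proof. exact: open_measurable_plane. Qed.

Let mu_ n i : spacetime_measurable T Om (u n i).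
Proof. by have [_ [[m _] _]] := u_leray_hopf n; exact: m. Qed.

Let muoo i : spacetime_measurable T Om (uoo i).
Proof. by have [[m _] _] := u_cvg; exact: m. Qed.

Lemma ae_and (P Q : R -> Prop) : {ae leb, forall t, t \in `]0, T[ -> P t} ->
  {ae leb, forall t, t \in `]0, T[ -> Q t} -> {ae leb, forall t, t \in `]0, T[ -> P t /\ Q t}.
Proof.
have FF := ae_filter_ringOfSetsType leb.
by apply: filterS2 => t h1 h2 tT; split; [exact: h1|exact: h2].
Qed.

Lemma ae_time (P : R -> Prop) : {ae leb, forall t, P t} -> {ae leb, forall t, t \in `]0, T[ -> P t}.
Proof. by have FF := ae_filter_ringOfSetsType leb; apply: filterS. Qed.

Lemma bounded_times (v : 'I_2 -> R -> plane R -> R) (P : R -> Prop) : LinftyL2 T Om v ->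
  {ae leb, forall t, t \in `]0, T[ -> P t} ->
  exists D E, [/\ full_time T D, forall t, D t -> P t & preflow T Om E (fun i => ext D Om (v i))].
Proof.
move=> [mv [C HC]] aP.
have [D fD HD] := good_times (ae_and HC aP).
exists D, (Num.max C 0); split=> //; first by move=> t /HD[].
apply: (ext_preflow OQ Oo fD mv); first by rewrite le_max lexx orbT.
by move=> t /HD[h _]; apply: le_trans h _; rewrite lee_fin le_max lexx.
Qed.

Lemma ext_weak_div0 D (v : 'I_2 -> R -> plane R -> R) :
  (forall t, D t -> weakly_divergence_free Om (at_time v t)) ->
  forall t, weak_div0 Om (fun i => ext D Om (v i) t).
Proof.
move=> h t; have [Dt|nD] := pselect (D t).
  have e i : ext D Om (v i) t = ext0 Om (v i t) by exact: ext_in.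
  by rewrite (funext e); exact: ext0_div (h t Dt).
move=> phi _; rewrite -[RHS](Int_0 leb2); apply: Int_ext => x.
by apply: big1 => i _; rewrite ext_out// mul0r.
Qed.

(** Done in two rounds. Each solution first has its own energy bound, enough to define extensions to
    which [weak_star_bounded] applies; the uniform bound it yields then costs one more null set of
    times for each n. *)
Lemma flows_exist (Q : nat -> R -> Prop) : (forall n, {ae leb, forall t, t \in `]0, T[ -> Q n t}) ->
  exists D C, 0 <= C /\ forall n, [/\ full_time T (D n), forall t, D n t -> Q n t &
    flow T Om C (fun i => ext (D n) Om (u n i))].
Proof.
move=> aQ; pose P n t := weakly_divergence_free Om (at_time (u n) t) /\ Q n t.
have aP n : {ae leb, forall t, t \in `]0, T[ -> P n t}.
  have [_ [_ [Du [_ wd _ _]]]] := u_leray_hopf n.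
  exact: ae_and wd (aQ n).
have un n : LinftyL2 T Om (u n) by have [_ []] := u_leray_hopf n.
have /choice[D1 HD1] := fun n => bounded_times (un n) (aP n).
have /choice[E1 H1] := HD1.
have fD n : full_time T (D1 n) by have [] := H1 n.
have pU n : preflow T Om (E1 n) (fun i => ext (D1 n) Om (u n i)) by have [] := H1 n.
have FF := ae_filter_ringOfSetsType leb.
have trivial_ae : {ae leb, forall t, t \in `]0, T[ -> True} by apply: filterE.
have [Doo [Eoo [fDoo _ poo]]] := bounded_times (proj1 u_cvg) trivial_ae.
have [C HC] : exists C, forall n, {ae leb, forall t, energy (fun i => ext (D1 n) Om (u n i) t) <= C}.
  apply: (@weak_star_bounded R T (fun n i => ext (D1 n) Om (u n i))).
  - by move=> n i; case: (pU n).
  - by move=> n t i; case: (pU n) => _ h _ _; exact: h.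
  - by move=> n i t x nt; case: (pU n) => _ _ _ h; apply: h => -[].
  - by move=> n; exists (E1 n); case: (pU n).
  move=> psi mp p2 shape fin.
  have h := weak_L2_bounded Oo mu_ u_cvg fD fDoo pU poo mp (fun i t => p2 t i) _ fin.
  apply: h => i t x nO; have [c [n ->]] := shape i t.
  by case: (pU n) => _ _ _ h; rewrite h ?mulr0// => -[].
have aD n : {ae leb, forall t, t \in `]0, T[ -> D1 n t /\ energy (fun i => ext (D1 n) Om (u n i) t) <= C}.
  by have [_ _ h] := fD n; exact: ae_and h (ae_time (HC n)).
have /choice[D HD] : forall n, exists D, full_time T D /\ forall t, D t -> D1 n t /\ energy (fun i => ext (D1 n) Om (u n i) t) <= C.
  by move=> n; have [D h1 h2] := good_times (aD n); exists D.
exists D, (Num.max C 0); split; first by rewrite le_max lexx orbT.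
move=> n; have [fDn HDn] := HD n; have [_ HP _] := H1 n; split=> //.
  by move=> t /HDn[/HP[]].
apply: flow_of; last first.
  by apply: ext_weak_div0 => t /HDn[/HP[]].
apply: (ext_preflow OQ Oo fDn (mu_ n)); first by rewrite le_max lexx orbT.
move=> t /HDn[Dt Et]; have [_ V2 _ _] := pU n.
have e i : ext (D1 n) Om (u n i) t = ext0 Om (u n i t) by exact: ext_in.
rewrite L2normsq_vec_energy; last by move=> i; rewrite -e; exact: V2.
by rewrite lee_fin -(funext e) le_max Et.
Qed.

Let weak_flows D C Doo Eoo : (forall n, full_time T (D n)) ->
  (forall n, flow T Om C (fun i => ext (D n) Om (u n i))) -> full_time T Doo ->
  preflow T Om Eoo (fun i => ext Doo Om (uoo i)) ->
  forall psi c, (forall i, jmeas (psi i)) -> (forall i t x, `|psi i t x| <= c) ->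
  \int[leb]_t inner (fun i => ext (D n) Om (u n i) t) (at_time psi t) @[n --> \oo] -->
  \int[leb]_t inner (fun i => ext Doo Om (uoo i) t) (at_time psi t).
Proof.
move=> fD fU fDoo poo psi c mp pc.
have pU n : preflow T Om C (fun i => ext (D n) Om (u n i)) by case: (fU n).
exact: (weak_bounded OQ Oo T0 mu_ u_cvg fD fDoo pU poo mp pc).
Qed.

(** Against th(t) grad phi every pairing of the sequence is 0, hence so is that of the limit;
    [weak_div0_ae] then gives the divergence at almost every time, and the exceptional times are
    removed. *)
Lemma limit_flow : exists D E, [/\ full_time T D, 0 <= E, flow T Om E (fun i => ext D Om (uoo i)) &
  forall t, D t -> weakly_divergence_free Om (at_time uoo t)].
Proof.
have FF := ae_filter_ringOfSetsType leb.
have trivial_ae : {ae leb, forall t, t \in `]0, T[ -> True} by apply: filterE.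
have [D [C [C0 HD]]] := flows_exist (fun=> trivial_ae).
have fD n : full_time T (D n) by have [] := HD n.
have fU n : flow T Om C (fun i => ext (D n) Om (u n i)) by have [] := HD n.
have [Doo [Eoo [fDoo _ poo]]] := bounded_times (proj1 u_cvg) trivial_ae.
have [mV V2 VE V0] := poo.
have wd : {ae leb, forall t, weak_div0 Om (fun i => ext Doo Om (uoo i) t)}.
  apply: (weak_div0_ae OQ Oo T0 mV V2 VE V0) => phi th c tp mth thc.
  have g2 i : L2 (grad phi i) by exact: (test_L2 OQ mO (test_pderiv i tp)).
  have [B _ HB] : exists2 B, 0 <= B & forall i x, `|grad phi i x| <= B.
    by apply: ord2_bounded => i; exact: test_function_bounded (test_pderiv i tp).
  pose psi (i : 'I_2) t x := th t * grad phi i x.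
  have mpsi i : jmeas (psi i).
    apply: measurable_funM; first exact: (measurableT_comp mth measurable_fst).
    exact: (measurableT_comp (test_measurable (test_pderiv i tp)) measurable_snd).
  have h := weak_flows fD fU fDoo poo (c := c * B) mpsi.
  have pc i t x : `|psi i t x| <= c * B by rewrite normrM; apply: ler_pM.
  have {}h := h pc.
  have e0 n : \int[leb]_t inner (fun i => ext (D n) Om (u n i) t) (at_time psi t) = 0.
    rewrite -[RHS](Int_0 leb); apply: Int_ext => t; case: (fU n) => _ U2 _ _ dU.
    have d0 : inner (fun i => ext (D n) Om (u n i) t) (grad phi) = 0.
      rewrite -(dU t phi tp) /inner -(IntD (mu := leb2) (L2_prod (U2 t 0) (g2 0)) (L2_prod (U2 t 1) (g2 1))).
      by apply: Int_ext => x; rewrite sum_ord2.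
    by apply: etrans (innerZ _ (U2 t) g2) _; rewrite d0 mulr0.
  have e1 : \int[leb]_t inner (fun i => ext Doo Om (uoo i) t) (at_time psi t) =
      \int[leb]_t (th t * inner (fun i => ext Doo Om (uoo i) t) (grad phi)).
    by apply: Int_ext => t; exact: innerZ _ (V2 t) g2.
  have h' := eq_cvg_lim e0 e1 h.
  by rewrite -(cvg_unique _ h' (cvg_cst 0)).
have aD : {ae leb, forall t, t \in `]0, T[ -> Doo t /\ weak_div0 Om (fun i => ext Doo Om (uoo i) t)}.
  by have [_ _ h] := fDoo; exact: ae_and h (ae_time wd).
have [D' fD' HD'] := good_times aD.
have wdf t : D' t -> weakly_divergence_free Om (at_time uoo t).
  move=> /HD'[Dt h] phi tp; apply: etrans (h phi tp); rewrite (Int_ext0 Om).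
  apply: Int_ext => x; rewrite /ext0; case: ifPn => xO.
    by apply: eq_bigr => i _; rewrite ext_in// /ext0 xO.
  by rewrite big1// => i _; rewrite ext_in// /ext0 (negbTE xO) mul0r.
exists D', (Num.max Eoo 0); split=> //; first by rewrite le_max lexx orbT.
apply: flow_of; last exact: ext_weak_div0.
apply: (ext_preflow OQ Oo fD' muoo); first by rewrite le_max lexx orbT.
move=> t /HD'[Dt _].
have e i : ext Doo Om (uoo i) t = ext0 Om (uoo i t) by exact: ext_in.
rewrite L2normsq_vec_energy; last by move=> i; rewrite -e; exact: V2.
by rewrite lee_fin -(funext e) le_max VE.
Qed.

Variable w : nat -> R -> plane R -> R.
Hypotheses (Om_nonempty : Om !=set0) (nu_cvg0 : nu n @[n --> \oo] --> 0)
  (w_measurable : forall n, spacetime_measurable T Om (w n))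
  (w_curl : forall n, {ae leb, forall t : R, t \in `]0, T[ ->
     weak_curl Om (fun i => u n i t) (w n t)})
  (w_bounded : forall K : set (plane R),
     measurable K -> relatively_compact_in K Om ->
     exists2 C : R, 0 < C &
     forall n, {ae leb, forall t : R, t \in `]0, T[ ->
       (\int[leb2]_(y in K) `|w n t y|%:E <= C%:E)%E})
  (w_no_concentration : forall K : set (plane R),
     K !=set0 -> relatively_compact_in K Om ->
     ereal_sup (range (fun n : nat =>
       (\int[leb]_(t in `]0%R, T[)
          ereal_sup [set \int[leb2]_(y in eball x r `&` Om) `|w n t y|%:E
                    | x in K])%E))
       @[r --> 0^'+] --> 0%E).

Lemma near_mass_concentration K (CK : R) (D : nat -> set R) : measurable K -> K `<=` Om -> K !=set0 ->
  relatively_compact_in K Om -> 0 < CK -> (forall n, full_time T (D n)) ->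
  (forall n t, L1 leb2 (ext (D n) K (w n) t)) ->
  (forall n t, \int[leb2]_x `|ext (D n) K (w n) t x| <= CK) ->
  forall dlt d0 : R, 0 < dlt -> 0 < d0 -> exists d : R, [/\ 0 < d, d <= d0 &
  forall n, L1 leb (fun t => near_mass d (ext (D n) K (w n) t)) /\
    \int[leb]_t near_mass d (ext (D n) K (w n) t) <= dlt].
Proof.
move=> mK KO K0 rK CK0 fD W1 WC dlt d0 dlt0 d00.
have [z0 Kz0] := K0.
have RF : ProperFilter (0 : R)^'+ by exact: at_right_proper_filter.
have /fine_cvgP[fF cF] := w_no_concentration K0 rK.
(* By [near_mass_le], the mass near the diagonal is at most CK times the supremum over balls. *)
have dl : 0 < dlt / CK by rewrite divr_gt0.
have /cvgrPdist_le/(_ _ dl) near1 := cF.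
have near2 : \forall r \near (0 : R)^'+, 0 < r by exact: nbhs_right_gt.
have near3 : \forall r \near (0 : R)^'+, r <= 2 * d0 by apply: nbhs_right_le; rewrite mulr_gt0.
have [r1 [[h1 h2] [h3 h4]]] := @filter_ex _ _ RF _ (filterI (filterI fF near1) (filterI near2 near3)).
(* [near_mass d] involves balls of radius 2 d, hence half of the radius given by the hypothesis. *)
pose d := r1 / 2; have rd : r1 = 2 * d by rewrite /d mulrC divfK// pnatr_eq0.
have dpos : 0 < d by rewrite /d divr_gt0.
exists d; split=> //; first by move: h4; rewrite rd ler_pM2l.
move=> n; set W := ext (D n) K (w n).
pose Sup t := ereal_sup [set (\int[leb2]_(y in eball x r1 `&` Om) `|w n t y|%:E)%E | x in K].
have [mD DT _] := fD n.
have mW : jmeas W by exact: (jmeas_ext mO mD DT mK KO (w_measurable n)).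
have g0 t : 0 <= near_mass d (W t) / CK by rewrite divr_ge0 ?(ltW CK0)// near_mass_ge0.
have Sup0 t : (0 <= Sup t)%E.
  apply: (@le_trans _ _ (\int[leb2]_(y in eball z0 r1 `&` Om) `|w n t y|%:E)%E).
    by apply: integral_ge0 => y _; rewrite lee_fin.
  by apply: ereal_sup_ubound; exists z0.
(* Extended by 0 to the whole line. It may take the value +oo and is not known to be measurable,
   which [ge0_le_integral_any] allows. *)
pose G := patch (fun=> 0%E) `]0, T[%classic Sup.
have pt t : ((near_mass d (W t) / CK)%:E <= G t)%E.
  have [Dt|nD] := pselect (D n t); last first.
    have -> : W t = (fun=> 0) by exact: ext_off.
    have -> : near_mass d (fun=> 0) = 0 :> R.
      rewrite /near_mass -[RHS](Int_0 leb2); apply: Int_ext => z.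
      by rewrite normr0 mul0r.
    by rewrite mul0r /G patchE; case: ifP.
  rewrite /G patchE mem_set; last exact: DT.
  have Wt : W t = ext0 K (w n t) by exact: ext_in.
  have ub x : K x -> (\int[leb2]_(y in eball x (2 * d) `&` Om) `|w n t y|%:E <= Sup t)%E.
    by move=> Kx; rewrite -rd; apply: ereal_sup_ubound; exists x.
  move: ub (Sup0 t); case: (Sup t) => [s||] ub s0; [|by rewrite leey|by []].
  rewrite lee_fin ler_pdivrMr// mulrC Wt; apply: (near_mass_le KO _ _ _ ub).
  - by rewrite -Wt; exact: W1.
  - by rewrite -Wt; exact: WC.
  - by rewrite -lee_fin.
have mg : measurable_fun setT (fun t => near_mass d (W t) / CK).
  by apply: measurable_funM => //; exact: near_mass_measurable.
have Ile : (\int[leb]_t (near_mass d (W t) / CK)%:E <= (dlt / CK)%:E)%E.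
  apply: (@le_trans _ _ (\int[leb]_t G t)%E).
    by apply: ge0_le_integral_any => t; [rewrite lee_fin|exact: pt].
  rewrite -(integral_mkcond (mu := leb) `]0, T[%classic Sup).
  apply: (@le_trans _ _ (ereal_sup (range (fun n : nat =>
       (\int[leb]_(t in `]0%R, T[)
          ereal_sup [set \int[leb2]_(y in eball x r1 `&` Om) `|w n t y|%:E
                    | x in K])%E)))).
    by apply: ereal_sup_ubound; exists n.
  rewrite -(fineK h1) lee_fin.
  by move: h2; rewrite /= sub0r normrN; apply: le_trans; exact: ler_norm.
have [Lg Ig] := Int_le_EFin (mu := leb) mg g0 Ile.
have E1 : (fun t => near_mass d (W t)) = (fun t => CK * (near_mass d (W t) / CK)).
  by apply/funext => t; rewrite mulrC divfK// gt_eqF.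
rewrite E1; split; first exact: (L1Zl (mu := leb)).
by rewrite (IntZl (mu := leb) CK Lg) mulrC -ler_pdivlMr.
Qed.

Lemma limit_euler_identity Doo E Phi : full_time T Doo -> 0 <= E ->
  flow T Om E (fun i => ext Doo Om (uoo i)) -> solenoidal_test_field `]0, T[ Om Phi ->
  \int[leb]_t inner (fun i => ext Doo Om (uoo i) t) (fun i x => derive1 (Phi i ^~ x) t) +
  \int[leb]_t quad (at_time Phi t) (fun i => ext Doo Om (uoo i) t) = 0.
Proof.
move=> fDoo E0 foo sol.
have [a [b [S [[a0 ab bT] cS SO outT outS]]]] := field_supports T0 sol.
have [x0 Ox0] := Om_nonempty.
have [K [r [mK rK KO K0 [r0 SK]]]] := compact_neighborhood OQ Oo cS SO Ox0.
have [CK CK0 wK] := w_bounded mK rK.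
have [L L0 PL] := field_pderiv_bound sol.
have /choice[Du HDu] := fun n => proj2 (proj2 (u_leray_hopf n)).
(* All the properties known at almost every time are required together, so that a single set [D n]
   serves for the velocity, its gradient and its vorticity on K. *)
pose Q n t := (forall i, H10 Om (u n i t) (fun j => Du n i j t)) /\
  (weak_curl Om (fun i => u n i t) (w n t) /\ (\int[leb2]_(y in K) `|w n t y|%:E <= CK%:E)%E).
have aQ n : {ae leb, forall t, t \in `]0, T[ -> Q n t}.
  by have [[_ _ h _] _ _ _] := HDu n; exact: ae_and h (ae_and (w_curl n) (wK n)).
have [D [C [C0 HD]]] := flows_exist aQ.
have fD n : full_time T (D n) by have [] := HD n.
have QD n t : D n t -> Q n t by have [_ h _] := HD n; exact: h.
have CE : C <= Num.max C E by rewrite le_max lexx.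
have EE : E <= Num.max C E by rewrite le_max lexx orbT.
have flow_le c c' V : c <= c' -> flow T Om c V -> flow T Om c' V.
  by move=> cc [k1 k2 k3 k4 k5]; split=> // t; exact: le_trans cc.
have fUC n : flow T Om C (fun i => ext (D n) Om (u n i)) by have [] := HD n.
have fU n := flow_le _ _ _ CE (fUC n).
have foo' := flow_le _ _ _ EE foo.
have poo : preflow T Om E (fun i => ext Doo Om (uoo i)) by case: foo.
have [N [_ HN]] := cvg_seq_bounded (cvgP _ nu_cvg0).
have nuN n : `|nu n| <= N + 1 by apply: (HN (N + 1)) => //; rewrite ltrDl.
have mW n : jmeas (ext (D n) K (w n)).
  by have [mD DT _] := fD n; exact: (jmeas_ext mO mD DT mK KO (w_measurable n)).
have WL n t : L1 leb2 (ext (D n) K (w n) t) /\ \int[leb2]_x `|ext (D n) K (w n) t x| <= CK.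
  have [Dt|nD] := pselect (D n t); last first.
    rewrite (ext_off _ _ nD); split; first exact: (L1_0 leb2).
    have -> : \int[leb2]_(x in [set: plane R]) `|0 : R| = 0.
      by rewrite -[RHS](Int_0 leb2); apply: Int_ext => x; rewrite normr0.
    exact: ltW.
  have mWt := jmeas_slice t (mW n); move: mWt; rewrite (ext_in _ _ Dt) => mWt.
  have [_ [_ h]] := QD n t Dt.
  have h' : (\int[leb2]_x (`|ext0 K (w n t) x|)%:E <= CK%:E)%E.
    apply: le_trans h; rewrite le_eqVlt; apply/orP; left; apply/eqP.
    rewrite [RHS](integral_mkcond (mu := leb2)); apply: eq_integral => x _.
    by rewrite patchE /ext0; case: ifP => _; rewrite ?normr0.
  have mA : measurable_fun setT (fun x => `|ext0 K (w n t) x|) by exact: measurableT_comp mWt.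
  have [i1 i2] := Int_le_EFin (mu := leb2) mA (fun x => normr_ge0 _) h'.
  split=> //; exact: (L1_le (mu := leb2) mWt i1 (fun x => lexx _)).
have Wrot n t : weak_rot K (fun i => ext (D n) Om (u n i) t) (ext (D n) K (w n) t).
  have [Dt|nD] := pselect (D n t); last first.
    by move=> phi _; apply: Int_ext => x; rewrite !ext_out// !mul0r subr0.
  have e i : ext (D n) Om (u n i) t = ext0 Om (u n i t) by exact: ext_in.
  rewrite (ext_in _ _ Dt) (funext e); apply: ext0_rot => //.
  by have [_ []] := QD n t Dt.
have conc := near_mass_concentration mK KO K0 rK CK0 fD (fun n t => (WL n t).1) (fun n t => (WL n t).2).
have ns n Psi (sPsi : solenoidal_test_field `]0, T[ Om Psi) :=
  navier_stokes_flow OQ Oo T0 (fD n) (mu_ n)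
    (fun i j => let: And4 h _ _ _ := HDu n in let: And4 _ m _ _ := h in m i j)
    (fun t Dt => (QD n t Dt).1) (fU n) (let: And4 _ _ h _ := HDu n in h) sPsi.
have weak := weak_flows fD fUC fDoo poo.
exact: (euler_identity OQ mO T0 fU foo' nuN weak ns sol SO a0 ab bT outT outS L0 PL KO r0 SK
  (fun n t => (WL n t).1) (fun n t => (WL n t).2) Wrot conc nu_cvg0).
Qed.

Lemma limit_euler_weak_solution : euler_weak_solution T Om uoo.
Proof.
have [D [E [fD E0 foo wd]]] := limit_flow; have [mD DT aD] := fD.
have poo : preflow T Om E (fun i => ext D Om (uoo i)) by case: foo.
have [mV V2 _ V0] := poo.
split; first by case: u_cvg.
  have FF := ae_filter_ringOfSetsType leb.
  by apply: filterS aD => t h tT; exact: wd (h tT).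
move=> Phi sol; apply: etrans (limit_euler_identity fD E0 foo sol).
apply: (congr2 +%R).
  have m1 i := (field_derive1 sol i).1.
  have [c hc] := vderive1_field sol.
  have li i t : L1 leb2 (fun x => ext D Om (uoo i) t x * derive1 (Phi i ^~ x) t).
    have -> : (fun x => ext D Om (uoo i) t x * derive1 (Phi i ^~ x) t) =
        (fun x => derive1 (Phi i ^~ x) t * ext D Om (uoo i) t x) by apply/funext => x; exact: mulrC.
    exact: (L1_bmul (mu := leb2) (jmeas_slice t (m1 i)) (hc i t) (V2 t i).1).
  rewrite -(pairing_transfer Oo fD muoo poo m1 li).
  congr (Rintegral _ _ _); apply/funext => t; congr (Rintegral _ _ _); apply/funext => x.
  by apply: eq_bigr => i _; exact: mulrC.
apply: (Int2_transfer (D := D)) => //.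
- rewrite /spacetime_measurable; apply: measurable_sum => i; apply: measurable_sum => j.
  apply: measurable_funM; last exact: muoo.
  apply: measurable_funM; last exact: muoo.
  exact: measurable_funTS (field_pderiv_jmeas sol i j).
- by apply: quad_measurable => // i j; exact: field_pderiv_jmeas sol i j.
- move=> t nD; rewrite /quad -[RHS](Int_0 leb2); apply: Int_ext => x.
  by apply: big1 => i _; apply: big1 => j _; rewrite !ext_out// mulr0.
move=> t Dt; rewrite (Int_ext0 Om) /quad; apply: Int_ext => x.
rewrite /ext0; case: ifPn => xO.
  by apply: eq_bigr => i _; apply: eq_bigr => j _; rewrite !ext_in// /ext0 xO.
by apply: esym; apply: big1 => i _; apply: big1 => j _; rewrite !ext_in// /ext0 (negbTE xO) mulr0.
Qed.

End vanishing_viscosity.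

(** * The theorem *)

Lemma bounded_obox (R : realType) (Om : set (plane R)) : bounded_set Om ->
  exists M : R, Om `<=` obox M.
Proof.
move=> [M [_ HM]]; exists (M + 2) => x Ox.
have h : `|x| <= M + 1 by apply: (HM (M + 1)) => //; rewrite ltrDl.
have h12 : `|x.1| <= `|x| /\ `|x.2| <= `|x|.
  by rewrite prod_normE !le_max !lexx orbT.
by case: h12 => h1 h2; split; lra.
Qed.

Theorem theorem1 (R : realType) (T : R) (hT : 0 < T)
  (Om : set (plane R)) (Om_open : open Om) (Om_nonempty : Om !=set0)
  (Om_bounded : bounded_set Om) (Om_smooth : smooth_boundary Om)
  (Om_connected : connected Om) (Om_simply_connected : simply_connected Om)
  (nu : nat -> R) (nu_gt0 : forall n, 0 < nu n) (nu_cvg0 : nu n @[n --> \oo] --> 0)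
  (u0 : nat -> 'I_2 -> plane R -> R) (u : nat -> 'I_2 -> R -> plane R -> R)
  (u_leray_hopf : forall n, leray_hopf T Om (nu n) (u0 n) (u n))
  (w : nat -> R -> plane R -> R)
  (w_measurable : forall n, spacetime_measurable T Om (w n))
  (w_curl : forall n, {ae lebesgue_measure, forall t : R, t \in `]0, T[ ->
     weak_curl Om (fun i => u n i t) (w n t)})
  (uoo : 'I_2 -> R -> plane R -> R)
  (u_cvg : weak_star_cvg T Om u uoo)
  (w_bounded : forall K : set (plane R),
     measurable K -> relatively_compact_in K Om ->
     exists2 C : R, 0 < C &
     forall n, {ae lebesgue_measure, forall t : R, t \in `]0, T[ ->
       (\int[leb2]_(y in K) `|w n t y|%:E <= C%:E)%E})
  (* K !=set0 only because the supremum of the empty set is -oo in \bar R *)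
  (w_no_concentration : forall K : set (plane R),
     K !=set0 -> relatively_compact_in K Om ->
     ereal_sup (range (fun n : nat =>
       (\int[lebesgue_measure]_(t in `]0%R, T[)
          ereal_sup [set \int[leb2]_(y in eball x r `&` Om) `|w n t y|%:E
                    | x in K])%E))
       @[r --> 0^'+] --> 0%E) :
  euler_weak_solution T Om uoo.
Proof.
have [M OQ] := bounded_obox Om_bounded.
exact: (limit_euler_weak_solution OQ Om_open hT u_leray_hopf u_cvg Om_nonempty nu_cvg0
  w_measurable w_curl w_bounded w_no_concentration).
Qed.
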